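(* Let $\boldsymbol w=(u,p,q)=(u,\varepsilon u_x,\varepsilon u_y)$, where $u$ is the solution of $-\varepsilon\Delta u+\mathbf a\cdot\nabla u+bu=f$ in $\Omega=(0,1)^2$, $u=0$ on $\partial\Omega$, and let $\boldsymbol W=(U,P,Q)\in\mathcal V_N^3$ be the numerical solution of the LDG method, i.e. $B(\boldsymbol W;\boldsymbol z)=\langle f,v\rangle$ for all $\boldsymbol z=(v,s,r)\in\mathcal V_N^3$, on any of the three layer-adapted meshes (S-mesh, BS-mesh, B-mesh). Then there is a constant $C>0$, independent of $\varepsilon$ and $N$, such that $$\|\boldsymbol\Pi\boldsymbol w-\boldsymbol W\|_E\le C M^\star N^{-(k+1)},$$ where $\boldsymbol\Pi\boldsymbol w=(\Pi^-u,\Pi_x^+p,\Pi_y^+q)\in\mathcal V_N^3$ is the local Gauss-Radau projection of $\boldsymbol w$ and $$M^\star:=\sqrt{\frac{\mu}{\varepsilon}}\,\bigl(\max|\psi'|\bigr)^{k+1},$$ which, up to constant factors depending only on $k$, equals $(\ln N)^{k+1}$ for the S-mesh, $(\ln N)^{1/2}$ for the BS-mesh, and $(\ln(1/\varepsilon))^{1/2}$ for the B-mesh. Furthermore, one has the $L^2$ error estimate $$\|\boldsymbol w-\boldsymbol W\|_2\le C M^\star N^{-(k+1)}.$$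
   Context: **Problem.** $\Omega=(0,1)\times(0,1)$, $\varepsilon>0$ is a small parameter, and $u$ solves $-\varepsilon\Delta u+\mathbf a\cdot\nabla u+bu=f$ in $\Omega$, $u=0$ on $\partial\Omega$. Here $\mathbf a=(a_1,a_2)$, $b$, $f$ are sufficiently smooth, $a_1\ge\alpha_1>0$, $a_2\ge\alpha_2>0$, and $b-\frac12\nabla\cdot\mathbf a\ge\beta>0$ on $\overline\Omega$, with constants $\alpha_1,\alpha_2,\beta$. For notational simplicity $\alpha_1=\alpha_2=:\alpha$. Set $p=\varepsilon u_x$, $q=\varepsilon u_y$. **Constants.** $C$ denotes a generic positive constant that may depend on $\mathbf a,b,f$, on $\sigma$ and on $k$ (and on the constants in the solution decomposition and the upper bound for the penalty parameters), but is independent of $\varepsilon$ and $N$. **Polynomial degree.** $k\ge1$ is a fixed integer. **Standing assumption on $u$.** $u\in C^{k+2,\kappa}(\Omega)$ for some $0<\kappa<1$, and $u=S+E_{21}+E_{12}+E_{22}$, where for all $(x,y)\in\overline\Omega$ and all integers $i,j\ge0$ with $i+j\le k+2$: $|\partial_x^i\partial_y^jS|\le C$, $|\partial_x^i\partial_y^jE_{21}|\le C\varepsilon^{-i}e^{-\alpha_1(1-x)/\varepsilon}$, $|\partial_x^i\partial_y^jE_{12}|\le C\varepsilon^{-j}e^{-\alpha_2(1-y)/\varepsilon}$, $|\partial_x^i\partial_y^jE_{22}|\le C\varepsilon^{-(i+j)}e^{-[\alpha_1(1-x)+\alpha_2(1-y)]/\varepsilon}$. **Meshes.** $N\ge4$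 is an even integer. The mesh-generating function $\varphi:[0,1/2]\to[0,\infty)$ is one of: $\varphi(t)=2t\ln N$ (S-mesh); $\varphi(t)=-\ln[1-2(1-N^{-1})t]$ (BS-mesh); $\varphi(t)=-\ln[1-2(1-\varepsilon)t]$ (B-mesh). Put $\psi:=e^{-\varphi}$; $\max|\psi'|$ is the maximum over $[0,1/2]$ (equal to $2\ln N$, $2$, $2$ respectively). The transition parameter is $\tau:=\min\{\frac12,\frac{\sigma\varepsilon}{\alpha}\varphi(\frac12)\}$. Standing assumptions: $\tau=\frac{\sigma\varepsilon}{\alpha}\varphi(\frac12)$ (i.e. the minimum is attained by the second term), $\varepsilon\le N^{-1}$, and $\sigma\ge k+2$. Mesh points: $x_i=y_i=2(1-\tau)i/N$ for $0\le i\le N/2$, and $x_i=y_i=1-\frac{\sigma\varepsilon}{\alpha}\varphi(\frac{N-i}{N})$ for $N/2+1\le i\le N$. Elements $K_{ij}=I_i\times J_j=(x_{i-1},x_i)\times(y_{j-1},y_j)$, $1\le i,j\le N$. Define $\mu=\varepsilon$ (S-mesh), $\mu=\varepsilon\ln N$ (BS-mesh), $\mu=\varepsilon\ln(1/\varepsilon)$ (B-mesh). **Finite element space.** $\mathcal P^k(I)$ is the space of polynomials of degree at most $k$ on the interval $I$; $\mathcal Q^k(K_{ij})=\mathcal P^k(I_i)\otimes\mathcal P^k(J_j)$; $\mathcal V_N=\{v\in L^2(\Omega): v|_{K}\in\mathcal Q^k(K)\text{ for every element }K\}$. Traces: $v^\pm_{i,y}=\lim_{x\to x_i^\pm}v(x,y)$,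 $v^\pm_{x,j}=\lim_{y\to y_j^\pm}v(x,y)$. Jumps: $[v]_{i,y}=v^+_{i,y}-v^-_{i,y}$ for $1\le i\le N-1$, $[v]_{0,y}=v^+_{0,y}$, $[v]_{N,y}=-v^-_{N,y}$; $[v]_{x,j}$ is defined analogously. $\langle\cdot,\cdot\rangle_D$ and $\|\cdot\|_D$ are the $L^2(D)$ inner product and norm; the subscript is dropped if $D=\Omega$. Derivatives of functions in $\mathcal V_N$ are taken elementwise. **LDG bilinear form.** For $\boldsymbol W=(U,P,Q)$, $\boldsymbol z=(v,s,r)$, $B(\boldsymbol W;\boldsymbol z)=\mathcal T_1+\mathcal T_2+\mathcal T_3+\mathcal T_4$ with $\mathcal T_1=\varepsilon^{-1}[\langle P,s\rangle+\langle Q,r\rangle]+\langle(b-\nabla\cdot\mathbf a)U,v\rangle$, $\mathcal T_2=\langle U,s_x\rangle+\sum_{j=1}^N\sum_{i=1}^{N-1}\langle U^-_{i,y},[s]_{i,y}\rangle_{J_j}+\langle U,r_y\rangle+\sum_{i=1}^N\sum_{j=1}^{N-1}\langle U^-_{x,j},[r]_{x,j}\rangle_{I_i}$, $\mathcal T_3=\langle P,v_x\rangle+\sum_{j=1}^N\bigl[\sum_{i=0}^{N-1}\langle P^+_{i,y},[v]_{i,y}\rangle_{J_j}-\langle P^-_{N,y},v^-_{N,y}\rangle_{J_j}\bigr]+\langle Q,v_y\rangle+\sum_{i=1}^N\bigl[\sum_{j=0}^{N-1}\langle Q^+_{x,j},[v]_{x,j}\rangle_{I_i}-\langle Q^-_{x,N},v^-_{x,N}\rangle_{I_i}\bigr]$,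 $\mathcal T_4=-\langle a_1U,v_x\rangle-\sum_{j=1}^N\bigl[\sum_{i=1}^N\langle(a_1)_{i,y}U^-_{i,y},[v]_{i,y}\rangle_{J_j}-\langle\lambda_1U^-_{N,y},v^-_{N,y}\rangle_{J_j}\bigr]-\langle a_2U,v_y\rangle-\sum_{i=1}^N\bigl[\sum_{j=1}^N\langle(a_2)_{x,j}U^-_{x,j},[v]_{x,j}\rangle_{I_i}-\langle\lambda_2U^-_{x,N},v^-_{x,N}\rangle_{I_i}\bigr]$, where $(a_1)_{i,y}=a_1(x_i,y)$, $(a_2)_{x,j}=a_2(x,y_j)$, and the penalty parameters satisfy $0\le\lambda_1,\lambda_2\le C$. The LDG solution exists and is unique. **Norms.** For $\boldsymbol V=(V_u,V_p,V_q)$: $\|\boldsymbol V\|_2^2=\varepsilon^{-1}\|V_p\|^2+\varepsilon^{-1}\|V_q\|^2+\|(b-\frac12\nabla\cdot\mathbf a)^{1/2}V_u\|^2$. For $\boldsymbol V\in\mathcal V_N^3$ the energy norm is $\|\boldsymbol V\|_E^2=B(\boldsymbol V;\boldsymbol V)$, i.e. $\|\boldsymbol V\|_E^2=\|\boldsymbol V\|_2^2+\sum_{j=1}^N\bigl[\sum_{i=0}^{N-1}\frac12\langle(a_1)_{i,y},[V_u]^2_{i,y}\rangle_{J_j}+\langle\frac12(a_1)_{N,y}+\lambda_1,[V_u]^2_{N,y}\rangle_{J_j}\bigr]+\sum_{i=1}^N\bigl[\sum_{j=0}^{N-1}\frac12\langle(a_2)_{x,j},[V_u]^2_{x,j}\rangle_{I_i}+\langle\frac12(a_2)_{x,N}+\lambda_2,[V_u]^2_{x,N}\rangle_{I_i}\bigr]$.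 **Gauss-Radau projections.** For $z\in C(\overline\Omega)$, $\Pi^-z,\Pi_x^+z,\Pi_y^+z\in\mathcal V_N$ are uniquely defined on each element $K_{ij}$ by (traces taken from inside $K_{ij}$): $\Pi^-$: $\int_{K_{ij}}(\Pi^-z)v=\int_{K_{ij}}zv$ for all $v\in\mathcal Q^{k-1}(K_{ij})$; $\int_{J_j}(\Pi^-z)^-_{i,y}v\,dy=\int_{J_j}z^-_{i,y}v\,dy$ for all $v\in\mathcal P^{k-1}(J_j)$; $\int_{I_i}(\Pi^-z)^-_{x,j}v\,dx=\int_{I_i}z^-_{x,j}v\,dx$ for all $v\in\mathcal P^{k-1}(I_i)$; $(\Pi^-z)(x_i^-,y_j^-)=z(x_i^-,y_j^-)$. $\Pi_x^+$: $\int_{K_{ij}}(\Pi_x^+z)v=\int_{K_{ij}}zv$ for all $v\in\mathcal P^{k-1}(I_i)\otimes\mathcal P^k(J_j)$; $\int_{J_j}(\Pi_x^+z)^+_{i-1,y}v\,dy=\int_{J_j}z^+_{i-1,y}v\,dy$ for all $v\in\mathcal P^k(J_j)$. $\Pi_y^+$: $\int_{K_{ij}}(\Pi_y^+z)v=\int_{K_{ij}}zv$ for all $v\in\mathcal P^k(I_i)\otimes\mathcal P^{k-1}(J_j)$; $\int_{I_i}(\Pi_y^+z)^+_{x,j-1}v\,dx=\int_{I_i}z^+_{x,j-1}v\,dx$ for all $v\in\mathcal P^k(I_i)$. *)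

(* Defs.v *)
From HB Require Import structures.
From mathcomp Require Import all_boot all_order all_algebra.
From mathcomp Require Import all_classical all_reals all_analysis.

Set Implicit Arguments.
Unset Strict Implicit.
Unset Printing Implicit Defensive.

Import Order.TTheory GRing.Theory Num.Theory.
Import numFieldNormedType.Exports.

Local Open Scope classical_set_scope.
Local Open Scope ring_scope.

Section UnitSquare.
Context {R : realType}.
Implicit Types (u v f g : R * R -> R) (m n i j : nat).

Definition Omega : set (R * R) := `]0, 1[ `*` `]0, 1[.
Definition Omegabar : set (R * R) := `[0, 1] `*` `[0, 1].

Definition dx u : R * R -> R := fun z => derive1 (fun t => u (t, z.2)) z.1.
Definition dy u : R * R -> R := fun z => derive1 (fun t => u (z.1, t)) z.2.

Definition pd i j u : R * R -> R := iter i dx (iter j dy u).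

(* Value at a point of Omegabar of the continuous extension of g from Omega. *)
Definition ext g (z : R * R) : R := lim (g w @[w --> within Omega (nbhs z)]).

(* The space C^m(Omega). *)
Fixpoint Cm m u : Prop :=
  {in Omega, continuous u} /\
  if m is m'.+1 then
    [/\ forall z, Omega z -> derivable (fun t => u (t, z.2)) z.1 1,
        forall z, Omega z -> derivable (fun t => u (z.1, t)) z.2 1,
        Cm m' (dx u) & Cm m' (dy u)]
  else True.

(* The space C^{m,kappa}(Omega) over the open set Omega: the derivatives of
   order m are locally Hoelder continuous, with no uniformity up to the
   boundary. *)
Definition Cholder m (kappa : R) u : Prop :=
  Cm m u /\
  forall i j, (i + j = m)%N -> forall z, Omega z ->
    exists2 r : R, 0 < r & exists H : R, forall z1 z2,
      Omega z1 -> Omega z2 -> ball z r z1 -> ball z r z2 ->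
      `|pd i j u z1 - pd i j u z2| <= H * `|z1 - z2| `^ kappa.

(* The space C^m(Omegabar): u is continuous on Omegabar and its derivatives of
   order at most m extend continuously from Omega to Omegabar. *)
Definition Cmbar m u : Prop :=
  [/\ {within Omegabar, continuous u}, Cm m u &
      forall i j, (i + j <= m)%N -> forall z, Omegabar z ->
        cvg (pd i j u w @[w --> within Omega (nbhs z)])].

Definition leb2 :
    {measure set (measurableTypeR R * measurableTypeR R)%type -> \bar R} :=
  (@lebesgue_measure R \x @lebesgue_measure R)%E.

Definition ip1 (D : set R) (f g : R -> R) : R :=
  \int[lebesgue_measure]_(t in D) (f t * g t).
Definition ip2 (D : set (R * R)) f g : R := \int[leb2]_(z in D) (f z * g z).
Definition normL2 f : R := Num.sqrt (ip2 Omega f f).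

Definition inL2 (D : set (R * R)) f : Prop :=
  measurable_fun (D : set (measurableTypeR R * measurableTypeR R)%type) f /\
  leb2.-integrable D (fun z => (f z ^+ 2)%:E).

End UnitSquare.

Section Problem.
Context {R : realType}.
Implicit Types u : R * R -> R.

Definition pde (eps : R) (a1 a2 b f u : R * R -> R) : Prop :=
  (forall z, Omega z ->
     - eps * (pd 2 0 u z + pd 0 2 u z)
     + (a1 z * dx u z + a2 z * dy u z) + b z * u z = f z) /\
  (forall z, (Omegabar `\` Omega) z -> u z = 0).

Definition decomposition (k : nat) (alpha K eps : R)
  (u S E21 E12 E22 : R * R -> R) : Prop :=
  [/\ [/\ Cmbar k.+2 S, Cmbar k.+2 E21, Cmbar k.+2 E12 & Cmbar k.+2 E22],
      forall z, Omegabar z -> u z = S z + E21 z + E12 z + E22 z &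
      forall x y, Omegabar (x, y) -> forall i j, (i + j <= k.+2)%N ->
      [/\ `|ext (pd i j S) (x, y)| <= K,
          `|ext (pd i j E21) (x, y)|
            <= K * eps ^- i * expR (- (alpha * (1 - x) / eps)),
          `|ext (pd i j E12) (x, y)|
            <= K * eps ^- j * expR (- (alpha * (1 - y) / eps)) &
          `|ext (pd i j E22) (x, y)|
            <= K * eps ^- (i + j)
               * expR (- ((alpha * (1 - x) + alpha * (1 - y)) / eps))]].

End Problem.

Inductive mesh_type := S_mesh | BS_mesh | B_mesh.

Section Mesh.
Context {R : realType} (M : mesh_type) (N : nat) (eps : R).

Definition phi (t : R) : R :=
  match M with
  | S_mesh => 2 * t * ln N%:R
  | BS_mesh => - ln (1 - 2 * (1 - N%:R^-1) * t)
  | B_mesh => - ln (1 - 2 * (1 - eps) * t)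
  end.

Definition psi (t : R) : R := expR (- phi t).

(* For the BS- and B-meshes this is 2 (1 - 1/N) and 2 (1 - eps), which only
   agrees with the customary value 2 up to a factor in [3/4, 1]. *)
Definition max_dpsi : R := sup [set `|derive1 psi t| | t in `[0, 2^-1]].

Definition mu : R :=
  match M with
  | S_mesh => eps
  | BS_mesh => eps * ln N%:R
  | B_mesh => eps * ln (1 / eps)
  end.

Definition Mstar (k : nat) : R := Num.sqrt (mu / eps) * max_dpsi ^+ k.+1.

Definition Mstar_rate (k : nat) : R :=
  match M with
  | S_mesh => ln N%:R ^+ k.+1
  | BS_mesh => Num.sqrt (ln N%:R)
  | B_mesh => Num.sqrt (ln (1 / eps))
  end.

Definition tau (sigma alpha : R) : R :=
  Num.min 2^-1 (sigma * eps / alpha * phi 2^-1).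

Definition node (sigma alpha : R) (i : nat) : R :=
  if (i <= N./2)%N then 2 * (1 - tau sigma alpha) * i%:R / N%:R
  else 1 - sigma * eps / alpha * phi ((N - i)%:R / N%:R).

End Mesh.

Section FiniteElements.
Context {R : realType} (k N : nat) (X : nat -> R).
Implicit Types (u v w z g : R * R -> R) (i j : nat).

(* With 1 <= i, j <= N throughout. *)
Definition Ival i : set R := `]X i.-1, X i[.
Definition Elt i j : set (R * R) := Ival i `*` Ival j.

(* P^m (x) P^n *)
Definition polyQ (m n : nat) v : Prop :=
  exists c : 'M[R]_(m.+1, n.+1), forall x y,
    v (x, y) = \sum_(r < m.+1) \sum_(s < n.+1) c r s * x ^+ r * y ^+ s.

Definition VN v : Prop :=
  inL2 Omega v /\
  forall i j, (1 <= i <= N)%N -> (1 <= j <= N)%N ->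
    exists2 g, polyQ k k g & forall p, Elt i j p -> v p = g p.

(* Traces: [trxm v i y] is v^-_{i,y}, [trym v j x] is v^-_{x,j}, etc. *)
Definition trxm v i (y : R) : R := lim (v (x, y) @[x --> (X i)^'-]).
Definition trxp v i (y : R) : R := lim (v (x, y) @[x --> (X i)^'+]).
Definition trym v j (x : R) : R := lim (v (x, y) @[y --> (X j)^'-]).
Definition tryp v j (x : R) : R := lim (v (x, y) @[y --> (X j)^'+]).

Definition jumpx v i (y : R) : R :=
  if i == 0%N then trxp v i y
  else if i == N then - trxm v i y else trxp v i y - trxm v i y.
Definition jumpy v j (x : R) : R :=
  if j == 0%N then tryp v j x
  else if j == N then - trym v j x else tryp v j x - trym v j x.

(* The limit at the node (x_i, y_j) from inside K_ij. *)
Definition corner v i j : R :=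
  lim (v p @[p --> within (Elt i j) (nbhs (X i, X j))]).

(* The L^2(Omega) inner product of functions given elementwise, used when a
   factor is an elementwise derivative. *)
Definition ipN u v : R :=
  \sum_(1 <= i < N.+1) \sum_(1 <= j < N.+1) ip2 (Elt i j) u v.

Definition GR_minus z v : Prop :=
  VN v /\
  forall i j, (1 <= i <= N)%N -> (1 <= j <= N)%N ->
  [/\ forall g, polyQ k.-1 k.-1 g -> ip2 (Elt i j) v g = ip2 (Elt i j) z g,
      forall q : {poly R}, (size q <= k)%N ->
        ip1 (Ival j) (trxm v i) (horner q) = ip1 (Ival j) (trxm z i) (horner q),
      forall q : {poly R}, (size q <= k)%N ->
        ip1 (Ival i) (trym v j) (horner q) = ip1 (Ival i) (trym z j) (horner q) &
      corner v i j = corner z i j].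

Definition GR_xplus z v : Prop :=
  VN v /\
  forall i j, (1 <= i <= N)%N -> (1 <= j <= N)%N ->
  (forall g, polyQ k.-1 k g -> ip2 (Elt i j) v g = ip2 (Elt i j) z g) /\
  (forall q : {poly R}, (size q <= k.+1)%N ->
     ip1 (Ival j) (trxp v i.-1) (horner q)
     = ip1 (Ival j) (trxp z i.-1) (horner q)).

Definition GR_yplus z v : Prop :=
  VN v /\
  forall i j, (1 <= i <= N)%N -> (1 <= j <= N)%N ->
  (forall g, polyQ k k.-1 g -> ip2 (Elt i j) v g = ip2 (Elt i j) z g) /\
  (forall q : {poly R}, (size q <= k.+1)%N ->
     ip1 (Ival i) (tryp v j.-1) (horner q)
     = ip1 (Ival i) (tryp z j.-1) (horner q)).

End FiniteElements.

Record triple (R : realType) := Triple {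
  tu : R * R -> R;
  tp : R * R -> R;
  tq : R * R -> R }.

Definition tsub (R : realType) (V W : triple R) : triple R :=
  Triple (tu V \- tu W) (tp V \- tp W) (tq V \- tq W).

Section LDG.
Context {R : realType} (k N : nat) (X : nat -> R) (eps : R)
        (a1 a2 b : R * R -> R) (lam1 lam2 : R).
Implicit Types (V W z : triple R).

Definition VN3 V : Prop := [/\ VN k N X (tu V), VN k N X (tp V) & VN k N X (tq V)].

Definition diva : R * R -> R := dx a1 \+ dy a2.

Definition ldgT1 W z : R :=
  eps^-1 * (ip2 Omega (tp W) (tp z) + ip2 Omega (tq W) (tq z))
  + ip2 Omega ((b \- diva) \* tu W) (tu z).

Definition ldgT2 W z : R :=
  let: Triple U _ _ := W in let: Triple _ s r := z in
  ipN N X U (dx s)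
  + \sum_(1 <= j < N.+1) \sum_(1 <= i < N)
      ip1 (Ival X j) (trxm X U i) (jumpx N X s i)
  + ipN N X U (dy r)
  + \sum_(1 <= i < N.+1) \sum_(1 <= j < N)
      ip1 (Ival X i) (trym X U j) (jumpy N X r j).

Definition ldgT3 W z : R :=
  let: Triple _ P Q := W in let: Triple v _ _ := z in
  ipN N X P (dx v)
  + \sum_(1 <= j < N.+1)
      (\sum_(0 <= i < N) ip1 (Ival X j) (trxp X P i) (jumpx N X v i)
       - ip1 (Ival X j) (trxm X P N) (trxm X v N))
  + ipN N X Q (dy v)
  + \sum_(1 <= i < N.+1)
      (\sum_(0 <= j < N) ip1 (Ival X i) (tryp X Q j) (jumpy N X v j)
       - ip1 (Ival X i) (trym X Q N) (trym X v N)).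

Definition ldgT4 W z : R :=
  let: Triple U _ _ := W in let: Triple v _ _ := z in
  - ipN N X (a1 \* U) (dx v)
  - \sum_(1 <= j < N.+1)
      (\sum_(1 <= i < N.+1)
         ip1 (Ival X j) (fun y => a1 (X i, y) * trxm X U i y) (jumpx N X v i)
       - ip1 (Ival X j) (fun y => lam1 * trxm X U N y) (trxm X v N))
  - ipN N X (a2 \* U) (dy v)
  - \sum_(1 <= i < N.+1)
      (\sum_(1 <= j < N.+1)
         ip1 (Ival X i) (fun x => a2 (x, X j) * trym X U j x) (jumpy N X v j)
       - ip1 (Ival X i) (fun x => lam2 * trym X U N x) (trym X v N)).

Definition B W z : R :=
  ldgT1 W z + ldgT2 W z + ldgT3 W z + ldgT4 W z.

Definition LDG_solution (f : R * R -> R) W : Prop :=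
  VN3 W /\ forall z, VN3 z -> B W z = ip2 Omega f (tu z).

Definition norm2 V : R :=
  Num.sqrt (eps^-1 * normL2 (tp V) ^+ 2 + eps^-1 * normL2 (tq V) ^+ 2
    + normL2 (fun p => Num.sqrt (b p - 2^-1 * diva p) * tu V p) ^+ 2).

(* The expanded form of B V V on VN3. *)
Definition normE V : R :=
  let v := tu V in
  Num.sqrt (norm2 V ^+ 2
    + \sum_(1 <= j < N.+1)
        (\sum_(0 <= i < N)
           2^-1 * ip1 (Ival X j) (fun y => a1 (X i, y))
                      (fun y => jumpx N X v i y ^+ 2)
         + ip1 (Ival X j) (fun y => 2^-1 * a1 (X N, y) + lam1)
               (fun y => jumpx N X v N y ^+ 2))
    + \sum_(1 <= i < N.+1)
        (\sum_(0 <= j < N)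
           2^-1 * ip1 (Ival X i) (fun x => a2 (x, X j))
                      (fun x => jumpy N X v j x ^+ 2)
         + ip1 (Ival X i) (fun x => 2^-1 * a2 (x, X N) + lam2)
               (fun x => jumpy N X v N x ^+ 2))).

End LDG.

(* Main.v *)
Require Import Defs.
From HB Require Import structures.
From mathcomp Require Import all_boot all_order all_algebra.
From mathcomp Require Import all_classical all_reals all_analysis.
From mathcomp Require Import ring lra.
Set Implicit Arguments.
Unset Strict Implicit.
Unset Printing Implicit Defensive.
Import Order.TTheory GRing.Theory Num.Theory.
Import numFieldNormedType.Exports.
Local Open Scope classical_set_scope.
Local Open Scope ring_scope.

(** Let xi = Pi w - W. The energy norm is generated by the bilinear form, so
    it suffices to estimate B(xi; xi) = B(Pi w; xi) - <f, v>, with v the first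
    component of xi, by half of B(xi; xi) plus C delta^2, where
    delta = (max |psi'| / N)^(k+1) <= M* N^-(k+1). The form is a sum of an
    x-part and a y-part, and the y-part is the x-part for the data with
    exchanged variables; only the x-part has to be analysed.

    Let pi_y be the Gauss-Radau projection in y, V = Pi^- u and r = pi_y u - V.
    Elementwise integration by parts, the conditions that define the
    projections and the boundary values of u give an exact formula
    (xdir_identity): up to the x-part of the differential operator, which the
    load cancels, the x-part of B(Pi w; (v, s, .)) is the sum of
    eps^-1 <P - eps pi_y u_x, s>, <(p - P)(1, .), v(1, .)>, <a_x r, v>,
    <(a - a(x_i, .)) r, v_x> and <a (pi_y u_x - u_x), v>. Projection errors
    bound all of these except the contribution of the layer at x = 1 to the
    last one: there pi_y u_x - u_x is of size delta eps^-1 times the layer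
    function, whose L2 norm is of order delta eps^-1/2. That defect g is
    integrated in x to G, of size delta times the layer function, and the
    discrete equation is tested with (0, Z, 0), where Z is a projection of G
    that interpolates at left end points. This expresses the integral of g v
    by boundary terms at x = 1 and by eps^-1 times inner products of Z with
    flux errors (dual_identity), and eps^-1 |Z|^2 is of order delta^2. Young's
    inequality then gives xdir_bound, and energy_bound follows.

    Projection errors come from polynomial approximation and from the
    stability of the projections, with a constant that is the same for all
    intervals (projection_constant, projection_error). The mesh enters through
    layer_mesh, proved for the three meshes in node_layer_mesh: an element is
    either so far from the layer that layer functions are of size delta, or
    short enough for k+1 derivatives to pay. Either way the power
    (k+1) / sigma of the layer function is spent; sigma >= k + 2 leaves a
    decaying weight whose integral is O(eps), as the factor eps^-1 in front of
    the fluxes requires (layer_error_weighted, om_sq_sum).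

    All this is carried out for matrices of coefficients and iterated
    integrals of continuous functions over boxes. The regularity assumed on
    the open square is transferred to continuous functions on the plane by
    continuous extension and the symmetry of mixed derivatives (smooth_mix);
    traces, inner products and projections of functions on the square are
    translated by B_Bm, integral_Omega and GR_minus_elt. *)

(** * One-dimensional integrals of continuous functions *)

Section Integral1.
Context {R : realType}.
Implicit Types (f g F G : R -> R) (a b c d : R).
Notation mu := (@lebesgue_measure R).

(** The iterated integrals of continuous functions over boxes carry the whole
    proof; with real values and closed intervals they are linear without side
    conditions on integrability. *)
Definition I1 a b f : R := \int[mu]_(x in `[a, b]) f x.

Lemma cont_itv_integrable a b f :
  continuous f -> mu.-integrable `[a, b] (EFin \o f).
Proof.
move=> cf; apply: continuous_compact_integrable; first exact: segment_compact.
exact: continuous_subspaceT.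
Qed.
Hint Resolve cont_itv_integrable : core.

Lemma cont1_cst c : continuous (fun _ : R => c).
Proof. by move=> x; exact: cvg_cst. Qed.

Lemma cont1D f g : continuous f -> continuous g -> continuous (fun x => f x + g x).
Proof. by move=> cf cg x; exact: cvgD (cf x) (cg x). Qed.

Lemma cont1N f : continuous f -> continuous (fun x => - f x).
Proof. by move=> cf x; exact: cvgN (cf x). Qed.

Lemma cont1M f g : continuous f -> continuous g -> continuous (fun x => f x * g x).
Proof. by move=> cf cg x; exact: cvgM (cf x) (cg x). Qed.

Lemma cont1X f n : continuous f -> continuous (fun x => f x ^+ n).
Proof.
move=> cf; elim: n => [|n IH]; first exact: cont1_cst.
by under eq_fun do rewrite exprS; exact: (cont1M cf IH).
Qed.

Lemma cont1_id : continuous (fun x : R => x).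
Proof. by move=> x; exact: cvg_id. Qed.

Lemma cont1_norm f : continuous f -> continuous (fun x => `|f x|).
Proof.
move=> cf x; apply: (@continuous_comp _ _ _ f _ x); first exact: cf.
exact: (@norm_continuous _ R^o).
Qed.

Lemma I1D a b f g : continuous f -> continuous g ->
  I1 a b (fun x => f x + g x) = I1 a b f + I1 a b g.
Proof. by move=> cf cg; rewrite /I1 RintegralD//; apply: cont_itv_integrable. Qed.

Lemma I1Z a b f c : continuous f -> I1 a b (fun x => c * f x) = c * I1 a b f.
Proof. by move=> cf; rewrite /I1 RintegralZl//; apply: cont_itv_integrable. Qed.

Lemma I1N a b f : continuous f -> I1 a b (fun x => - f x) = - I1 a b f.
Proof.
move=> cf; rewrite -mulN1r -I1Z//; congr I1.
by apply/funext => x; rewrite mulN1r.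
Qed.

Lemma I1B a b f g : continuous f -> continuous g ->
  I1 a b (fun x => f x - g x) = I1 a b f - I1 a b g.
Proof. by move=> cf cg; rewrite /I1 RintegralB//; apply: cont_itv_integrable. Qed.

Lemma eq_I1 a b f g : (forall x, a <= x <= b -> f x = g x) -> I1 a b f = I1 a b g.
Proof.
by move=> fg; apply: eq_Rintegral => x; rewrite inE /= in_itv /=; exact: fg.
Qed.

Lemma le_I1 a b f g : continuous f -> continuous g ->
  (forall x, a <= x <= b -> f x <= g x) -> I1 a b f <= I1 a b g.
Proof.
by move=> cf cg fg; apply: le_Rintegral => //; apply: cont_itv_integrable.
Qed.

Lemma I1_cst a b c : a <= b -> I1 a b (fun=> c) = c * (b - a).
Proof.
move=> ab; rewrite /I1 Rintegral_cst//; congr (_ * _).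
have -> : fine (mu `[a, b]) = b - a; last by [].
rewrite lebesgue_measure_itv /= lte_fin; by case: ltgtP ab => //= -> _; rewrite subrr.
Qed.

Lemma I1_0 a b : I1 a b (fun=> 0) = 0.
Proof. by rewrite /I1 Rintegral_cst// mul0r. Qed.

Lemma I1_xx a f : I1 a a f = 0.
Proof. by rewrite /I1 set_itv1 Rintegral_set1. Qed.

Lemma I1_ge0 a b f : (forall x, a <= x <= b -> 0 <= f x) -> 0 <= I1 a b f.
Proof. by move=> f0; apply: Rintegral_ge0 => x; rewrite /= in_itv /=; exact: f0. Qed.

Lemma ler_norm_I1 a b f : continuous f -> `|I1 a b f| <= I1 a b (fun x => `|f x|).
Proof. by move=> cf; apply: le_normr_Rintegral => //; exact: cont_itv_integrable. Qed.

Lemma I1_sum_cont (I : Type) (r : seq I) (P : pred I) a b (F : I -> R -> R) :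
  (forall i, continuous (F i)) ->
  continuous (fun x => \sum_(i <- r | P i) F i x) /\
  I1 a b (fun x => \sum_(i <- r | P i) F i x) = \sum_(i <- r | P i) I1 a b (F i).
Proof.
move=> cF; elim: r => [|i r [cr IH]].
  rewrite big_nil; split; first by under eq_fun do rewrite big_nil; exact: cst_continuous.
  by under eq_I1 do rewrite big_nil; exact: I1_0.
rewrite big_cons; split.
  under eq_fun do rewrite big_cons; case: (P i) => // x.
  by apply: (@continuousD _ R^o R) ; [exact: cF|exact: cr].
under eq_I1 do rewrite big_cons.
by case: (P i) => //; rewrite I1D// IH.
Qed.

Lemma I1_sum (I : Type) (r : seq I) (P : pred I) a b (F : I -> R -> R) :
  (forall i, continuous (F i)) ->
  I1 a b (fun x => \sum_(i <- r | P i) F i x) = \sum_(i <- r | P i) I1 a b (F i).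
Proof. by move=> cF; have [] := I1_sum_cont r P a b cF. Qed.

Lemma I1_FTC a b F f : a <= b -> continuous f -> continuous F ->
  (forall x, a < x < b -> is_derive x 1 F (f x)) ->
  I1 a b f = F b - F a.
Proof.
rewrite le_eqVlt => /predU1P[->|ab] cf cF dF; first by rewrite I1_xx subrr.
rewrite /I1 /Rintegral (@continuous_FTC2 _ f F)//.
- exact: continuous_subspaceT.
- split.
  + by move=> x; rewrite in_itv /= => xab; have [] := dF x xab.
  + exact: cvg_at_right_filter (cF _).
  + exact: cvg_at_left_filter (cF _).
- by move=> x; rewrite in_itv /= => xab; rewrite derive1E; have [_ ->] := dF x xab.
Qed.

Lemma I1_oo a b f : continuous f -> \int[mu]_(x in `]a, b[) f x = I1 a b f.
Proof.
move=> cf; rewrite Rintegral_itv_bndo_bndc; last first.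
  by apply: integrableS (@cont_itv_integrable a b f cf) => //; exact: subset_itv_oo_cc.
rewrite Rintegral_itv_obnd_cbnd//.
by apply: integrableS (@cont_itv_integrable a b f cf) => //; exact: subset_itv_oc_cc.
Qed.

Lemma I1_oo_eq a b f F : continuous F -> (forall x, a < x < b -> f x = F x) ->
  \int[mu]_(x in `]a, b[) f x = I1 a b F.
Proof.
move=> cF fF; rewrite -I1_oo//; apply: eq_Rintegral => x.
by rewrite inE /= in_itv /=; exact: fF.
Qed.

Lemma I1_cat a b c f : continuous f -> a <= b <= c ->
  I1 a c f = I1 a b f + I1 b c f.
Proof.
move=> cf /andP[ab bc]; apply/eqP; rewrite addrC -subr_eq; apply/eqP.
rewrite /I1 Rintegral_itvB//; last exact: cont_itv_integrable.
rewrite Rintegral_itv_obnd_cbnd//.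
by apply: integrableS (@cont_itv_integrable b c f cf) => //; exact: subset_itv_oc_cc.
Qed.

Lemma I1_derive a x f : continuous f -> a < x ->
  is_derive x 1 (fun y => I1 a y f) (f x).
Proof.
move=> cf ax.
have [] := @continuous_FTC1_closed R f a x (x + 1) _ _ ax (cf x).
- by rewrite ltrDl.
- exact: cont_itv_integrable.
by move=> d e; split; [exact: d|rewrite -derive1E; exact: e].
Qed.

End Integral1.

(** * Continuous functions of two variables *)

Section Integral2.
Context {R : realType}.
Implicit Types (f g : R -> R) (F G : R -> R -> R) (a b c d : R).
Notation mu := (@lebesgue_measure R).
Notation RR := (measurableTypeR R * measurableTypeR R)%type.

Definition cont2 F := continuous (fun z : R * R => F z.1 z.2).
Definition I2 a b c d F : R := I1 a b (fun x => I1 c d (F x)).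

(** Measurability in the plane refers to the product sigma-algebra; an open
    set is the countable union of the rational rectangles that it contains. *)
Lemma open2_measurable (U : set (R * R)) : open U -> measurable (U : set RR).
Proof.
move=> oU.
pose rect (p q r s : rat) : set RR :=
  (`]ratr p, ratr q[%classic : set R) `*` (`]ratr r, ratr s[%classic : set R).
pose G p q r s : set RR := if pselect (rect p q r s `<=` U) then rect p q r s else set0.
have -> : (U : set RR) = \bigcup_p \bigcup_q \bigcup_r \bigcup_s G p q r s.
  apply/seteqP; split => [[x y] Uxy|z [p _] [q _] [r _] [s _]].
    have /nbhs_ballP[e /= e0 eU] := open_nbhs_nbhs (conj oU Uxy).
    have [p] : exists q, ratr q \in `](x - e), x[ by apply: rat_in_itvoo; rewrite ltrBlDr ltrDl.
    rewrite in_itv /= => /andP[p1 p2].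
    have [q] : exists q, ratr q \in `]x, (x + e)[ by apply: rat_in_itvoo; rewrite ltrDl.
    rewrite in_itv /= => /andP[q1 q2].
    have [r] : exists q, ratr q \in `](y - e), y[ by apply: rat_in_itvoo; rewrite ltrBlDr ltrDl.
    rewrite in_itv /= => /andP[r1 r2].
    have [s] : exists q, ratr q \in `]y, (y + e)[ by apply: rat_in_itvoo; rewrite ltrDl.
    rewrite in_itv /= => /andP[s1 s2].
    exists p => //; exists q => //; exists r => //; exists s => //.
    rewrite /G; case: pselect => [ru|]; last first.
      case=> -[x' y'] [/=]; rewrite !in_itv /= => /andP[h1 h2] /andP[h3 h4].
      apply: eU; split; rewrite /ball /= ltr_norml; apply/andP; split; lra.
    by split; rewrite /= in_itv /=; apply/andP.
  by rewrite /G; case: pselect => [h /h //|nh []].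
apply: bigcupT_measurable_rat => p; apply: bigcupT_measurable_rat => q.
apply: bigcupT_measurable_rat => r; apply: bigcupT_measurable_rat => s.
rewrite /G; case: pselect => ru; last exact: measurable0.
have m1 : measurable (`]ratr p, ratr q[%classic : set (measurableTypeR R)) by exact: measurable_itv.
have m2 : measurable (`]ratr r, ratr s[%classic : set (measurableTypeR R)) by exact: measurable_itv.
exact: (measurableX m1 m2).
Qed.

Lemma cont_measurable2 (U : set (R * R)) (h : R * R -> R) :
  open U -> {in U, continuous h} -> measurable_fun (U : set RR) h.
Proof.
move=> oU ch mU; apply: (measurability _ (measurable_realfun.RGenOpens.measurableE R)) => //.
move=> Y [A [a [b AE]] <-]; rewrite {}AE; apply: open2_measurable.
rewrite openE => z [Uz /= hz].
apply: filterI; first exact: open_nbhs_nbhs.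
apply: (ch z (mem_set Uz)); apply: open_nbhs_nbhs; split => //.
Qed.

Lemma cont2_measurable F (D : set RR) : measurable D -> cont2 F ->
  measurable_fun D (fun z => F z.1 z.2).
Proof.
move=> mD cF; apply: (@measurable_funS _ _ _ _ setT) => //.
by apply: cont_measurable2; [exact: openT|move=> z _; exact: cF].
Qed.

Lemma cont2_bounded F a b c d : cont2 F ->
  exists M, 0 <= M /\ forall x y, a <= x <= b -> c <= y <= d -> `|F x y| <= M.
Proof.
move=> cF.
have : compact ((fun z : R * R => F z.1 z.2) @` (`[a, b] `*` `[c, d])).
  apply: continuous_compact; last by apply: compact_setX; exact: segment_compact.
  exact: continuous_subspaceT.
move=> /compact_bounded [M [Mr MF]].
exists (`|M| + 1); split; first by rewrite addr_ge0.
move=> x y xab ycd; apply: (MF (`|M| + 1)); first by rewrite ltr_pwDr// ler_norm.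
by exists (x, y) => //; split; rewrite /= in_itv.
Qed.

Lemma cont2_along (T : topologicalType) F (f g : T -> R) :
  cont2 F -> continuous f -> continuous g -> continuous (fun t => F (f t) (g t)).
Proof.
move=> cF cf cg t.
exact: (cvg_comp (fun t => (f t, g t)) _ (cvg_pair (cf t) (cg t)) (cF (f t, g t))).
Qed.

Lemma cont_fst : continuous (fst : R * R -> R).
Proof. by move=> z; exact: cvg_fst. Qed.

Lemma cont_snd : continuous (snd : R * R -> R).
Proof. by move=> z; exact: cvg_snd. Qed.

Lemma cont2_s1 F x : cont2 F -> continuous (F x).
Proof. by move=> cF; apply: (@cont2_along _ F (fun=> x) id) => // t; [exact: cvg_cst|exact: cvg_id]. Qed.

Lemma cont2_s2 F y : cont2 F -> continuous (F ^~ y).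
Proof. by move=> cF; apply: (@cont2_along _ F id (fun=> y)) => // t; [exact: cvg_id|exact: cvg_cst]. Qed.

Lemma cont2_swap F : cont2 F -> cont2 (fun x y => F y x).
Proof. by move=> cF; apply: (@cont2_along _ F snd fst) => //; [exact: cont_snd|exact: cont_fst]. Qed.

Lemma cont2_fst f : continuous f -> cont2 (fun x y => f x).
Proof. by move=> cf z; apply: (@continuous_comp _ _ _ fst f z); [exact: cont_fst|exact: cf]. Qed.

Lemma cont2_snd f : continuous f -> cont2 (fun x y => f y).
Proof. by move=> cf z; apply: (@continuous_comp _ _ _ snd f z); [exact: cont_snd|exact: cf]. Qed.

Lemma cont2_cst c : cont2 (fun _ _ => c).
Proof. exact: cst_continuous. Qed.

Lemma cont2D F G : cont2 F -> cont2 G -> cont2 (fun x y => F x y + G x y).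
Proof. by move=> cF cG z; exact: cvgD (cF z) (cG z). Qed.

Lemma cont2N F : cont2 F -> cont2 (fun x y => - F x y).
Proof. by move=> cF z; exact: cvgN (cF z). Qed.

Lemma cont2M F G : cont2 F -> cont2 G -> cont2 (fun x y => F x y * G x y).
Proof. by move=> cF cG z; exact: cvgM (cF z) (cG z). Qed.

Lemma cont2_norm F : cont2 F -> cont2 (fun x y => `|F x y|).
Proof.
move=> cF z; apply: (@continuous_comp _ _ _ (fun z : R * R => F z.1 z.2) _ z); first exact: cF.
exact: (@norm_continuous _ R^o).
Qed.

Lemma cont2X F n : cont2 F -> cont2 (fun x y => F x y ^+ n).
Proof.
move=> cF; elim: n => [|n IH]; first exact: cont2_cst.
by under eq_fun do under eq_fun do rewrite exprS; exact: (cont2M cF IH).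
Qed.

Lemma cont2_sum (I : Type) (r : seq I) (P : pred I) (F : I -> R -> R -> R) :
  (forall i, cont2 (F i)) -> cont2 (fun x y => \sum_(i <- r | P i) F i x y).
Proof.
move=> cF; elim: r => [|i r IH].
  by under eq_fun do under eq_fun do rewrite big_nil; exact: cont2_cst.
under eq_fun do under eq_fun do rewrite big_cons.
by case: (P i) => //; exact: (cont2D (cF i) IH).
Qed.

Lemma cont_I1 F c d : cont2 F -> continuous (fun x => I1 c d (F x)).
Proof.
move=> cF x0.
have [M [M0 MF]] := cont2_bounded (x0 - 1) (x0 + 1) c d cF.
apply: (@continuity_under_integral _ _ _ mu F `[c, d]%classic _ (x0 - 1) (x0 + 1) _ _ (fun=> M)) => //.
- by move=> x _; apply: cont_itv_integrable; exact: cont2_s1.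
- by apply: aeW => y _ x _; exact: cont2_s2.
- by apply: cont_itv_integrable; exact: cst_continuous.
- move=> x; rewrite /= in_itv /= => /andP[x1 x2]; apply: aeW => y.
  by rewrite /= in_itv /= => ycd; apply: MF => //; rewrite (ltW x1) (ltW x2).
- by rewrite inE /= in_itv /= ltrBlDr !ltrDl ltr01.
Qed.

End Integral2.

(** * Integrals over rectangles *)

Section Prod.
Context {R : realType}.
Implicit Types (f g : R -> R) (F G : R -> R -> R) (a b c d : R).
Notation mu := (@lebesgue_measure R).
Notation RR := (measurableTypeR R * measurableTypeR R)%type.
Local Notation rect a b c d := ((`]a, b[ : set (measurableTypeR R)) `*` (`]c, d[ : set (measurableTypeR R))).

Lemma mrect a b c d : measurable (rect a b c d : set RR).
Proof.
have m1 : measurable (`]a, b[ : set (measurableTypeR R)) by exact: measurable_itv.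
have m2 : measurable (`]c, d[ : set (measurableTypeR R)) by exact: measurable_itv.
exact: (measurableX m1 m2).
Qed.

Lemma leb2_rectE (A B : set (measurableTypeR R)) : measurable A -> measurable B ->
  (@leb2 R) (A `*` B) = (mu A * mu B)%E.
Proof. by move=> mA mB; exact: product_measure1E. Qed.

Lemma leb2_rect_fin a b c d : ((@leb2 R) (rect a b c d) < +oo)%E.
Proof.
rewrite leb2_rectE; try exact: measurable_itv.
rewrite !lebesgue_measure_itv /=; do 2 case: ifP => _;
  by rewrite ?mul0e ?mule0 // -!EFinD -EFinM ltry.
Qed.

Lemma leb2_rect_int a b c d F : cont2 F ->
  (@leb2 R).-integrable (rect a b c d) (fun z => (F z.1 z.2)%:E).
Proof.
move=> cF; have [M [M0 MF]] := cont2_bounded a b c d cF.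
apply: measurable_bounded_integrable.
- exact: mrect.
- exact: leb2_rect_fin.
- by apply: cont2_measurable => //; exact: mrect.
- exists M; split; first exact: num_real.
  move=> N MN [x y] /= [xab ycd]; apply: le_trans (ltW MN); apply: MF.
    by move: xab; rewrite /= in_itv /= => /andP[/ltW-> /ltW->].
  by move: ycd; rewrite /= in_itv /= => /andP[/ltW-> /ltW->].
Qed.

Lemma EFin_I1oo a b f : continuous f ->
  (\int[mu]_(x in `]a, b[) (f x)%:E)%E = (I1 a b f)%:E.
Proof.
move=> cf; rewrite -I1_oo// /Rintegral fineK//.
apply: integrable_fin_num => //.
by apply: integrableS (@cont_itv_integrable _ a b f cf) => //; exact: subset_itv_oo_cc.
Qed.

(** Fubini, in both orders; h need only agree with the continuous function F
    inside the rectangle. *)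
Lemma leb2_rectI2 a b c d (h : R * R -> R) F : cont2 F ->
  (forall x y, a < x < b -> c < y < d -> h (x, y) = F x y) ->
  \int[leb2]_(z in rect a b c d) h z = I2 a b c d F /\
  \int[leb2]_(z in rect a b c d) h z = I2 c d a b (fun y x => F x y).
Proof.
move=> cF hF.
pose g : RR -> \bar R := (fun z => (F z.1 z.2)%:E) \_ (rect a b c d).
have gi : (@leb2 R).-integrable setT g.
  by apply/(integrable_mkcond _ (mrect _ _ _ _)); exact: leb2_rect_int.
have -> : \int[leb2]_(z in rect a b c d) h z = fine (\int[leb2]_z g z)%E.
  rewrite /Rintegral -integral_mkcond; congr fine; apply: eq_integral => -[x y].
  by rewrite inE /= => -[] /=; rewrite !in_itv /= => xab ycd; rewrite hF.
have gE x y : g (x, y) = if (a < x < b) && (c < y < d) then (F x y)%:E else 0%E.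
  rewrite /g patchE; case: ifPn.
    by rewrite inE /= => -[] /=; rewrite !in_itv /= => -> ->.
  by move/negP => H; case: ifPn => // /andP[xab ycd]; case: H; rewrite inE; split; rewrite /= in_itv.
split.
  rewrite /leb2 -integral12_prod_meas1// /I2.
  transitivity (fine (\int[mu]_(x in `]a, b[) (I1 c d (F x))%:E)%E); last first.
    by rewrite EFin_I1oo//; exact: cont_I1.
  congr fine; rewrite integral_mkcond [RHS]integral_mkcond patch_setT.
  apply: eq_integral => x _; rewrite /fubini_F patchE.
  case: ifPn => [|/negP nx].
    rewrite inE /= in_itv /= => xab; rewrite -EFin_I1oo; last exact: cont2_s1.
    rewrite [RHS]integral_mkcond; apply: eq_integral => y _; rewrite gE xab /= patchE.
    by congr (if _ then _ else _); apply/idP/idP; rewrite inE /= in_itv.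
  rewrite -[RHS](@integral0 _ _ _ mu setT); apply: eq_integral => y _; rewrite gE.
  by case: ifPn => // /andP[xab _]; case: nx; rewrite inE /= in_itv.
rewrite /leb2 -integral21_prod_meas1// /I2.
transitivity (fine (\int[mu]_(y in `]c, d[) (I1 a b (F ^~ y))%:E)%E); last first.
  by rewrite EFin_I1oo//; apply: (@cont_I1 _ (fun y x => F x y)); exact: cont2_swap.
congr fine; rewrite integral_mkcond [RHS]integral_mkcond patch_setT.
apply: eq_integral => y _; rewrite /fubini_G patchE.
case: ifPn => [|/negP ny].
  rewrite inE /= in_itv /= => ycd; rewrite -EFin_I1oo; last exact: cont2_s2.
  rewrite [RHS]integral_mkcond; apply: eq_integral => x _; rewrite gE ycd andbT /= patchE.
  by congr (if _ then _ else _); apply/idP/idP; rewrite inE /= in_itv.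
rewrite -[RHS](@integral0 _ _ _ mu setT); apply: eq_integral => x _; rewrite gE.
by case: ifPn => // /andP[_ ycd]; case: ny; rewrite inE /= in_itv.
Qed.

Lemma I2_swap a b c d F : cont2 F -> I2 a b c d F = I2 c d a b (fun y x => F x y).
Proof.
by move=> cF; have [<- <-] := @leb2_rectI2 a b c d (fun z => F z.1 z.2) F cF (fun _ _ _ _ => erefl).
Qed.

Lemma I2D a b c d F G : cont2 F -> cont2 G ->
  I2 a b c d (fun x y => F x y + G x y) = I2 a b c d F + I2 a b c d G.
Proof.
move=> cF cG; rewrite /I2 -I1D; try exact: cont_I1.
by apply: eq_I1 => x _; rewrite I1D//; exact: cont2_s1.
Qed.

Lemma I2Z a b c d F k : cont2 F ->
  I2 a b c d (fun x y => k * F x y) = k * I2 a b c d F.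
Proof.
move=> cF; rewrite /I2 -I1Z; try exact: cont_I1.
by apply: eq_I1 => x _; rewrite I1Z//; exact: cont2_s1.
Qed.

Lemma I2N a b c d F : cont2 F ->
  I2 a b c d (fun x y => - F x y) = - I2 a b c d F.
Proof.
move=> cF; rewrite /I2 -I1N; try exact: cont_I1.
by apply: eq_I1 => x _; rewrite I1N//; exact: cont2_s1.
Qed.

Lemma I2B a b c d F G : cont2 F -> cont2 G ->
  I2 a b c d (fun x y => F x y - G x y) = I2 a b c d F - I2 a b c d G.
Proof. by move=> cF cG; rewrite I2D//; [rewrite I2N|exact: cont2N]. Qed.

Lemma eq_I2 a b c d F G :
  (forall x y, a <= x <= b -> c <= y <= d -> F x y = G x y) -> I2 a b c d F = I2 a b c d G.
Proof. by move=> FG; apply: eq_I1 => x xab; apply: eq_I1 => y ycd; exact: FG. Qed.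

Lemma le_I2 a b c d F G : cont2 F -> cont2 G ->
  (forall x y, a <= x <= b -> c <= y <= d -> F x y <= G x y) -> I2 a b c d F <= I2 a b c d G.
Proof.
move=> cF cG FG; apply: le_I1; try exact: cont_I1.
by move=> x xab; apply: le_I1 => [||y ycd]; [exact: cont2_s1|exact: cont2_s1|exact: FG].
Qed.

Lemma I2_ge0 a b c d F :
  (forall x y, a <= x <= b -> c <= y <= d -> 0 <= F x y) -> 0 <= I2 a b c d F.
Proof. by move=> F0; apply: I1_ge0 => x xab; apply: I1_ge0 => y; exact: F0. Qed.

Lemma I2_fst a b c d f : c <= d -> continuous f ->
  I2 a b c d (fun x _ => f x) = (d - c) * I1 a b f.
Proof.
move=> cd cf; rewrite /I2 -I1Z//; apply: eq_I1 => x _.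
by rewrite I1_cst// mulrC.
Qed.

End Prod.

(** * Calculus of polynomials *)

Section PolyCalculus.
Context {R : realType}.
Implicit Types (p q : {poly R}) (a b c d x y : R).

Lemma is_derive_horner p x : is_derive x 1 (horner p) (p^`()).[x].
Proof.
elim/poly_ind: p x => [|p c IH] x.
  rewrite deriv0 horner0; have -> : horner 0 = cst 0 :> (R -> R) by apply/funext => y; rewrite horner0.
  exact: is_derive_cst.
have -> : horner (p * 'X + c%:P) = (horner p * id + cst c)%R :> (R -> R).
  by apply/funext => y; rewrite hornerMXaddC.
rewrite derivMXaddC hornerD hornerMX.
have -> : p.[x] + (p^`()).[x] * x = (p.[x] *: 1 + x *: (p^`()).[x]) + 0.
  by rewrite addr0 -[_ *: 1]/(p.[x] * 1) mulr1 -[x *: _]/(x * _) mulrC.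
exact: is_deriveD.
Qed.

Definition primp p : {poly R} := \poly_(i < (size p).+1) (p`_i.-1 / i%:R).

Lemma deriv_primp p : (primp p)^`() = p.
Proof.
apply/polyP => i; rewrite coef_deriv coef_poly ltnS /=.
case: ltnP => ip; first by rewrite -[LHS]mulr_natr mulfVK ?pnatr_eq0.
by rewrite mul0rn nth_default.
Qed.

Lemma cont_horner p : continuous (horner p).
Proof. exact: continuous_horner. Qed.
Hint Resolve cont_horner : core.

Lemma I1_horner a b p : a <= b -> I1 a b (horner p) = (primp p).[b] - (primp p).[a].
Proof.
move=> ab; apply: I1_FTC => //.
by move=> x _; rewrite -[in p.[x]](deriv_primp p); exact: is_derive_horner.
Qed.

Lemma poly_zero_on p a b : a < b -> (forall x, a < x < b -> p.[x] = 0) -> p = 0.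
Proof.
move=> ab p0; apply/eqP/contraT => pN0.
pose s := [seq a + (b - a) / (i.+2)%:R | i <- iota 0 (size p)].
have : (size s < size p)%N.
  apply: max_poly_roots => //.
    apply/allP => _ /mapP[i _ ->]; apply/rootP/p0.
    have h : 0 < (i.+2%:R)^-1 :> R by rewrite invr_gt0.
    have h1 : (i.+2%:R)^-1 < 1 :> R by rewrite invf_lt1 ?ltr1n.
    by rewrite ltrDl mulr_gt0 ?subr_gt0//= -ltrBrDl gtr_pMr// subr_gt0.
  rewrite map_inj_uniq ?iota_uniq// => i j /addrI.
  have ba : b - a != 0 by rewrite subr_eq0 gt_eqF.
  by move=> /(mulfI ba) /invr_inj /eqP; rewrite eqr_nat => /eqP[].
by rewrite size_map size_iota ltnn.
Qed.

(** A nonnegative continuous function with zero integral vanishes, and a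
    polynomial that vanishes on an interval is zero. *)
Lemma I1_poly_ge0_eq0 p : (forall x, 0 <= x <= 1 -> 0 <= p.[x]) ->
  I1 0 1 (horner p) = 0 -> p = 0.
Proof.
move=> p0 I0.
suff : primp p - ((primp p).[0])%:P = 0.
  by move=> /(congr1 (@deriv _)); rewrite derivB derivC subr0 deriv_primp deriv0.
apply: (@poly_zero_on _ 0 1) => // x /andP[x0 x1]; rewrite hornerD hornerN hornerC.
have h0 : 0 <= I1 0 x (horner p).
  by apply: I1_ge0 => y /andP[y0 yx]; apply: p0; rewrite y0 (le_trans yx (ltW x1)).
have h1 : 0 <= I1 x 1 (horner p).
  by apply: I1_ge0 => y /andP[xy y1]; apply: p0; rewrite y1 (le_trans (ltW x0) xy).
have : I1 0 1 (horner p) = I1 0 x (horner p) + I1 x 1 (horner p).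
  by apply: I1_cat => //; rewrite (ltW x0) (ltW x1).
rewrite I0 => h2; rewrite -I1_horner ?(ltW x0)//; lra.
Qed.

Lemma I1_scale c d q : c < d ->
  I1 c d (fun y => q.[(y - c) / (d - c)]) = (d - c) * I1 0 1 (horner q).
Proof.
move=> cd; pose L := (d - c)^-1 *: ('X - c%:P).
have LE y : L.[y] = (y - c) / (d - c) by rewrite hornerZ hornerXsubC mulrC.
have h0 : d - c != 0 by rewrite subr_eq0 gt_eqF.
have -> : I1 c d (fun y => q.[(y - c) / (d - c)]) = I1 c d (horner (q \Po L)).
  by apply: eq_I1 => y _; rewrite horner_comp LE.
pose P := (d - c) *: (primp q \Po L).
have dP x : c < x < d -> is_derive x 1 (horner P) (q \Po L).[x].
  move=> _; have -> : (q \Po L).[x] = (P^`()).[x]; last exact: is_derive_horner.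
  rewrite /P derivZ hornerZ deriv_comp deriv_primp hornerM /L derivZ derivXsubC hornerZ hornerC.
  by rewrite mulr1 mulrCA divff// mulr1.
rewrite (I1_FTC (ltW cd) (@cont_horner _) (@cont_horner _) dP) I1_horner//.
by rewrite /P !hornerZ !horner_comp !LE subrr mul0r divff// mulrBr.
Qed.

End PolyCalculus.
#[export] Hint Resolve cont_horner : core.

(** * Degrees of freedom on an interval *)

(** The Gauss-Radau projections that interpolate at the right or the left end
    point, and the L2 projection. *)
Inductive proj_kind := Radau_right | Radau_left | Orthogonal.

Section Reference.
Context {R : realType} (k : nat).
Implicit Types (p q r : {poly R}) (g : R -> R) (a b c d x y : R) (K : proj_kind) (m : nat).

Definition is_moment K m := (m < k)%N || (if K is Orthogonal then true else false).

Definition ref_dof K m q : R :=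
  if is_moment K m then I1 0 1 (horner (q * 'X^m))
  else q.[if K is Radau_right then 1 else 0].

(** Moments are taken against powers of the affine coordinate and divided by
    the length: a degree of freedom on [c, d] is that of the rescaled function
    on [0, 1]. *)
Definition dof K c d m g : R :=
  if is_moment K m then (d - c)^-1 * I1 c d (fun y => g y * ((y - c) / (d - c)) ^+ m)
  else g (if K is Radau_right then d else c).

Lemma dof_poly K c d m q : c < d ->
  dof K c d m (fun y => q.[(y - c) / (d - c)]) = ref_dof K m q.
Proof.
move=> cd; have h0 : d - c != 0 by rewrite subr_eq0 gt_eqF.
rewrite /dof /ref_dof; case: ifP => _.
  rewrite -[RHS](mulKf h0) -I1_scale//; congr (_ * _).
  by apply: eq_I1 => y _; rewrite hornerM hornerXn.
by case: K; rewrite ?divff// subrr mul0r.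
Qed.

Lemma ref_dofD K m p q : ref_dof K m (p + q) = ref_dof K m p + ref_dof K m q.
Proof.
rewrite /ref_dof; case: ifP => _; last by rewrite hornerD.
rewrite -I1D; try exact: cont_horner.
by apply: eq_I1 => x _; rewrite mulrDl hornerD.
Qed.

Lemma ref_dofZ K m c q : ref_dof K m (c *: q) = c * ref_dof K m q.
Proof.
rewrite /ref_dof; case: ifP => _; last by rewrite hornerZ.
rewrite -I1Z; try exact: cont_horner.
by apply: eq_I1 => x _; rewrite -scalerAl hornerZ.
Qed.

Lemma ref_dof_sum K m (I : Type) (s : seq I) (F : I -> {poly R}) :
  ref_dof K m (\sum_(i <- s) F i) = \sum_(i <- s) ref_dof K m (F i).
Proof.
elim: s => [|i r IH]; last by rewrite !big_cons ref_dofD IH.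
by rewrite !big_nil -[X in ref_dof K m X](scale0r 0) ref_dofZ mul0r.
Qed.

Definition nmom K := if K is Orthogonal then k.+1 else k.

Lemma is_momentE K m : (m < nmom K)%N -> is_moment K m.
Proof. by rewrite /nmom /is_moment; case: K => //= h; rewrite ?h ?orbT. Qed.

Lemma nmom_le K : (nmom K <= k.+1)%N. Proof. by case: K => /=. Qed.

Lemma horner_moment (q r : {poly R}) n : (size r <= n)%N ->
  I1 0 1 (horner (q * r)) = \sum_(m < n) r`_m * I1 0 1 (horner (q * 'X^m)).
Proof.
move=> sr; have rE : r = \poly_(m < n) r`_m.
  apply/polyP => i; rewrite coef_poly; case: ltnP => // ki.
  by rewrite nth_default// (leq_trans sr).
rewrite {1}rE poly_def mulr_sumr.
have -> : horner (\sum_(m < n) q * (r`_m *: 'X^m)) =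
     (fun x => \sum_(m < n) (r`_m * (q * 'X^m).[x])).
  apply/funext => x; rewrite horner_sum; apply: eq_bigr => m _.
  by rewrite -scalerAr hornerZ.
rewrite I1_sum; last by move=> m; apply: cont1M; [exact: cont1_cst|exact: cont_horner].
by apply: eq_bigr => m _; rewrite I1Z//; exact: cont_horner.
Qed.

(** Vanishing moments against the powers give orthogonality to all polynomials
    in their span. *)
Lemma moments_ortho K q r : (size r <= nmom K)%N ->
  (forall m, (m < k.+1)%N -> ref_dof K m q = 0) -> I1 0 1 (horner (q * r)) = 0.
Proof.
move=> sr q0; rewrite (horner_moment q sr) big1// => m _.
have := q0 m (leq_trans (ltn_ord m) (nmom_le K)).
by rewrite /ref_dof is_momentE// => ->; rewrite mulr0.
Qed.

(** Unisolvence: if the Radau degrees of freedom of q vanish then q = (x - z)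
    r with z an end point and deg r < k, and the integral of q r, a function
    of constant sign, is zero. *)
Lemma ref_dof_inj K q : (size q <= k.+1)%N ->
  (forall m, (m < k.+1)%N -> ref_dof K m q = 0) -> q = 0.
Proof.
move=> sq q0.
have key z (c : R) : (forall x, 0 <= x <= 1 -> 0 <= c * (x - z)) -> c != 0 -> (nmom K = k) ->
    root q z -> q = 0.
  move=> cz c0 Kk /factor_theorem[r qE].
  have [r0|rN0] := eqVneq r 0; first by rewrite qE r0 mul0r.
  have sr : (size r <= nmom K)%N.
    by move: sq; rewrite Kk qE size_Mmonic ?monicXsubC// size_XsubC addnC.
  have H := moments_ortho sr q0.
  have : (c *: (q * r)) = 0.
    apply: I1_poly_ge0_eq0.
      move=> x x01; rewrite hornerZ qE !hornerM hornerXsubC.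
      by rewrite mulrAC mulrCA -expr2 mulr_ge0 ?sqr_ge0// cz.
    have -> : horner (c *: (q * r)) = (fun x => c * (q * r).[x]).
      by apply/funext => x; rewrite hornerZ.
    by rewrite I1Z ?H ?mulr0//; exact: cont_horner.
  move/eqP; rewrite scaler_eq0 (negPf c0) /= mulf_eq0 (negPf rN0) orbF => /eqP.
  by [].
case: K key sq q0 => key sq q0.
- apply: (key 1 (-1)) => //; first by move=> x /andP[_ x1]; rewrite mulN1r opprB subr_ge0.
  have := q0 k (ltnSn k); rewrite /ref_dof /is_moment ltnn /= => qk.
  exact/rootP.
- apply: (key 0 1) => //; first by move=> x /andP[x0 _]; rewrite mul1r subr0.
  have := q0 k (ltnSn k); rewrite /ref_dof /is_moment ltnn /= => qk.
  exact/rootP.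
- have H := @moments_ortho Orthogonal q q sq q0.
  have : q * q = 0.
    by apply: I1_poly_ge0_eq0 => // x _; rewrite hornerM -expr2 sqr_ge0.
  by move/eqP; rewrite mulf_eq0 orbb => /eqP.
Qed.

Definition dof_mx K : 'M[R]_k.+1 := \matrix_(l, m) ref_dof K m 'X^l.

Definition rowpoly (v : 'rV[R]_k.+1) : {poly R} := \sum_(l < k.+1) v ord0 l *: 'X^l.

Lemma ref_dof_row K (v : 'rV[R]_k.+1) (m : 'I_k.+1) :
  ref_dof K m (rowpoly v) = (v *m dof_mx K) 0 m.
Proof.
rewrite ref_dof_sum mxE; apply: eq_bigr => l _.
by rewrite ref_dofZ mxE.
Qed.

Lemma coef_rowpoly (v : 'rV[R]_k.+1) (l : 'I_k.+1) :
  (rowpoly v)`_l = v ord0 l.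
Proof.
rewrite coef_sum (bigD1 l)//= coefZ coefXn eqxx mulr1 big1 ?addr0// => i il.
by rewrite coefZ coefXn; case: eqP => [/val_inj li|]; rewrite ?mulr0//; rewrite li eqxx in il.
Qed.

Lemma size_rowpoly (v : 'rV[R]_k.+1) :
  (size (rowpoly v) <= k.+1)%N.
Proof.
apply: (leq_trans (size_sum _ _ _)); apply/bigmax_leqP => i _.
by apply: (leq_trans (size_scale_leq _ _)); rewrite size_polyXn.
Qed.

Lemma dof_mx_unit K : dof_mx K \in unitmx.
Proof.
rewrite -row_free_unit; apply: inj_row_free => v v0.
have q0 : rowpoly v = 0.
  apply: (@ref_dof_inj K); first exact: size_rowpoly.
  move=> m mk; have := ref_dof_row K v (Ordinal mk); rewrite v0 mxE; exact.
by apply/rowP => l; rewrite mxE -coef_rowpoly q0 coef0.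
Qed.

Definition dual K (m : 'I_k.+1) : {poly R} :=
  rowpoly (row m (invmx (dof_mx K))).

Lemma size_dual K (m : 'I_k.+1) : (size (dual K m) <= k.+1)%N.
Proof. exact: size_rowpoly. Qed.

Lemma ref_dof_dual K (m l : 'I_k.+1) : ref_dof K l (dual K m) = (m == l)%:R.
Proof.
by rewrite ref_dof_row -row_mul mulVmx ?dof_mx_unit// !mxE.
Qed.

Lemma ref_repr K q : (size q <= k.+1)%N ->
  q = \sum_(m < k.+1) ref_dof K m q *: dual K m.
Proof.
move=> sq; apply/eqP; rewrite -subr_eq0; apply/eqP.
set p := \sum_(m < _) _.
have sp : (size p <= k.+1)%N.
  apply: (leq_trans (size_sum _ _ _)); apply/bigmax_leqP => i _.
  exact: (leq_trans (size_scale_leq _ _)) (size_dual _ _).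
apply: (@ref_dof_inj K).
  by apply: (leq_trans (size_polyD _ _)); rewrite geq_max sq size_polyN.
move=> m mk; rewrite ref_dofD -scaleN1r ref_dofZ mulN1r ref_dof_sum.
rewrite (bigD1 (Ordinal mk))//= big1.
  by rewrite ref_dofZ (ref_dof_dual K (Ordinal mk) (Ordinal mk)) eqxx mulr1 addr0 subrr.
by move=> i iN; rewrite ref_dofZ (ref_dof_dual K i (Ordinal mk)) (negPf iN) mulr0.
Qed.

End Reference.

(** * One-dimensional projections *)

Section Projection.
Context {R : realType} (k : nat).
Implicit Types (p q r : {poly R}) (f g : R -> R) (F : R -> R -> R) (a b c d x y : R) (K : proj_kind) (m : nat).
Notation dof := (@dof R k).
Notation ref_dof := (@ref_dof R k).
Notation dual := (@dual R k).

(** Written in the dual basis the projection is defined for every function,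
    linear, and bounded by a constant that does not depend on the interval. *)
Definition proj K c d g y : R :=
  \sum_(m < k.+1) dof K c d m g * (dual K m).[(y - c) / (d - c)].

Lemma cont_affine c d : continuous (fun y : R => (y - c) / (d - c)).
Proof.
apply: cont1M; last exact: cont1_cst.
by apply: cont1D; [exact: cont1_id|exact: cont1_cst].
Qed.

Lemma cont_scaled q c d : continuous (fun y => q.[(y - c) / (d - c)]).
Proof.
move=> y; apply: (@continuous_comp _ _ _ (fun y => (y - c) / (d - c)) (horner q) y).
  exact: cont_affine.
exact: cont_horner.
Qed.

Lemma scaled_poly q c d : exists2 q' : {poly R}, (size q' <= size q)%N &
  forall y, q'.[y] = q.[(y - c) / (d - c)].
Proof.
exists (q \Po ((d - c)^-1 *: ('X - c%:P))).
  have [->|q0] := eqVneq q 0; first by rewrite comp_poly0.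
  apply: (leq_trans (size_comp_poly_leq _ _)).
  have : (size ((d - c)^-1 *: ('X - c%:P)) <= 2)%N.
    by apply: (leq_trans (size_scale_leq _ _)); rewrite size_XsubC.
  move=> h; have : (0 < size q)%N by rewrite size_poly_gt0.
  case: (size q) => // n _; case: (size _) h => [|[|[|]]] //= _; by rewrite ?muln0 ?muln1.
by move=> y; rewrite horner_comp hornerZ hornerXsubC mulrC.
Qed.

Lemma unscaled_poly q c d : c < d -> exists2 q' : {poly R}, (size q' <= size q)%N &
  forall y, q.[y] = q'.[(y - c) / (d - c)].
Proof.
move=> cd; have h0 : d - c != 0 by rewrite subr_eq0 gt_eqF.
have [q' sq' qE] := scaled_poly q (- c / (d - c)) ((1 - c) / (d - c)).
exists q' => // y; rewrite qE; congr (q.[_]).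
by rewrite !mulNr !opprK -!mulrDl !subrK mul1r invrK mulfVK.
Qed.

Lemma proj_ref K c d g : exists2 q : {poly R}, (size q <= k.+1)%N /\
   (forall m, (m < k.+1)%N -> ref_dof K m q = dof K c d m g) &
   proj K c d g = (fun y => q.[(y - c) / (d - c)]).
Proof.
exists (\sum_(m < k.+1) dof K c d m g *: dual K m); last first.
  by apply/funext => y; rewrite horner_sum; apply: eq_bigr => m _; rewrite hornerZ.
split.
  apply: (leq_trans (size_sum _ _ _)); apply/bigmax_leqP => i _.
  exact: (leq_trans (size_scale_leq _ _)) (size_dual _ _).
move=> m mk; rewrite ref_dof_sum (bigD1 (Ordinal mk))//= big1.
  by rewrite ref_dofZ (ref_dof_dual K (Ordinal mk) (Ordinal mk)) eqxx mulr1 addr0.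
by move=> i iN; rewrite ref_dofZ (ref_dof_dual K i (Ordinal mk)) (negPf iN) mulr0.
Qed.

Lemma proj_polyP K c d g : exists2 q : {poly R}, (size q <= k.+1)%N &
   proj K c d g = horner q.
Proof.
have [q [sq _] ->] := proj_ref K c d g.
have [q' sq' q'E] := scaled_poly q c d.
by exists q'; [exact: leq_trans sq' sq|apply/funext => y; rewrite q'E].
Qed.

Lemma cont_proj K c d g : continuous (proj K c d g).
Proof. by have [q _ ->] := proj_polyP K c d g; exact: cont_horner. Qed.

Lemma dof_proj K c d m g : c < d -> (m < k.+1)%N ->
  dof K c d m (proj K c d g) = dof K c d m g.
Proof. by move=> cd mk; have [q [sq qE] ->] := proj_ref K c d g; rewrite dof_poly// qE. Qed.

Lemma proj_id K c d q : c < d -> (size q <= k.+1)%N -> proj K c d (horner q) = horner q.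
Proof.
move=> cd sq; have [q' sq' qE] := unscaled_poly q cd.
have qE' : horner q = (fun y => q'.[(y - c) / (d - c)]) by apply/funext.
apply/funext => y; rewrite /proj qE'.
under eq_bigr do rewrite dof_poly//.
rewrite {2}(ref_repr K (leq_trans sq' sq)) horner_sum.
by apply: eq_bigr => m _; rewrite hornerZ.
Qed.

Lemma cont_dof_integrand c d m g : continuous g ->
  continuous (fun y => g y * ((y - c) / (d - c)) ^+ m).
Proof. by move=> cg; apply: cont1M => //; apply: cont1X; exact: cont_affine. Qed.

Lemma dofD K c d m f g : continuous f -> continuous g ->
  dof K c d m (fun y => f y + g y) = dof K c d m f + dof K c d m g.
Proof.
move=> cf cg; rewrite /dof; case: ifP => // _; rewrite -mulrDr -I1D; try exact: cont_dof_integrand.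
by congr (_ * _); apply: eq_I1 => y _; rewrite mulrDl.
Qed.

Lemma dofZ K c d m e g : continuous g ->
  dof K c d m (fun y => e * g y) = e * dof K c d m g.
Proof.
move=> cg; rewrite /dof; case: ifP => // _; rewrite mulrCA; congr (_ * _).
rewrite -I1Z; last exact: cont_dof_integrand.
by apply: eq_I1 => y _; rewrite mulrA.
Qed.

Lemma dofB K c d m f g : continuous f -> continuous g ->
  dof K c d m (fun y => f y - g y) = dof K c d m f - dof K c d m g.
Proof.
move=> cf cg; rewrite dofD//; last exact: cont1N.
congr (_ + _); rewrite -mulN1r -dofZ//; apply: congr1.
by apply/funext => y; rewrite mulN1r.
Qed.

Lemma eq_dof K c d m f g : c <= d -> (forall y, c <= y <= d -> f y = g y) ->
  dof K c d m f = dof K c d m g.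
Proof.
move=> cd fg; rewrite /dof; case: ifP => _.
  by congr (_ * _); apply: eq_I1 => y ycd; rewrite fg.
by case: K; rewrite fg ?cd ?lexx.
Qed.

Lemma eq_proj K c d f g : c <= d -> (forall y, c <= y <= d -> f y = g y) ->
  proj K c d f = proj K c d g.
Proof.
by move=> cd fg; apply/funext => y; apply: eq_bigr => m _; rewrite (eq_dof K m cd fg).
Qed.

Lemma projD K c d f g y : continuous f -> continuous g ->
  proj K c d (fun y => f y + g y) y = proj K c d f y + proj K c d g y.
Proof. by move=> cf cg; rewrite /proj -big_split; apply: eq_bigr => m _ /=; rewrite dofD// mulrDl. Qed.

Lemma projB K c d f g y : continuous f -> continuous g ->
  proj K c d (fun y => f y - g y) y = proj K c d f y - proj K c d g y.
Proof. by move=> cf cg; rewrite /proj -sumrB; apply: eq_bigr => m _ /=; rewrite dofB// mulrBl. Qed.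

Lemma projZ K c d e g y : continuous g ->
  proj K c d (fun y => e * g y) y = e * proj K c d g y.
Proof. by move=> cg; rewrite /proj mulr_sumr; apply: eq_bigr => m _ /=; rewrite dofZ// mulrA. Qed.

Lemma proj_right c d g : c < d -> proj Radau_right c d g d = g d.
Proof.
by move=> cd; have := dof_proj Radau_right g cd (ltnSn k); rewrite /dof /is_moment ltnn.
Qed.

Lemma proj_left c d g : c < d -> proj Radau_left c d g c = g c.
Proof.
by move=> cd; have := dof_proj Radau_left g cd (ltnSn k); rewrite /dof /is_moment ltnn.
Qed.

Lemma I1_moments c d g q n : c < d -> continuous g -> (size q <= n)%N ->
  exists w : nat -> R,
  I1 c d (fun y => g y * q.[y]) =
    \sum_(m < n) w m * I1 c d (fun y => g y * ((y - c) / (d - c)) ^+ m) /\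
  forall f, continuous f -> I1 c d (fun y => f y * q.[y]) =
    \sum_(m < n) w m * I1 c d (fun y => f y * ((y - c) / (d - c)) ^+ m).
Proof.
move=> cd cg sq; have [q' sq' qE] := unscaled_poly q cd.
suff H f : continuous f -> I1 c d (fun y => f y * q.[y]) =
    \sum_(m < n) q'`_m * I1 c d (fun y => f y * ((y - c) / (d - c)) ^+ m).
  by exists (fun m => q'`_m); split; [exact: H|exact: H].
move=> cf.
transitivity (I1 c d (fun y => \sum_(m < n) q'`_m * (f y * ((y - c) / (d - c)) ^+ m))).
  apply: eq_I1 => y _; rewrite qE (horner_coef_wide _ (leq_trans sq' sq)) mulr_sumr.
  by apply: eq_bigr => m _; rewrite mulrCA.
rewrite I1_sum; last by move=> m; apply: cont1M; [exact: cont1_cst|exact: @cont_dof_integrand c d m _ cf].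
by apply: eq_bigr => m _; rewrite I1Z//; exact: @cont_dof_integrand c d m _ cf.
Qed.

Lemma proj_moment K c d g q : c < d -> continuous g -> (size q <= nmom k K)%N ->
  I1 c d (fun y => proj K c d g y * q.[y]) = I1 c d (fun y => g y * q.[y]).
Proof.
move=> cd cg sq; have [w [-> H]] := I1_moments cd cg sq.
rewrite H; last exact: cont_proj.
apply: eq_bigr => m _; congr (_ * _).
have mk : (m < k.+1)%N := leq_trans (ltn_ord m) (nmom_le k K).
have := dof_proj K g cd mk; rewrite /dof is_momentE//.
by apply: mulfI; rewrite invr_eq0 subr_eq0 gt_eqF.
Qed.

Lemma dual_bound : exists2 C : R, 1 <= C &
  forall K t, 0 <= t <= 1 -> \sum_(m < k.+1) `|(dual K m).[t]| <= C.
Proof.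
have H K : exists C : R, 0 <= C /\ forall t, 0 <= t <= 1 -> \sum_(m < k.+1) `|(dual K m).[t]| <= C.
  have cF : cont2 (fun t _ : R => \sum_(m < k.+1) `|(dual K m).[t]|).
    apply: cont2_sum => m; apply: cont2_norm; apply: (cont2_fst (@cont_horner _ _)).
  have [C [C0 HC]] := cont2_bounded 0 1 0 1 cF.
  exists C; split => // t t01; apply: le_trans (HC t 0 t01 _).
    exact: ler_norm.
  by rewrite lexx ler01.
have [C1 [C10 H1]] := H Radau_right; have [C2 [C20 H2]] := H Radau_left.
have [C3 [C30 H3]] := H Orthogonal.
exists (1 + C1 + C2 + C3); first by rewrite -!addrA lerDl !addr_ge0.
move=> K t t01; case: K; [have := H1 t t01|have := H2 t t01|have := H3 t t01]; lra.
Qed.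

Lemma unit_affine c d y : c < d -> c <= y <= d -> 0 <= (y - c) / (d - c) <= 1.
Proof.
move=> cd /andP[cy yd]; have h : 0 < d - c by rewrite subr_gt0.
by rewrite divr_ge0 ?subr_ge0 ?(ltW cd)//= ler_pdivrMr// mul1r lerB.
Qed.

Lemma proj_le_dof C K c d g M y : c < d -> c <= y <= d ->
  (forall K t, 0 <= t <= 1 -> \sum_(m < k.+1) `|(dual K m).[t]| <= C) ->
  0 <= M -> (forall m, (m < k.+1)%N -> `|dof K c d m g| <= M) ->
  `|proj K c d g y| <= C * M.
Proof.
move=> cd ycd HC M0 HM; have t01 := unit_affine cd ycd.
apply: (le_trans (ler_norm_sum _ _ _)).
apply: (@le_trans _ _ (\sum_(m < k.+1) `|(dual K m).[(y - c) / (d - c)]| * M)).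
  by apply: ler_sum => m _; rewrite normrM mulrC ler_wpM2l// HM.
by rewrite -mulr_suml ler_wpM2r// HC.
Qed.

Lemma moment_le c d m g W : c < d -> continuous g -> continuous W ->
  (forall y, c <= y <= d -> `|g y| <= W y) ->
  `|(d - c)^-1 * I1 c d (fun y => g y * ((y - c) / (d - c)) ^+ m)| <= (d - c)^-1 * I1 c d W.
Proof.
move=> cd cg cW gW; have h : 0 <= (d - c)^-1 by rewrite invr_ge0 subr_ge0 ltW.
rewrite normrM ger0_norm// ler_wpM2l//.
have cI := @cont_dof_integrand c d m g cg.
apply: (le_trans (ler_norm_I1 _ _ cI)); apply: le_I1 => //; first exact: cont1_norm.
move=> y ycd; rewrite normrM; have /andP[t0 t1] := unit_affine cd ycd.
rewrite -[leRHS]mulr1 ler_pM ?gW//.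
by rewrite normrX ger0_norm// exprn_ile1.
Qed.

Lemma dof_le K c d m g M : c < d -> continuous g ->
  (forall y, c <= y <= d -> `|g y| <= M) -> `|dof K c d m g| <= M.
Proof.
move=> cd cg gM; rewrite /dof; case: ifP => _.
  have := @moment_le c d m g (fun=> M) cd cg (@cont1_cst _ M) gM.
  by rewrite I1_cst ?(ltW cd)// mulrCA mulVf ?mulr1// subr_eq0 gt_eqF.
by case: K; apply: gM; rewrite lexx (ltW cd).
Qed.

(** The weight W is smallest at the left end point, so its mean also bounds
    the value of g there. At the right end point this would fail, which
    excludes Radau_right. *)
Lemma dof_le_avg K c d m g W : K <> Radau_right -> c < d -> continuous g -> continuous W ->
  (forall y, c <= y <= d -> `|g y| <= W y) -> (forall y, c <= y <= d -> W c <= W y) ->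
  `|dof K c d m g| <= (d - c)^-1 * I1 c d W.
Proof.
move=> KN cd cg cW gW Wc; rewrite /dof; case: ifP => _; first exact: moment_le.
have Wle : W c <= (d - c)^-1 * I1 c d W.
  rewrite ler_pdivlMl ?subr_gt0// mulrC -I1_cst ?(ltW cd)//.
  by apply: le_I1 => //; exact: cont1_cst.
by case: K KN => // _; apply: le_trans Wle; apply: gW; rewrite lexx (ltW cd).
Qed.

Lemma cont_dof K c d m F : cont2 F -> continuous (fun x => dof K c d m (F x)).
Proof.
move=> cF; rewrite /dof; case: (is_moment k K m); last by apply: cont2_s2.
apply: cont1M; first exact: cont1_cst.
apply: (@cont_I1 _ (fun x y => F x y * ((y - c) / (d - c)) ^+ m)).
by apply: cont2M => //; apply: (@cont2_snd _ (fun y => ((y - c) / (d - c)) ^+ m)); apply: cont1X; exact: cont_affine.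
Qed.

Lemma cont2_proj K c d F : cont2 F -> cont2 (fun x y => proj K c d (F x) y).
Proof.
move=> cF; apply: cont2_sum => m; apply: cont2M.
  by apply: (@cont2_fst _ (fun x => dof K c d m (F x))); exact: cont_dof.
by apply: (@cont2_snd _ (fun y => (dual K m).[(y - c) / (d - c)])); exact: cont_scaled.
Qed.

Lemma dof_I1 K a b c d m F : cont2 F ->
  I1 a b (fun x => dof K c d m (F x)) = dof K c d m (fun t => I1 a b (fun x => F x t)).
Proof.
move=> cF; rewrite /dof; case: (is_moment k K m) => //.
have cG : cont2 (fun x y => F x y * ((y - c) / (d - c)) ^+ m).
  by apply: cont2M => //; apply: (@cont2_snd _ (fun y => ((y - c) / (d - c)) ^+ m)); apply: cont1X; exact: cont_affine.
rewrite (@I1Z _ a b (fun x => I1 c d (fun y => F x y * ((y - c) / (d - c)) ^+ m))); last exact: (cont_I1 cG).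
congr (_ * _); have := I2_swap a b c d cG; rewrite /I2 => ->.
apply: eq_I1 => y _; rewrite [RHS]mulrC -I1Z; last exact: cont2_s2.
by apply: eq_I1 => x _; rewrite mulrC.
Qed.

(** Moments and point values in the two variables commute by Fubini. *)
Lemma dof_comm K K' a b c d m l F : cont2 F ->
  dof K c d m (fun t => dof K' a b l (F ^~ t)) = dof K' a b l (fun s => dof K c d m (F s)).
Proof.
move=> cF; have [lm|lm] := boolP (is_moment k K' l); last first.
  have E h : dof K' a b l h = h (if K' is Radau_right then b else a) by rewrite /dof (negPf lm).
  by rewrite E; under [in LHS]eq_fun do rewrite E.
have E h : dof K' a b l h = (b - a)^-1 * I1 a b (fun s => h s * ((s - a) / (b - a)) ^+ l).
  by rewrite /dof lm.
rewrite E; under [in LHS]eq_fun do rewrite E.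
have cG : cont2 (fun s t => F s t * ((s - a) / (b - a)) ^+ l).
  by apply: cont2M => //; apply: (@cont2_fst _ (fun y => ((y - a) / (b - a)) ^+ l)); apply: cont1X; exact: cont_affine.
rewrite dofZ; last by apply: (@cont_I1 _ (fun t s => F s t * ((s - a) / (b - a)) ^+ l)); exact: (cont2_swap cG).
congr (_ * _); rewrite -(dof_I1 K a b c d m cG); apply: eq_I1 => s _.
rewrite [RHS]mulrC -dofZ; last exact: cont2_s1.
by congr (dof _ _ _ _ _); apply/funext => t; rewrite mulrC.
Qed.

Lemma dof_sum K c d m (n : nat) (w : 'I_n -> R) (G : 'I_n -> R -> R) :
  (forall i, continuous (G i)) ->
  dof K c d m (fun y => \sum_(i < n) G i y * w i) = \sum_(i < n) dof K c d m (G i) * w i.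
Proof.
move=> cG; rewrite /dof; case: (is_moment k K m) => //.
rewrite (@eq_I1 _ c d _ (fun y => \sum_(i < n) w i * (G i y * ((y - c) / (d - c)) ^+ m))); last first.
  by move=> y _; rewrite mulr_suml; apply: eq_bigr => i _; rewrite mulrAC mulrC.
have cI i := @cont_dof_integrand c d m (G i) (cG i).
rewrite I1_sum; last by move=> i; apply: cont1M; [exact: cont1_cst|exact: cI].
by rewrite mulr_sumr; apply: eq_bigr => i _; rewrite I1Z// mulrCA mulrC.
Qed.

Lemma proj_comm K K' a b c d F x y : cont2 F ->
  proj K c d (fun t => proj K' a b (F ^~ t) x) y = proj K' a b (fun s => proj K c d (F s) y) x.
Proof.
move=> cF; rewrite /proj.
under eq_bigr => m _.
  rewrite dof_sum; last by move=> l; apply: (@cont_dof K' a b l (fun t s => F s t)); exact: cont2_swap.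
  under eq_bigr do rewrite dof_comm//.
  over.
under [RHS]eq_bigr => l _.
  rewrite dof_sum; last by move=> m; exact: cont_dof.
  over.
under eq_bigr do rewrite mulr_suml.
rewrite exchange_big /=; apply: eq_bigr => l _; rewrite mulr_suml; apply: eq_bigr => m _.
by rewrite mulrAC.
Qed.

End Projection.

(** * Polynomials in two variables and functions differentiable in x *)

Section Ev.
Context {R : realType} (k : nat).
Implicit Types (C : 'M[R]_k.+1) (x y : R).

(** A polynomial of degree at most k in each variable is its matrix of
    coefficients; transposing the matrix exchanges the variables. *)
Definition ev C x y : R := \sum_(r < k.+1) \sum_(s < k.+1) C r s * x ^+ r * y ^+ s.
Definition evx C x y : R := \sum_(r < k.+1) \sum_(s < k.+1) C r s * (x ^+ r.-1 *+ r) * y ^+ s.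

Definition polx C y : {poly R} := \sum_(r < k.+1) (\sum_(s < k.+1) C r s * y ^+ s) *: 'X^r.

Lemma evE C x y : ev C x y = (polx C y).[x].
Proof.
rewrite horner_sum; apply: eq_bigr => r _; rewrite hornerZ hornerXn mulr_suml.
by apply: eq_bigr => s _; rewrite mulrAC.
Qed.

Lemma evxE C x y : evx C x y = ((polx C y)^`()).[x].
Proof.
rewrite raddf_sum horner_sum; apply: eq_bigr => r _ /=.
rewrite derivZ derivXn hornerZ hornerMn hornerXn mulr_suml.
by apply: eq_bigr => s _; rewrite mulrAC.
Qed.

Lemma size_polx C y : (size (polx C y) <= k.+1)%N.
Proof.
apply: (leq_trans (size_sum _ _ _)); apply/bigmax_leqP => i _.
by apply: (leq_trans (size_scale_leq _ _)); rewrite size_polyXn.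
Qed.

Lemma size_dpolx C y : (size ((polx C y)^`()) <= k)%N.
Proof.
have [->|q0] := eqVneq (polx C y) 0; first by rewrite deriv0 size_poly0.
by have := leq_trans (lt_size_deriv q0) (size_polx C y); rewrite ltnS.
Qed.

Lemma ev_tr C x y : ev C^T y x = ev C x y.
Proof.
rewrite /ev exchange_big; apply: eq_bigr => r _; apply: eq_bigr => s _.
by rewrite mxE mulrAC.
Qed.

Lemma evx_poly C x : exists2 q : {poly R}, (size q <= k.+1)%N & forall y, evx C x y = q.[y].
Proof.
exists (\sum_(s < k.+1) (\sum_(r < k.+1) C r s * (x ^+ r.-1 *+ r)) *: 'X^s).
  apply: (leq_trans (size_sum _ _ _)); apply/bigmax_leqP => i _.
  by apply: (leq_trans (size_scale_leq _ _)); rewrite size_polyXn.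
move=> y; rewrite horner_sum /evx exchange_big; apply: eq_bigr => s _ /=.
by rewrite hornerZ hornerXn mulr_suml.
Qed.

Lemma ev_poly C x : exists2 q : {poly R}, (size q <= k.+1)%N & forall y, ev C x y = q.[y].
Proof. by exists (polx C^T x) => [|y]; [exact: size_polx|rewrite -evE ev_tr]. Qed.

Lemma cont_ev C : cont2 (ev C).
Proof.
apply: cont2_sum => r; apply: cont2_sum => s; apply: cont2M.
  apply: cont2M; first exact: cont2_cst.
  by apply: (@cont2_fst _ (fun x => x ^+ r)); apply: cont1X; exact: cont1_id.
by apply: (@cont2_snd _ (fun x => x ^+ s)); apply: cont1X; exact: cont1_id.
Qed.

Lemma cont_evx C : cont2 (evx C).
Proof.
apply: cont2_sum => r; apply: cont2_sum => s; apply: cont2M.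
  apply: cont2M; first exact: cont2_cst.
  apply: (@cont2_fst _ (fun x => x ^+ r.-1 *+ r)).
  under eq_fun do rewrite -mulr_natr.
  by apply: cont1M; [apply: cont1X; exact: cont1_id|exact: cont1_cst].
by apply: (@cont2_snd _ (fun x => x ^+ s)); apply: cont1X; exact: cont1_id.
Qed.

Lemma is_derive_ev C x y : is_derive x 1 (fun x => ev C x y) (evx C x y).
Proof.
have -> : (fun x => ev C x y) = horner (polx C y) by apply/funext => t; rewrite evE.
by rewrite evxE; exact: is_derive_horner.
Qed.

Lemma evB C D x y : ev (C - D) x y = ev C x y - ev D x y.
Proof.
rewrite /ev -sumrB; apply: eq_bigr => r _; rewrite -sumrB; apply: eq_bigr => s _.
by rewrite !mxE !mulrBl.
Qed.

Lemma ev0 x y : ev 0 x y = 0.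
Proof. by rewrite /ev big1// => r _; rewrite big1// => s _; rewrite !mxE !mul0r. Qed.

Lemma evx0 x y : evx 0 x y = 0.
Proof. by rewrite /evx big1// => r _; rewrite big1// => s _; rewrite !mxE !mul0r. Qed.

End Ev.

(** G is differentiable in x, with derivative g, for 0 < x < 1 and y in [c,
    d]; both functions are continuous on the whole plane, so that integration
    by parts reaches the boundary. *)
Definition dX {R : realType} (c d : R) (G g : R -> R -> R) : Prop :=
  [/\ cont2 G, cont2 g & forall x y : R, 0 < x < 1 -> c <= y <= d ->
     is_derive x 1 (fun x => G x y) (g x y)].

Section DX.
Context {R : realType}.
Implicit Types (F f G g : R -> R -> R) (a b c d x y : R).

Lemma is_derive_near (f g : R -> R) x df : (\forall t \near x, f t = g t) ->
  is_derive x 1 f df -> is_derive x 1 g df.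
Proof.
move=> fg [df1 <-]; split; last by rewrite (near_eq_derive _ fg).
exact: near_eq_derivable fg df1.
Qed.

Lemma I1_dX a b c d G g y : 0 <= a -> a <= b -> b <= 1 -> c <= y <= d -> dX c d G g ->
  I1 a b (fun x => g x y) = G b y - G a y.
Proof.
move=> a0 ab b1 ycd [cG cg dG].
apply: (@I1_FTC _ a b (fun x => G x y)) => //; [exact: cont2_s2|exact: cont2_s2|].
move=> x /andP[ax xb]; apply: dG => //.
by rewrite (le_lt_trans a0 ax) (lt_le_trans xb b1).
Qed.

Lemma I2_dX a b c d G g : 0 <= a -> a <= b -> b <= 1 -> dX c d G g ->
  I2 a b c d g = I1 c d (G b) - I1 c d (G a).
Proof.
move=> a0 ab b1 H; have [cG cg _] := H.
rewrite I2_swap// /I2 -I1B; try exact: cont2_s1.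
by apply: eq_I1 => y ycd; exact: (I1_dX a0 ab b1 ycd H).
Qed.

Lemma dXM c d F f G g : dX c d F f -> dX c d G g ->
  dX c d (fun x y => F x y * G x y) (fun x y => F x y * g x y + G x y * f x y).
Proof.
move=> [cF cf dF] [cG cg dG]; split.
- exact: cont2M.
- by apply: cont2D; exact: cont2M.
- by move=> x y x01 ycd; have := dF x y x01 ycd; have := dG x y x01 ycd => ? ?; exact: is_deriveM.
Qed.

Lemma dX_ev k (C : 'M[R]_k.+1) c d : dX c d (ev C) (evx C).
Proof. by split; [exact: cont_ev|exact: cont_evx|move=> x y _ _; exact: is_derive_ev]. Qed.

Lemma dX_sub c d c' d' G g : c <= c' -> d' <= d -> dX c d G g -> dX c' d' G g.
Proof.
move=> cc dd [cG cg dG]; split => // x y x01 /andP[cy yd]; apply: dG => //.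
by rewrite (le_trans cc cy) (le_trans yd dd).
Qed.

(** A degree of freedom of G (x, .) is its value at a fixed abscissa plus the
    integral over x of that of g, because degrees of freedom commute with
    integration. *)
Lemma dX_proj k K c d c' d' G g : c < d -> dX c d G g ->
  dX c' d' (fun x y => proj k K c d (G x) y) (fun x y => proj k K c d (g x) y).
Proof.
move=> cd H; have [cG cg dG] := H; split; try exact: cont2_proj.
move=> x y /andP[x0 x1] _.
have -> : (fun x => proj k K c d (G x) y) =
   \sum_(m < k.+1) (fun x => dof k K c d m (G x) * (dual K m).[(y - c) / (d - c)]).
  by apply/funext => t; rewrite fct_sumE.
apply: is_derive_sum => m.
have Hm : is_derive x 1 (fun x => dof k K c d m (G x)) (dof k K c d m (g x)).
  have cm : continuous (fun x => dof k K c d m (g x)) by exact: cont_dof.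
  pose z := x / 2%:R.
  have z0 : 0 < z by rewrite /z divr_gt0.
  have zx : z < x by rewrite /z ltr_pdivrMr// mulr_natr mulr2n ltrDl.
  have D := @I1_derive _ z x _ cm zx.
  have D2 : is_derive x 1 (fun t => dof k K c d m (G z) + I1 z t (fun x => dof k K c d m (g x))) (0 + dof k K c d m (g x)).
    by apply: is_deriveD.
  rewrite add0r in D2; apply: (is_derive_near _ D2).
  near=> t.
  have zt : z <= t by apply: ltW; near: t; exact: lt_nbhsr.
  have t1 : t <= 1 by apply: ltW; near: t; exact: lt_nbhsl.
  rewrite dof_I1// -dofD; [|exact: cont2_s1|].
    apply: eq_dof; first exact: ltW.
    by move=> s scd /=; rewrite (@I1_dX z t c d G g s)// ?(ltW z0)// addrC subrK.
  by apply: (@cont_I1 _ (fun s x => g x s)); exact: cont2_swap.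
pose w := (dual K m).[(y - c) / (d - c)].
have := is_deriveM Hm (is_derive_cst w x 1).
rewrite scaler0 add0r -[w *: _]/(w * _) [w * _]mulrC => h; exact: h.
Unshelve. all: by end_near. Qed.

End DX.

(** * The forms in the x-direction on a strip of elements *)

Ltac ct :=
  solve [ match goal with
    | H : cont2 ?F |- cont2 ?F => exact H
    | H : cont2 ?F |- cont2 (fun x y => ?F x y) => exact H
    | |- cont2 (ev _) => exact: cont_ev
    | |- cont2 (evx _) => exact: cont_evx
    | |- cont2 (fun x y => ev _ x y) => exact: cont_ev
    | |- cont2 (fun x y => evx _ x y) => exact: cont_evx
    | H : forall i, cont2 (?F i) |- cont2 (?F ?j) => exact (H j)
    | H : forall i, cont2 (?F i) |- cont2 (fun x y => ?F ?j x y) => exact (H j)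
    | H : forall i l, cont2 (?F i l) |- cont2 (?F ?j ?m) => exact (H j m)
    | H : forall i l, cont2 (?F i l) |- cont2 (fun x y => ?F ?j ?m x y) => exact (H j m)
    | H : forall i, continuous (?F i) |- continuous (?F ?j) => exact (H j)
    | H : forall i, continuous (?F i) |- continuous (fun x => ?F ?j x) => exact (H j)
    | |- cont2 (fun x y => @?F x y * @?G x y) => refine (@cont2M _ F G _ _); ct
    | |- cont2 (fun x y => @?F x y + @?G x y) => refine (@cont2D _ F G _ _); ct
    | |- cont2 (fun x y => - @?F x y) => refine (@cont2N _ F _); ct
    | |- cont2 (fun x y => `| @?F x y |) => refine (@cont2_norm _ F _); ct
    | |- cont2 (fun x y => @?F x y ^+ _) => refine (@cont2X _ F _ _); ct
    | |- cont2 (fun x y => proj ?k ?K ?c ?d (@?F x) y) => refine (@cont2_proj _ k K c d F _); ct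
    | |- cont2 (fun x y => proj ?k ?K ?c ?d (fun t => @?F y t) x) =>
           refine (@cont2_swap _ _ (@cont2_proj _ k K c d F _)); ct
    | |- cont2 (fun _ _ => ?c) => exact: cont2_cst
    | |- cont2 (fun x y => ?F y x) => refine (@cont2_swap _ F _); ct
    | |- cont2 (fun x y => @?f x) => refine (@cont2_fst _ f _); ct
    | |- cont2 (fun x y => @?f y) => refine (@cont2_snd _ f _); ct
    | H : continuous ?F |- continuous ?F => exact H
    | H : continuous ?F |- continuous (fun x => ?F x) => exact H
    | |- continuous (fun x => x) => exact: cont1_id
    | |- continuous (fun _ => ?c) => exact: cont1_cst
    | |- continuous (horner _) => exact: cont_horner
    | |- continuous (fun x => _.[x]) => exact: cont_horner
    | |- continuous (proj _ _ _ _ _) => exact: cont_proj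
    | |- continuous (fun x => proj _ _ _ _ _ x) => exact: cont_proj
    | |- continuous (fun x => @?F x * @?G x) => refine (@cont1M _ F G _ _); ct
    | |- continuous (fun x => @?F x + @?G x) => refine (@cont1D _ F G _ _); ct
    | |- continuous (fun x => - @?F x) => refine (@cont1N _ F _); ct
    | |- continuous (fun x => `| @?F x |) => refine (@cont1_norm _ F _); ct
    | |- continuous (fun x => @?F x ^+ _) => refine (@cont1X _ F _ _); ct
    | |- continuous (fun x => I1 ?c ?d (@?F x)) => refine (@cont_I1 _ F c d _); ct
    | |- continuous (fun y => ?F ?x y) => refine (@cont2_s1 _ F x _); ct
    | |- continuous (fun x => ?F x ?y) => refine (@cont2_s2 _ F y _); ct
    | |- continuous (?F ?x) => refine (@cont2_s1 _ F x _); ct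
    end ].

Section Tele.
Context {R : realType}.
Lemma tele_shift (f : nat -> R) N : (0 < N)%N ->
  \sum_(i < N) f i.+1 = \sum_(i < N) (if (i : nat) == 0%N then 0 else f i) + f N.
Proof.
case: N => // n _; rewrite big_ord_recr /= [in RHS]big_ord_recl /= add0r; congr (_ + _).
Qed.

Lemma tele_shift0 (f : nat -> R) N : (0 < N)%N ->
  \sum_(i < N) (if i.+1 == N then 0 else f i.+1) =
  \sum_(i < N) (if (i : nat) == 0%N then 0 else f i).
Proof.
case: N => // n _; rewrite big_ord_recr /= eqxx addr0 [in RHS]big_ord_recl /= add0r.
by apply: eq_bigr => i _; rewrite eqSS ltn_eqF.
Qed.

Lemma sum_at_last (e : R) N : (0 < N)%N -> \sum_(i < N) (if i.+1 == N then e else 0) = e.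
Proof.
case: N => // n _; rewrite big_ord_recr /= eqxx big1 ?add0r// => i _.
by rewrite eqSS ltn_eqF.
Qed.
End Tele.

Section Strip.
Context {R : realType} (k N : nat) (X : nat -> R) (c d : R).
Implicit Types (U V P s v : nat -> 'M[R]_k.+1) (a G g : R -> R -> R).

Notation J := (I1 c d).
Notation K i := (I2 (X i) (X i.+1) c d).

(** On the strip (0, 1) x (c, d), element i is [X i, X i.+1] and the
    polynomial on it has index i.+1. The terms at a node are grouped by the
    element of the test function; at X N the trace of P comes from inside. *)
Definition b3 P v : R := \sum_(i < N)
  (K i (fun x y => ev (P i.+1) x y * evx (v i.+1) x y)
   + J (fun y => ev (P i.+1) (X i) y * ev (v i.+1) (X i) y)
   - J (fun y => ev (P (if i.+1 == N then N else i.+2)) (X i.+1) y * ev (v i.+1) (X i.+1) y)).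

Definition b2 U s : R := \sum_(i < N)
  (K i (fun x y => ev (U i.+1) x y * evx (s i.+1) x y)
   + (if (i : nat) == 0%N then 0 else J (fun y => ev (U i) (X i) y * ev (s i.+1) (X i) y))
   - (if i.+1 == N then 0 else J (fun y => ev (U i.+1) (X i.+1) y * ev (s i.+1) (X i.+1) y))).

Definition b4 a lam U v : R := - (\sum_(i < N)
  (K i (fun x y => a x y * ev (U i.+1) x y * evx (v i.+1) x y)
   + (if (i : nat) == 0%N then 0
      else J (fun y => a (X i) y * ev (U i) (X i) y * ev (v i.+1) (X i) y))
   - J (fun y => a (X i.+1) y * ev (U i.+1) (X i.+1) y * ev (v i.+1) (X i.+1) y)))
  + J (fun y => lam * ev (U N) (X N) y * ev (v N) (X N) y).

Definition jmp v i y : R :=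
  (if i == N then 0 else ev (v i.+1) (X i) y) - (if i == 0%N then 0 else ev (v i) (X i) y).

Definition jump_energy a lam v : R :=
  \sum_(i < N) 2^-1 * J (fun y => a (X i) y * jmp v i y ^+ 2)
  + J (fun y => (2^-1 * a (X N) y + lam) * jmp v N y ^+ 2).

Hypothesis N0 : (0 < N)%N.
Hypothesis X0 : X 0 = 0.
Hypothesis XN : X N = 1.
Hypothesis Xinc : forall i, (i < N)%N -> X i < X i.+1.

Lemma X_ge0 i : (i <= N)%N -> 0 <= X i.
Proof. by elim: i => [|i IH] iN; rewrite ?X0// (le_trans (IH (ltnW iN)))// ltW// Xinc. Qed.

Lemma X_le1 i : (i <= N)%N -> X i <= 1.
Proof.
have H n : (i + n <= N)%N -> X i <= X (i + n).
  elim: n => [|n IH]; rewrite ?addn0// addnS => h.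
  by rewrite (le_trans (IH (ltnW h)))// ltW// Xinc.
by move=> iN; rewrite -XN -(subnKC iN) H// subnKC.
Qed.

Lemma ibp (G g : R -> R -> R) (C : 'M[R]_k.+1) (i : 'I_N) : dX c d G g ->
  K i (fun x y => G x y * evx C x y) =
    J (fun y => G (X i.+1) y * ev C (X i.+1) y) - J (fun y => G (X i) y * ev C (X i) y)
    - K i (fun x y => g x y * ev C x y).
Proof.
move=> H; have [cG cg _] := H.
have D := dXM H (dX_ev C c d).
have := I2_dX (X_ge0 (ltnW (ltn_ord i))) (ltW (Xinc (ltn_ord i))) (X_le1 (ltn_ord i)) D.
rewrite I2D; [|ct|ct] => <-.
rewrite (@eq_I2 _ _ _ _ _ (fun x y => ev C x y * g x y) (fun x y => g x y * ev C x y)).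
  by rewrite addrK.
by move=> x y _ _; rewrite mulrC.
Qed.

(** After integration by parts on each element only products of a trace of U
    from the left and one of s from the right are left, and these cancel. *)
Lemma b2_b3_dual U s : b2 U s = - b3 s U.
Proof.
apply/eqP; rewrite -subr_eq0 opprK; apply/eqP; rewrite -big_split /=.
pose mm i := J (fun y => ev (U i) (X i) y * ev (s i) (X i) y).
pose mp i := J (fun y => ev (U i) (X i) y * ev (s i.+1) (X i) y).
transitivity (\sum_(i < N) ((if (i : nat) == 0%N then 0 else mp i)
   - (if i.+1 == N then 0 else mp i.+1))); last first.
  by rewrite sumrB tele_shift0// subrr.
apply: eq_bigr => i _.
rewrite (ibp (s i.+1) i (dX_ev (U i.+1) c d)).
have -> : K i (fun x y => ev (s i.+1) x y * evx (U i.+1) x y) =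
  K i (fun x y => evx (U i.+1) x y * ev (s i.+1) x y) by apply: eq_I2 => x y _ _; rewrite mulrC.
have -> : J (fun y => ev (s i.+1) (X i) y * ev (U i.+1) (X i) y) =
  J (fun y => ev (U i.+1) (X i) y * ev (s i.+1) (X i) y) by apply: eq_I1 => y _; rewrite mulrC.
have -> : J (fun y => ev (s (if i.+1 == N then N else i.+2)) (X i.+1) y * ev (U i.+1) (X i.+1) y) =
  if i.+1 == N then mm i.+1 else mp i.+1.
  case: ifPn => [/eqP iN|_]; last by apply: eq_I1 => y _; rewrite mulrC.
  have -> : s N = s i.+1 by rewrite iN.
  by apply: eq_I1 => y _; rewrite mulrC.
rewrite -/(mm i.+1) -/(mp i) -/(mp i.+1); case: ifP => _; case: ifP => _; ring.
Qed.

(** Inside the elements P may be replaced by G because of its moments, at the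
    nodes because it interpolates at left end points; integration by parts
    then telescopes up to x = 1, where the trace of P is from inside. *)
Lemma b3_radau G g P v : dX c d G g ->
  (forall i : 'I_N, K i (fun x y => ev (P i.+1) x y * evx (v i.+1) x y)
     = K i (fun x y => G x y * evx (v i.+1) x y)) ->
  (forall (i : 'I_N) (q : {poly R}), (size q <= k.+1)%N ->
     J (fun y => ev (P i.+1) (X i) y * q.[y]) = J (fun y => G (X i) y * q.[y])) ->
  b3 P v = - (\sum_(i < N) K i (fun x y => g x y * ev (v i.+1) x y))
    + J (fun y => (G (X N) y - ev (P N) (X N) y) * ev (v N) (X N) y).
Proof.
move=> H R1 R2; have [cG cg _] := H.
pose e := J (fun y => (G (X N) y - ev (P N) (X N) y) * ev (v N) (X N) y).
transitivity (\sum_(i < N) (- K i (fun x y => g x y * ev (v i.+1) x y)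
   + if i.+1 == N then e else 0)); last first.
  rewrite big_split /= sumrN; congr (_ + _).
  by rewrite sum_at_last.
have tr (i : 'I_N) z : J (fun y => ev (P i.+1) (X i) y * ev (v z) (X i) y) =
   J (fun y => G (X i) y * ev (v z) (X i) y).
  have [q sq qE] := ev_poly (v z) (X i).
  under eq_I1 do rewrite qE; under [RHS]eq_I1 do rewrite qE.
  exact: R2.
apply: eq_bigr => i _; rewrite R1 (ibp _ _ H) tr.
have [iN|iN] := eqVneq i.+1 N.
  rewrite iN /e.
  have -> : J (fun y => (G (X N) y - ev (P N) (X N) y) * ev (v N) (X N) y) =
    J (fun y => G (X N) y * ev (v N) (X N) y) - J (fun y => ev (P N) (X N) y * ev (v N) (X N) y).
    by rewrite -I1B; [|ct|ct]; apply: eq_I1 => y _; rewrite mulrBl.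
  ring.
have iN' : (i.+1 < N)%N by rewrite ltn_neqAle iN ltn_ord.
have := tr (Ordinal iN') i.+1; rewrite /= => ->; ring.
Qed.

(** Since a v v' = (a v^2)' / 2 - a' v^2 / 2, the boundary terms complete to
    squares of jumps. *)
Lemma b4_energy a ax lam v : dX c d a ax ->
  b4 a lam v v = jump_energy a lam v
   + 2^-1 * \sum_(i < N) K i (fun x y => ax x y * ev (v i.+1) x y ^+ 2).
Proof.
move=> H; have [ca cax _] := H.
pose m i := J (fun y => a (X i) y * ev (v i) (X i) y ^+ 2).
pose p i := J (fun y => a (X i) y * ev (v i.+1) (X i) y ^+ 2).
pose q i := J (fun y => a (X i) y * ev (v i) (X i) y * ev (v i.+1) (X i) y).
pose A (i : nat) := K i (fun x y => ax x y * ev (v i.+1) x y ^+ 2).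
pose L := J (fun y => lam * ev (v N) (X N) y * ev (v N) (X N) y).
have e4 : b4 a lam v v = - (\sum_(i < N) (2^-1 * (m i.+1 - p i - A i)
    + (if (i : nat) == 0%N then 0 else q i) - m i.+1)) + L.
  rewrite /b4; congr (- _ + _); apply: eq_bigr => i _; congr (_ + _ - _).
    have D : dX c d (fun x y => a x y * ev (v i.+1) x y)
       (fun x y => a x y * evx (v i.+1) x y + ev (v i.+1) x y * ax x y).
      exact: dXM H (dX_ev _ _ _).
    have := ibp (v i.+1) i D.
    rewrite (@eq_I2 _ _ _ _ _ (fun x y => (a x y * evx (v i.+1) x y + ev (v i.+1) x y * ax x y) * ev (v i.+1) x y)
       (fun x y => a x y * ev (v i.+1) x y * evx (v i.+1) x y + ax x y * ev (v i.+1) x y ^+ 2)); last first.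
      by move=> x y _ _; ring.
    rewrite I2D; [|ct|ct]; rewrite -/(A i).
    have -> : J (fun y => a (X i.+1) y * ev (v i.+1) (X i.+1) y * ev (v i.+1) (X i.+1) y) = m i.+1.
      by apply: eq_I1 => y _; ring.
    have -> : J (fun y => a (X i) y * ev (v i.+1) (X i) y * ev (v i.+1) (X i) y) = p i.
      by apply: eq_I1 => y _; ring.
    by move=> h; lra.
  by apply: eq_I1 => y _; ring.
have ee : jump_energy a lam v = \sum_(i < N) 2^-1 * (p i + (if (i : nat) == 0%N then 0 else m i)
    - 2%:R * (if (i : nat) == 0%N then 0 else q i)) + (2^-1 * m N + L).
  rewrite /jump_energy; congr (_ + _).
    apply: eq_bigr => i _; congr (_ * _); rewrite /jmp ltn_eqF//.
    case: ifPn => i0.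
      by rewrite mulr0 addr0 subr0; apply: eq_I1 => y _; rewrite subr0.
    rewrite /p /m /q -I1Z; last by ct.
    rewrite -I1D; [|ct|ct]; rewrite -I1B; [|ct|ct].
    by apply: eq_I1 => y _; ring.
  rewrite /m /L -I1Z; last by ct.
  rewrite -I1D; [|ct|ct]; apply: eq_I1 => y _.
  by rewrite /jmp eqxx gtn_eqF//; ring.
have hm : 2^-1 * m N = \sum_(i < N) (2^-1 * m i.+1 - (if (i : nat) == 0%N then 0 else 2^-1 * m i)).
  by rewrite sumrB (tele_shift (fun i => 2^-1 * m i))// addrC addKr.
rewrite e4 ee hm.
set S1 := \sum_(i < N) _; set S2 := \sum_(i < N) _; set S3 := \sum_(i < N) _; set S4 := \sum_(i < N) _.
suff : - S1 = S2 + S3 + 2^-1 * S4 by move=> ->; ring.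
rewrite /S1 /S2 /S3 /S4 -sumrN mulr_sumr -!big_split /=; apply: eq_bigr => i _; rewrite -/(A i).
by case: ifP => _; field.
Qed.

End Strip.

(** * The forms at the Gauss-Radau projection of the solution *)

Lemma I2_0 {R : realType} (a b c d : R) : I2 a b c d (fun _ _ => 0) = 0.
Proof. by rewrite /I2 -[RHS](I1_0 a b); apply: eq_I1 => x _; rewrite I1_0. Qed.

Section Consistency.
Context {R : realType} (k N : nat) (X : nat -> R) (c d : R).
Implicit Types (U V P s v : nat -> 'M[R]_k.+1) (a G g : R -> R -> R).

Notation J := (I1 c d).
Notation K i := (I2 (X i) (X i.+1) c d).
Notation Rr := Radau_right.

Hypothesis N0 : (0 < N)%N.
Hypothesis X0 : X 0 = 0.
Hypothesis XN : X N = 1.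
Hypothesis Xinc : forall i, (i < N)%N -> X i < X i.+1.
Hypothesis cd : c < d.

Variables (u ux : R -> R -> R).
Hypothesis Hu : dX c d u ux.
Hypothesis u0 : forall y, c <= y <= d -> u 0 y = 0.
Hypothesis u1 : forall y, c <= y <= d -> u 1 y = 0.

Definition py x y := proj k Rr c d (u x) y.
Definition pyx x y := proj k Rr c d (ux x) y.

Variable V : nat -> 'M[R]_k.+1.
Hypothesis HV : forall i, (i < N)%N -> forall x y,
  ev (V i.+1) x y = proj k Rr (X i) (X i.+1) (py ^~ y) x.

Definition proj_defect i x y := py x y - ev (V i.+1) x y.

Let cu : cont2 u. Proof. by case: Hu. Qed.
Let cux : cont2 ux. Proof. by case: Hu. Qed.
Lemma cont_py : cont2 py. Proof. exact: cont2_proj. Qed.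
Lemma cont_pyx : cont2 pyx. Proof. exact: cont2_proj. Qed.
Lemma cont_defect i : cont2 (proj_defect i).
Proof. by have ? := @cont_py; rewrite /proj_defect; ct. Qed.

Lemma proj0 y f : (forall y, c <= y <= d -> f y = 0) -> proj k Rr c d f y = 0.
Proof.
move=> f0; rewrite (@eq_proj _ _ _ _ _ _ (fun t => 0 * t) (ltW cd)); last first.
  by move=> t tcd; rewrite f0// mul0r.
by rewrite projZ ?mul0r//; exact: cont1_id.
Qed.

Lemma V_right i y : (i < N)%N -> ev (V i.+1) (X i.+1) y = py (X i.+1) y.
Proof. by move=> iN; rewrite HV// proj_right// Xinc. Qed.

(** The defect of a right Gauss-Radau projection is orthogonal in x to
    polynomials of degree less than k, among them the x-derivatives of test
    functions. *)
Lemma defect_moment i (C : 'M[R]_k.+1) (w : R -> R) : (i < N)%N -> continuous w ->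
  K i (fun x y => w y * proj_defect i x y * evx C x y) = 0.
Proof.
move=> iN cw; have cr := @cont_defect i; have cp := @cont_py.
rewrite I2_swap; last by ct.
rewrite /I2 -(I1_0 c d); apply: eq_I1 => y _.
transitivity (w y * I1 (X i) (X i.+1) (fun x => proj_defect i x y * evx C x y)).
  by rewrite -I1Z; [|ct]; apply: eq_I1 => x _; rewrite mulrA.
suff -> : I1 (X i) (X i.+1) (fun x => proj_defect i x y * evx C x y) = 0 by rewrite mulr0.
have cpy : continuous (py ^~ y) by ct.
have h := @proj_moment _ k Rr (X i) (X i.+1) (py ^~ y) ((polx C y)^`()) (Xinc iN) cpy (size_dpolx _ _).
transitivity (I1 (X i) (X i.+1) (fun x => py x y * ((polx C y)^`()).[x]
   - proj k Rr (X i) (X i.+1) (py ^~ y) x * ((polx C y)^`()).[x])).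
  by apply: eq_I1 => x _; rewrite /proj_defect HV// evxE mulrBl.
by rewrite I1B; [rewrite h subrr|ct|ct].
Qed.

(** With a replaced by its value at the right node the defect is orthogonal to
    the derivative of the test function, so it enters with the factor a - a (X
    i.+1), which is of the size of the element. *)
Lemma element_identity a ax (C : 'M[R]_k.+1) (i : 'I_N) : dX c d a ax ->
  K i (fun x y => a x y * ev (V i.+1) x y * evx C x y) =
    J (fun y => a (X i.+1) y * py (X i.+1) y * ev C (X i.+1) y)
    - J (fun y => a (X i) y * py (X i) y * ev C (X i) y)
    - K i (fun x y => (ax x y * py x y + a x y * pyx x y) * ev C x y)
    - K i (fun x y => (a x y - a (X i.+1) y) * proj_defect i x y * evx C x y).
Proof.
move=> Ha; have [ca cax _] := Ha.
have cr := @cont_defect i; have cp := @cont_py; have cpx := @cont_pyx.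
have Dp : dX c d py pyx by exact: dX_proj.
have D := dXM Ha Dp.
have := ibp X0 XN Xinc C i D.
rewrite (@eq_I2 _ _ _ _ _ (fun x y => (a x y * pyx x y + py x y * ax x y) * ev C x y)
   (fun x y => (ax x y * py x y + a x y * pyx x y) * ev C x y)); last by move=> x y _ _; ring.
move=> <-.
have cai : continuous (a (X i.+1)) by ct.
have h0 := @defect_moment i C (a (X i.+1)) (ltn_ord i) cai.
rewrite (@eq_I2 _ _ _ _ _ (fun x y => (a x y - a (X i.+1) y) * proj_defect i x y * evx C x y)
  (fun x y => a x y * proj_defect i x y * evx C x y - a (X i.+1) y * proj_defect i x y * evx C x y)); last first.
  by move=> x y _ _; ring.
have car : cont2 (fun x y => a x y * proj_defect i x y * evx C x y) by ct.
have cair : cont2 (fun x y => a (X i.+1) y * proj_defect i x y * evx C x y) by ct.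
have cav : cont2 (fun x y => a x y * py x y * evx C x y) by ct.
rewrite (I2B _ _ _ _ car cair) h0 subr0 -(I2B _ _ _ _ cav car).
by apply: eq_I2 => x y _ _; rewrite /proj_defect; ring.
Qed.

(** The traces of V at the nodes are those of the y-projection of u, which is
    continuous in x and vanishes at x = 0 and x = 1: the boundary terms of
    neighbouring elements cancel. *)
Lemma b4_radau a ax lam v : dX c d a ax ->
  b4 N X c d a lam V v = \sum_(i < N)
    (K i (fun x y => (ax x y * py x y + a x y * pyx x y) * ev (v i.+1) x y)
     + K i (fun x y => (a x y - a (X i.+1) y) * proj_defect i x y * evx (v i.+1) x y)).
Proof.
move=> Ha; rewrite /b4.
have -> : J (fun y => lam * ev (V N) (X N) y * ev (v N) (X N) y) = 0.
  rewrite -[RHS](I1_0 c d); apply: eq_I1 => y ycd.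
  have h := V_right y (ltn_ord (Ordinal (ltac:(by rewrite prednK) : (N.-1 < N)%N))).
  rewrite /= prednK// in h.
  by rewrite h XN /py proj0 ?mulr0 ?mul0r// => t; exact: u1.
rewrite addr0 -sumrN; apply: eq_bigr => i _; rewrite (element_identity _ _ Ha).
have -> : (if (i : nat) == 0%N then 0 else J (fun y => a (X i) y * ev (V i) (X i) y * ev (v i.+1) (X i) y))
  = J (fun y => a (X i) y * py (X i) y * ev (v i.+1) (X i) y).
  case: ifPn => [/eqP ->|i0].
    rewrite X0 -[LHS](I1_0 c d); apply: eq_I1 => y ycd.
    by rewrite /py proj0 ?mulr0 ?mul0r// => t; exact: u0.
  apply: eq_I1 => y _; congr (_ * _ * _).
  have iN : (i.-1 < N)%N by rewrite (leq_ltn_trans (leq_pred _)).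
  by have := V_right y iN; rewrite prednK ?lt0n// => ->.
have -> : J (fun y => a (X i.+1) y * ev (V i.+1) (X i.+1) y * ev (v i.+1) (X i.+1) y)
  = J (fun y => a (X i.+1) y * py (X i.+1) y * ev (v i.+1) (X i.+1) y).
  by apply: eq_I1 => y _; rewrite V_right.
have alg (A B C D : R) : - (A - B - C - D + B - A) = C + D by ring.
exact: alg.
Qed.

(** The two forms differ in the term at x = 1, which is zero because V
    vanishes there. *)
Lemma b2_b4 s : b2 N X c d V s = - b4 N X c d (fun _ _ => 1) 0 V s.
Proof.
rewrite /b4 /b2.
have -> : J (fun y => 0 * ev (V N) (X N) y * ev (s N) (X N) y) = 0.
  by rewrite -[RHS](I1_0 c d); apply: eq_I1 => y _; rewrite !mul0r.
rewrite addr0 opprK; apply: eq_bigr => i _.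
have cong (A A' B B' C C' : R) : A = A' -> B = B' -> C = C' -> A + B - C = A' + B' - C'.
  by move=> -> -> ->.
apply: cong.
- by apply: eq_I2 => x y _ _; rewrite mul1r.
- by case: ifP => // _; apply: eq_I1 => y _; rewrite mul1r.
- have [iN|_] := eqVneq i.+1 N; last by apply: eq_I1 => y _; rewrite mul1r.
  rewrite -[LHS](I1_0 c d); apply: eq_I1 => y ycd; rewrite V_right//.
  by rewrite iN XN /py proj0 ?mulr0 ?mul0r// => t; exact: u1.
Qed.

Lemma b2_radau s :
  b2 N X c d V s = - \sum_(i < N) K i (fun x y => pyx x y * ev (s i.+1) x y).
Proof.
have D1 : dX c d (fun _ _ => 1) (fun _ _ => 0).
  by split; [ct|ct|move=> x y _ _; exact: is_derive_cst].
rewrite b2_b4 (b4_radau _ _ D1); congr (- _); apply: eq_bigr => i _.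
have -> : K i (fun x y => (1 - 1) * proj_defect i x y * evx (s i.+1) x y) = 0.
  by rewrite -[RHS](I2_0 (X i) (X i.+1) c d); apply: eq_I2 => x y _ _; rewrite subrr !mul0r.
rewrite addr0.
by apply: eq_I2 => x y _ _; rewrite mul0r add0r mul1r.
Qed.

End Consistency.

(** * The inverse inequality *)

Section Inverse.
Context {R : realType} (k : nat).
Implicit Types (q : {poly R}) (a b x y : R).

(** The variance of |f| over the interval is nonnegative. *)
Lemma jensen_norm a b (f : R -> R) : a < b -> continuous f ->
  I1 a b (fun x => `|f x|) ^+ 2 <= (b - a) * I1 a b (fun x => f x ^+ 2).
Proof.
move=> ab cf; have h0 : 0 < b - a by rewrite subr_gt0.
set M := I1 a b _; pose m := M / (b - a).
have : 0 <= I1 a b (fun x => (`|f x| - m) ^+ 2) by apply: I1_ge0 => x _; exact: sqr_ge0.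
have -> : I1 a b (fun x => (`|f x| - m) ^+ 2) =
  I1 a b (fun x => f x ^+ 2) - 2%:R * m * M + m ^+ 2 * (b - a).
  rewrite -I1Z; last by ct.
  rewrite -[X in _ + X](I1_cst (m ^+ 2) (ltW ab)) -I1B; [|ct|ct]; rewrite -I1D; [|ct|ct].
  apply: eq_I1 => x _; rewrite -[f x ^+ 2]real_normK ?num_real//; ring.
have -> : I1 a b (fun x => f x ^+ 2) - 2%:R * m * M + m ^+ 2 * (b - a) =
  (b - a)^-1 * ((b - a) * I1 a b (fun x => f x ^+ 2) - M ^+ 2).
  by rewrite /m; field; rewrite gt_eqF.
by rewrite pmulr_rge0 ?invr_gt0// subr_ge0.
Qed.

(** Expanding q in the dual basis bounds q' pointwise by (b - a)^-2 times the
    L1 norm of q. *)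
Lemma inverse_inequality : exists2 C : R, 0 < C & forall a b q, a < b -> (size q <= k.+1)%N ->
  (b - a) ^+ 2 * I1 a b (fun x => (q^`()).[x] ^+ 2) <= C * I1 a b (fun x => q.[x] ^+ 2).
Proof.
pose F (t _ : R) : R := \sum_(m < k.+1) `|((dual Orthogonal m)^`()).[t]|.
have cF : cont2 F.
  by apply: cont2_sum => m; apply: cont2_norm; apply: (cont2_fst (@cont_horner _ _)).
have [C [C0 HC]] := cont2_bounded 0 1 0 1 cF.
exists (C ^+ 2 + 1); first by rewrite ltr_wpDl// sqr_ge0.
move=> a b q ab sq; have h0 : 0 < b - a by rewrite subr_gt0.
have hN : b - a != 0 by rewrite gt_eqF.
pose L := (b - a)^-1 *: ('X - a%:P).
have LE y : L.[y] = (y - a) / (b - a) by rewrite hornerZ hornerXsubC mulrC.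
have qE : q = \sum_(m < k.+1) dof k Orthogonal a b m (horner q) *: ((dual Orthogonal m) \Po L).
  apply/eqP; rewrite -subr_eq0; apply/eqP; apply: (@poly_zero_on _ _ a b ab) => x _.
  rewrite hornerD hornerN -[in q.[x]](proj_id Orthogonal ab sq) horner_sum.
  apply/eqP; rewrite subr_eq0; apply/eqP; apply: eq_bigr => m _.
  by rewrite hornerZ horner_comp LE.
pose M := I1 a b (fun x => `|q.[x]|).
have M0 : 0 <= M by apply: I1_ge0.
have dofM (m : 'I_k.+1) : `|dof k Orthogonal a b m (horner q)| <= (b - a)^-1 * M.
  rewrite /dof is_momentE ?ltn_ord//.
  by apply: (@moment_le _ a b m (horner q) (fun x => `|q.[x]|)) => //; ct.
have dq x : a <= x <= b -> `|(q^`()).[x]| <= (b - a)^-1 * ((b - a)^-1 * M) * C.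
  move=> xab; have t01 := unit_affine ab xab.
  rewrite {1}qE raddf_sum horner_sum.
  apply: (le_trans (ler_norm_sum _ _ _)).
  apply: (@le_trans _ _ (\sum_(m < k.+1) (b - a)^-1 * ((b - a)^-1 * M) * `|((dual Orthogonal m)^`()).[(x - a) / (b - a)]|)).
    apply: ler_sum => /= l _.
    rewrite derivZ hornerZ deriv_comp hornerM horner_comp LE /L derivZ derivXsubC hornerZ hornerC mulr1.
    have hi0 : 0 <= (b - a)^-1 by rewrite invr_ge0 ltW.
    rewrite !normrM (ger0_norm hi0).
    have alg (dm dd hi : R) : 0 <= hi -> 0 <= dd -> dm <= hi * M -> dm * (dd * hi) <= hi * (hi * M) * dd.
      move=> h1 h2 h3; have -> : dm * (dd * hi) = hi * dd * dm by ring.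
      have -> : hi * (hi * M) * dd = hi * dd * (hi * M) by ring.
      by rewrite ler_wpM2l// mulr_ge0.
    by apply: alg => //; exact: dofM.
  rewrite -mulr_sumr ler_wpM2l//.
    by rewrite !mulr_ge0 ?invr_ge0 ?(ltW h0).
  apply: le_trans (ler_norm _) _; apply: (HC _ 0 t01); by rewrite lexx ler01.
have cq : continuous (fun x => q.[x]) by ct.
have J1 := jensen_norm ab cq; rewrite -/M in J1.
apply: (@le_trans _ _ ((b - a) ^+ 2 * (((b - a)^-1 * ((b - a)^-1 * M) * C) ^+ 2 * (b - a)))).
  rewrite ler_wpM2l ?sqr_ge0// -I1_cst ?(ltW ab)//.
  apply: le_I1; [ct|ct|] => x xab.
  by rewrite -[leLHS]real_normK ?num_real// lerXn2r ?nnegrE ?dq// !mulr_ge0 ?invr_ge0 ?(ltW h0).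
have -> : (b - a) ^+ 2 * (((b - a)^-1 * ((b - a)^-1 * M) * C) ^+ 2 * (b - a)) =
   C ^+ 2 * ((b - a)^-1 * M ^+ 2) by field.
apply: (@le_trans _ _ (C ^+ 2 * I1 a b (fun x => q.[x] ^+ 2))).
  by rewrite ler_wpM2l ?sqr_ge0// ler_pdivrMl.
rewrite ler_wpM2r ?lerDl// I1_ge0// => x _; exact: sqr_ge0.
Qed.

End Inverse.

(** * Sums over the elements *)

Section Sums.
Context {R : realType} (N : nat) (X : nat -> R).
Implicit Types (F G : nat -> nat -> R -> R -> R) (f g : nat -> R -> R).

Definition S2 F : R := \sum_(j < N) \sum_(i < N) I2 (X i) (X i.+1) (X j) (X j.+1) (F i j).
Definition S1 f : R := \sum_(j < N) I1 (X j) (X j.+1) (f j).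

Definition inK i j x y := (X i <= x <= X i.+1) /\ (X j <= y <= X j.+1).

Lemma S2D F G : (forall i j, cont2 (F i j)) -> (forall i j, cont2 (G i j)) ->
  S2 (fun i j x y => F i j x y + G i j x y) = S2 F + S2 G.
Proof.
move=> cF cG; rewrite -big_split; apply: eq_bigr => j _.
by rewrite -big_split; apply: eq_bigr => i _; rewrite I2D.
Qed.

Lemma S2Z F e : (forall i j, cont2 (F i j)) ->
  S2 (fun i j x y => e * F i j x y) = e * S2 F.
Proof.
move=> cF; rewrite mulr_sumr; apply: eq_bigr => j _.
by rewrite mulr_sumr; apply: eq_bigr => i _; rewrite I2Z.
Qed.

Lemma eq_S2 F G : (forall i j x y, (i < N)%N -> (j < N)%N -> inK i j x y -> F i j x y = G i j x y) ->
  S2 F = S2 G.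
Proof.
move=> FG; apply: eq_bigr => j _; apply: eq_bigr => i _.
by apply: eq_I2 => x y hx hy; apply: FG.
Qed.

Lemma S2B F G : (forall i j, cont2 (F i j)) -> (forall i j, cont2 (G i j)) ->
  S2 (fun i j x y => F i j x y - G i j x y) = S2 F - S2 G.
Proof.
move=> cF cG; rewrite /S2 -sumrB; apply: eq_bigr => j _; rewrite -sumrB.
by apply: eq_bigr => i _; apply: I2B; [exact: cF|exact: cG].
Qed.

Lemma le_S2 F G : (forall i j, cont2 (F i j)) -> (forall i j, cont2 (G i j)) ->
  (forall i j x y, (i < N)%N -> (j < N)%N -> inK i j x y -> F i j x y <= G i j x y) ->
  S2 F <= S2 G.
Proof.
move=> cF cG FG; apply: ler_sum => j _; apply: ler_sum => i _.
by apply: le_I2 => // x y hx hy; apply: FG.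
Qed.

Lemma S2_ge0 F :
  (forall i j x y, (i < N)%N -> (j < N)%N -> inK i j x y -> 0 <= F i j x y) -> 0 <= S2 F.
Proof.
move=> F0; apply: sumr_ge0 => j _; apply: sumr_ge0 => i _.
by apply: I2_ge0 => x y hx hy; apply: F0.
Qed.

Lemma S2_bound F G : (forall i j, cont2 (F i j)) -> (forall i j, cont2 (G i j)) ->
  (forall i j x y, (i < N)%N -> (j < N)%N -> inK i j x y -> `|F i j x y| <= G i j x y) ->
  `|S2 F| <= S2 G.
Proof.
move=> cF cG FG; rewrite ler_norml -mulN1r -S2Z//; apply/andP; split; apply: le_S2 => //.
- by move=> i j; apply: cont2M => //; exact: cont2_cst.
- by move=> i j x y iN jN hK; have := FG i j x y iN jN hK; rewrite mulN1r ler_norml => /andP[].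
- by move=> i j x y iN jN hK; have := FG i j x y iN jN hK; rewrite ler_norml => /andP[].
Qed.

Lemma S2_swap F : (forall i j, cont2 (F i j)) ->
  S2 (fun i j x y => F j i y x) = S2 F.
Proof.
move=> cF; rewrite /S2 exchange_big; apply: eq_bigr => j _; apply: eq_bigr => i _.
by rewrite [RHS]I2_swap.
Qed.

Lemma S1_bound f g : (forall j, continuous (f j)) -> (forall j, continuous (g j)) ->
  (forall j y, (j < N)%N -> X j <= y <= X j.+1 -> `|f j y| <= g j y) -> `|S1 f| <= S1 g.
Proof.
move=> cf cg fg; apply: (le_trans (ler_norm_sum _ _ _)); apply: ler_sum => j _.
apply: (le_trans (ler_norm_I1 _ _ (@cf j))); apply: le_I1 => //; first exact: cont1_norm.
by move=> y hy; apply: fg.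
Qed.

Lemma S1D f g : (forall j, continuous (f j)) -> (forall j, continuous (g j)) ->
  S1 (fun j y => f j y + g j y) = S1 f + S1 g.
Proof. by move=> cf cg; rewrite -big_split; apply: eq_bigr => j _; rewrite I1D. Qed.

Lemma S1Z f e : (forall j, continuous (f j)) ->
  S1 (fun j y => e * f j y) = e * S1 f.
Proof. by move=> cf; rewrite mulr_sumr; apply: eq_bigr => j _; rewrite I1Z. Qed.

Lemma S1_ge0 f : (forall j y, (j < N)%N -> X j <= y <= X j.+1 -> 0 <= f j y) -> 0 <= S1 f.
Proof. by move=> f0; apply: sumr_ge0 => j _; apply: I1_ge0 => y; exact: f0. Qed.

Hypothesis X0 : X 0 = 0.
Hypothesis XN : X N = 1.
Hypothesis Xinc : forall i, (i < N)%N -> X i < X i.+1.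

Lemma S1_cst e : S1 (fun _ _ => e) = e.
Proof.
rewrite /S1 (eq_bigr (fun j : 'I_N => e * (X j.+1 - X j))); last first.
  by move=> j _; rewrite I1_cst// ltW// Xinc.
rewrite -mulr_sumr -(big_mkord xpredT (fun j => X j.+1 - X j)) telescope_sumr// XN X0 subr0.
by rewrite mulr1.
Qed.

Lemma S2_fst f : (forall i, continuous (f i)) ->
  S2 (fun i _ x _ => f i x) = \sum_(i < N) I1 (X i) (X i.+1) (f i).
Proof.
move=> cf; rewrite -[RHS]S1_cst /S1; apply: eq_bigr => j _.
rewrite I1_cst; last by rewrite ltW// Xinc.
rewrite mulr_suml; apply: eq_bigr => i _; rewrite I2_fst//; last by rewrite ltW// Xinc.
by rewrite mulrC.
Qed.

Lemma S2_cst e : S2 (fun _ _ _ _ => e) = e.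
Proof. by rewrite (S2_fst (f := fun _ _ => e))//; [exact: S1_cst|move=> _; exact: cont1_cst]. Qed.

End Sums.

Lemma young {R : realType} (t a b : R) : 0 < t -> `|a * b| <= t * a ^+ 2 + (4%:R * t)^-1 * b ^+ 2.
Proof.
move=> t0; have tN : t != 0 by rewrite gt_eqF.
have H (s : R) : s ^+ 2 = 1 -> s * (a * b) <= t * a ^+ 2 + (4%:R * t)^-1 * b ^+ 2.
  move=> s1; rewrite -subr_ge0.
  have -> : t * a ^+ 2 + (4%:R * t)^-1 * b ^+ 2 - s * (a * b) =
    t * (a - s * (2%:R * t)^-1 * b) ^+ 2 + (4%:R * t)^-1 * b ^+ 2 * (1 - s ^+ 2) by field.
  by rewrite s1 subrr mulr0 addr0 mulr_ge0 ?sqr_ge0// ltW.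
have m1 : (-1) ^+ 2 = 1 :> R by rewrite sqrrN expr1n.
rewrite ler_norml; apply/andP; split.
  by have := H (-1) m1; rewrite mulN1r lerNl.
by have := H 1 (expr1n _ 2); rewrite mul1r.
Qed.

(** * The estimate in the x-direction *)

Section Algebra.
Context {R : realType}.

Lemma alg_dual (A B C D E F : R) : A + B = C -> B = - D -> D = - E + F -> E = F + C - A.
Proof. lra. Qed.

Lemma alg_xdir (A B C D T U M M1 M2 M3 M5 M6 D4 : R) : A + B = C -> D = - U + T ->
  forall E, E = M + D4 -> M = M1 + M2 + U + M3 + M5 + M6 ->
  A + B + D + E - M1 - M2 = C + T + M3 + D4 + M5 + M6.
Proof. by move=> ? ? E ? ?; lra. Qed.

Lemma alg_sum (E1 Ev Eb x1 x2 x3 x4 x5 x6 x7 x8 t y z c1 c2 c3 c4 c5 c6 c7 c8 : R) :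
  0 <= t * E1 -> 0 <= t * Eb -> `|x1| <= t * E1 + y * c1 * z -> `|x2| <= t * Eb + y * c2 * z ->
  `|x3| <= t * Ev + y * c3 * z -> `|x4| <= t * Ev + y * c4 * z ->
  `|x5| <= t * Ev + y * c5 * z -> `|x6| <= t * Eb + y * c6 * z ->
  `|x7| <= c7 * z -> `|x8| <= t * E1 + y * c8 * z ->
  `|x1 + x2 + x3 + x4 + x5 + (x6 + x7 - x8)| <=
     3%:R * t * (E1 + Ev + Eb) + (y * (c1 + c2 + c3 + c4 + c5 + c6 + c8) + c7) * z.
Proof.
move=> e1 eb; have : 2%:R * (t * E1) + 3%:R * (t * Ev) + 2%:R * (t * Eb) <= 3%:R * t * (E1 + Ev + Eb) by lra.
rewrite -(lerD2r ((y * (c1 + c2 + c3 + c4 + c5 + c6 + c8) + c7) * z)) => h.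
move=> b1 b2 b3 b4 b5 b6 b7 b8; apply: le_trans h; move: b1 b2 b3 b4 b5 b6 b7 b8.
have -> : 2%:R * (t * E1) + 3%:R * (t * Ev) + 2%:R * (t * Eb) + (y * (c1 + c2 + c3 + c4 + c5 + c6 + c8) + c7) * z =
  (t * E1 + y * c1 * z) + (t * Eb + y * c2 * z) + (t * Ev + y * c3 * z)
  + (t * Ev + y * c4 * z) + (t * Ev + y * c5 * z)
  + (t * Eb + y * c6 * z) + c7 * z + (t * E1 + y * c8 * z) by ring.
move: (t * E1 + _) (t * Eb + _) (t * Ev + y * c3 * z) (t * Ev + y * c4 * z) (t * Ev + y * c5 * z)
  (t * Eb + _) (c7 * z) (t * E1 + _) => d1 d2 d3 d4 d5 d6 d7 d8.
rewrite !ler_norml => /andP[p1 q1] /andP[p2 q2] /andP[p3 q3] /andP[p4 q4] /andP[p5 q5].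
by move=> /andP[p6 q6] /andP[p7 q7] /andP[p8 q8]; apply/andP; split; lra.
Qed.

End Algebra.

Section Global.
Context {R : realType} (k N : nat) (X : nat -> R).
Implicit Types (U s P v : nat -> nat -> 'M[R]_k.+1).
(** The strip j of a family; families are numbered from 1, strips from 0. *)
Definition col U (j i : nat) := U i j.+1.
Definition B2 U s : R := \sum_(j < N) b2 N X (X j) (X j.+1) (col U j) (col s j).
Definition B3 P v : R := \sum_(j < N) b3 N X (X j) (X j.+1) (col P j) (col v j).
Definition B4 a lam U v : R := \sum_(j < N) b4 N X (X j) (X j.+1) a lam (col U j) (col v j).
End Global.

Section XDir.
Context {R : realType} (k N : nat) (X : nat -> R) (eps : R).
Notation Rr := Radau_right.
Notation S2 := (S2 N X).
Notation S1 := (S1 N X).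
Notation inK := (inK X).
Hypothesis N0 : (0 < N)%N.
Hypothesis X0 : X 0 = 0.
Hypothesis XN : X N = 1.
Hypothesis Xinc : forall i, (i < N)%N -> X i < X i.+1.
Hypothesis eps0 : 0 < eps.

Variables (a ax u ux uxx uxr uxl : R -> R -> R).
Hypothesis Ha : dX 0 1 a ax.
Hypothesis Hu : dX 0 1 u ux.
Hypothesis Hux : dX 0 1 ux uxx.
Hypothesis cuxr : cont2 uxr.
Hypothesis cuxl : cont2 uxl.
Hypothesis uxE : forall x y, ux x y = uxr x y + uxl x y.
Hypothesis u0 : forall y, 0 <= y <= 1 -> u 0 y = 0.
Hypothesis u1 : forall y, 0 <= y <= 1 -> u 1 y = 0.

Definition flux x y := eps * ux x y.
Notation p := flux.
Definition pyj (f : R -> R -> R) j x y := proj k Rr (X j) (X j.+1) (f x) y.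

(** What the forms see of a left Gauss-Radau projection in x: the moments
    against derivatives of test functions and the traces at left nodes. The
    projected function may depend on the strip. *)
Definition radau_x (F : nat -> R -> R -> R) (P : nat -> nat -> 'M[R]_k.+1) :=
  (forall i j (C : 'M[R]_k.+1), (i < N)%N -> (j < N)%N ->
     I2 (X i) (X i.+1) (X j) (X j.+1) (fun x y => ev (P i.+1 j.+1) x y * evx C x y)
     = I2 (X i) (X i.+1) (X j) (X j.+1) (fun x y => F j x y * evx C x y)) /\
  (forall i j (q : {poly R}), (i < N)%N -> (j < N)%N -> (size q <= k.+1)%N ->
     I1 (X j) (X j.+1) (fun y => ev (P i.+1 j.+1) (X i) y * q.[y])
     = I1 (X j) (X j.+1) (fun y => F j (X i) y * q.[y])).

Variables V P Z : nat -> nat -> 'M[R]_k.+1.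
Hypothesis HV : forall i j, (i < N)%N -> (j < N)%N -> forall x y,
  ev (V i.+1 j.+1) x y = proj k Rr (X i) (X i.+1) ((pyj u j) ^~ y) x.
Hypothesis HP : radau_x (fun=> p) P.

Variables (G g : nat -> R -> R -> R).
Hypothesis HG : forall j, dX (X j) (X j.+1) (G j) (g j).
Hypothesis gE : forall j x y, (j < N)%N -> 0 <= x <= 1 -> X j <= y <= X j.+1 ->
  g j x y = a x y * (pyj uxl j x y - uxl x y).
Hypothesis HZ : radau_x G Z.

Lemma Xin i y : (i < N)%N -> X i <= y <= X i.+1 -> 0 <= y <= 1.
Proof.
move=> iN /andP[h1 h2]; rewrite (le_trans (X_ge0 X0 Xinc (ltnW iN)) h1).
by rewrite (le_trans h2)// (X_le1 XN Xinc).
Qed.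

Let ca : cont2 a. Proof. by case: Ha. Qed.
Let cax : cont2 ax. Proof. by case: Ha. Qed.
Let cu : cont2 u. Proof. by case: Hu. Qed.
Let cux : cont2 ux. Proof. by case: Hu. Qed.
Let cuxx : cont2 uxx. Proof. by case: Hux. Qed.
Let cG j : cont2 (G j). Proof. by case: (HG j). Qed.
Let cg j : cont2 (g j). Proof. by case: (HG j). Qed.
Let cp : cont2 p. Proof. by apply: cont2M => //; exact: cont2_cst. Qed.
Lemma cont_pyj f j : cont2 f -> cont2 (pyj f j). Proof. by move=> cf; exact: cont2_proj. Qed.

Let sub01 j : (j < N)%N -> forall F f, dX 0 1 F f -> dX (X j) (X j.+1) F f.
Proof.
by move=> jN F f; apply: dX_sub; [exact: (X_ge0 X0 Xinc (ltnW jN))|exact: (X_le1 XN Xinc)].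
Qed.

(** The defect in x of the tensor-product projection of u. *)
Definition rdef i j x y := pyj u j x y - ev (V i.+1 j.+1) x y.
Lemma cont_rdef i j : cont2 (rdef i j).
Proof. by have h := @cont_pyj u j cu; rewrite /rdef; ct. Qed.

Lemma B2V s : B2 N X V s = - S2 (fun i j x y => pyj ux j x y * ev (s i.+1 j.+1) x y).
Proof.
rewrite /B2 /S2 -sumrN; apply: eq_bigr => j _.
rewrite (@b2_radau _ k N X (X j) (X j.+1) N0 X0 XN Xinc (Xinc (ltn_ord j)) u ux (sub01 (ltn_ord j) Hu) _ _ (col V j)) //.
- by move=> y hy; apply: u0; exact: Xin hy.
- by move=> y hy; apply: u1; exact: Xin hy.
- by move=> i iN x y; exact: HV.
Qed.

Lemma B4V lam v : B4 N X a lam V v =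
  S2 (fun i j x y => (ax x y * pyj u j x y + a x y * pyj ux j x y) * ev (v i.+1 j.+1) x y)
  + S2 (fun i j x y => (a x y - a (X i.+1) y) * rdef i j x y * evx (v i.+1 j.+1) x y).
Proof.
rewrite /B4 /S2 -big_split; apply: eq_bigr => j _ /=.
rewrite (@b4_radau _ k N X (X j) (X j.+1) N0 X0 XN Xinc (Xinc (ltn_ord j)) u ux (sub01 (ltn_ord j) Hu) _ _ (col V j) _ a ax) //.
- exact: big_split.
- by move=> y hy; apply: u0; exact: Xin hy.
- by move=> y hy; apply: u1; exact: Xin hy.
- by move=> i iN x y; exact: HV.
- exact: sub01.
Qed.

Lemma B3rad (F f : nat -> R -> R -> R) Q v : (forall j, (j < N)%N -> dX (X j) (X j.+1) (F j) (f j)) -> radau_x F Q ->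
  B3 N X Q v = - S2 (fun i j x y => f j x y * ev (v i.+1 j.+1) x y)
   + S1 (fun j y => (F j (X N) y - ev (Q N j.+1) (X N) y) * ev (v N j.+1) (X N) y).
Proof.
move=> HF [R1 R2]; rewrite /B3 /S2 /S1 -sumrN -big_split; apply: eq_bigr => j _ /=.
have h1 (i : 'I_N) : I2 (X i) (X i.+1) (X j) (X j.+1) (fun x y => ev (col Q j i.+1) x y * evx (col v j i.+1) x y)
   = I2 (X i) (X i.+1) (X j) (X j.+1) (fun x y => F j x y * evx (col v j i.+1) x y) by exact: R1.
have h2 (i : 'I_N) (q : {poly R}) (sq : (size q <= k.+1)%N) :
     I1 (X j) (X j.+1) (fun y => ev (col Q j i.+1) (X i) y * q.[y])
     = I1 (X j) (X j.+1) (fun y => F j (X i) y * q.[y]) by exact: R2.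
exact: (@b3_radau _ k N X (X j) (X j.+1) N0 X0 XN Xinc (F j) (f j) (col Q j) (col v j) (HF j (ltn_ord j)) h1 h2).
Qed.

Variables v s : nat -> nat -> 'M[R]_k.+1.

Definition rho i j x y := ev (P i.+1 j.+1) x y - eps * pyj ux j x y.

Let cpy j : cont2 (pyj u j). Proof. exact: cont_pyj. Qed.
Let cpyx j : cont2 (pyj ux j). Proof. exact: cont_pyj. Qed.
Let cpyr j : cont2 (pyj uxr j). Proof. exact: cont_pyj. Qed.
Let cpyl j : cont2 (pyj uxl j). Proof. exact: cont_pyj. Qed.
Let crd i j : cont2 (rdef i j). Proof. exact: cont_rdef. Qed.
Let crho i j : cont2 (rho i j). Proof. by rewrite /rho; ct. Qed.

Lemma rho_identity t :
  eps^-1 * S2 (fun i j x y => ev (P i.+1 j.+1) x y * ev (t i.+1 j.+1) x y) + B2 N X V t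
  = eps^-1 * S2 (fun i j x y => rho i j x y * ev (t i.+1 j.+1) x y).
Proof.
rewrite B2V; have -> : S2 (fun i j x y => rho i j x y * ev (t i.+1 j.+1) x y) =
  S2 (fun i j x y => ev (P i.+1 j.+1) x y * ev (t i.+1 j.+1) x y) -
  eps * S2 (fun i j x y => pyj ux j x y * ev (t i.+1 j.+1) x y).
  rewrite -S2Z; last by move=> i j; ct.
  rewrite -S2B; [|by move=> i j; ct|by move=> i j; ct].
  by apply: eq_S2 => i j x y _ _ _; rewrite /rho mulrBl mulrA.
by rewrite mulrBr mulKf// gt_eqF.
Qed.

(** The layer part g of the convection defect is of size delta / eps in the
    layer, too large in L2. Its primitive G in x is of size delta, and by
    b3_radau the form B2 tested with the projection Z of G returns the
    integral of g v; the discrete equation turns B2 into terms with the factor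
    eps^-1 that are small because Z lives in the layer. *)
Lemma dual_identity :
  eps^-1 * S2 (fun i j x y => ev (s i.+1 j.+1) x y * ev (Z i.+1 j.+1) x y) + B2 N X v Z
   = eps^-1 * S2 (fun i j x y => ev (P i.+1 j.+1) x y * ev (Z i.+1 j.+1) x y) + B2 N X V Z ->
  S2 (fun i j x y => g j x y * ev (v i.+1 j.+1) x y) =
    S1 (fun j y => (G j (X N) y - ev (Z N j.+1) (X N) y) * ev (v N j.+1) (X N) y)
    + eps^-1 * S2 (fun i j x y => rho i j x y * ev (Z i.+1 j.+1) x y)
    - eps^-1 * S2 (fun i j x y => ev (s i.+1 j.+1) x y * ev (Z i.+1 j.+1) x y).
Proof.
move=> gal; have h1 := etrans gal (rho_identity Z).
have h2 : B2 N X v Z = - B3 N X Z v.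
  by rewrite /B2 /B3 -sumrN; apply: eq_bigr => j _; exact: b2_b3_dual.
have h3 := @B3rad G g Z v (fun j _ => HG j) HZ.
exact: alg_dual h1 h2 h3.
Qed.

(** The x-part of the form at the projected solution, minus the x-part of the
    differential operator, consists of terms that each contain a projection
    error. *)
Lemma xdir_identity lam :
  eps^-1 * S2 (fun i j x y => ev (P i.+1 j.+1) x y * ev (s i.+1 j.+1) x y)
   + B2 N X V s + B3 N X P v + B4 N X a lam V v
   - S2 (fun i j x y => ax x y * ev (V i.+1 j.+1) x y * ev (v i.+1 j.+1) x y)
   - S2 (fun i j x y => (a x y * ux x y - eps * uxx x y) * ev (v i.+1 j.+1) x y)
  = eps^-1 * S2 (fun i j x y => rho i j x y * ev (s i.+1 j.+1) x y)
    + S1 (fun j y => (p (X N) y - ev (P N j.+1) (X N) y) * ev (v N j.+1) (X N) y)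
    + S2 (fun i j x y => ax x y * rdef i j x y * ev (v i.+1 j.+1) x y)
    + S2 (fun i j x y => (a x y - a (X i.+1) y) * rdef i j x y * evx (v i.+1 j.+1) x y)
    + S2 (fun i j x y => a x y * (pyj uxr j x y - uxr x y) * ev (v i.+1 j.+1) x y)
    + S2 (fun i j x y => g j x y * ev (v i.+1 j.+1) x y).
Proof.
have dp j : (j < N)%N -> dX (X j) (X j.+1) p (fun x y => eps * uxx x y).
  move=> jN; have [c1 c2 d1] := sub01 jN Hux; split => //; first by ct.
  move=> x y x01 hy; have := @is_deriveM _ _ (fun=> eps) (ux ^~ y) x 1 0 _ (is_derive_cst _ _ _) (d1 x y x01 hy).
  by rewrite scaler0 addr0; apply.
have h1 := rho_identity s.
have h2 := @B3rad (fun=> p) (fun _ x y => eps * uxx x y) P v dp HP.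
have h3 := B4V lam v.
have h4 : S2 (fun i j x y => (ax x y * pyj u j x y + a x y * pyj ux j x y) * ev (v i.+1 j.+1) x y)
  = S2 (fun i j x y => ax x y * ev (V i.+1 j.+1) x y * ev (v i.+1 j.+1) x y)
  + S2 (fun i j x y => (a x y * ux x y - eps * uxx x y) * ev (v i.+1 j.+1) x y)
  + S2 (fun i j x y => eps * uxx x y * ev (v i.+1 j.+1) x y)
  + S2 (fun i j x y => ax x y * rdef i j x y * ev (v i.+1 j.+1) x y)
  + S2 (fun i j x y => a x y * (pyj uxr j x y - uxr x y) * ev (v i.+1 j.+1) x y)
  + S2 (fun i j x y => g j x y * ev (v i.+1 j.+1) x y).
  do 5 (rewrite -S2D; [|by move=> i j; ct|by move=> i j; ct]).
  apply: eq_S2 => i j x y iN jN [hx hy].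
  have cr1 : continuous (uxr x) by ct.
  have cl1 : continuous (uxl x) by ct.
  have -> : pyj ux j x y = pyj uxr j x y + pyj uxl j x y.
    rewrite /pyj -projD//; congr (proj _ _ _ _ _ _).
    by apply/funext => t; rewrite uxE.
  rewrite gE ?(Xin iN hx)// uxE /rdef; ring.
exact: alg_xdir h1 h2 _ h3 h4.
Qed.

Variables (A Cw Cs Cpi Cinv delta : R) (om : nat -> R -> R).
Hypothesis A0 : 0 <= A.
Hypothesis d0 : 0 <= delta.
Hypothesis Cs0 : 0 <= Cs.
Hypothesis Cpi0 : 0 <= Cpi.
Hypothesis Cinv0 : 0 < Cinv.
Hypothesis HCpi : forall c d g M y, c < d -> continuous g -> c <= y <= d ->
  (forall t, c <= t <= d -> `|g t| <= M) -> `|proj k Rr c d g y| <= Cpi * M.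
Hypothesis HCinv : forall b c (q : {poly R}), b < c -> (size q <= k.+1)%N ->
  (c - b) ^+ 2 * I1 b c (fun x => (q^`()).[x] ^+ 2) <= Cinv * I1 b c (fun x => q.[x] ^+ 2).
Hypothesis Abound : forall x y, 0 <= x <= 1 -> 0 <= y <= 1 -> `|a x y| <= A /\ `|ax x y| <= A.
Hypothesis com : forall i, continuous (om i).
Hypothesis om_sum : eps^-1 * \sum_(i < N) I1 (X i) (X i.+1) (fun x => om i x ^+ 2) <= Cw.
Hypothesis om_eps : forall i x, (i < N)%N -> X i <= x <= X i.+1 -> eps <= om i x.
Hypothesis om_end : om N.-1 1 <= Cw.
Hypothesis D1 : forall i j x y, (i < N)%N -> (j < N)%N -> inK i j x y ->
  `|pyj uxr j x y - uxr x y| <= delta.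
Hypothesis D2 : forall i j x y, (i < N)%N -> (j < N)%N -> inK i j x y ->
  eps * `|pyj uxl j x y - uxl x y| <= delta * om i x.
Hypothesis D3 : forall i x y, (i < N)%N -> X i <= x <= X i.+1 -> 0 <= y <= 1 ->
  `|u x y - proj k Rr (X i) (X i.+1) (u ^~ y) x| <= delta.
Hypothesis D4 : forall i j x y, (i < N)%N -> (j < N)%N -> inK i j x y ->
  `|p x y - ev (P i.+1 j.+1) x y| <= delta * om i x.
Hypothesis D5 : forall i j x y, (i < N)%N -> (j < N)%N -> inK i j x y ->
  `|ev (Z i.+1 j.+1) x y| <= Cs * delta * om i x.
Hypothesis D6 : forall j y, (j < N)%N -> X j <= y <= X j.+1 -> `|G j 1 y| <= Cs * delta.

Let om0 i x : (i < N)%N -> X i <= x <= X i.+1 -> 0 <= om i x.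
Proof. by move=> iN hx; apply: le_trans (om_eps iN hx); exact: ltW. Qed.

Let Om := \sum_(i < N) I1 (X i) (X i.+1) (fun x => om i x ^+ 2).

Lemma young_om t c (H F : nat -> nat -> R -> R -> R) : 0 < t ->
  (forall i j, cont2 (H i j)) -> (forall i j, cont2 (F i j)) ->
  (forall i j x y, (i < N)%N -> (j < N)%N -> inK i j x y -> `|H i j x y| <= c * om i x) ->
  `|S2 (fun i j x y => H i j x y * F i j x y)| <=
    t * S2 (fun i j x y => F i j x y ^+ 2) + (4%:R * t)^-1 * c ^+ 2 * Om.
Proof.
move=> t0 cH cF HF.
have -> : t * S2 (fun i j x y => F i j x y ^+ 2) + (4%:R * t)^-1 * c ^+ 2 * Om =
   S2 (fun i j x y => t * F i j x y ^+ 2 + (4%:R * t)^-1 * c ^+ 2 * om i x ^+ 2).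
  rewrite S2D; [|by move=> i j; ct|by move=> i j; ct].
  rewrite S2Z; [|by move=> i j; ct]; rewrite S2Z; [|by move=> i j; ct].
  by rewrite /Om (S2_fst X0 XN Xinc)// => i; ct.
apply: S2_bound; [by move=> i j; ct|by move=> i j; ct|].
move=> i j x y iN jN hK; rewrite mulrC; apply: (le_trans (young _ _ t0)).
rewrite lerD2l -mulrA ler_wpM2l ?invr_ge0 ?mulr_ge0 ?(ltW t0)//.
rewrite -exprMn -[leLHS]real_normK ?num_real//.
have h := HF i j x y iN jN hK.
by rewrite lerXn2r ?nnegrE// (le_trans _ h).
Qed.

Lemma young_const t c (H F : nat -> nat -> R -> R -> R) : 0 < t ->
  (forall i j, cont2 (H i j)) -> (forall i j, cont2 (F i j)) ->
  (forall i j x y, (i < N)%N -> (j < N)%N -> inK i j x y -> `|H i j x y| <= c) ->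
  `|S2 (fun i j x y => H i j x y * F i j x y)| <=
    t * S2 (fun i j x y => F i j x y ^+ 2) + (4%:R * t)^-1 * c ^+ 2.
Proof.
move=> t0 cH cF HF.
rewrite -[X in _ <= _ + X](S2_cst X0 XN Xinc ((4%:R * t)^-1 * c ^+ 2)) -S2Z; last by move=> i j; ct.
rewrite -S2D; [|by move=> i j; ct|by move=> i j; ct].
apply: S2_bound; [by move=> i j; ct|by move=> i j; ct|].
move=> i j x y iN jN hK; rewrite mulrC; apply: (le_trans (young _ _ t0)).
rewrite lerD2l ler_wpM2l ?invr_ge0 ?mulr_ge0 ?(ltW t0)//.
rewrite -[leLHS]real_normK ?num_real//.
have h := HF i j x y iN jN hK.
by rewrite lerXn2r ?nnegrE// (le_trans _ h).
Qed.

Lemma young_trace t c (H F : nat -> R -> R) : 0 < t ->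
  (forall j, continuous (H j)) -> (forall j, continuous (F j)) ->
  (forall j y, (j < N)%N -> X j <= y <= X j.+1 -> `|H j y| <= c) ->
  `|S1 (fun j y => H j y * F j y)| <= t * S1 (fun j y => F j y ^+ 2) + (4%:R * t)^-1 * c ^+ 2.
Proof.
move=> t0 cH cF HF.
have cF2 j : continuous (fun y => F j y ^+ 2) by apply: cont1X.
rewrite -[X in _ <= _ + X](S1_cst X0 XN Xinc ((4%:R * t)^-1 * c ^+ 2)) -S1Z//.
rewrite -S1D; [|by move=> j; apply: cont1M; [exact: cont1_cst|exact: cF2]|by move=> j; exact: cont1_cst].
apply: S1_bound; first by move=> j; apply: cont1M.
  by move=> j; apply: cont1D; [apply: cont1M; [exact: cont1_cst|exact: cF2]|exact: cont1_cst].
move=> j y jN hy; rewrite mulrC; apply: (le_trans (young _ _ t0)).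
rewrite lerD2l ler_wpM2l ?invr_ge0 ?mulr_ge0 ?(ltW t0)//.
rewrite -[leLHS]real_normK ?num_real//.
have h := HF j y jN hy.
by rewrite lerXn2r ?nnegrE// (le_trans _ h).
Qed.

(** The projections in x and y commute, so the defect is the y-projection of u
    minus its x-projection. *)
Lemma rdef_bound i j x y : (i < N)%N -> (j < N)%N -> inK i j x y ->
  `|rdef i j x y| <= Cpi * delta.
Proof.
move=> iN jN [hx hy].
have cq : cont2 (fun t x => proj k Rr (X i) (X i.+1) (u ^~ t) x).
  exact: (@cont2_proj _ k Rr (X i) (X i.+1) (fun t x => u x t) (cont2_swap cu)).
have -> : rdef i j x y = proj k Rr (X j) (X j.+1)
    (fun t => u x t - proj k Rr (X i) (X i.+1) (u ^~ t) x) y.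
  rewrite /rdef HV// projB; [|ct|exact: (@cont2_s2 _ _ x cq)]; congr (_ - _).
  by rewrite proj_comm.
apply: HCpi => //; [exact: Xinc|by apply: cont1D; [ct|apply: cont1N; exact: (@cont2_s2 _ _ x cq)]|].
by move=> t ht; apply: D3 => //; exact: Xin ht.
Qed.

Lemma rho_bound i j x y : (i < N)%N -> (j < N)%N -> inK i j x y ->
  `|rho i j x y| <= 3%:R * delta * om i x.
Proof.
move=> iN jN hK; have [hx hy] := hK.
have cr1 : continuous (uxr x) by ct.
have cl1 : continuous (uxl x) by ct.
have -> : rho i j x y = - (p x y - ev (P i.+1 j.+1) x y) -
   (eps * (pyj uxr j x y - uxr x y) + eps * (pyj uxl j x y - uxl x y)).
  have -> : p x y = eps * (uxr x y + uxl x y) by rewrite /flux uxE.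
  rewrite /rho; have -> : pyj ux j x y = pyj uxr j x y + pyj uxl j x y.
    rewrite /pyj -projD//; congr (proj _ _ _ _ _ _).
    by apply/funext => t; rewrite uxE.
  ring.
apply: (le_trans (ler_normB _ _)); rewrite normrN.
have h1 := D4 iN jN hK.
have h2 : `|eps * (pyj uxr j x y - uxr x y)| <= delta * om i x.
  rewrite normrM gtr0_norm// mulrC; apply: ler_pM => //; [exact: ltW|exact: D1 hK|exact: om_eps].
have h3 : `|eps * (pyj uxl j x y - uxl x y)| <= delta * om i x.
  by rewrite normrM gtr0_norm//; exact: D2.
have := ler_normD (eps * (pyj uxr j x y - uxr x y)) (eps * (pyj uxl j x y - uxl x y)).
move: h1 h2 h3; lra.
Qed.

Lemma coef_variation i x y : (i < N)%N -> X i <= x <= X i.+1 -> 0 <= y <= 1 ->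
  `|a x y - a (X i.+1) y| <= A * (X i.+1 - X i).
Proof.
move=> iN /andP[h1 h2] hy.
have x0 : 0 <= x := le_trans (X_ge0 X0 Xinc (ltnW iN)) h1.
have x1 : X i.+1 <= 1 := X_le1 XN Xinc iN.
rewrite distrC -(@I1_dX _ x (X i.+1) 0 1 a ax y)//.
have cx : continuous (ax ^~ y) by ct.
apply: (le_trans (ler_norm_I1 _ _ cx)).
apply: (@le_trans _ _ (I1 x (X i.+1) (fun=> A))).
  apply: le_I1; [exact: cont1_norm|exact: cont1_cst|] => z /andP[s1 s2].
  by have [] := Abound (_ : 0 <= z <= 1) hy; rewrite ?(le_trans x0 s1) ?(le_trans s2 x1).
by rewrite I1_cst// ler_wpM2l// lerB.
Qed.

(** On each horizontal line this is the one-dimensional inverse inequality. *)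
Lemma inverse_S2 : S2 (fun i j x y => ((X i.+1 - X i) * evx (v i.+1 j.+1) x y) ^+ 2) <=
  Cinv * S2 (fun i j x y => ev (v i.+1 j.+1) x y ^+ 2).
Proof.
rewrite mulr_sumr; apply: ler_sum => j _; rewrite mulr_sumr; apply: ler_sum => i _.
have c1 : cont2 (fun x y => ((X i.+1 - X i) * evx (v i.+1 j.+1) x y) ^+ 2) by ct.
have c2 : cont2 (fun x y => ev (v i.+1 j.+1) x y ^+ 2) by ct.
rewrite (I2_swap _ _ _ _ c1) (I2_swap _ _ _ _ c2) /I2 -I1Z; last first.
  by apply: (@cont_I1 _ (fun y x => ev (v i.+1 j.+1) x y ^+ 2)); exact: (cont2_swap c2).
apply: le_I1.
- by apply: (@cont_I1 _ (fun y x => ((X i.+1 - X i) * evx (v i.+1 j.+1) x y) ^+ 2)); exact: (cont2_swap c1).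
- apply: cont1M; first exact: cont1_cst.
  by apply: (@cont_I1 _ (fun y x => ev (v i.+1 j.+1) x y ^+ 2)); exact: (cont2_swap c2).
move=> y _.
have -> : I1 (X i) (X i.+1) (fun x => ev (v i.+1 j.+1) x y ^+ 2) =
  I1 (X i) (X i.+1) (fun x => (polx (v i.+1 j.+1) y).[x] ^+ 2).
  by apply: eq_I1 => x _; rewrite evE.
have -> : I1 (X i) (X i.+1) (fun x => ((X i.+1 - X i) * evx (v i.+1 j.+1) x y) ^+ 2) =
  (X i.+1 - X i) ^+ 2 * I1 (X i) (X i.+1) (fun x => ((polx (v i.+1 j.+1) y)^`()).[x] ^+ 2).
  rewrite -I1Z; last by ct.
  by apply: eq_I1 => x _; rewrite exprMn evxE.
apply: HCinv; [exact: Xinc|exact: size_polx].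
Qed.

Definition xdir_const t : R :=
  (4%:R * t)^-1 * (9%:R * Cw + Cw ^+ 2 + (A * Cpi) ^+ 2 + Cinv * (A * Cpi) ^+ 2 + A ^+ 2
    + (Cs + Cs * Cw) ^+ 2 + Cs ^+ 2 * Cw) + 3%:R * Cs * Cw.

(** Young's inequality for each of the eight terms. The weight om carries the
    layer: the integral of its square is O(eps), which compensates the factor
    eps^-1 in front of the fluxes. *)
Lemma xdir_bound lam t : 0 < t ->
  eps^-1 * S2 (fun i j x y => ev (s i.+1 j.+1) x y * ev (Z i.+1 j.+1) x y) + B2 N X v Z
   = eps^-1 * S2 (fun i j x y => ev (P i.+1 j.+1) x y * ev (Z i.+1 j.+1) x y) + B2 N X V Z ->
  `|eps^-1 * S2 (fun i j x y => ev (P i.+1 j.+1) x y * ev (s i.+1 j.+1) x y)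
   + B2 N X V s + B3 N X P v + B4 N X a lam V v
   - S2 (fun i j x y => ax x y * ev (V i.+1 j.+1) x y * ev (v i.+1 j.+1) x y)
   - S2 (fun i j x y => (a x y * ux x y - eps * uxx x y) * ev (v i.+1 j.+1) x y)|
  <= 3%:R * t * (eps^-1 * S2 (fun i j x y => ev (s i.+1 j.+1) x y ^+ 2)
      + S2 (fun i j x y => ev (v i.+1 j.+1) x y ^+ 2)
      + S1 (fun j y => ev (v N j.+1) (X N) y ^+ 2))
     + xdir_const t * delta ^+ 2.
Proof.
move=> t0 gal; rewrite xdir_identity (dual_identity gal).
set Es := S2 (fun i j x y => ev (s i.+1 j.+1) x y ^+ 2).
set Ev := S2 (fun i j x y => ev (v i.+1 j.+1) x y ^+ 2).
set Eb := S1 (fun j y => ev (v N j.+1) (X N) y ^+ 2).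
have ei : 0 < eps^-1 by rewrite invr_gt0.
have N1 : (N.-1 < N)%N by rewrite prednK.
have XN1 : X N.-1 <= 1 <= X N.-1.+1 by rewrite prednK// XN lexx andbT (X_le1 XN Xinc)// leq_pred.
have Cw0 : 0 <= Cw by apply: le_trans om_end; exact: om0.
have OmC : eps^-1 * Om <= Cw by [].
have Om0 : 0 <= Om.
  by apply: sumr_ge0 => i _; apply: I1_ge0 => x _; exact: sqr_ge0.
have cev (f : nat -> nat -> 'M[R]_k.+1) i j : cont2 (ev (f i.+1 j.+1)) by exact: cont_ev.
have b1 : `|eps^-1 * S2 (fun i j x y => rho i j x y * ev (s i.+1 j.+1) x y)| <=
   t * (eps^-1 * Es) + (4%:R * t)^-1 * (9%:R * Cw) * delta ^+ 2.
  rewrite normrM gtr0_norm//.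
  have := @young_om t (3%:R * delta) (fun i j => rho i j) (fun i j => ev (s i.+1 j.+1)) t0
    crho (cev s) rho_bound.
  rewrite -/Es => h.
  apply: (le_trans (ler_wpM2l (ltW ei) h)).
  rewrite mulrDr mulrCA lerD2l exprMn.
  have -> : eps^-1 * ((4%:R * t)^-1 * (3%:R ^+ 2 * delta ^+ 2) * Om) =
     (4%:R * t)^-1 * (9%:R * (eps^-1 * Om)) * delta ^+ 2 by ring.
  rewrite ler_wpM2r ?sqr_ge0// ler_wpM2l ?invr_ge0 ?mulr_ge0 ?(ltW t0)//.
  by rewrite ler_wpM2l.
have b2 : `|S1 (fun j y => (p (X N) y - ev (P N j.+1) (X N) y) * ev (v N j.+1) (X N) y)| <=
   t * Eb + (4%:R * t)^-1 * Cw ^+ 2 * delta ^+ 2.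
  have -> : (4%:R * t)^-1 * Cw ^+ 2 * delta ^+ 2 = (4%:R * t)^-1 * (delta * Cw) ^+ 2 by ring.
  apply: (@young_trace t (delta * Cw) (fun j y => p (X N) y - ev (P N j.+1) (X N) y)
     (fun j => ev (v N j.+1) (X N))) => //.
  - by move=> j; ct.
  - by move=> j; ct.
  move=> j y jN hy; rewrite XN.
  have := @D4 N.-1 j 1 y N1 jN (conj XN1 hy); rewrite prednK// => h.
  by apply: (le_trans h); rewrite ler_wpM2l.
have ab i j x y : (i < N)%N -> (j < N)%N -> inK i j x y -> `|a x y| <= A /\ `|ax x y| <= A.
  by move=> iN jN [hx hy]; apply: Abound; [exact: Xin hx|exact: Xin hy].
have b3 : `|S2 (fun i j x y => ax x y * rdef i j x y * ev (v i.+1 j.+1) x y)| <=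
   t * Ev + (4%:R * t)^-1 * (A * Cpi) ^+ 2 * delta ^+ 2.
  have -> : (4%:R * t)^-1 * (A * Cpi) ^+ 2 * delta ^+ 2 = (4%:R * t)^-1 * (A * (Cpi * delta)) ^+ 2 by ring.
  apply: (@young_const t (A * (Cpi * delta)) (fun i j x y => ax x y * rdef i j x y)
     (fun i j => ev (v i.+1 j.+1))) => //.
    by move=> i j; ct.
  move=> i j x y iN jN hK; rewrite normrM.
  by apply: ler_pM => //; [have [] := ab _ _ _ _ iN jN hK|exact: rdef_bound].
(* The variation of a gains the length of the element, which the inverse
   inequality for the derivative of v spends. *)
have b4 : `|S2 (fun i j x y => (a x y - a (X i.+1) y) * rdef i j x y * evx (v i.+1 j.+1) x y)| <=
   t * Ev + (4%:R * t)^-1 * (Cinv * (A * Cpi) ^+ 2) * delta ^+ 2.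
  have tc : 0 < t / Cinv by rewrite divr_gt0.
  have -> : S2 (fun i j x y => (a x y - a (X i.+1) y) * rdef i j x y * evx (v i.+1 j.+1) x y) =
    S2 (fun i j x y => (X i.+1 - X i)^-1 * (a x y - a (X i.+1) y) * rdef i j x y * ((X i.+1 - X i) * evx (v i.+1 j.+1) x y)).
    apply: eq_S2 => i j x y iN jN hK; field.
    by rewrite subr_eq0 gt_eqF// Xinc.
  have H i j x y : (i < N)%N -> (j < N)%N -> inK i j x y ->
    `|(X i.+1 - X i)^-1 * (a x y - a (X i.+1) y) * rdef i j x y| <= A * (Cpi * delta).
    move=> iN jN hK; rewrite normrM; apply: ler_pM => //; last exact: rdef_bound.
    have hi : 0 < X i.+1 - X i by rewrite subr_gt0 Xinc.
    rewrite normrM gtr0_norm ?invr_gt0// ler_pdivrMl// mulrC.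
    by case: hK => hx hy; apply: coef_variation => //; exact: Xin hy.
  have c1 i j : cont2 (fun x y => (X i.+1 - X i)^-1 * (a x y - a (X i.+1) y) * rdef i j x y) by ct.
  have c2 i j : cont2 (fun x y => (X i.+1 - X i) * evx (v i.+1 j.+1) x y) by ct.
  have := @young_const (t / Cinv) (A * (Cpi * delta)) 
     (fun i j x y => (X i.+1 - X i)^-1 * (a x y - a (X i.+1) y) * rdef i j x y)
     (fun i j x y => (X i.+1 - X i) * evx (v i.+1 j.+1) x y) tc c1 c2 H => h.
  apply: (le_trans h); apply: lerD.
    rewrite -mulrA ler_wpM2l ?(ltW t0)// ler_pdivrMl//; exact: inverse_S2.
  rewrite le_eqVlt; apply/orP; left; apply/eqP.
  by field; rewrite (gt_eqF t0) (gt_eqF Cinv0).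
have b5 : `|S2 (fun i j x y => a x y * (pyj uxr j x y - uxr x y) * ev (v i.+1 j.+1) x y)| <=
   t * Ev + (4%:R * t)^-1 * A ^+ 2 * delta ^+ 2.
  have -> : (4%:R * t)^-1 * A ^+ 2 * delta ^+ 2 = (4%:R * t)^-1 * (A * delta) ^+ 2 by ring.
  apply: (@young_const t (A * delta) (fun i j x y => a x y * (pyj uxr j x y - uxr x y))
     (fun i j => ev (v i.+1 j.+1))) => //.
    by move=> i j; ct.
  move=> i j x y iN jN hK; rewrite normrM.
  by apply: ler_pM => //; [have [] := ab _ _ _ _ iN jN hK|exact: D1 hK].
have b6 : `|S1 (fun j y => (G j (X N) y - ev (Z N j.+1) (X N) y) * ev (v N j.+1) (X N) y)| <=
   t * Eb + (4%:R * t)^-1 * (Cs + Cs * Cw) ^+ 2 * delta ^+ 2.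
  have -> : (4%:R * t)^-1 * (Cs + Cs * Cw) ^+ 2 * delta ^+ 2 =
    (4%:R * t)^-1 * (Cs * delta + Cs * delta * Cw) ^+ 2 by ring.
  apply: (@young_trace t (Cs * delta + Cs * delta * Cw) (fun j y => G j (X N) y - ev (Z N j.+1) (X N) y)
     (fun j => ev (v N j.+1) (X N))) => //.
  - by move=> j; ct.
  - by move=> j; ct.
  move=> j y jN hy; rewrite XN; apply: (le_trans (ler_normB _ _)); apply: lerD; first exact: D6.
  have := @D5 N.-1 j 1 y N1 jN (conj XN1 hy); rewrite prednK// => h.
  by apply: (le_trans h); rewrite ler_wpM2l// mulr_ge0.
(* Both factors carry the weight om, so no energy term arises. *)
have b7 : `|eps^-1 * S2 (fun i j x y => rho i j x y * ev (Z i.+1 j.+1) x y)| <=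
   3%:R * Cs * Cw * delta ^+ 2.
  rewrite normrM gtr0_norm//.
  have h : `|S2 (fun i j x y => rho i j x y * ev (Z i.+1 j.+1) x y)| <=
     S2 (fun i j x y => 3%:R * Cs * delta ^+ 2 * om i x ^+ 2).
    apply: S2_bound; [by move=> i j; ct|by move=> i j; ct|].
    move=> i j x y iN jN hK; rewrite normrM.
    have -> : 3%:R * Cs * delta ^+ 2 * om i x ^+ 2 = (3%:R * delta * om i x) * (Cs * delta * om i x) by ring.
    by apply: ler_pM => //; [exact: rho_bound|exact: D5 hK].
  apply: (le_trans (ler_wpM2l (ltW ei) h)).
  rewrite S2Z; [|by move=> i j; ct].
  rewrite (S2_fst X0 XN Xinc (f := fun i x => om i x ^+ 2)); last by move=> i; ct.
  have -> : eps^-1 * (3%:R * Cs * delta ^+ 2 * \sum_(i < N) I1 (X i) (X i.+1) (fun x => om i x ^+ 2))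
    = 3%:R * Cs * (eps^-1 * Om) * delta ^+ 2 by rewrite /Om; ring.
  by rewrite ler_wpM2r ?sqr_ge0// ler_wpM2l// mulr_ge0.
have b8 : `|eps^-1 * S2 (fun i j x y => ev (s i.+1 j.+1) x y * ev (Z i.+1 j.+1) x y)| <=
   t * (eps^-1 * Es) + (4%:R * t)^-1 * (Cs ^+ 2 * Cw) * delta ^+ 2.
  rewrite normrM gtr0_norm//.
  have -> : S2 (fun i j x y => ev (s i.+1 j.+1) x y * ev (Z i.+1 j.+1) x y) =
    S2 (fun i j x y => ev (Z i.+1 j.+1) x y * ev (s i.+1 j.+1) x y).
    by apply: eq_S2 => i j x y _ _ _; rewrite mulrC.
  have := @young_om t (Cs * delta) (fun i j => ev (Z i.+1 j.+1)) (fun i j => ev (s i.+1 j.+1)) t0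
    (cev Z) (cev s) D5.
  rewrite -/Es => h.
  apply: (le_trans (ler_wpM2l (ltW ei) h)).
  rewrite mulrDr mulrCA lerD2l exprMn.
  have -> : eps^-1 * ((4%:R * t)^-1 * (Cs ^+ 2 * delta ^+ 2) * Om) =
     (4%:R * t)^-1 * (Cs ^+ 2 * (eps^-1 * Om)) * delta ^+ 2 by ring.
  rewrite ler_wpM2r ?sqr_ge0// ler_wpM2l ?invr_ge0 ?mulr_ge0 ?(ltW t0)//.
  by rewrite ler_wpM2l ?sqr_ge0.
have e1 : 0 <= t * (eps^-1 * Es).
  by rewrite !mulr_ge0 ?(ltW t0) ?(ltW ei)// S2_ge0// => *; exact: sqr_ge0.
have eb : 0 <= t * Eb.
  by rewrite mulr_ge0 ?(ltW t0)// S1_ge0// => *; exact: sqr_ge0.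
exact: (alg_sum e1 eb b1 b2 b3 b4 b5 b6 b7 b8).
Qed.

End XDir.

(** * Errors of the projections *)

Section Approximation.
Context {R : realType} (k : nat).
Implicit Types (p q : {poly R}) (a b c d x y M : R).

(** Integrate an approximation of the derivative. *)
Lemma poly_approx n (f : nat -> R -> R) c d M : c < d ->
  (forall m, (m <= n)%N -> continuous (f m)) ->
  (forall m x, (m < n)%N -> c < x < d -> is_derive x 1 (f m) (f m.+1 x)) ->
  (forall x, c <= x <= d -> `|f n x| <= M) ->
  exists2 q : {poly R}, (size q <= n)%N & forall x, c <= x <= d -> `|f 0%N x - q.[x]| <= M * (d - c) ^+ n.
Proof.
move=> cd; elim: n f => [|n IH] f cf df fM.
  by exists 0 => [|x xcd]; rewrite ?size_poly0// horner0 subr0 expr0 mulr1 fM.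
have [|||q sq qf] := IH (fun m => f m.+1).
- by move=> m mn; apply: cf.
- by move=> m x mn xcd; apply: df.
- exact: fM.
exists (primp q + (f 0%N c - (primp q).[c])%:P).
  apply: (leq_trans (size_polyD _ _)); rewrite geq_max; apply/andP; split.
    by apply: (leq_trans (size_poly _ _)).
  by apply: (leq_trans (size_polyC_leq1 _)).
move=> x /andP[cx xd].
have cf0 : continuous (f 0%N) by apply: cf.
have cf1 : continuous (f 1%N) by apply: cf.
have h1 : I1 c x (f 1%N) = f 0%N x - f 0%N c.
  apply: I1_FTC => // t /andP[ct tx]; apply: df => //.
  by rewrite ct (lt_le_trans tx xd).
have h2 := I1_horner q cx.
have -> : f 0%N x - (primp q + (f 0%N c - (primp q).[c])%:P).[x] =
   I1 c x (fun t => f 1%N t - q.[t]).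
  have cq0 : continuous (fun t => q.[t]) by ct.
  rewrite (I1B c x cf1 cq0).
  rewrite h1 -[fun t => q.[t]]/(horner q) h2 hornerD hornerC; ring.
have cq : continuous (fun t => f 1%N t - q.[t]) by apply: cont1D => //; apply: cont1N; exact: cont_horner.
apply: (le_trans (ler_norm_I1 _ _ cq)).
have M0 : 0 <= M * (d - c) ^+ n by apply: le_trans (normr_ge0 _) (qf c _); rewrite lexx ltW.
apply: (@le_trans _ _ (I1 c x (fun=> M * (d - c) ^+ n))).
  apply: le_I1; [exact: cont1_norm|exact: cont1_cst|] => t /andP[ct tx].
  by apply: qf; rewrite ct (le_trans tx xd).
rewrite I1_cst// exprSr mulrA ler_wpM2l// lerB//.
Qed.

(** The sum of the absolute values of the dual basis over [0, 1] serves for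
    every interval. *)
Lemma projection_constant : exists2 C : R, 1 <= C &
  (forall K c d (g : R -> R) M y, c < d -> continuous g -> c <= y <= d ->
    (forall t, c <= t <= d -> `|g t| <= M) -> `|proj k K c d g y| <= C * M) /\
  (forall K c d (g W : R -> R) y, K <> Radau_right -> c < d -> continuous g -> continuous W -> c <= y <= d ->
    (forall t, c <= t <= d -> `|g t| <= W t) -> (forall t, c <= t <= d -> W c <= W t) ->
    `|proj k K c d g y| <= C * ((d - c)^-1 * I1 c d W)).
Proof.
have [C C1 HC] := @dual_bound R k; exists C => //; split.
  move=> K c d g M y cd cg ycd gM; apply: (proj_le_dof cd ycd HC).
    by apply: le_trans (normr_ge0 _) (gM c _); rewrite lexx ltW.
  by move=> m mk; exact: dof_le.
move=> K c d g W y KN cd cg cW ycd gW Wc; apply: (proj_le_dof cd ycd HC).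
  rewrite mulr_ge0 ?invr_ge0 ?subr_ge0 ?(ltW cd)// I1_ge0// => t tcd.
  exact: le_trans (normr_ge0 _) (gW t tcd).
by move=> m mk; exact: dof_le_avg.
Qed.

(** The Bramble-Hilbert argument: the projection reproduces the approximating
    polynomial. *)
Lemma projection_error (C : R) K (f : nat -> R -> R) c d M : 0 <= C -> c < d ->
  (forall (g : R -> R) M y, continuous g -> c <= y <= d ->
    (forall t, c <= t <= d -> `|g t| <= M) -> `|proj k K c d g y| <= C * M) ->
  (forall m, (m <= k.+1)%N -> continuous (f m)) ->
  (forall m x, (m < k.+1)%N -> c < x < d -> is_derive x 1 (f m) (f m.+1 x)) ->
  (forall x, c <= x <= d -> `|f k.+1 x| <= M) ->
  forall x, c <= x <= d -> `|f 0%N x - proj k K c d (f 0%N) x| <= (1 + C) * (M * (d - c) ^+ k.+1).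
Proof.
move=> C0 cd HC cf df fM x xcd.
have [q sq qf] := poly_approx cd cf df fM.
have cf0 : continuous (f 0%N) by apply: cf.
have cq : continuous (horner q) by exact: cont_horner.
have -> : f 0%N x - proj k K c d (f 0%N) x =
   (f 0%N x - q.[x]) - proj k K c d (fun t => f 0%N t - q.[t]) x.
  by rewrite projB// [X in _ - (_ - X)](_ : _ = q.[x]) ?proj_id//; ring.
apply: (le_trans (ler_normB _ _)); rewrite mulrDl mul1r; apply: lerD; first exact: qf.
apply: HC => //; apply: cont1D => //; exact: cont1N.
Qed.

Lemma evZ e (C : 'M[R]_k.+1) x y : ev (e *: C) x y = e * ev C x y.
Proof.
rewrite /ev mulr_sumr; apply: eq_bigr => r _; rewrite mulr_sumr; apply: eq_bigr => s _.
by rewrite mxE !mulrA.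
Qed.

Lemma evD (C D : 'M[R]_k.+1) x y : ev (C + D) x y = ev C x y + ev D x y.
Proof.
rewrite /ev -big_split; apply: eq_bigr => r _; rewrite -big_split; apply: eq_bigr => s _.
by rewrite !mxE !mulrDl.
Qed.

Lemma ev_sum (I : Type) (r : seq I) (F : I -> 'M[R]_k.+1) x y :
  ev (\sum_(i <- r) F i) x y = \sum_(i <- r) ev (F i) x y.
Proof.
elim: r => [|i r IH]; first by rewrite !big_nil ev0.
by rewrite !big_cons -IH evD.
Qed.

Lemma proj_matrix K K' a b c d (F : R -> R -> R) : cont2 F -> exists C : 'M[R]_k.+1,
  forall x y, ev C x y = proj k K a b (fun s => proj k K' c d (F s) y) x.
Proof.
move=> cF.
have HK K0 e g : exists Q : 'I_k.+1 -> {poly R}, forall m, (size (Q m) <= k.+1)%N /\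
    forall y, (Q m).[y] = (dual K0 m).[(y - e) / (g - e)].
  pose P (m : 'I_k.+1) (q : {poly R}) := (size q <= k.+1)%N /\ forall y, q.[y] = (dual K0 m).[(y - e) / (g - e)].
  have ex (m : 'I_k.+1) : exists q, P m q.
    have [q sq qE] := scaled_poly (dual K0 m) e g.
    by exists q; split => //; exact: leq_trans sq (size_dual _ _).
  by exists (fun m => projT1 (cid (ex m))) => m; case: (cid (ex m)).
have [Q HQ] := HK K a b; have [Q' HQ'] := HK K' c d.
pose D (l m : 'I_k.+1) := dof k K a b l (fun s => dof k K' c d m (F s)).
pose M (l m : 'I_k.+1) : 'M[R]_k.+1 := \matrix_(r, s) ((Q l)`_r * (Q' m)`_s).
have ME l m x y : ev (M l m) x y = (Q l).[x] * (Q' m).[y].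
  rewrite (horner_coef_wide _ (HQ l).1) (horner_coef_wide _ (HQ' m).1) mulr_suml /ev.
  apply: eq_bigr => r _; rewrite mulr_sumr; apply: eq_bigr => s _.
  by rewrite mxE; ring.
exists (\sum_(l < k.+1) \sum_(m < k.+1) D l m *: M l m) => x y.
rewrite ev_sum /proj; apply: eq_bigr => l _.
rewrite ev_sum dof_sum; last by move=> m; exact: cont_dof.
rewrite mulr_suml; apply: eq_bigr => m _.
by rewrite evZ ME (HQ l).2 (HQ' m).2 /D; ring.
Qed.

(** On each line the y-section of a test function has degree at most k, so the
    L2 projection in y is not seen and the one in x has the right moments and
    interpolates. *)
Lemma tensor_radau (X : nat -> R) i j (F : R -> R -> R) (Z : 'M[R]_k.+1) :
  X i < X i.+1 -> X j < X j.+1 -> cont2 F ->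
  (forall x y, ev Z x y = proj k Radau_left (X i) (X i.+1)
     (fun s => proj k Orthogonal (X j) (X j.+1) (F s) y) x) ->
  (forall C : 'M[R]_k.+1,
     I2 (X i) (X i.+1) (X j) (X j.+1) (fun x y => ev Z x y * evx C x y)
     = I2 (X i) (X i.+1) (X j) (X j.+1) (fun x y => F x y * evx C x y)) /\
  (forall q : {poly R}, (size q <= k.+1)%N ->
     I1 (X j) (X j.+1) (fun y => ev Z (X i) y * q.[y])
     = I1 (X j) (X j.+1) (fun y => F (X i) y * q.[y])).
Proof.
move=> hi hj cF HZ.
pose Py x y := proj k Orthogonal (X j) (X j.+1) (F x) y.
have cP : cont2 Py by exact: cont2_proj.
split=> [C|q sq].
  transitivity (I2 (X i) (X i.+1) (X j) (X j.+1) (fun x y => Py x y * evx C x y)).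
    rewrite I2_swap; last by ct.
    rewrite [RHS]I2_swap; last by ct.
    apply: eq_I1 => y _.
    transitivity (I1 (X i) (X i.+1) (fun x => proj k Radau_left (X i) (X i.+1) (Py ^~ y) x * ((polx C y)^`()).[x])).
      by apply: eq_I1 => x _; rewrite HZ evxE.
    rewrite proj_moment//; [|ct|exact: size_dpolx].
    by apply: eq_I1 => x _; rewrite evxE.
  apply: eq_I1 => x _; have [q sq qE] := evx_poly C x.
  transitivity (I1 (X j) (X j.+1) (fun y => Py x y * q.[y])).
    by apply: eq_I1 => y _; rewrite qE.
  rewrite proj_moment//; last by ct.
  by apply: eq_I1 => y _; rewrite qE.
transitivity (I1 (X j) (X j.+1) (fun y => Py (X i) y * q.[y])).
  by apply: eq_I1 => y _; rewrite HZ proj_left.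
by rewrite proj_moment//; ct.
Qed.

End Approximation.

(** * The mesh-generating functions *)

Section Mesh.
Context {R : realType}.
Implicit Types (M : mesh_type) (N i : nat) (eps t x : R).

Lemma ln4_ge1 N : (4 <= N)%N -> 1 <= ln N%:R :> R.
Proof.
move=> N4.
have h : ln (2%:R^-1) <= - 2%:R^-1 :> R.
  have := @le_ln1Dx R (- 2%:R^-1); have -> : 1 + - 2%:R^-1 = 2%:R^-1 :> R by field.
  by apply; lra.
have h2 : 1 <= ln 4%:R :> R.
  have -> : 4%:R = (2%:R^-1 * 2%:R^-1)^-1 :> R by field.
  rewrite lnV ?posrE ?mulr_gt0 ?invr_gt0// lnM ?posrE ?invr_gt0//; lra.
apply: (le_trans h2); rewrite ler_ln ?posrE ?ltr0n ?ler_nat//; exact: (leq_trans _ N4).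
Qed.

(** The value of max_dpsi. For the BS- and B-meshes psi is affine. *)
Definition slope M N eps : R :=
  match M with
  | S_mesh => 2%:R * ln N%:R
  | BS_mesh => 2%:R * (1 - N%:R^-1)
  | B_mesh => 2%:R * (1 - eps)
  end.

Lemma sup_eqP (A : set R) x : A x -> (forall y, A y -> y <= x) -> sup A = x.
Proof.
move=> Ax ub; apply/eqP; rewrite eq_le; apply/andP; split.
  by apply: ge_sup; [exists x|].
by apply: ub_le_sup => //; exists x.
Qed.

Section MeshN.
Variables (N : nat) (eps : R).
Hypothesis N4 : (4 <= N)%N.
Hypothesis eps0 : 0 < eps.
Hypothesis epsN : eps <= N%:R^-1.

Let Npos : 0 < N%:R :> R. Proof. by rewrite ltr0n (leq_trans _ N4). Qed.
Let N4R : N%:R^-1 <= 4%:R^-1 :> R.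
Proof. by rewrite lef_pV2 ?posrE// ler_nat. Qed.
Let eps4 : eps <= 4%:R^-1. Proof. exact: le_trans N4R. Qed.

(** The value of psi at 1/2. *)
Definition psi_end M : R := match M with S_mesh => N%:R^-1 | BS_mesh => N%:R^-1 | B_mesh => eps end.

Lemma slope_ge1 M : 1 <= slope M N eps.
Proof.
case: M => /=; [have := ln4_ge1 N4; lra|have := N4R; lra|have := eps4; lra].
Qed.

Lemma lin_pos M t : M <> S_mesh -> 0 <= t <= 2%:R^-1 -> psi_end M <= 1 - slope M N eps * t.
Proof.
move=> MS /andP[t0 t1].
have h : slope M N eps * t <= slope M N eps * 2%:R^-1.
  by rewrite ler_wpM2l// (le_trans _ (slope_ge1 M)).
by apply: le_trans (_ : _ <= 1 - slope M N eps * 2%:R^-1) _; [case: M MS h => //= _ _; lra|lra].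
Qed.

Lemma psi_end_gt0 M : 0 < psi_end M.
Proof. by case: M => //=; rewrite invr_gt0. Qed.

Lemma psiS t : psi S_mesh N eps t = expR (- (slope S_mesh N eps * t)).
Proof. by rewrite /psi /phi /=; congr (expR (- _)); ring. Qed.

Lemma psi_lin M t : M <> S_mesh -> 0 < 1 - slope M N eps * t ->
  psi M N eps t = 1 - slope M N eps * t.
Proof. by case: M => //= _ h; rewrite /psi /phi opprK lnK// posrE. Qed.

Lemma psi_lin_itv M t : M <> S_mesh -> 0 <= t <= 2%:R^-1 ->
  psi M N eps t = 1 - slope M N eps * t.
Proof. by move=> MS t01; rewrite psi_lin// (lt_le_trans (psi_end_gt0 M))// lin_pos. Qed.

Lemma derive_psi M t : 0 <= t <= 2%:R^-1 ->
  `|derive1 (psi M N eps) t| = slope M N eps * (if M is S_mesh then psi M N eps t else 1).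
Proof.
move=> t01; have sl0 : 0 <= slope M N eps := le_trans ler01 (slope_ge1 M).
have MS : M = S_mesh \/ M <> S_mesh by case: M {sl0}; [left|right|right].
case: MS => [->|MS].
  have E : psi S_mesh N eps = (fun t => expR ((- slope S_mesh N eps) * t)).
    by apply/funext => x; rewrite psiS mulNr.
  rewrite E derive1E.
  have D : is_derive t 1 (fun t => expR ((- slope S_mesh N eps) * t)) (expR ((- slope S_mesh N eps) * t) * (- slope S_mesh N eps)).
    have D1 : is_derive t 1 (fun t : R => (- slope S_mesh N eps) * t) (- slope S_mesh N eps).
      have := @is_deriveM _ _ (fun=> - slope S_mesh N eps) id t 1 0 1 (is_derive_cst _ _ _) (is_derive_id _ _).
      by rewrite scaler0 addr0 -[_ *: 1]/(_ * 1) mulr1.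
    have := is_derive1_comp (g := fun t : R => (- slope S_mesh N eps) * t) (is_derive_expR _) D1.
    by apply.
  rewrite (@derive_val _ _ _ _ _ _ _ D) normrM normrN ger0_norm ?expR_ge0//.
  by rewrite ger0_norm ?(le_trans ler01 (slope_ge1 _))// mulrC.
have -> : (if M is S_mesh then psi M N eps t else 1) = 1 by case: M MS {sl0}.
rewrite mulr1 derive1E.
have D : is_derive t 1 (psi M N eps) (- slope M N eps).
  have D1 : is_derive t 1 (fun t : R => 1 - slope M N eps * t) (- slope M N eps).
    have -> : (fun t : R => 1 - slope M N eps * t) = horner (1 - slope M N eps *: 'X).
      by apply/funext => x; rewrite hornerD hornerN hornerZ hornerX hornerC.
    have -> : - slope M N eps = ((1 - slope M N eps *: 'X)^`()).[t].
      by rewrite derivB derivC derivZ derivX sub0r hornerN hornerZ hornerC mulr1.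
    exact: is_derive_horner.
  apply: (is_derive_near _ D1).
  have cn : continuous (fun t : R => 1 - slope M N eps * t).
    by apply: cont1D; [exact: cont1_cst|apply: cont1N; apply: cont1M; [exact: cont1_cst|exact: cont1_id]].
  have pt : 0 < 1 - slope M N eps * t by rewrite (lt_le_trans (psi_end_gt0 M))// lin_pos.
  have : \forall x \near t, 0 < 1 - slope M N eps * x.
    exact: (cn t _ (lt_nbhsr pt)).
  by apply: filterS => x hx; rewrite psi_lin.
by rewrite (@derive_val _ _ _ _ _ _ _ D) normrN ger0_norm.
Qed.

Lemma max_dpsiE M : max_dpsi M N eps = slope M N eps.
Proof.
have sl0 : 0 <= slope M N eps := le_trans ler01 (slope_ge1 M).
apply: sup_eqP.
  have h0 : ((0 : R) <= 0) && ((0 : R) <= 2%:R^-1) by rewrite lexx /=; lra.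
  exists 0; first by rewrite /= in_itv.
  rewrite derive_psi//.
  by case: M {sl0}; rewrite ?mulr1// psiS mulr0 oppr0 expR0 mulr1.
move=> y [t]; rewrite /= in_itv /= => t01 <-; rewrite derive_psi//.
case: M sl0 => sl0; rewrite ?mulr1// -[leRHS]mulr1 ler_wpM2l//.
rewrite psiS -[leRHS]expR0 ler_expR oppr_le0 mulr_ge0//.
by case/andP: t01.
Qed.

Lemma mu_eps_ge1 M : 1 <= mu M N eps / eps.
Proof.
have e0 : eps != 0 by rewrite gt_eqF.
have l1 := ln4_ge1 N4.
case: M => /=; first by rewrite divff.
  by have -> : eps * ln N%:R / eps = ln N%:R by field.
have -> : eps * ln (1 / eps) / eps = ln (1 / eps) by field.
rewrite div1r.
apply: (le_trans l1); rewrite ler_ln ?posrE ?invr_gt0//.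
by rewrite -[leLHS]invrK lef_pV2 ?posrE ?invr_gt0.
Qed.

(** The factor sqrt (mu / eps) is at least 1, so a rate in terms of the slope
    alone implies the one in terms of Mstar. *)
Lemma slope_pow_le_Mstar M k : slope M N eps ^+ k.+1 <= Mstar M N eps k.
Proof.
rewrite /Mstar max_dpsiE ler_peMl ?exprn_ge0 ?(le_trans ler01 (slope_ge1 M))//.
by rewrite -[leLHS]sqrtr1 ler_wsqrtr// mu_eps_ge1.
Qed.

Lemma Mstar_rate_equiv M k :
  Mstar_rate M N eps k <= Mstar M N eps k <= 2%:R ^+ k.+1 * Mstar_rate M N eps k.
Proof.
have e0 : eps != 0 by rewrite gt_eqF.
have l1 := ln4_ge1 N4.
have s1 := slope_ge1 M.
rewrite /Mstar max_dpsiE; case: M s1 => /= s1.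
- rewrite divff// sqrtr1 mul1r exprMn lexx andbT ler_peMl ?exprn_ge0 ?(le_trans ler01 l1)//.
  by rewrite exprn_ege1// ler1n.
- have -> : eps * ln N%:R / eps = ln N%:R by field.
  rewrite [2%:R ^+ _ * _]mulrC; apply/andP; split.
    by rewrite ler_peMr ?sqrtr_ge0// exprn_ege1.
  rewrite ler_wpM2l ?sqrtr_ge0// lerXn2r ?nnegrE ?(le_trans ler01 s1)//.
  have : 0 <= N%:R^-1 :> R by rewrite invr_ge0.
  lra.
- have -> : eps * ln (1 / eps) / eps = ln (1 / eps) by field.
  rewrite [2%:R ^+ _ * _]mulrC; apply/andP; split.
    by rewrite ler_peMr ?sqrtr_ge0// exprn_ege1.
  rewrite ler_wpM2l ?sqrtr_ge0// lerXn2r ?nnegrE ?(le_trans ler01 s1)//.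
  by have := ltW eps0; lra.
Qed.

End MeshN.
End Mesh.

(** * The layer-adapted meshes *)

Section LayerMesh.
Context {R : realType}.

(** The power 1 / sigma of the layer function; at the nodes of the fine part
    it is the value of psi. *)
Definition root_layer (eps alpha sigma x : R) : R := expR (- (alpha * (1 - x) / (sigma * eps))).

(** The properties of the meshes on which the error analysis rests. An element
    is either coarse, and root_layer is of size m / N up to its right end
    point, or its length is O(eps) and length / eps times root_layer is of
    size m / N. *)
Definition layer_mesh (eps alpha sigma m : R) (N : nat) (X : nat -> R) (C0 : R) : Prop :=
  [/\ X 0%N = 0, X N = 1, forall i, (i < N)%N -> X i < X i.+1,
      forall i, (i < N)%N -> X i.+1 - X i <= C0 / N%:R &
      forall i, (i < N)%N ->
        root_layer eps alpha sigma (X i.+1) <= C0 * (m / N%:R) \/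
        (X i.+1 - X i <= C0 * eps /\
         (X i.+1 - X i) / eps * root_layer eps alpha sigma (X i.+1) <= C0 * (m / N%:R))].

Variables (M : mesh_type) (n : nat) (eps alpha sigma : R).
Let N := (2 * n)%N.
Hypothesis n2 : (2 <= n)%N.
Hypothesis eps0 : 0 < eps.
Hypothesis epsN : eps <= N%:R^-1.
Hypothesis alpha0 : 0 < alpha.
Hypothesis sigma0 : 0 < sigma.
Hypothesis Htau : tau M N eps sigma alpha = sigma * eps / alpha * phi M N eps 2%:R^-1.

Let X := node M N eps sigma alpha.
Let s := sigma * eps / alpha.
Let m := slope M N eps.
Let t i : R := (N - i)%:R / N%:R.

Let N4 : (4 <= N)%N. Proof. by rewrite /N; case: n n2 => [|[|n']] // _; rewrite mul2n !doubleS. Qed.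
Let Npos : 0 < N%:R :> R. Proof. by rewrite ltr0n (leq_trans _ N4). Qed.
Let nN : N./2 = n. Proof. by rewrite /N mul2n doubleK. Qed.
Let m1 : 1 <= m. Proof. exact: slope_ge1. Qed.
Let s0 : 0 < s. Proof. by rewrite /s divr_gt0// mulr_gt0. Qed.
Let psi1 : psi M N eps 2%:R^-1 <= N%:R^-1.
Proof.
have h0 : ((0 : R) <= 2%:R^-1) && ((2%:R^-1 : R) <= 2%:R^-1) by rewrite lexx andbT; lra.
have MS : M = S_mesh \/ M <> S_mesh by case: (M); [left|right|right].
case: MS => [->|MS].
  rewrite psiS /=; have -> : 2%:R * ln N%:R * 2%:R^-1 = ln N%:R :> R by field.
  by rewrite expRN lnK// posrE.
rewrite psi_lin_itv//; move: MS epsN; rewrite /m; case: (M) => //= _ h; lra.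
Qed.

Let phi_half_ge0 : 0 <= phi M N eps 2%:R^-1.
Proof.
have h : psi M N eps 2%:R^-1 <= 1.
  by apply: (le_trans psi1); rewrite invf_le1// ler1n (leq_trans _ N4).
by move: h; rewrite /psi -[leRHS]expR0 ler_expR oppr_le0.
Qed.

Let tau_le : s * phi M N eps 2%:R^-1 <= 2%:R^-1.
Proof. by rewrite /s -Htau /tau ge_min lexx. Qed.

Lemma t_bounds i : (n <= i <= N)%N -> ((0 : R) <= t i) && (t i <= 2%:R^-1).
Proof.
move=> /andP[ni iN]; apply/andP; split; first by rewrite divr_ge0// ler0n.
rewrite /t ler_pdivrMr// natrB// /N natrM.
have : n%:R <= i%:R :> R by rewrite ler_nat.
lra.
Qed.

Lemma nodeE i : (n <= i <= N)%N -> X i = 1 - s * phi M N eps (t i).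
Proof.
move=> /andP[ni iN]; rewrite /X /node nN.
have [h|h] := leqP i n; last by [].
have -> : i = n by apply/eqP; rewrite eqn_leq h ni.
have n0 : n%:R != 0 :> R by rewrite pnatr_eq0; case: (n) n2.
have -> : t n = 2%:R^-1.
  rewrite /t; have -> : (N - n)%N = n by rewrite /N mul2n -addnn addnK.
  by rewrite /N natrM invfM mulrCA mulfV// mulr1.
rewrite Htau -/s /N natrM.
move: (s * _) (n%:R : R) n0 => z w w0; by field.
Qed.

Lemma coarse_nodeE i : (i <= n)%N -> X i = 2%:R * (1 - s * phi M N eps 2%:R^-1) * i%:R / N%:R.
Proof. by move=> h; rewrite /X /node nN h Htau. Qed.

Lemma root_layerE i : (n <= i <= N)%N -> root_layer eps alpha sigma (X i) = psi M N eps (t i).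
Proof.
move=> h; rewrite /root_layer nodeE// /psi; congr (expR (- _)).
rewrite /s; field.
by rewrite !gt_eqF.
Qed.

Lemma tS i : (i < N)%N -> t i = t i.+1 + N%:R^-1.
Proof.
move=> iN; rewrite /t subnS -{1}(prednK (n := N - i)) ?subn_gt0//.
by rewrite -addn1 natrD mulrDl div1r.
Qed.

Lemma psi_gt0 x : 0 < psi M N eps x. Proof. exact: expR_gt0. Qed.

Lemma phiE x : phi M N eps x = - ln (psi M N eps x).
Proof. by rewrite /psi expRK opprK. Qed.

(** On the S-mesh phi is linear. On the other meshes psi is affine and phi = -
    ln psi is compared with its tangent; away from the transition point psi (t
    i) >= m / N, which bounds the ratio of consecutive values of psi. *)
Lemma phi_step i : (n <= i < N)%N ->
  [/\ 0 < phi M N eps (t i) - phi M N eps (t i.+1),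
      s * (phi M N eps (t i) - phi M N eps (t i.+1)) <= (1 + 2%:R * sigma / alpha) / N%:R &
      (n < i)%N -> phi M N eps (t i) - phi M N eps (t i.+1) <= 2%:R /\
      (phi M N eps (t i) - phi M N eps (t i.+1)) * psi M N eps (t i.+1) <= 2%:R * (m / N%:R)].
Proof.
move=> /andP[ni iN].
have tb := t_bounds (_ : (n <= i <= N)%N); rewrite ni (ltnW iN) in tb; have {}tb := tb isT.
have tb' := t_bounds (_ : (n <= i.+1 <= N)%N); rewrite (leq_trans ni (leqnSn i)) iN in tb'; have {}tb' := tb' isT.
have tE := tS iN.
have mN : 0 < m / N%:R by rewrite divr_gt0// (lt_le_trans ltr01 m1).
have MS : M = S_mesh \/ M <> S_mesh by case: (M); [left|right|right].
case: MS => [MS|MS].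
  have E : phi M N eps (t i) - phi M N eps (t i.+1) = m / N%:R.
    by rewrite /m /phi MS tE /=; ring.
  have lN : ln N%:R <= N%:R :> R.
    have h1 : -1 < N%:R - 1 :> R by have h := Npos; lra.
    have := le_ln1Dx h1; rewrite addrC subrK; lra.
  have mN2 : m / N%:R <= 2%:R.
    by rewrite ler_pdivrMr// /m MS /=; lra.
  rewrite E; split => //.
  - have -> : s * (m / N%:R) = 2%:R * (s * phi M N eps 2%:R^-1) / N%:R.
      by rewrite /phi /m MS /=; field; rewrite gt_eqF.
    rewrite ler_wpM2r ?invr_ge0 ?(ltW Npos)//.
    have h := tau_le; have h2 : 0 <= 2%:R * sigma / alpha by rewrite divr_ge0 ?mulr_ge0 ?(ltW sigma0) ?(ltW alpha0).
    by apply: (@le_trans _ _ 1); [lra|rewrite lerDl].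
  - move=> _; split => //.
    have p1 : psi M N eps (t i.+1) <= 1.
      rewrite MS psiS -[leRHS]expR0 ler_expR oppr_le0 mulr_ge0//.
        by have := m1; rewrite /m MS; lra.
      by case/andP: tb'.
    apply: (@le_trans _ _ (m / N%:R * 1)); first by rewrite ler_wpM2l// ltW.
    lra.
have P := psi_lin_itv N4 eps0 epsN MS tb.
have P' := psi_lin_itv N4 eps0 epsN MS tb'.
have pe := lin_pos N4 epsN MS tb; rewrite -P in pe.
have pe0 : 0 < psi_end N eps M by exact: psi_end_gt0.
have diff : psi M N eps (t i.+1) = psi M N eps (t i) + m / N%:R.
  by rewrite P P' tE /m; ring.
have p0 := psi_gt0 (t i).
have E : phi M N eps (t i) - phi M N eps (t i.+1) = ln (1 + (m / N%:R) / psi M N eps (t i)).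
  rewrite !phiE opprK addrC -ln_div ?posrE ?psi_gt0// diff mulrDl divff ?gt_eqF//.
have r0 : 0 < (m / N%:R) / psi M N eps (t i) by rewrite divr_gt0.
have lnle : ln (1 + (m / N%:R) / psi M N eps (t i)) <= (m / N%:R) / psi M N eps (t i).
  by apply: le_ln1Dx; lra.
have epsle : eps <= psi M N eps (t i).
  by apply: le_trans pe; move: epsN; case: (M) MS.
have b1 : (m / N%:R) / psi M N eps (t i) <= m / (N%:R * eps).
  by rewrite invfM mulrA ler_wpM2l ?(ltW mN)// lef_pV2.
have m2 : m <= 2%:R.
  rewrite /m; move: MS; case: (M) => //= _.
    have h : 0 <= N%:R^-1 :> R by rewrite invr_ge0 ltW.
    lra.
  by have := ltW eps0; lra.
rewrite E; split.
- by apply: ln_gt0; rewrite ltrDl.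
- apply: (@le_trans _ _ (s * (m / (N%:R * eps)))).
    by rewrite ler_wpM2l ?(ltW s0)// (le_trans lnle).
  have -> : s * (m / (N%:R * eps)) = (sigma / alpha * m) / N%:R.
    by rewrite /s; field; rewrite !gt_eqF.
  rewrite ler_wpM2r ?invr_ge0 ?(ltW Npos)//.
  have h : 0 <= sigma / alpha by rewrite divr_ge0 ?(ltW sigma0) ?(ltW alpha0).
  have : sigma / alpha * m <= sigma / alpha * 2%:R by rewrite ler_wpM2l.
  have -> : 2%:R * sigma / alpha = sigma / alpha * 2%:R by ring.
  lra.
- move=> ni'.
  have tb2 : t i + N%:R^-1 <= 2%:R^-1.
    rewrite /t -[X in _ + X]mul1r -mulrDl ler_pdivrMr// natrB ?(ltnW iN)// /N natrM.
    have : n.+1%:R <= i%:R :> R by rewrite ler_nat.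
    by rewrite -addn1 natrD; lra.
  (* At t i + 1 / N the affine function psi is still positive. *)
  have pm : m / N%:R <= psi M N eps (t i).
    have hb : ((0 : R) <= t i + N%:R^-1) && (t i + N%:R^-1 <= 2%:R^-1).
      by rewrite tb2 andbT addr_ge0 ?invr_ge0 ?(ltW Npos)//; case/andP: tb.
    have := lin_pos N4 epsN MS hb; rewrite P -/m => h; have := pe0; lra.
  have r1 : (m / N%:R) / psi M N eps (t i) <= 1 by rewrite ler_pdivrMr// mul1r.
  split; first by apply: (le_trans lnle); lra.
  rewrite diff.
  apply: (@le_trans _ _ ((m / N%:R) / psi M N eps (t i) * (psi M N eps (t i) + m / N%:R))).
    by rewrite ler_wpM2r// addr_ge0 ?(ltW p0) ?(ltW mN).
  have -> : (m / N%:R) / psi M N eps (t i) * (psi M N eps (t i) + m / N%:R) =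
     m / N%:R + (m / N%:R) / psi M N eps (t i) * (m / N%:R).
    by field; rewrite !gt_eqF.
  have : (m / N%:R) / psi M N eps (t i) * (m / N%:R) <= 1 * (m / N%:R) by rewrite ler_wpM2r// ltW.
  lra.
Qed.

(** The elements up to the first one right of the transition point count as
    coarse, since psi is at most a multiple of m / N there; phi_step settles
    the others. In the constant, expR 2 bounds the ratio of consecutive values
    of psi on the S-mesh, where m / N <= 2, and the multiples of sigma / alpha
    come from the scale sigma eps / alpha of the fine part. *)
Lemma node_layer_mesh : layer_mesh eps alpha sigma m N X (10%:R + expR 2%:R + 2%:R * sigma / alpha + 2%:R * (sigma / alpha)).
Proof.
have sa : 0 < sigma / alpha by rewrite divr_gt0.
have sa2 : 2%:R * sigma / alpha = 2%:R * (sigma / alpha) by rewrite mulrA.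
have e2 : 0 < expR 2%:R :> R by exact: expR_gt0.
have mN : 0 < m / N%:R by rewrite divr_gt0// (lt_le_trans ltr01 m1).
have nN' : (n <= N)%N by rewrite /N leq_pmull.
have N2 : N%:R = 2%:R * n%:R :> R by rewrite /N natrM.
have tl := tau_le; have ph := phi_half_ge0.
have tge : 0 <= s * phi M N eps 2%:R^-1 by rewrite mulr_ge0 ?(ltW s0).
have fineS i : (n <= i < N)%N -> X i.+1 - X i = s * (phi M N eps (t i) - phi M N eps (t i.+1)).
  move=> /andP[ni iN]; rewrite !nodeE ?ni ?(ltnW iN) ?iN ?(leq_trans ni)//; ring.
have coarseS i : (i < n)%N -> X i.+1 - X i = 2%:R * (1 - s * phi M N eps 2%:R^-1) / N%:R.
  move=> ni; rewrite !coarse_nodeE ?(ltnW ni)// -addn1 natrD; ring.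
split.
- by rewrite coarse_nodeE// mulr0 mul0r.
- rewrite nodeE ?leqnn ?nN'// /t subnn mul0r.
  have -> : phi M N eps 0 = 0; last by rewrite mulr0 subr0.
  by rewrite /phi; case: (M); rewrite !(mulr0, mul0r) ?subr0 ?ln1 ?oppr0.
- move=> i iN; rewrite -subr_gt0; have [ni|ni] := leqP n i.
    rewrite fineS ?ni// mulr_gt0//.
    have hi : (n <= i < N)%N by rewrite ni iN.
    by have [] := phi_step hi.
  by rewrite coarseS// divr_gt0// mulr_gt0//; lra.
- move=> i iN; have [ni|ni] := leqP n i.
    rewrite fineS ?ni//.
    have hi : (n <= i < N)%N by rewrite ni iN.
    have [_ h _] := phi_step hi.
    apply: (le_trans h); rewrite ler_wpM2r ?invr_ge0 ?(ltW Npos)//; lra.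
  by rewrite coarseS// ler_wpM2r ?invr_ge0 ?(ltW Npos)//; lra.
move=> i iN; have [ni|ni] := ltnP n i.
  right; rewrite fineS ?iN ?(ltnW ni)//.
  have hi : (n <= i < N)%N by rewrite (ltnW ni) iN.
  have [_ _ h] := phi_step hi.
  have {h} [h1 h2] := h ni; split.
    apply: (@le_trans _ _ (s * 2%:R)); first by rewrite ler_wpM2l// ltW.
    have -> : s * 2%:R = 2%:R * (sigma / alpha) * eps by rewrite /s; ring.
    by rewrite ler_wpM2r ?(ltW eps0)//; lra.
  rewrite root_layerE ?iN ?(leq_trans (ltnW ni))//.
  have -> : s * (phi M N eps (t i) - phi M N eps (t i.+1)) / eps * psi M N eps (t i.+1) =
    (sigma / alpha) * ((phi M N eps (t i) - phi M N eps (t i.+1)) * psi M N eps (t i.+1)).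
    by rewrite /s; field; rewrite !gt_eqF.
  apply: (@le_trans _ _ (sigma / alpha * (2%:R * (m / N%:R)))); first by rewrite ler_wpM2l// ltW.
  have -> : sigma / alpha * (2%:R * (m / N%:R)) = 2%:R * (sigma / alpha) * (m / N%:R) by ring.
  by rewrite ler_wpM2r ?(ltW mN)//; lra.
left.
have psi1m : psi M N eps 2%:R^-1 <= m / N%:R.
  by apply: (le_trans psi1); rewrite ler_peMl// invr_ge0 ltW.
have tn : t n = 2%:R^-1.
  rewrite /t; have -> : (N - n)%N = n by rewrite /N mul2n -addnn addnK.
  by rewrite N2 invfM mulrCA mulfV ?mulr1// pnatr_eq0; case: (n) n2.
have mono x y : x <= y -> root_layer eps alpha sigma x <= root_layer eps alpha sigma y.
  move=> xy; rewrite /root_layer ler_expR lerN2 ler_wpM2r ?invr_ge0 ?mulr_ge0 ?(ltW sigma0) ?(ltW eps0)//.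
  by rewrite ler_wpM2l ?(ltW alpha0)// lerB.
have [->|ni'] := eqVneq i n; last first.
  have iltn : (i < n)%N by rewrite ltn_neqAle ni' ni.
  apply: (@le_trans _ _ (root_layer eps alpha sigma (X n))).
    apply: mono; rewrite !coarse_nodeE//.
    rewrite ler_wpM2r ?invr_ge0 ?(ltW Npos)// ler_wpM2l ?ler_nat//; lra.
  rewrite root_layerE ?leqnn ?nN'// tn; apply: (le_trans psi1m).
  by rewrite ler_peMl ?(ltW mN)//; lra.
(* On the first fine element psi starts with psi (1/2) <= 1 / N. *)
have nN1 : (n < N)%N by rewrite /N mul2n -addnn -[X in (X < _)%N]addn0 ltn_add2l (leq_trans _ n2).
rewrite root_layerE ?nN1 ?leqnSn//.
have tE := tS nN1; rewrite tn in tE.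
have tb' := t_bounds (_ : (n <= n.+1 <= N)%N); rewrite leqnSn nN1 in tb'; have {}tb' := tb' isT.
have MS : M = S_mesh \/ M <> S_mesh by case: (M); [left|right|right].
case: MS => [MS|MS].
  have lN : ln N%:R <= N%:R :> R.
    have h1 : -1 < N%:R - 1 :> R by have h := Npos; lra.
    have := le_ln1Dx h1; rewrite addrC subrK; lra.
  have -> : psi M N eps (t n.+1) = psi M N eps 2%:R^-1 * expR (2%:R * ln N%:R / N%:R).
    rewrite MS !psiS -expRD; congr expR; rewrite tE /=; ring.
  apply: (@le_trans _ _ (m / N%:R * expR 2%:R)).
    apply: ler_pM => //; rewrite ?expR_ge0 ?(ltW (psi_gt0 _))// ler_expR ler_pdivrMr//.
    by rewrite ler_wpM2l.
  by rewrite mulrC ler_wpM2r ?(ltW mN)//; lra.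
have h0 : ((0 : R) <= 2%:R^-1) && ((2%:R^-1 : R) <= 2%:R^-1) by rewrite lexx andbT; lra.
have P := psi_lin_itv N4 eps0 epsN MS h0.
have P' := psi_lin_itv N4 eps0 epsN MS tb'.
have -> : psi M N eps (t n.+1) = psi M N eps 2%:R^-1 + m / N%:R.
  by rewrite P P' tE /m; ring.
apply: (@le_trans _ _ (2%:R * (m / N%:R))); first lra.
by rewrite ler_wpM2r ?(ltW mN)//; lra.
Qed.

End LayerMesh.

(** * Projection of layer functions *)

Section LayerError.
Context {R : realType} (k N : nat) (X : nat -> R) (eps alpha sigma m C0 Cp : R).
Hypothesis N0 : (0 < N)%N.
Hypothesis eps0 : 0 < eps.
Hypothesis eps1 : eps <= 1.
Hypothesis alpha0 : 0 < alpha.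
Hypothesis sigmak : k.+2%:R <= sigma.
Hypothesis m1 : 1 <= m.
Hypothesis C00 : 0 <= C0.
Hypothesis Hmesh : layer_mesh eps alpha sigma m N X C0.
Hypothesis Cp1 : 1 <= Cp.
Hypothesis HCp : forall K (c d : R) (g : R -> R) (M y : R), c < d -> continuous g -> c <= y <= d ->
    (forall t, c <= t <= d -> `|g t| <= M) -> `|proj k K c d g y| <= Cp * M.
Hypothesis HCa : forall K c d (g W : R -> R) y, K <> Radau_right -> c < d -> continuous g -> continuous W -> c <= y <= d ->
    (forall t, c <= t <= d -> `|g t| <= W t) -> (forall t, c <= t <= d -> W c <= W t) ->
    `|proj k K c d g y| <= Cp * ((d - c)^-1 * I1 c d W).

Let X0 : X 0 = 0. Proof. by case: Hmesh. Qed.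
Let XN : X N = 1. Proof. by case: Hmesh. Qed.
Let Xinc i : (i < N)%N -> X i < X i.+1. Proof. by case: Hmesh => _ _ h _ _; apply: h. Qed.
Let Xstep i : (i < N)%N -> X i.+1 - X i <= C0 / N%:R. Proof. by case: Hmesh => _ _ _ h _; apply: h. Qed.
Let sigma0 : 0 < sigma. Proof. by apply: lt_le_trans sigmak; rewrite ltr0n. Qed.
Let NR : 0 < N%:R :> R. Proof. by rewrite ltr0n. Qed.

(** In lay = root_layer^(k+1) * wgt the first factor pays for the
    approximation error; wgt has the rate gam * alpha / eps and keeps the
    decay in x. Its exponent is positive because sigma > k + 1. *)
Definition gam := 1 - k.+1%:R / sigma.
Definition delta := (m / N%:R) ^+ k.+1.
Definition lay x := expR (- (alpha * (1 - x) / eps)).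
Definition wgt x := expR (- (gam * alpha * (1 - x) / eps)).
Definition avg i := (X i.+1 - X i)^-1 * I1 (X i) (X i.+1) wgt.
(** The flux errors are bounded by delta * om: eps stands for the regular
    part, wgt and its means over the elements for the layer. *)
Definition om i x := eps + wgt x + avg i.

Lemma gam_gt0 : 0 < gam.
Proof.
rewrite /gam subr_gt0 ltr_pdivrMr// mul1r.
by apply: lt_le_trans sigmak; rewrite ltr_nat.
Qed.

Lemma delta_ge0 : 0 <= delta.
Proof. by rewrite /delta exprn_ge0// divr_ge0 ?(ltW NR)// (le_trans ler01 m1). Qed.

Lemma layE x : lay x = root_layer eps alpha sigma x ^+ k.+1 * wgt x.
Proof.
rewrite /lay /root_layer /wgt -expRM_natl -expRD; congr expR.
rewrite /gam; field.
by rewrite !gt_eqF.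
Qed.

Lemma wgt_ge0 x : 0 <= wgt x. Proof. exact: expR_ge0. Qed.

Lemma wgt_mono x y : x <= y -> wgt x <= wgt y.
Proof.
move=> xy; rewrite /wgt ler_expR lerN2 ler_wpM2r ?invr_ge0 ?(ltW eps0)//.
by rewrite ler_wpM2l ?mulr_ge0 ?(ltW gam_gt0) ?(ltW alpha0)// lerB.
Qed.

Lemma root_mono x y : x <= y -> root_layer eps alpha sigma x <= root_layer eps alpha sigma y.
Proof.
move=> xy; rewrite /root_layer ler_expR lerN2 ler_wpM2r ?invr_ge0 ?mulr_ge0 ?(ltW eps0) ?(ltW sigma0)//.
by rewrite ler_wpM2l ?(ltW alpha0)// lerB.
Qed.

Lemma lay_mono x y : x <= y -> lay x <= lay y.
Proof.
move=> xy; rewrite /lay ler_expR lerN2 ler_wpM2r ?invr_ge0 ?(ltW eps0)//.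
by rewrite ler_wpM2l ?(ltW alpha0)// lerB.
Qed.

Lemma wgt_le1 x : x <= 1 -> wgt x <= 1.
Proof. by move=> /wgt_mono; rewrite {2}/wgt subrr mulr0 mul0r oppr0 expR0. Qed.

Lemma lay_le1 x : x <= 1 -> lay x <= 1.
Proof. by move=> /lay_mono; rewrite {2}/lay subrr mulr0 mul0r oppr0 expR0. Qed.

Lemma root_le1 x : x <= 1 -> root_layer eps alpha sigma x <= 1.
Proof. by move=> /root_mono; rewrite {2}/root_layer subrr mulr0 mul0r oppr0 expR0. Qed.

Lemma lay_le_wgt x : x <= 1 -> lay x <= wgt x.
Proof.
move=> x1; rewrite layE ler_piMl ?wgt_ge0// exprn_ile1 ?expR_ge0 ?root_le1//.
Qed.

Lemma cont_expR : continuous (@expR R).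
Proof. by move=> x; exact: continuous_expR. Qed.

Lemma cont_wgt : continuous wgt.
Proof.
have c : continuous (fun x : R => - (gam * alpha * (1 - x) / eps)).
  apply: cont1N; apply: cont1M; last exact: cont1_cst.
  apply: cont1M; first exact: cont1_cst.
  by apply: cont1D; [exact: cont1_cst|apply: cont1N; exact: cont1_id].
by move=> x; apply: (@continuous_comp _ _ _ _ (@expR R) x); [exact: c|exact: cont_expR].
Qed.

Lemma cont_lay : continuous lay.
Proof.
have c : continuous (fun x : R => - (alpha * (1 - x) / eps)).
  apply: cont1N; apply: cont1M; last exact: cont1_cst.
  apply: cont1M; first exact: cont1_cst.
  by apply: cont1D; [exact: cont1_cst|apply: cont1N; exact: cont1_id].
by move=> x; apply: (@continuous_comp _ _ _ _ (@expR R) x); [exact: c|exact: cont_expR].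
Qed.

Lemma I1_expR (e : R) a b : 0 < e -> a <= b ->
  I1 a b (fun x : R => expR (- (e * (1 - x) / eps))) =
    eps / e * (expR (- (e * (1 - b) / eps)) - expR (- (e * (1 - a) / eps))).
Proof.
move=> e0 ab.
have c : continuous (fun x : R => - (e * (1 - x) / eps)).
  apply: cont1N; apply: cont1M; last exact: cont1_cst.
  apply: cont1M; first exact: cont1_cst.
  by apply: cont1D; [exact: cont1_cst|apply: cont1N; exact: cont1_id].
have ce : continuous (fun x : R => expR (- (e * (1 - x) / eps))).
  by move=> x; apply: (@continuous_comp _ _ _ _ (@expR R) x); [exact: c|exact: cont_expR].
have D (x : R) : a < x < b -> is_derive x 1 (fun x : R => eps / e * expR (- (e * (1 - x) / eps))) (expR (- (e * (1 - x) / eps))).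
  move=> _.
  have D1 : is_derive x 1 (fun x : R => - (e * (1 - x) / eps)) (e / eps).
    have -> : (fun x : R => - (e * (1 - x) / eps)) = horner ((- e / eps) *: (1 - 'X)).
      by apply/funext => y; rewrite hornerZ hornerD hornerN hornerX hornerC; ring.
    have -> : e / eps = (((- e / eps) *: (1 - 'X))^`()).[x].
      by rewrite derivZ derivB derivC derivX sub0r hornerZ hornerN hornerC; ring.
    exact: is_derive_horner.
  have D2 := is_derive1_comp (g := fun x : R => - (e * (1 - x) / eps)) (is_derive_expR _) D1.
  have D3 := is_deriveM (is_derive_cst (eps / e) x 1) D2.
  move: D3; rewrite scaler0 addr0.
  have -> : (cst (eps / e)) x *: (expR (- (e * (1 - x) / eps)) * (e / eps)) = expR (- (e * (1 - x) / eps)).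
    by rewrite /cst -[_ *: _]/(_ * _); field; rewrite !gt_eqF.
  by apply.
have cF : continuous (fun x : R => eps / e * expR (- (e * (1 - x) / eps))).
  by apply: (cont1M (@cont1_cst _ _) ce).
by rewrite (I1_FTC ab ce cF D) [RHS]mulrBr.
Qed.

Lemma avg_ge0 i : (i < N)%N -> 0 <= avg i.
Proof.
move=> iN; rewrite /avg mulr_ge0 ?invr_ge0 ?subr_ge0 ?(ltW (Xinc iN))// I1_ge0// => x _; exact: wgt_ge0.
Qed.

Lemma avg_le1 i : (i < N)%N -> avg i <= 1.
Proof.
move=> iN; have h : 0 < X i.+1 - X i by rewrite subr_gt0 Xinc.
rewrite /avg ler_pdivrMl// mulr1 -[leRHS]mul1r -I1_cst ?(ltW (Xinc iN))//.
apply: le_I1; [exact: cont_wgt|exact: cont1_cst|] => x /andP[_ x1].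
by apply: wgt_le1; rewrite (le_trans x1)// (X_le1 XN Xinc).
Qed.

Lemma avg_sum : \sum_(i < N) (X i.+1 - X i) * avg i <= eps / (gam * alpha).
Proof.
have ga0 : 0 < gam * alpha by rewrite mulr_gt0// gam_gt0.
rewrite (eq_bigr (fun i : 'I_N => eps / (gam * alpha) * (wgt (X i.+1) - wgt (X i)))); last first.
  move=> i _; have h : X i.+1 - X i != 0 by rewrite subr_eq0 gt_eqF// Xinc.
  by rewrite /avg mulVKf// (I1_expR ga0 (ltW (Xinc (ltn_ord i)))).
rewrite -mulr_sumr -(big_mkord xpredT (fun i => wgt (X i.+1) - wgt (X i))) telescope_sumr//.
rewrite -[leRHS]mulr1 ler_wpM2l ?divr_ge0 ?(ltW eps0) ?(ltW ga0)//.
have := wgt_ge0 (X 0); have := wgt_le1 (x := X N); rewrite XN lexx => /(_ isT); lra.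
Qed.

Lemma cont_om i : continuous (om i).
Proof. by have cw := @cont_wgt; rewrite /om; ct. Qed.

Lemma om_ge_eps i x : (i < N)%N -> eps <= om i x.
Proof. by move=> iN; have := wgt_ge0 x; have := avg_ge0 iN; rewrite /om; lra. Qed.

Lemma om_le3 i x : (i < N)%N -> x <= 1 -> om i x <= 3%:R.
Proof. by move=> iN x1; have := wgt_le1 x1; have := avg_le1 iN; have := eps1; rewrite /om; lra. Qed.

(** om is at most 3 and its integral is O(eps), hence so is that of its
    square. *)
Lemma om_sq_sum : eps^-1 * \sum_(i < N) I1 (X i) (X i.+1) (fun x => om i x ^+ 2) <=
  3%:R * (1 + 2%:R / (gam * alpha)).
Proof.
have ga0 : 0 < gam * alpha by rewrite mulr_gt0// gam_gt0.
have cw := @cont_wgt.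
have H (i : 'I_N) : I1 (X i) (X i.+1) (fun x => om i x ^+ 2) <=
    3%:R * (eps * (X i.+1 - X i) + 2%:R * ((X i.+1 - X i) * avg i)).
  have iN := ltn_ord i.
  have hN : X i.+1 - X i != 0 by rewrite subr_eq0 gt_eqF// Xinc.
  have co := @cont_om i.
  have c2 : continuous (fun x => om i x ^+ 2) by exact: cont1X.
  apply: (@le_trans _ _ (I1 (X i) (X i.+1) (fun x => 3%:R * om i x))).
    apply: le_I1 => //; first by apply: cont1M => //; exact: cont1_cst.
    move=> x /andP[_ x1]; have x11 : x <= 1 by rewrite (le_trans x1)// (X_le1 XN Xinc).
    rewrite expr2 ler_wpM2r ?om_le3//.
    by apply: le_trans (om_ge_eps x iN); exact: ltW.
  rewrite I1Z// ler_wpM2l//.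
  have -> : I1 (X i) (X i.+1) (om i) = eps * (X i.+1 - X i) + I1 (X i) (X i.+1) wgt + avg i * (X i.+1 - X i).
    rewrite -!(I1_cst _ (ltW (Xinc iN))) -I1D; [|ct|ct]; rewrite -I1D; [|ct|ct].
    by [].
  have -> : I1 (X i) (X i.+1) wgt = (X i.+1 - X i) * avg i by rewrite /avg mulVKf.
  by rewrite [avg i * _]mulrC; lra.
have : \sum_(i < N) I1 (X i) (X i.+1) (fun x => om i x ^+ 2) <=
    \sum_(i < N) 3%:R * (eps * (X i.+1 - X i) + 2%:R * ((X i.+1 - X i) * avg i)).
  by apply: ler_sum => i _; exact: H.
rewrite -mulr_sumr big_split /= -mulr_sumr -mulr_sumr.
rewrite -(big_mkord xpredT (fun i => X i.+1 - X i)) telescope_sumr// XN X0 subr0 mulr1 => h.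
rewrite ler_pdivrMl//; apply: (le_trans h).
have := avg_sum; move: (\sum_(i < N) _) => S hS.
have -> : eps * (3%:R * (1 + 2%:R / (gam * alpha))) = 3%:R * (eps + 2%:R * (eps / (gam * alpha))) by ring.
lra.
Qed.

Definition CL := (1 + Cp) * C0 ^+ k.+1 * expR (gam * alpha * C0).

Let Cp0 : 0 <= Cp. Proof. exact: le_trans Cp1. Qed.
Let e1 : 1 <= expR (gam * alpha * C0).
Proof. by rewrite -[leLHS]expR0 ler_expR !mulr_ge0 ?(ltW gam_gt0) ?(ltW alpha0). Qed.
Let C0k : 0 <= C0 ^+ k.+1. Proof. exact: exprn_ge0. Qed.

Lemma CL_ge0 : 0 <= CL.
Proof. by rewrite /CL !mulr_ge0 ?expR_ge0// addr_ge0. Qed.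

Lemma CL_coarse : (1 + Cp) * C0 ^+ k.+1 <= CL.
Proof. by rewrite /CL ler_peMr// mulr_ge0// addr_ge0. Qed.

Section Chain.
Variables (f : nat -> R -> R) (A : R).
Hypothesis A0 : 0 <= A.
Hypothesis cf : forall j, (j <= k.+1)%N -> continuous (f j).
Hypothesis df : forall j (x : R), (j < k.+1)%N -> 0 < x < 1 -> is_derive x 1 (f j) (f j.+1 x).

Let dfi i : (i < N)%N -> forall j (x : R), (j < k.+1)%N -> X i < x < X i.+1 -> is_derive x 1 (f j) (f j.+1 x).
Proof.
move=> iN j x jk /andP[h1 h2]; apply: df => //.
rewrite (le_lt_trans (X_ge0 X0 Xinc (ltnW iN)) h1) /=.
exact: lt_le_trans h2 (X_le1 XN Xinc iN).
Qed.
Let x01 i x : (i < N)%N -> X i <= x <= X i.+1 -> 0 <= x <= 1.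
Proof.
move=> iN /andP[h1 h2]; rewrite (le_trans (X_ge0 X0 Xinc (ltnW iN)) h1).
by rewrite (le_trans h2)// (X_le1 XN Xinc).
Qed.

Lemma regular_error K i x : (forall x, 0 <= x <= 1 -> `|f k.+1 x| <= A) ->
  (i < N)%N -> X i <= x <= X i.+1 ->
  `|f 0%N x - proj k K (X i) (X i.+1) (f 0%N) x| <= CL * A * delta.
Proof.
move=> fA iN hx.
have h0 : 0 <= X i.+1 - X i by rewrite subr_ge0 ltW// Xinc.
have H := @projection_error R k Cp K f (X i) (X i.+1) A Cp0 (Xinc iN)
  (fun g M y cg hy hg => HCp K (Xinc iN) cg hy hg) cf (dfi iN) (fun x hx => fA x (x01 iN hx)) x hx.
apply: (le_trans H).
have h1 : (X i.+1 - X i) ^+ k.+1 <= C0 ^+ k.+1 * delta.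
  rewrite /delta -exprMn lerXn2r ?nnegrE// ?mulr_ge0 ?invr_ge0 ?(ltW NR) ?(le_trans ler01 m1)//.
  apply: (le_trans (Xstep iN)); rewrite ler_wpM2l// ler_peMl ?invr_ge0 ?(ltW NR)//.
apply: (@le_trans _ _ ((1 + Cp) * (A * (C0 ^+ k.+1 * delta)))).
  by rewrite ler_wpM2l ?addr_ge0// ler_wpM2l.
have -> : (1 + Cp) * (A * (C0 ^+ k.+1 * delta)) = (1 + Cp) * C0 ^+ k.+1 * (A * delta) by ring.
by rewrite -[CL * A * _]mulrA ler_wpM2r ?mulr_ge0 ?delta_ge0// CL_coarse.
Qed.

Hypothesis f0A : forall x, 0 <= x <= 1 -> `|f 0%N x| <= A * lay x.
Hypothesis fkA : forall x, 0 <= x <= 1 -> `|f k.+1 x| <= A * eps ^- k.+1 * lay x.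

Let fine_error K i x : (i < N)%N -> X i <= x <= X i.+1 ->
  X i.+1 - X i <= C0 * eps ->
  (X i.+1 - X i) / eps * root_layer eps alpha sigma (X i.+1) <= C0 * (m / N%:R) ->
  `|f 0%N x - proj k K (X i) (X i.+1) (f 0%N) x| <= CL * A * delta * wgt x.
Proof.
move=> iN hx hle hr.
have h0 : 0 <= X i.+1 - X i by rewrite subr_ge0 ltW// Xinc.
have fM t : X i <= t <= X i.+1 -> `|f k.+1 t| <= A * eps ^- k.+1 * lay (X i.+1).
  move=> ht; apply: (le_trans (fkA (x01 iN ht))).
  by rewrite ler_wpM2l ?mulr_ge0 ?invr_ge0 ?exprn_ge0 ?(ltW eps0)// lay_mono//; case/andP: ht.
have H := @projection_error R k Cp K f (X i) (X i.+1) _ Cp0 (Xinc iN)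
  (fun g M y cg hy hg => HCp K (Xinc iN) cg hy hg) cf (dfi iN) fM x hx.
apply: (le_trans H).
have -> : A * eps ^- k.+1 * lay (X i.+1) * (X i.+1 - X i) ^+ k.+1 =
  A * (((X i.+1 - X i) / eps * root_layer eps alpha sigma (X i.+1)) ^+ k.+1 * wgt (X i.+1)).
  by rewrite layE !exprMn exprVn; ring.
have h1 : ((X i.+1 - X i) / eps * root_layer eps alpha sigma (X i.+1)) ^+ k.+1 <= C0 ^+ k.+1 * delta.
  rewrite /delta -exprMn lerXn2r ?nnegrE//.
    by rewrite mulr_ge0 ?expR_ge0// divr_ge0// ltW.
  by rewrite !mulr_ge0 ?invr_ge0 ?(ltW NR) ?(le_trans ler01 m1).
(* On an element of length O(eps) wgt varies by a bounded factor. *)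
have h2 : wgt (X i.+1) <= expR (gam * alpha * C0) * wgt x.
  rewrite /wgt -expRD ler_expR -subr_ge0.
  have -> : gam * alpha * C0 + - (gam * alpha * (1 - x) / eps) - - (gam * alpha * (1 - X i.+1) / eps)
     = gam * alpha * ((C0 * eps - (X i.+1 - x)) / eps) by field; rewrite gt_eqF.
  apply: mulr_ge0; first by rewrite mulr_ge0 ?(ltW gam_gt0) ?(ltW alpha0).
  apply: divr_ge0; last exact: ltW.
  rewrite subr_ge0.
  by apply: le_trans hle; rewrite lerB//; case/andP: hx.
apply: (@le_trans _ _ ((1 + Cp) * (A * (C0 ^+ k.+1 * delta * (expR (gam * alpha * C0) * wgt x))))).
  rewrite ler_wpM2l ?addr_ge0// ler_wpM2l//; apply: ler_pM => //; rewrite ?wgt_ge0//.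
  by rewrite exprn_ge0// mulr_ge0 ?expR_ge0// divr_ge0// ltW.
by rewrite le_eqVlt; apply/orP; left; apply/eqP; rewrite /CL; ring.
Qed.

Let coarse_val i x : (i < N)%N -> X i <= x <= X i.+1 ->
  root_layer eps alpha sigma (X i.+1) <= C0 * (m / N%:R) ->
  `|f 0%N x| <= A * C0 ^+ k.+1 * delta * wgt x.
Proof.
move=> iN hx hr; apply: (le_trans (f0A (x01 iN hx))).
have -> : A * C0 ^+ k.+1 * delta * wgt x = A * (C0 ^+ k.+1 * delta * wgt x) by ring.
rewrite ler_wpM2l// layE ler_wpM2r ?wgt_ge0// /delta -exprMn.
have hx1 : root_layer eps alpha sigma x <= C0 * (m / N%:R).
  by apply: le_trans hr; apply: root_mono; case/andP: hx.
by rewrite lerXn2r ?nnegrE ?expR_ge0// (le_trans _ hx1)// expR_ge0.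
Qed.

Let cAd : 0 <= A * C0 ^+ k.+1 * delta.
Proof. by rewrite !mulr_ge0// delta_ge0. Qed.

(** On a coarse element the function and its projection are small by
    themselves; on a fine one the derivative of order k + 1 is used. *)
Lemma layer_error K i x : (i < N)%N -> X i <= x <= X i.+1 ->
  `|f 0%N x - proj k K (X i) (X i.+1) (f 0%N) x| <= CL * A * delta.
Proof.
move=> iN hx; have [_ _ _ _ /(_ i iN) [hr|[hle hr]]] := Hmesh; last first.
  apply: (le_trans (fine_error K iN hx hle hr)).
  have w1 : wgt x <= 1 by apply: wgt_le1; case/andP: (x01 iN hx).
  exact: ler_piMr (mulr_ge0 (mulr_ge0 CL_ge0 A0) delta_ge0) w1.
have fM t : X i <= t <= X i.+1 -> `|f 0%N t| <= A * C0 ^+ k.+1 * delta.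
  move=> ht; apply: (le_trans (coarse_val iN ht hr)).
  by apply: ler_piMr => //; apply: wgt_le1; case/andP: (x01 iN ht).
apply: (le_trans (ler_normB _ _)).
apply: (@le_trans _ _ (A * C0 ^+ k.+1 * delta + Cp * (A * C0 ^+ k.+1 * delta))).
  by apply: lerD; [exact: fM|exact: HCp (Xinc iN) (cf (leq0n _)) hx fM].
have -> : A * C0 ^+ k.+1 * delta + Cp * (A * C0 ^+ k.+1 * delta) =
  (1 + Cp) * C0 ^+ k.+1 * (A * delta) by ring.
by rewrite -[CL * A * _]mulrA ler_wpM2r ?mulr_ge0 ?delta_ge0// CL_coarse.
Qed.

(** The decay in x is kept. On a coarse element the projection is bounded by
    the mean of the layer function, which brings in the means of wgt. *)
Lemma layer_error_weighted K i x : K <> Radau_right -> (i < N)%N -> X i <= x <= X i.+1 ->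
  `|f 0%N x - proj k K (X i) (X i.+1) (f 0%N) x| <= CL * A * delta * (wgt x + avg i).
Proof.
move=> KN iN hx; have [_ _ _ _ /(_ i iN) [hr|[hle hr]]] := Hmesh; last first.
  apply: (le_trans (fine_error K iN hx hle hr)).
  by rewrite ler_wpM2l ?lerDl ?avg_ge0//; exact: mulr_ge0 (mulr_ge0 CL_ge0 A0) delta_ge0.
apply: (le_trans (ler_normB _ _)).
have cW : continuous (fun t => A * C0 ^+ k.+1 * delta * wgt t).
  by apply: cont1M; [exact: cont1_cst|exact: cont_wgt].
have P : `|proj k K (X i) (X i.+1) (f 0%N) x| <= Cp * ((A * C0 ^+ k.+1 * delta) * avg i).
  have mono t : X i <= t <= X i.+1 -> A * C0 ^+ k.+1 * delta * wgt (X i) <= A * C0 ^+ k.+1 * delta * wgt t.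
    by move=> /andP[ht _]; rewrite ler_wpM2l// wgt_mono.
  have := @HCa K (X i) (X i.+1) (f 0%N) _ x KN (Xinc iN) (cf (leq0n _)) cW hx
    (fun t ht => coarse_val iN ht hr) mono.
  rewrite I1Z; last exact: cont_wgt.
  have E z : (X i.+1 - X i)^-1 * (z * I1 (X i) (X i.+1) wgt) = z * avg i by rewrite mulrCA.
  by rewrite E.
apply: (@le_trans _ _ (A * C0 ^+ k.+1 * delta * wgt x + Cp * ((A * C0 ^+ k.+1 * delta) * avg i))).
  by apply: lerD P; exact: (coarse_val iN hx hr).
apply: (@le_trans _ _ ((1 + Cp) * C0 ^+ k.+1 * (A * delta) * (wgt x + avg i))).
  have -> : (1 + Cp) * C0 ^+ k.+1 * (A * delta) * (wgt x + avg i) =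
    A * C0 ^+ k.+1 * delta * wgt x + Cp * ((A * C0 ^+ k.+1 * delta) * avg i)
    + (A * C0 ^+ k.+1 * delta * avg i + Cp * ((A * C0 ^+ k.+1 * delta) * wgt x)) by ring.
  rewrite lerDl; apply: addr_ge0; first by apply: mulr_ge0 cAd _; exact: avg_ge0.
  by apply: mulr_ge0 Cp0 _; apply: mulr_ge0 cAd _; exact: wgt_ge0.
apply: ler_wpM2r; first by rewrite addr_ge0 ?wgt_ge0 ?avg_ge0.
by rewrite -[CL * A * _]mulrA ler_wpM2r ?mulr_ge0 ?delta_ge0// CL_coarse.
Qed.

End Chain.

End LayerError.

(** * Primitives in x *)

Section Primitive.
Context {R : realType}.
Implicit Types (f : R -> R) (g : R -> R -> R) (a b x y : R).

Lemma I1_empty a b f : b < a -> I1 a b f = 0.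
Proof. by move=> ba; rewrite /I1 set_itv_ge ?bnd_simp -?ltNge// Rintegral_set0. Qed.

Lemma I1_lipschitz f M B x x' : continuous f -> 0 <= M -> (forall t, 0 <= t <= B -> `|f t| <= M) ->
  x <= B -> x' <= B -> `|I1 0 x f - I1 0 x' f| <= M * `|x - x'|.
Proof.
move=> cf M0 fM; wlog xx : x x' / x' <= x => [H xB x'B|xB _].
  have [h|h] := leP x' x; first exact: H.
  by rewrite distrC [`|x - _|]distrC; apply: H => //; exact: ltW.
rewrite [`|x - x'|]ger0_norm ?subr_ge0//.
have [x0|x0] := ltP x 0.
  by rewrite !I1_empty ?(le_lt_trans xx)// subrr normr0 mulr_ge0// subr_ge0.
have main z : 0 <= z -> z <= x -> `|I1 z x f| <= M * (x - z).
  move=> z0 zx; apply: (le_trans (ler_norm_I1 _ _ cf)); rewrite -I1_cst//.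
  apply: le_I1; [exact: cont1_norm|exact: cont1_cst|] => t /andP[zt tx].
  by apply: fM; rewrite (le_trans z0 zt) (le_trans tx xB).
have [x'0|x'0] := ltP x' 0.
  rewrite [X in _ - X]I1_empty// subr0; apply: (le_trans (main 0 (lexx _) x0)).
  by rewrite ler_wpM2l// lerB// ltW.
rewrite (@I1_cat _ 0 x' x f cf) ?x'0 ?xx// addrC addKr; exact: main.
Qed.

Lemma cont2_primitive g : cont2 g -> cont2 (fun x y => I1 0 x (g ^~ y)).
Proof.
move=> cg [x0 y0].
have [M [M0 HM]] := cont2_bounded 0 (`|x0| + 1) (y0 - 1) (y0 + 1) cg.
have cH : continuous (fun y => I1 0 x0 (g ^~ y)).
  by apply: (@cont_I1 _ (fun y x => g x y)); exact: cont2_swap.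
apply/cvgrPdist_le => /= e e0.
have e2 : 0 < e / 2%:R by rewrite divr_gt0.
have d0 : 0 < e / 2%:R / (M + 1) by rewrite divr_gt0// ltr_wpDl.
have m0 : 0 < Num.min 1 (e / 2%:R / (M + 1)) by rewrite lt_min ltr01.
have nx : \forall z \near (x0, y0), `|x0 - z.1| < Num.min 1 (e / 2%:R / (M + 1)).
  exact: (@cont_fst R (x0, y0) _ (nbhsx_ballx x0 _ m0)).
have ny : \forall z \near (x0, y0), `|y0 - z.2| < 1.
  exact: (@cont_snd R (x0, y0) _ (nbhsx_ballx y0 _ ltr01)).
have ny2 : \forall z \near (x0, y0), `|I1 0 x0 (g ^~ y0) - I1 0 x0 (g ^~ z.2)| <= e / 2%:R.
  have h : \forall y \near y0, `|I1 0 x0 (g ^~ y0) - I1 0 x0 (g ^~ y)| <= e / 2%:R.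
    by have /cvgrPdist_le := cH y0; apply.
  exact: (@cont_snd R (x0, y0) _ h).
near=> z.
have h1 : `|x0 - z.1| < Num.min 1 (e / 2%:R / (M + 1)) by near: z.
have h2 : `|y0 - z.2| < 1 by near: z.
have h3 : `|I1 0 x0 (g ^~ y0) - I1 0 x0 (g ^~ z.2)| <= e / 2%:R by near: z.
move: h1; rewrite lt_min => /andP[h1 h1'].
have -> : I1 0 x0 (g ^~ y0) - I1 0 z.1 (g ^~ z.2) =
  (I1 0 x0 (g ^~ y0) - I1 0 x0 (g ^~ z.2)) + (I1 0 x0 (g ^~ z.2) - I1 0 z.1 (g ^~ z.2)) by ring.
apply: (le_trans (ler_normD _ _)).
have -> : e = e / 2%:R + e / 2%:R by field.
apply: lerD => //.
have cgz : continuous (g ^~ z.2) by ct.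
have HL := @I1_lipschitz (g ^~ z.2) M (`|x0| + 1) x0 z.1 cgz M0.
apply: le_trans (HL _ _ _) _.
- move=> t /andP[t0 tB]; apply: HM; first by rewrite t0.
  by move: h2; rewrite ltr_norml => /andP[? ?]; apply/andP; split; lra.
- by have := ler_norm x0; lra.
- by have := ler_norm x0; move: h1; rewrite ltr_norml => /andP[? ?]; lra.
apply: (@le_trans _ _ (M * (e / 2%:R / (M + 1)))); first by rewrite ler_wpM2l// ltW.
rewrite mulrCA ler_piMr ?(ltW e2)// ler_pdivrMr ?mul1r ?lerDl// ltr_wpDl//.
Unshelve. all: by end_near. Qed.

End Primitive.

(** F i j is the mixed derivative of order (i, j). *)
Definition smooth2 {R : realType} (n : nat) (F : nat -> nat -> R -> R -> R) : Prop :=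
  (forall i j, (i + j <= n)%N -> cont2 (F i j)) /\
  (forall i j, (i + j < n)%N -> dX 0 1 (F i j) (F i.+1 j) /\
     dX 0 1 (fun y x => F i j x y) (fun y x => F i j.+1 x y)).

(** * The estimate in the x-direction for a decomposed solution *)

Section XData.
Context {R : realType} (k N : nat) (X : nat -> R) (eps alpha sigma m C0 Cp : R).
Hypothesis N0 : (0 < N)%N.
Hypothesis eps0 : 0 < eps.
Hypothesis eps1 : eps <= 1.
Hypothesis alpha0 : 0 < alpha.
Hypothesis sigmak : k.+2%:R <= sigma.
Hypothesis m1 : 1 <= m.
Hypothesis C00 : 0 <= C0.
Hypothesis Hmesh : layer_mesh eps alpha sigma m N X C0.
Hypothesis Cp1 : 1 <= Cp.
Hypothesis HCp : forall K (c d : R) (g : R -> R) (M y : R), c < d -> continuous g -> c <= y <= d ->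
    (forall t, c <= t <= d -> `|g t| <= M) -> `|proj k K c d g y| <= Cp * M.
Hypothesis HCa : forall K c d (g W : R -> R) y, K <> Radau_right -> c < d -> continuous g -> continuous W -> c <= y <= d ->
    (forall t, c <= t <= d -> `|g t| <= W t) -> (forall t, c <= t <= d -> W c <= W t) ->
    `|proj k K c d g y| <= Cp * ((d - c)^-1 * I1 c d W).
Notation lay := (lay eps alpha).
Notation wgt := (wgt k eps alpha sigma).
Notation avg := (avg k X eps alpha sigma).
Notation om := (om k X eps alpha sigma).
Notation delta := (delta k N m).
Notation CL := (CL k alpha sigma C0 Cp).
Notation inK := (inK X).

Let X0 : X 0 = 0. Proof. by case: Hmesh. Qed.
Let XN : X N = 1. Proof. by case: Hmesh. Qed.
Let Xinc i : (i < N)%N -> X i < X i.+1. Proof. by case: Hmesh => _ _ h _ _; apply: h. Qed.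
Let x01 i x : (i < N)%N -> X i <= x <= X i.+1 -> 0 <= x <= 1. Proof. exact: (Xin X0 XN Xinc). Qed.
Let lay0 x : 0 <= lay x. Proof. exact: expR_ge0. Qed.
Let lay1 x : 0 <= x <= 1 -> lay x <= 1. Proof. by case/andP => _ h; exact: lay_le1. Qed.
Let einv i : 0 <= eps ^- i. Proof. by rewrite invr_ge0 exprn_ge0// ltW. Qed.
Let CL0 : 0 <= CL. Proof. exact: CL_ge0. Qed.
Let del0 : 0 <= delta. Proof. exact: delta_ge0. Qed.

Section OneFunction.
Variables (F : nat -> nat -> R -> R -> R).
Hypothesis sF : smooth2 k.+2 F.

Let cF i j : (i + j <= k.+2)%N -> cont2 (F i j). Proof. by case: sF => h _; exact: h. Qed.

Lemma y_regular K i j x y A : (i <= 1)%N -> 0 <= A -> 0 <= x <= 1 ->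
  (forall y, 0 <= y <= 1 -> `|F i k.+1 x y| <= A) ->
  (j < N)%N -> X j <= y <= X j.+1 ->
  `|F i 0%N x y - proj k K (X j) (X j.+1) (F i 0%N x) y| <= CL * A * delta.
Proof.
move=> i1 A0 hx hA jN hy.
apply: (regular_error N0 alpha0 sigmak m1 C00 Hmesh Cp1 HCp (f := fun l y => F i l x y) A0) => //.
- move=> l lk; apply: cont2_s1; apply: cF.
  by rewrite -[k.+2]add1n leq_add.
- move=> l t lk t01; case: sF => _ /(_ i l) [].
    by rewrite -[k.+2]add1n -addnS leq_add.
  by move=> _ [_ _ d]; exact: d.
Qed.

Lemma y_layer K i j x y A : (i <= 1)%N -> 0 <= A -> 0 <= x <= 1 ->
  (forall y, 0 <= y <= 1 -> `|F i 0%N x y| <= A * lay y) ->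
  (forall y, 0 <= y <= 1 -> `|F i k.+1 x y| <= A * eps ^- k.+1 * lay y) ->
  (j < N)%N -> X j <= y <= X j.+1 ->
  `|F i 0%N x y - proj k K (X j) (X j.+1) (F i 0%N x) y| <= CL * A * delta.
Proof.
move=> i1 A0 hx hA hB jN hy.
apply: (layer_error N0 eps0 alpha0 sigmak m1 C00 Hmesh Cp1 HCp (f := fun l y => F i l x y) A0) => //.
- move=> l lk; apply: cont2_s1; apply: cF.
  by rewrite -[k.+2]add1n leq_add.
- move=> l t lk t01; case: sF => _ /(_ i l) [].
    by rewrite -[k.+2]add1n -addnS leq_add.
  by move=> _ [_ _ d]; exact: d.
Qed.

Let cfx i y : (i <= 1)%N -> forall l, (l <= k.+1)%N -> continuous (fun x => F (i + l) 0 x y).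
Proof.
move=> i1 l lk; apply: cont2_s2; apply: cF.
by rewrite addn0 -[k.+2]add1n leq_add.
Qed.
Let dfx i y : (i <= 1)%N -> 0 <= y <= 1 -> forall l (t : R), (l < k.+1)%N -> 0 < t < 1 ->
  is_derive t 1 (fun x => F (i + l) 0 x y) (F (i + l.+1) 0 t y).
Proof.
move=> i1 hy l t lk t01; case: sF => _ /(_ (i + l)%N 0%N) [].
  by rewrite addn0 -[k.+2]add1n -addnS leq_add.
by move=> [_ _ d] _; rewrite addnS; exact: d.
Qed.

Lemma x_regular K i l x y A : (i <= 1)%N -> 0 <= A -> 0 <= y <= 1 ->
  (forall x, 0 <= x <= 1 -> `|F (i + k.+1)%N 0%N x y| <= A) ->
  (l < N)%N -> X l <= x <= X l.+1 ->
  `|F i 0%N x y - proj k K (X l) (X l.+1) (fun s => F i 0%N s y) x| <= CL * A * delta.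
Proof.
move=> i1 A0 hy hA lN hx.
have := regular_error N0 alpha0 sigmak m1 C00 Hmesh Cp1 HCp (f := fun l x => F (i + l)%N 0%N x y) A0
  (@cfx i y i1) (@dfx i y i1 hy) K hA lN hx.
by rewrite addn0.
Qed.

Section XLayer.
Variables (i : nat) (y A : R).
Hypothesis i1 : (i <= 1)%N.
Hypothesis A0 : 0 <= A.
Hypothesis hy : 0 <= y <= 1.
Hypothesis hA : forall x, 0 <= x <= 1 -> `|F i 0%N x y| <= A * lay x.
Hypothesis hB : forall x, 0 <= x <= 1 -> `|F (i + k.+1)%N 0%N x y| <= A * eps ^- k.+1 * lay x.

Let hA' x : 0 <= x <= 1 -> `|F (i + 0)%N 0%N x y| <= A * lay x.
Proof. by rewrite addn0; exact: hA. Qed.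

Lemma x_layer K l x : (l < N)%N -> X l <= x <= X l.+1 ->
  `|F i 0%N x y - proj k K (X l) (X l.+1) (fun s => F i 0%N s y) x| <= CL * A * delta.
Proof.
move=> lN hx.
have := layer_error N0 eps0 alpha0 sigmak m1 C00 Hmesh Cp1 HCp (f := fun l x => F (i + l)%N 0%N x y) A0
  (@cfx i y i1) (@dfx i y i1 hy) hA' hB K lN hx.
by rewrite addn0.
Qed.

Lemma x_layer_weighted K l x : K <> Radau_right -> (l < N)%N -> X l <= x <= X l.+1 ->
  `|F i 0%N x y - proj k K (X l) (X l.+1) (fun s => F i 0%N s y) x| <= CL * A * delta * (wgt x + avg l).
Proof.
move=> KN lN hx.
have := layer_error_weighted N0 eps0 alpha0 sigmak m1 C00 Hmesh Cp1 HCp HCa (f := fun l x => F (i + l)%N 0%N x y) A0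
  (@cfx i y i1) (@dfx i y i1 hy) hA' hB KN lN hx.
by rewrite addn0.
Qed.
End XLayer.

End OneFunction.

Variables (S E1 E2 E3 : nat -> nat -> R -> R -> R) (K0 : R).
Hypothesis K00 : 0 <= K0.
Hypothesis sS : smooth2 k.+2 S.
Hypothesis s1 : smooth2 k.+2 E1.
Hypothesis s2 : smooth2 k.+2 E2.
Hypothesis s3 : smooth2 k.+2 E3.
Hypothesis bS : forall i j x y, (i + j <= k.+2)%N -> 0 <= x <= 1 -> 0 <= y <= 1 -> `|S i j x y| <= K0.
Hypothesis b1 : forall i j x y, (i + j <= k.+2)%N -> 0 <= x <= 1 -> 0 <= y <= 1 ->
  `|E1 i j x y| <= K0 * eps ^- i * lay x.
Hypothesis b2 : forall i j x y, (i + j <= k.+2)%N -> 0 <= x <= 1 -> 0 <= y <= 1 ->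
  `|E2 i j x y| <= K0 * eps ^- j * lay y.
Hypothesis b3 : forall i j x y, (i + j <= k.+2)%N -> 0 <= x <= 1 -> 0 <= y <= 1 ->
  `|E3 i j x y| <= K0 * eps ^- (i + j) * (lay x * lay y).

Definition usum i j x y := (S i j x y + E2 i j x y) + (E1 i j x y + E3 i j x y).
(** S and E2 are regular in x, while E1 and E3 have a layer at x = 1. *)
Definition ureg i j x y := S i j x y + E2 i j x y.
Definition ulay i j x y := E1 i j x y + E3 i j x y.

Definition del := 4%:R * CL * K0 * (1 + Cp) * delta.

Let q0 : 0 <= CL * K0 * delta. Proof. exact: mulr_ge0 (mulr_ge0 CL0 K00) del0. Qed.
Let delE : del = 4%:R * (CL * K0 * delta) * (1 + Cp). Proof. by rewrite /del; ring. Qed.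
Let Cp0 : 0 <= Cp. Proof. exact: le_trans Cp1. Qed.
Let del4 : 4%:R * (CL * K0 * delta) <= del.
Proof. by rewrite delE; apply: ler_peMr; [exact: mulr_ge0 (ler0n _ _) q0|rewrite lerDl]. Qed.
Lemma del_ge0 : 0 <= del. Proof. by apply: le_trans del4; exact: mulr_ge0 (ler0n _ _) q0. Qed.

Let k2 i j : (i <= 1)%N -> (j <= k.+1)%N -> (i + j <= k.+2)%N.
Proof. by move=> hi hj; rewrite -[k.+2]add1n leq_add. Qed.

Let cS i j : (i + j <= k.+2)%N -> cont2 (S i j). Proof. by case: sS => h _; exact: h. Qed.
Let c1 i j : (i + j <= k.+2)%N -> cont2 (E1 i j). Proof. by case: s1 => h _; exact: h. Qed.
Let c2 i j : (i + j <= k.+2)%N -> cont2 (E2 i j). Proof. by case: s2 => h _; exact: h. Qed.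
Let c3 i j : (i + j <= k.+2)%N -> cont2 (E3 i j). Proof. by case: s3 => h _; exact: h. Qed.

Lemma cont_ureg i j : (i + j <= k.+2)%N -> cont2 (ureg i j).
Proof. by move=> h; apply: cont2D; [exact: cS|exact: c2]. Qed.
Lemma cont_ulay i j : (i + j <= k.+2)%N -> cont2 (ulay i j).
Proof. by move=> h; apply: cont2D; [exact: c1|exact: c3]. Qed.
Lemma cont_usum i j : (i + j <= k.+2)%N -> cont2 (usum i j).
Proof. by move=> h; apply: cont2D; [exact: cont_ureg|exact: cont_ulay]. Qed.

Lemma reg_y_error K i j x y : (i <= 1)%N -> 0 <= x <= 1 -> (j < N)%N -> X j <= y <= X j.+1 ->
  `|ureg i 0%N x y - proj k K (X j) (X j.+1) (ureg i 0%N x) y| <= 2%:R * (CL * K0 * delta).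
Proof.
move=> i1 hx jN hy.
have hi : (i + 0 <= k.+2)%N by exact: k2.
have cs : continuous (S i 0%N x) by apply: cont2_s1; exact: cS.
have c2' : continuous (E2 i 0%N x) by apply: cont2_s1; exact: c2.
rewrite /ureg projD//.
have -> : S i 0%N x y + E2 i 0%N x y - (proj k K (X j) (X j.+1) (S i 0%N x) y + proj k K (X j) (X j.+1) (E2 i 0%N x) y)
 = (S i 0%N x y - proj k K (X j) (X j.+1) (S i 0%N x) y) + (E2 i 0%N x y - proj k K (X j) (X j.+1) (E2 i 0%N x) y) by ring.
apply: (le_trans (ler_normD _ _)).
have h1 := @y_regular S sS K i j x y K0 i1 K00 hx (fun t ht => bS (k2 i1 (leqnn _)) hx ht) jN hy.
have h2 : `|E2 i 0%N x y - proj k K (X j) (X j.+1) (E2 i 0%N x) y| <= CL * K0 * delta.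
  apply: y_layer => //.
    by move=> t ht; have := b2 hi hx ht; rewrite expr0 invr1 mulr1.
  by move=> t ht; exact: b2 (k2 i1 (leqnn _)) hx ht.
lra.
Qed.

(** The layer in x is a factor independent of y in front of an error in y,
    which for E3 is again that of a layer function. *)
Lemma lay_y_error K i j x y : (i <= 1)%N -> 0 <= x <= 1 -> (j < N)%N -> X j <= y <= X j.+1 ->
  `|ulay i 0%N x y - proj k K (X j) (X j.+1) (ulay i 0%N x) y| <= 2%:R * (CL * K0 * delta) * (eps ^- i * lay x).
Proof.
move=> i1 hx jN hy.
have hi : (i + 0 <= k.+2)%N by exact: k2.
have c1' : continuous (E1 i 0%N x) by apply: cont2_s1; exact: c1.
have c3' : continuous (E3 i 0%N x) by apply: cont2_s1; exact: c3.
rewrite /ulay projD//.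
have -> : E1 i 0%N x y + E3 i 0%N x y - (proj k K (X j) (X j.+1) (E1 i 0%N x) y + proj k K (X j) (X j.+1) (E3 i 0%N x) y)
 = (E1 i 0%N x y - proj k K (X j) (X j.+1) (E1 i 0%N x) y) + (E3 i 0%N x y - proj k K (X j) (X j.+1) (E3 i 0%N x) y) by ring.
apply: (le_trans (ler_normD _ _)).
pose A := K0 * eps ^- i * lay x.
have A0 : 0 <= A by exact: mulr_ge0 (mulr_ge0 K00 (einv i)) (lay0 x).
have h1 := @y_regular E1 s1 K i j x y A i1 A0 hx (fun t ht => b1 (k2 i1 (leqnn _)) hx ht) jN hy.
have h2 : `|E3 i 0%N x y - proj k K (X j) (X j.+1) (E3 i 0%N x) y| <= CL * A * delta.
  apply: y_layer => //.
    by move=> t ht; have := b3 hi hx ht; rewrite addn0 /A !mulrA.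
  move=> t ht; have := b3 (k2 i1 (leqnn k.+1)) hx ht.
  by rewrite exprD invfM /A; congr (_ <= _); ring.
have -> : 2%:R * (CL * K0 * delta) * (eps ^- i * lay x) = 2%:R * (CL * A * delta) by rewrite /A; ring.
lra.
Qed.

Let e0inv x : eps ^- 0 * x = x. Proof. by rewrite expr0 invr1 mul1r. Qed.

Lemma u_y_error K j x y : 0 <= x <= 1 -> (j < N)%N -> X j <= y <= X j.+1 ->
  `|usum 0%N 0%N x y - proj k K (X j) (X j.+1) (usum 0%N 0%N x) y| <= del.
Proof.
move=> hx jN hy.
have cr : continuous (ureg 0%N 0%N x) by apply: cont2_s1; exact: cont_ureg.
have cl : continuous (ulay 0%N 0%N x) by apply: cont2_s1; exact: cont_ulay.
have -> : usum 0%N 0%N x y - proj k K (X j) (X j.+1) (usum 0%N 0%N x) y =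
 (ureg 0%N 0%N x y - proj k K (X j) (X j.+1) (ureg 0%N 0%N x) y) + (ulay 0%N 0%N x y - proj k K (X j) (X j.+1) (ulay 0%N 0%N x) y).
  by rewrite /usum projD// /ureg /ulay; ring.
apply: (le_trans (ler_normD _ _)).
have h1 := @reg_y_error K 0 j x y isT hx jN hy.
have h2 := @lay_y_error K 0 j x y isT hx jN hy.
have h3 : 2%:R * (CL * K0 * delta) * (eps ^- 0 * lay x) <= 2%:R * (CL * K0 * delta).
  by rewrite e0inv ler_piMr ?lay1// mulr_ge0.
apply: le_trans del4.
by move: h1 h2 h3; move: (CL * K0 * delta) => z; lra.
Qed.

Lemma u_x_error K i x y : 0 <= y <= 1 -> (i < N)%N -> X i <= x <= X i.+1 ->
  `|usum 0%N 0%N x y - proj k K (X i) (X i.+1) ((usum 0%N 0%N) ^~ y) x| <= del.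
Proof.
move=> hy iN hx.
have h00 : (0 + 0 <= k.+2)%N by [].
have d1 : continuous (S 0%N 0%N ^~ y) by apply: cont2_s2; exact: cS.
have d2 : continuous (E2 0%N 0%N ^~ y) by apply: cont2_s2; exact: c2.
have d3 : continuous (E1 0%N 0%N ^~ y) by apply: cont2_s2; exact: c1.
have d4 : continuous (E3 0%N 0%N ^~ y) by apply: cont2_s2; exact: c3.
have -> : usum 0%N 0%N x y - proj k K (X i) (X i.+1) ((usum 0%N 0%N) ^~ y) x =
  (S 0%N 0%N x y - proj k K (X i) (X i.+1) (S 0%N 0%N ^~ y) x) + (E2 0%N 0%N x y - proj k K (X i) (X i.+1) (E2 0%N 0%N ^~ y) x)
  + (E1 0%N 0%N x y - proj k K (X i) (X i.+1) (E1 0%N 0%N ^~ y) x) + (E3 0%N 0%N x y - proj k K (X i) (X i.+1) (E3 0%N 0%N ^~ y) x).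
  rewrite /usum projD; [|exact: cont1D|exact: cont1D]; rewrite !projD//; ring.
have hk : (0 + k.+1 + 0 <= k.+2)%N by rewrite addn0.
have ly := lay1 hy.
have h1 := @x_regular S sS K 0 i x y K0 isT K00 hy (fun t ht => bS hk ht hy) iN hx.
have h2 : `|E2 0%N 0%N x y - proj k K (X i) (X i.+1) (E2 0%N 0%N ^~ y) x| <= CL * K0 * delta.
  apply: x_regular => // t ht; apply: (le_trans (b2 hk ht hy)).
  by rewrite expr0 invr1 mulr1 ler_piMr.
have h3 : `|E1 0%N 0%N x y - proj k K (X i) (X i.+1) (E1 0%N 0%N ^~ y) x| <= CL * K0 * delta.
  apply: x_layer => // t ht; last by have := b1 hk ht hy; rewrite add0n.
  by have := b1 h00 ht hy; rewrite expr0 invr1 mulr1.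
have h4 : `|E3 0%N 0%N x y - proj k K (X i) (X i.+1) (E3 0%N 0%N ^~ y) x| <= CL * K0 * delta.
  apply: x_layer => // t ht; [have := b3 h00 ht hy|have := b3 hk ht hy] => h; apply: (le_trans h).
    by rewrite addn0 expr0 invr1 mulr1 ler_wpM2l// ler_piMr.
  by rewrite add0n addn0 ler_wpM2l ?mulr_ge0// ler_piMr.
apply: le_trans del4.
apply: (le_trans (ler_normD _ _)); move: (ler_normD (S 0%N 0%N x y - proj k K (X i) (X i.+1) (S 0%N 0%N ^~ y) x + (E2 0%N 0%N x y - proj k K (X i) (X i.+1) (E2 0%N 0%N ^~ y) x)) (E1 0%N 0%N x y - proj k K (X i) (X i.+1) (E1 0%N 0%N ^~ y) x)).
move: (ler_normD (S 0%N 0%N x y - proj k K (X i) (X i.+1) (S 0%N 0%N ^~ y) x) (E2 0%N 0%N x y - proj k K (X i) (X i.+1) (E2 0%N 0%N ^~ y) x)).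
move: h1 h2 h3 h4; move: (CL * K0 * delta) => z; lra.
Qed.

Let cw := @cont_wgt _ k eps alpha sigma.
Let cl := @cont_lay _ eps alpha.
Let om_eps i x : (i < N)%N -> eps <= om i x. Proof. by move=> iN; exact: om_ge_eps Hmesh _ x iN. Qed.
Let lay_om i x : (i < N)%N -> x <= 1 -> lay x <= om i x.
Proof.
move=> iN x1; apply: (le_trans (lay_le_wgt eps0 alpha0 sigmak x1)).
have := @avg_ge0 _ k N X eps alpha sigma m C0 Hmesh i iN.
by rewrite /om; move: (ltW eps0); lra.
Qed.
Let avg_om i x : (i < N)%N -> avg i <= om i x.
Proof. by move=> iN; have := wgt_ge0 k eps alpha sigma x; rewrite /om; move: (ltW eps0); lra. Qed.
Let q2_del : 2%:R * (CL * K0 * delta) <= del.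
Proof. by apply: le_trans del4; move: q0; lra. Qed.

Lemma reg_dx_error j x y : 0 <= x <= 1 -> (j < N)%N -> X j <= y <= X j.+1 ->
  `|pyj k X (ureg 1 0) j x y - ureg 1%N 0%N x y| <= del.
Proof.
move=> hx jN hy; rewrite distrC; apply: le_trans q2_del; exact: reg_y_error.
Qed.

Lemma lay_dx_error K j x y : 0 <= x <= 1 -> (j < N)%N -> X j <= y <= X j.+1 ->
  eps * `|ulay 1%N 0%N x y - proj k K (X j) (X j.+1) (ulay 1 0 x) y| <= 2%:R * (CL * K0 * delta) * lay x.
Proof.
move=> hx jN hy; have := @lay_y_error K 1 j x y isT hx jN hy; rewrite expr1 => h.
by rewrite -ler_pdivlMl// (le_trans h)// mulrCA.
Qed.

Lemma lay_dx_error_om i j x y : (i < N)%N -> (j < N)%N -> inK i j x y ->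
  eps * `|pyj k X (ulay 1 0) j x y - ulay 1%N 0%N x y| <= del * om i x.
Proof.
move=> iN jN [hx hy]; have h01 := x01 iN hx; rewrite distrC.
apply: (le_trans (lay_dx_error Radau_right h01 jN hy)).
apply: ler_pM => //; first by move: q0; lra.
by apply: lay_om => //; case/andP: h01.
Qed.

Let k10 : (1 + 0 <= k.+2)%N. Proof. by []. Qed.
Let cu10 : cont2 (usum 1 0). Proof. exact: cont_usum k10. Qed.

Let px_error i x y : 0 <= y <= 1 -> (i < N)%N -> X i <= x <= X i.+1 ->
  eps * `|usum 1%N 0%N x y - proj k Radau_left (X i) (X i.+1) ((usum 1 0) ^~ y) x| <= 2%:R * (CL * K0 * delta) * om i x.
Proof.
move=> hy iN hx.
have d1 : continuous (S 1%N 0%N ^~ y) by apply: cont2_s2; exact: cS.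
have d2 : continuous (E2 1%N 0%N ^~ y) by apply: cont2_s2; exact: c2.
have d3 : continuous (E1 1%N 0%N ^~ y) by apply: cont2_s2; exact: c1.
have d4 : continuous (E3 1%N 0%N ^~ y) by apply: cont2_s2; exact: c3.
have -> : usum 1%N 0%N x y - proj k Radau_left (X i) (X i.+1) ((usum 1 0) ^~ y) x =
  (S 1%N 0%N x y - proj k Radau_left (X i) (X i.+1) (S 1%N 0%N ^~ y) x) + (E2 1%N 0%N x y - proj k Radau_left (X i) (X i.+1) (E2 1%N 0%N ^~ y) x)
  + (E1 1%N 0%N x y - proj k Radau_left (X i) (X i.+1) (E1 1%N 0%N ^~ y) x) + (E3 1%N 0%N x y - proj k Radau_left (X i) (X i.+1) (E3 1%N 0%N ^~ y) x).
  rewrite /usum projD; [|exact: cont1D|exact: cont1D]; rewrite !projD//; ring.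
have hk : (1 + k.+1 + 0 <= k.+2)%N by rewrite addn0.
have ly := lay1 hy.
have A0 : 0 <= K0 * eps ^- 1 := mulr_ge0 K00 (einv 1).
have h1 : `|S 1%N 0%N x y - proj k Radau_left (X i) (X i.+1) (S 1%N 0%N ^~ y) x| <= CL * K0 * delta.
  by apply: x_regular => // t ht; exact: bS hk ht hy.
have h2 : `|E2 1%N 0%N x y - proj k Radau_left (X i) (X i.+1) (E2 1%N 0%N ^~ y) x| <= CL * K0 * delta.
  apply: x_regular => // t ht; apply: (le_trans (b2 hk ht hy)).
  by rewrite expr0 invr1 mulr1 ler_piMr.
have h3 : `|E1 1%N 0%N x y - proj k Radau_left (X i) (X i.+1) (E1 1%N 0%N ^~ y) x| <= CL * (K0 * eps ^- 1) * delta * (wgt x + avg i).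
  apply: x_layer_weighted => // t ht; first exact: b1 k10 ht hy.
  have := b1 hk ht hy; by rewrite exprD invfM mulrA.
have h4 : `|E3 1%N 0%N x y - proj k Radau_left (X i) (X i.+1) (E3 1%N 0%N ^~ y) x| <= CL * (K0 * eps ^- 1) * delta * (wgt x + avg i).
  apply: x_layer_weighted => // t ht; [have := b3 k10 ht hy|have := b3 hk ht hy] => h; apply: (le_trans h).
    by rewrite ler_wpM2l// ler_piMr.
  by rewrite addn0 exprD invfM [K0 * (_ * _)]mulrA ler_wpM2l ?mulr_ge0// ler_piMr.
have e4 : CL * (K0 * eps ^- 1) * delta * (wgt x + avg i) = eps^-1 * (CL * K0 * delta * (wgt x + avg i)).
  by rewrite expr1; ring.
rewrite e4 in h3 h4.
rewrite -ler_pdivlMl//.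
have -> : eps^-1 * (2%:R * (CL * K0 * delta) * om i x) =
  2%:R * (CL * K0 * delta) + 2%:R * (eps^-1 * (CL * K0 * delta * (wgt x + avg i))).
  by rewrite /om; field; rewrite gt_eqF.
move: h1 h2 h3 h4; move: (CL * K0 * delta) (eps^-1 * _) => z z2.
move: (S _ _ _ _ - _) (E2 _ _ _ _ - _) (E1 _ _ _ _ - _) (E3 _ _ _ _ - _) => e1 e2 e3 e4'.
have := ler_normD (e1 + e2 + e3) e4'; have := ler_normD (e1 + e2) e3; have := ler_normD e1 e2; lra.
Qed.

Definition is_flux_proj (P : nat -> nat -> 'M[R]_k.+1) := forall i j, (i < N)%N -> (j < N)%N -> forall x y,
  ev (P i.+1 j.+1) x y = proj k Radau_left (X i) (X i.+1)
     (fun s => proj k Orthogonal (X j) (X j.+1) (flux eps (usum 1 0) s) y) x.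

(** p - P = (p - pi_x p) + pi_x (p - pi_y p), where the second term needs the
    weighted stability of the left Gauss-Radau projection. *)
Lemma flux_error P i j x y : is_flux_proj P -> (i < N)%N -> (j < N)%N -> inK i j x y ->
  `|flux eps (usum 1 0) x y - ev (P i.+1 j.+1) x y| <= del * om i x.
Proof.
move=> HP iN jN [hx hy]; rewrite HP//.
pose D s := usum 1%N 0%N s y - proj k Orthogonal (X j) (X j.+1) (usum 1 0 s) y.
have cP : cont2 (fun s => proj k Orthogonal (X j) (X j.+1) (usum 1 0 s)) by exact: cont2_proj.
have cD : continuous D.
  by apply: cont1D; [exact: (@cont2_s2 _ _ y cu10)|apply: cont1N; exact: (@cont2_s2 _ _ y cP)].
have cuy : continuous (usum 1 0 ^~ y) by exact: (@cont2_s2 _ _ y cu10).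
have cPy : continuous (fun s => proj k Orthogonal (X j) (X j.+1) (usum 1 0 s) y) by exact: (@cont2_s2 _ _ y cP).
have -> : (fun s => proj k Orthogonal (X j) (X j.+1) (flux eps (usum 1 0) s) y) =
   (fun s => eps * proj k Orthogonal (X j) (X j.+1) (usum 1 0 s) y).
  apply/funext => s; rewrite /flux projZ//; exact: (@cont2_s1 _ _ s cu10).
rewrite projZ// /flux.
have -> : eps * usum 1%N 0%N x y - eps * proj k Radau_left (X i) (X i.+1) (fun s => proj k Orthogonal (X j) (X j.+1) (usum 1 0 s) y) x =
  eps * (usum 1%N 0%N x y - proj k Radau_left (X i) (X i.+1) ((usum 1 0) ^~ y) x) + proj k Radau_left (X i) (X i.+1) (fun s => eps * D s) x.
  rewrite projZ// /D projB//; ring.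
apply: (le_trans (ler_normD _ _)).
have h1 : `|eps * (usum 1%N 0%N x y - proj k Radau_left (X i) (X i.+1) ((usum 1 0) ^~ y) x)| <= 2%:R * (CL * K0 * delta) * om i x.
  by rewrite normrM gtr0_norm//; apply: px_error => //; exact: x01 jN hy.
pose W t := 2%:R * (CL * K0 * delta) * (eps + wgt t).
have cW : continuous W.
  by apply: cont1M; [exact: cont1_cst|apply: cont1D; [exact: cont1_cst|exact: cw]].
have h2 : `|proj k Radau_left (X i) (X i.+1) (fun s => eps * D s) x| <= Cp * ((X i.+1 - X i)^-1 * I1 (X i) (X i.+1) W).
  apply: HCa => //; [exact: Xinc|by apply: cont1M => //; exact: cont1_cst| |]; last first.
    move=> t /andP[ht _]; rewrite /W ler_wpM2l//; first by move: q0; lra.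
    by rewrite lerD2l; apply: (wgt_mono eps0 alpha0 sigmak).
  move=> t ht; have t01 := x01 iN ht.
  have cr : continuous (ureg 1%N 0%N t) by apply: cont2_s1; exact: cont_ureg.
  have cll : continuous (ulay 1%N 0%N t) by apply: cont2_s1; exact: cont_ulay.
  have -> : D t = (ureg 1%N 0%N t y - proj k Orthogonal (X j) (X j.+1) (ureg 1 0 t) y) + (ulay 1%N 0%N t y - proj k Orthogonal (X j) (X j.+1) (ulay 1 0 t) y).
    by rewrite /D /usum projD// /ureg /ulay; ring.
  rewrite mulrDr /W [leRHS]mulrDr; apply: (le_trans (ler_normD _ _)).
  rewrite !normrM gtr0_norm//; apply: lerD.
    by rewrite [leRHS]mulrC ler_wpM2l ?(ltW eps0)//; exact: reg_y_error.
  apply: (le_trans (lay_dx_error Orthogonal t01 jN hy)).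
  apply: ler_wpM2l; first by move: q0; lra.
  by apply: (lay_le_wgt eps0 alpha0 sigmak); case/andP: t01.
have E : (X i.+1 - X i)^-1 * I1 (X i) (X i.+1) W = 2%:R * (CL * K0 * delta) * (eps + avg i).
  have hi : X i.+1 - X i != 0 by rewrite subr_eq0 gt_eqF// Xinc.
  rewrite I1Z; last by apply: cont1D; [exact: cont1_cst|exact: cw].
  rewrite I1D; [|exact: cont1_cst|exact: cw].
  rewrite I1_cst ?(ltW (Xinc iN))// mulrCA mulrDr; congr (_ * (_ + _)).
  by rewrite mulrCA mulVf// mulr1.
rewrite E in h2.
have h3 : 2%:R * (CL * K0 * delta) * (eps + avg i) <= 2%:R * (CL * K0 * delta) * om i x.
  apply: ler_wpM2l; first by move: q0; lra.
  by rewrite /om; have := wgt_ge0 k eps alpha sigma x; lra.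
have h4 := le_trans h2 (ler_wpM2l Cp0 h3).
have hom : 0 <= CL * K0 * delta * om i x by apply: mulr_ge0 q0 _; apply: le_trans (om_eps x iN); exact: ltW.
have hom2 : 0 <= Cp * (CL * K0 * delta * om i x) by exact: mulr_ge0.
have hh := lerD h1 h4; apply: (le_trans hh).
rewrite delE.
have -> : 4 * (CL * K0 * delta) * (1 + Cp) * om i x = 4 * (CL * K0 * delta * om i x) + 4 * (Cp * (CL * K0 * delta * om i x)) by ring.
have -> : 2 * (CL * K0 * delta) * om i x + Cp * (2 * (CL * K0 * delta) * om i x) = 2 * (CL * K0 * delta * om i x) + 2 * (Cp * (CL * K0 * delta * om i x)) by ring.
lra.
Qed.

Lemma dXD c d (F f G g : R -> R -> R) : dX c d F f -> dX c d G g ->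
  dX c d (fun x y => F x y + G x y) (fun x y => f x y + g x y).
Proof.
move=> [cF cf dF] [cG cg dG]; split; [exact: cont2D|exact: cont2D|].
by move=> x y hx hy; apply: is_deriveD; [exact: dF|exact: dG].
Qed.

Lemma dX_usum i : (i < k.+2)%N -> dX 0 1 (usum i 0) (usum i.+1 0).
Proof.
move=> h; rewrite -(addn0 i) in h.
by apply: dXD; apply: dXD;
  [case: sS|case: s2|case: s1|case: s3] => _ /(_ i 0%N h) [d _]; exact: d.
Qed.

Section Total.
Variables (a ax : R -> R -> R) (A Cinv : R).
Hypothesis Ha : dX 0 1 a ax.
Hypothesis A0 : 0 <= A.
Hypothesis Abound : forall x y, 0 <= x <= 1 -> 0 <= y <= 1 -> `|a x y| <= A /\ `|ax x y| <= A.
Hypothesis Cinv0 : 0 < Cinv.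
Hypothesis HCinv : forall b c (q : {poly R}), b < c -> (size q <= k.+1)%N ->
  (c - b) ^+ 2 * I1 b c (fun x => (q^`()).[x] ^+ 2) <= Cinv * I1 b c (fun x => q.[x] ^+ 2).
Hypothesis u0 : forall y, 0 <= y <= 1 -> usum 0 0 0 y = 0.
Hypothesis u1 : forall y, 0 <= y <= 1 -> usum 0 0 1 y = 0.

(** The convection defect of the layer part, and its primitive in x. *)
Definition gdef j x y := a x y * (pyj k X (ulay 1 0) j x y - ulay 1%N 0%N x y).
Definition Gdef j x y := I1 0 x (gdef j ^~ y).

Let cul : cont2 (ulay 1 0). Proof. exact: cont_ulay. Qed.
Let cpl j : cont2 (pyj k X (ulay 1 0) j). Proof. exact: cont_pyj. Qed.
Let cgd j : cont2 (gdef j).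
Proof. by have [ca _ _] := Ha; have h1 := @cpl j; have h2 := @cul; rewrite /gdef; ct. Qed.
Let cGd j : cont2 (Gdef j). Proof. exact: cont2_primitive. Qed.

Let dXG j : dX (X j) (X j.+1) (Gdef j) (gdef j).
Proof.
split; [exact: cGd|exact: cgd|] => x y /andP[x0 _] _.
by apply: I1_derive; [exact: (@cont2_s2 _ _ y (@cgd j))|].
Qed.

Let Gbound j x y : 0 <= x <= 1 -> (j < N)%N -> X j <= y <= X j.+1 ->
  `|Gdef j x y| <= A / alpha * (2%:R * (CL * K0 * delta)) * lay x.
Proof.
move=> /andP[x0 x1] jN hy.
have cg : continuous (gdef j ^~ y) by exact: (@cont2_s2 _ _ y (@cgd j)).
apply: (le_trans (ler_norm_I1 _ _ cg)).
pose c := A * (2%:R * (CL * K0 * delta)) / eps.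
have c0 : 0 <= c.
  rewrite /c; apply: divr_ge0; last exact: ltW.
  by apply: mulr_ge0 A0 _; move: q0; lra.
apply: (@le_trans _ _ (I1 0 x (fun t => c * lay t))).
  apply: le_I1; [exact: cont1_norm|by apply: cont1M; [exact: cont1_cst|exact: cl]|].
  move=> t /andP[t0 tx]; have t01 : 0 <= t <= 1 by rewrite t0 (le_trans tx).
  have hy1 := x01 jN hy.
  rewrite /gdef normrM /c.
  have -> : A * (2%:R * (CL * K0 * delta)) / eps * lay t = A * (eps^-1 * (2%:R * (CL * K0 * delta) * lay t)) by ring.
  apply: ler_pM => //; first by have [] := Abound t01 hy1.
  by rewrite ler_pdivlMl// distrC; exact: lay_dx_error.
rewrite I1Z; last exact: cl.
rewrite (I1_expR eps0 alpha0 x0).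
have -> : c * (eps / alpha * (expR (- (alpha * (1 - x) / eps)) - expR (- (alpha * (1 - 0) / eps)))) =
  A / alpha * (2%:R * (CL * K0 * delta)) * (lay x - lay 0).
  rewrite /c /lay; field; by rewrite !gt_eqF.
apply: ler_wpM2l; last by have := lay0 0; lra.
by apply: mulr_ge0; [rewrite divr_ge0// ltW|move: q0; lra].
Qed.

Let Cs := Cp ^+ 2 * A / alpha.
Let Cs0 : 0 <= Cs. Proof. by rewrite /Cs divr_ge0 ?mulr_ge0 ?sqr_ge0 ?(ltW alpha0). Qed.
Let Cw := 3%:R * (1 + 2%:R / (gam k sigma * alpha)).
Let Cw3 : 3%:R <= Cw.
Proof.
have : 0 <= 2%:R / (gam k sigma * alpha).
  by rewrite divr_ge0// mulr_ge0 ?(ltW alpha0) ?(ltW (gam_gt0 sigmak)).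
by rewrite /Cw; lra.
Qed.

Let Aq : A / alpha * (2%:R * (CL * K0 * delta)) <= A / alpha * del.
Proof. by rewrite ler_wpM2l ?divr_ge0 ?(ltW alpha0). Qed.

Variables V P : nat -> nat -> 'M[R]_k.+1.
Hypothesis HV : forall i j, (i < N)%N -> (j < N)%N -> forall x y,
  ev (V i.+1 j.+1) x y = proj k Radau_right (X i) (X i.+1) ((pyj k X (usum 0 0) j) ^~ y) x.
Hypothesis HP : is_flux_proj P.

(** The error of the y-projection plus the defect in x. *)
Lemma u_error i j x y : (i < N)%N -> (j < N)%N -> inK i j x y ->
  `|usum 0%N 0%N x y - ev (V i.+1 j.+1) x y| <= (1 + Cp) * del.
Proof.
move=> iN jN hK; have [hx hy] := hK.
have cu : cont2 (usum 0 0) by exact: cont_usum.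
have h1 := @u_y_error Radau_right j x y (x01 iN hx) jN hy.
have h2 : `|rdef X (usum 0 0) V i j x y| <= Cp * del.
  apply: (@rdef_bound _ k N X X0 XN Xinc (usum 0 0) (usum 1 0) (dX_usum (ltn0Sn _)) V HV Cp del _ _ i j x y iN jN hK).
    by move=> c d g M t; exact: HCp.
  by move=> i' x' y' iN' hx' hy'; exact: u_x_error.
have -> : usum 0%N 0%N x y - ev (V i.+1 j.+1) x y =
  (usum 0%N 0%N x y - proj k Radau_right (X j) (X j.+1) (usum 0 0 x) y) + rdef X (usum 0 0) V i j x y.
  by rewrite /rdef /pyj; ring.
by apply: (le_trans (ler_normD _ _)); rewrite mulrDl mul1r; exact: lerD.
Qed.

Definition xdir_total_const t := xdir_const A Cw Cs Cp Cinv t.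

(** The general estimate with Z the tensor-product projection of the primitive
    Gdef. *)
Lemma xdir_total v s lam t : 0 < t ->
  (forall Z : nat -> nat -> 'M[R]_k.+1,
   eps^-1 * S2 N X (fun i j x y => ev (s i.+1 j.+1) x y * ev (Z i.+1 j.+1) x y) + B2 N X v Z
   = eps^-1 * S2 N X (fun i j x y => ev (P i.+1 j.+1) x y * ev (Z i.+1 j.+1) x y) + B2 N X V Z) ->
  `|eps^-1 * S2 N X (fun i j x y => ev (P i.+1 j.+1) x y * ev (s i.+1 j.+1) x y)
   + B2 N X V s + B3 N X P v + B4 N X a lam V v
   - S2 N X (fun i j x y => ax x y * ev (V i.+1 j.+1) x y * ev (v i.+1 j.+1) x y)
   - S2 N X (fun i j x y => (a x y * usum 1 0 x y - eps * usum 2 0 x y) * ev (v i.+1 j.+1) x y)|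
  <= 3%:R * t * (eps^-1 * S2 N X (fun i j x y => ev (s i.+1 j.+1) x y ^+ 2)
      + S2 N X (fun i j x y => ev (v i.+1 j.+1) x y ^+ 2)
      + S1 N X (fun j y => ev (v N j.+1) (X N) y ^+ 2))
     + xdir_total_const t * del ^+ 2.
Proof.
move=> t0 gal.
pose PZ i j (C : 'M[R]_k.+1) := forall x y, ev C x y = proj k Radau_left (X i) (X i.+1)
     (fun s => proj k Orthogonal (X j) (X j.+1) (Gdef j s) y) x.
have exZ i j : exists C, PZ i j C.
  exact: (proj_matrix k Radau_left Orthogonal (X i) (X i.+1) (X j) (X j.+1) (@cGd j)).
pose Z i j := projT1 (cid (exZ i.-1 j.-1)).
have ZE i j : PZ i j (Z i.+1 j.+1) by rewrite /Z; case: (cid _).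
have HZ : radau_x N X Gdef Z.
  split=> [i j C iN jN|i j q iN jN].
    by have [h _] := tensor_radau (Xinc iN) (Xinc jN) (@cGd j) (ZE i j); exact: h.
  by have [_ h] := tensor_radau (Xinc iN) (Xinc jN) (@cGd j) (ZE i j); exact: h.
have cfl : cont2 (flux eps (usum 1 0)) by apply: cont2M; [exact: cont2_cst|exact: cu10].
have HP' : radau_x N X (fun=> flux eps (usum 1 0)) P.
  split=> [i j C iN jN|i j q iN jN].
    by have [h _] := tensor_radau (Xinc iN) (Xinc jN) cfl (HP iN jN); exact: h.
  by have [_ h] := tensor_radau (Xinc iN) (Xinc jN) cfl (HP iN jN); exact: h.
(* The L2 projection in y keeps the bound by wgt, which depends on x only;
   then the weighted stability in x applies. *)
have D5 i j x y : (i < N)%N -> (j < N)%N -> inK i j x y -> `|ev (Z i.+1 j.+1) x y| <= Cs * del * om i x.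
  move=> iN jN [hx hy]; rewrite ZE.
  pose W t := Cp * (A / alpha * del) * wgt t.
  have cA : 0 <= Cp * (A / alpha * del).
    by apply: mulr_ge0 Cp0 _; apply: mulr_ge0 _ del_ge0; rewrite divr_ge0// ltW.
  have cW : continuous W by apply: cont1M; [exact: cont1_cst|exact: cw].
  have cP : cont2 (fun s => proj k Orthogonal (X j) (X j.+1) (Gdef j s)).
    exact: cont2_proj (@cGd j).
  have h : `|proj k Radau_left (X i) (X i.+1) (fun s0 => proj k Orthogonal (X j) (X j.+1) (Gdef j s0) y) x|
    <= Cp * ((X i.+1 - X i)^-1 * I1 (X i) (X i.+1) W).
    apply: HCa => //; [exact: Xinc|exact: (@cont2_s2 _ _ y cP)| |]; last first.
      by move=> r /andP[hr _]; rewrite /W ler_wpM2l//; apply: (wgt_mono eps0 alpha0 sigmak).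
    move=> r hr; rewrite /W -mulrA; apply: HCp => //; [exact: Xinc|exact: (@cont2_s1 _ _ r (@cGd j))|].
    move=> y' hy'; have r01 := x01 iN hr; apply: (le_trans (Gbound r01 jN hy')).
    apply: ler_pM => //.
      by apply: mulr_ge0; [rewrite divr_ge0// ltW|move: q0; lra].
    by apply: (lay_le_wgt eps0 alpha0 sigmak); case/andP: r01.
  apply: (le_trans h); rewrite I1Z; last exact: cw.
  rewrite [_^-1 * _]mulrCA.
  have -> : Cs * del * om i x = Cp * (Cp * (A / alpha * del) * om i x) by rewrite /Cs; ring.
  by apply: ler_wpM2l => //; apply: ler_wpM2l => //; exact: avg_om.
have D6 j y : (j < N)%N -> X j <= y <= X j.+1 -> `|Gdef j 1 y| <= Cs * del.
  move=> jN hy; have := Gbound (x := 1) (j := j) (y := y) _ jN hy; rewrite ler01 lexx => /(_ isT) h.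
  apply: (le_trans h).
  have l1 : lay 1 <= 1 by exact: lay_le1.
  apply: (@le_trans _ _ (A / alpha * del)).
    apply: (le_trans _ Aq); apply: ler_piMr => //.
    by apply: mulr_ge0; [rewrite divr_ge0// ltW|move: q0; lra].
  have -> : Cs * del = Cp ^+ 2 * (A / alpha * del) by rewrite /Cs; ring.
  apply: ler_peMl; first by apply: mulr_ge0 _ del_ge0; rewrite divr_ge0// ltW.
  by rewrite exprn_ege1.
have hend : om N.-1 1 <= Cw.
  by apply: le_trans Cw3; apply: (om_le3 eps0 eps1 alpha0 sigmak Hmesh) => //; rewrite prednK.
refine (@xdir_bound R k N X eps N0 X0 XN Xinc eps0 a ax (usum 0 0) (usum 1 0) (usum 2 0) (ureg 1 0) (ulay 1 0)
  Ha (dX_usum (ltn0Sn _)) (dX_usum _) (cont_ureg k10) (cont_ulay k10) (fun x y => erefl) u0 u1 V P Z HV HP' Gdef gdef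
  dXG (fun _ _ _ _ _ _ => erefl) HZ v s A Cw Cs Cp Cinv del om A0 del_ge0 Cs0 Cinv0 _ HCinv Abound _ _ _ hend
  _ _ _ _ D5 D6 lam t t0 (gal Z)).
- by [].
- by move=> c d g M y; exact: HCp.
- by move=> i; exact: cont_om.
- exact: (om_sq_sum eps0 eps1 alpha0 sigmak Hmesh).
- by move=> i x iN _; exact: om_eps.
- by move=> i j x y iN jN [hx hy]; apply: reg_dx_error => //; exact: x01 hx.
- by move=> i j x y iN jN hK; exact: lay_dx_error_om.
- by move=> i x y iN hx hy; exact: u_x_error.
- by move=> i j x y iN jN hK; exact: flux_error.
Qed.

End Total.

End XData.

(** * Derivatives up to the boundary of the square *)

Section Extension.
Context {R : realType}.
Implicit Types (g : R * R -> R) (G : R -> R -> R) (z : R * R) (t x y : R).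

(** A continuous retraction of the line onto [0, 1], by which functions on the
    closed square are extended to the plane. *)
Definition clamp t : R := 2^-1 * (`|t| - `|t - 1| + 1).

Lemma clamp_id t : 0 <= t <= 1 -> clamp t = t.
Proof.
move=> /andP[t0 t1]; rewrite /clamp ger0_norm// ler0_norm ?subr_le0//; lra.
Qed.

Lemma clamp01 t : 0 <= clamp t <= 1.
Proof.
rewrite /clamp; case: (ger0P t) => t0; case: (ger0P (t - 1)) => t1; lra.
Qed.

Lemma cont_clamp : continuous clamp.
Proof. by rewrite /clamp; ct. Qed.

Lemma OmegabarP z : Omegabar z <-> (0 <= z.1 <= 1) /\ (0 <= z.2 <= 1).
Proof. by rewrite /Omegabar /= !in_itv. Qed.

Lemma OmegaP z : Omega z <-> (0 < z.1 < 1) /\ (0 < z.2 < 1).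
Proof. by rewrite /Omega /= !in_itv. Qed.

Lemma itv01_dense t e : 0 <= t <= 1 -> 0 < e -> exists2 s, 0 < s < 1 & `|t - s| < e.
Proof.
move=> ht e0; pose d := Num.min 2^-1 (e / 2).
have d0 : 0 < d by rewrite lt_min; apply/andP; split; lra.
have d1 : d <= 2^-1 by rewrite ge_min lexx.
have d2 : d <= e / 2 by rewrite ge_min lexx orbT.
exists (t + d * (1 - 2 * t)); first nra.
have -> : t - (t + d * (1 - 2 * t)) = - (d * (1 - 2 * t)) by ring.
rewrite normrN normrM gtr0_norm//.
have : `|1 - 2 * t| <= 1 by rewrite ler_norml; lra.
move=> h; have : d * `|1 - 2 * t| <= d by rewrite ler_piMr// ltW.
lra.
Qed.

Lemma Omega_closure z : Omegabar z -> closure Omega z.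
Proof.
move=> /OmegabarP[h1 h2] U [[V W] /= [/nbhs_ballP[d d0 dV] /nbhs_ballP[e e0 eW]] VWU].
have [s hs ds] := itv01_dense h1 d0; have [r hr er] := itv01_dense h2 e0.
exists (s, r); split; first exact/OmegaP.
by apply: VWU; split; [apply: dV|apply: eW].
Qed.

Lemma Omega_within_proper z : Omegabar z -> ProperFilter (within Omega (nbhs z)).
Proof. by move=> /Omega_closure h; exact: within_nbhs_proper. Qed.

Lemma Omega_sub z : Omega z -> Omegabar z.
Proof.
move=> /OmegaP[/andP[a1 a2] /andP[b1 b2]]; apply/OmegabarP.
by rewrite !ltW.
Qed.

(** The closed square is in the closure of the open one, so the limit is
    unique. *)
Lemma ext_eq g G z : cont2 G -> (forall z, Omega z -> g z = G z.1 z.2) -> Omegabar z ->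
  ext g z = G z.1 z.2.
Proof.
move=> cG gG zO; have PF := Omega_within_proper zO.
apply/cvg_lim => //.
have : (fun w : R * R => G w.1 w.2) @ within Omega (nbhs z) --> G z.1 z.2.
  by apply: cvg_trans (cG z); apply: cvg_app; exact: cvg_within.
apply: cvg_trans; apply: near_eq_cvg; near=> w; apply/esym/gG.
by near: w; exact: withinT.
Unshelve. all: by end_near. Qed.

Definition bar g x y : R := ext g (clamp x, clamp y).

Lemma bar_ext g x y : 0 <= x <= 1 -> 0 <= y <= 1 -> bar g x y = ext g (x, y).
Proof. by move=> hx hy; rewrite /bar !clamp_id. Qed.

Lemma bar_Omega g z : {in Omega, continuous g} -> Omega z -> g z = bar g z.1 z.2.
Proof.
move=> cg zO; have PF := Omega_within_proper (Omega_sub zO).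
move/OmegabarP: (Omega_sub zO) => [h1 h2].
rewrite bar_ext//; case: z => x y in zO PF h1 h2 *; apply/esym/cvg_lim => //=.
have c := cg (x, y) (mem_set zO).
by apply: cvg_trans c; apply: cvg_app; exact: cvg_within.
Qed.

(** Near z the values of g in the open square are close to ext g z, hence so
    are their limits at neighbouring points. *)
Lemma cont_bar g : (forall z, Omegabar z -> cvg (g w @[w --> within Omega (nbhs z)])) -> cont2 (bar g).
Proof.
move=> cg.
have main z : Omegabar z -> forall e : R, 0 < e ->
    \forall z' \near z, Omegabar z' -> `|ext g z - ext g z'| <= e.
  move=> zO e e0; have PF := Omega_within_proper zO.
  have /cvgrPdist_le /(_ e e0) h : g w @[w --> within Omega (nbhs z)] --> ext g z by exact: cg.
  have h' : nbhs z [set w | Omega w -> `|ext g z - g w| <= e] by exact: h.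
  have := nbhs_interior h'; apply: filterS => z' hz' z'O.
  have PF' := Omega_within_proper z'O.
  have hw : \forall w \near within Omega (nbhs z'), `|ext g z - g w| <= e by exact: hz'.
  have a1 : ext g z' <= ext g z + e.
    apply: limr_le; first exact: cg.
    by apply: filterS hw => w; rewrite ler_norml; lra.
  have a2 : ext g z - e <= ext g z'.
    apply: limr_ge; first exact: cg.
    by apply: filterS hw => w; rewrite ler_norml; lra.
  by rewrite ler_norml; lra.
move=> [x y]; apply/cvgrPdist_le => /= e e0.
have zO : Omegabar (clamp x, clamp y) by apply/OmegabarP; rewrite !clamp01.
have := main _ zO e e0 => H.
have cc : (fun z : R * R => (clamp z.1, clamp z.2)) @ (x, y) --> (clamp x, clamp y).
  have c1 : (fun z : R * R => clamp z.1) @ (x, y) --> clamp x.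
    exact: (continuous_comp (@cont_fst R (x, y)) (@cont_clamp x)).
  have c2 : (fun z : R * R => clamp z.2) @ (x, y) --> clamp y.
    exact: (continuous_comp (@cont_snd R (x, y)) (@cont_clamp y)).
  exact: (cvg_pair c1 c2).
have h' : \forall w \near (x, y), Omegabar (clamp w.1, clamp w.2) ->
    `|ext g (clamp x, clamp y) - ext g (clamp w.1, clamp w.2)| <= e by exact: (cc _ H).
near=> w; rewrite /bar /=; near: w; apply: filterS h' => w; apply.
by apply/OmegabarP; rewrite !clamp01.
Unshelve. all: by end_near.
Qed.

Lemma bar_closed g z : {within Omegabar, continuous g} -> Omegabar z -> g z = bar g z.1 z.2.
Proof.
move=> cg zO; have PF := Omega_within_proper zO.
move/OmegabarP: (zO) => [h1 h2].
rewrite bar_ext//; case: z => x y in zO PF h1 h2 *; apply/esym/cvg_lim => //=.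
have /subspace_continuousP /(_ _ zO) c := cg.
apply: cvg_trans c; apply: cvg_app; apply: within_subset; exact: Omega_sub.
Qed.

(** The integrated relation between g and G passes to the limit in y; its
    derivative in x is the claim. *)
Lemma dX_closure (G g : R -> R -> R) : cont2 G -> cont2 g ->
  (forall x y, 0 < x < 1 -> 0 < y < 1 -> is_derive x 1 (G ^~ y) (g x y)) -> dX 0 1 G g.
Proof.
move=> cG cg D; split=> // x y x01 hy.
have E : forall a b, 0 < a -> a <= b -> b < 1 -> I1 a b (g ^~ y) = G b y - G a y.
  move=> a b a0 ab b1.
  have cgi : continuous (fun y => I1 a b (g ^~ y)).
    by apply: (@cont_I1 _ (fun y x => g x y)); exact: cont2_swap.
  have cr : continuous (fun y => I1 a b (g ^~ y) - (G b y - G a y)).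
    apply: cont1D => //; apply: cont1N; apply: cont1D; first exact: (@cont2_s1 _ _ b cG).
    by apply: cont1N; exact: (@cont2_s1 _ _ a cG).
  apply/eqP; rewrite -subr_eq0 -normr_le0; apply/ler_addgt0Pr => e e0; rewrite add0r.
  have /cvgrPdist_le /(_ e e0) /nbhs_ballP[d d0 hd] := cr y.
  have [s hs ds] := itv01_dense hy d0.
  have := hd s ds; rewrite /= (_ : I1 a b (g ^~ s) = G b s - G a s) ?subrr ?subr0//.
  have cgs : continuous (g ^~ s) by exact: (@cont2_s2 _ _ s cg).
  have cGs : continuous (G ^~ s) by exact: (@cont2_s2 _ _ s cG).
  apply: (I1_FTC ab cgs cGs).
  by move=> t /andP[at_ tb]; apply: D => //; rewrite (lt_trans a0 at_) (lt_trans tb b1).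
(* The relation holds away from the sides x = 0 and x = 1 only, so the
   integral starts inside. *)
case/andP: x01 => x0 x1; pose a := x / 2.
have a0 : 0 < a by rewrite /a; lra.
have ax : a < x by rewrite /a; lra.
have D1 : is_derive x 1 (fun t => I1 a t (g ^~ y)) (g x y).
  exact: (I1_derive (@cont2_s2 _ _ y cg) ax).
have D2 := is_deriveD (is_derive_cst (G a y) x 1) D1.
rewrite add0r in D2; apply: (is_derive_near _ D2).
near=> t.
have a_t : a <= t by apply: ltW; near: t; exact: lt_nbhsr.
have t1 : t < 1 by near: t; exact: lt_nbhsl.
have e := E a t a0 a_t t1.
change (G a y + I1 a t (g ^~ y) = G t y); rewrite e; ring.
Unshelve. all: by end_near. Qed.

Lemma I1_eq0_cont (f : R -> R) a b : continuous f -> (forall x, a < x < b -> I1 a x f = 0) ->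
  forall x, a < x < b -> f x = 0.
Proof.
move=> cf H x /andP[ax xb].
have D := I1_derive cf ax.
have : is_derive x 1 (fun y => I1 a y f) (0 : R).
  have := is_derive_cst (0 : R) x 1; apply: is_derive_near; near=> t; rewrite H//.
  by apply/andP; split; near: t; [exact: lt_nbhsr|exact: lt_nbhsl].
by case: D => _ <- [_ <-].
Unshelve. all: by end_near. Qed.

(** The mixed difference of A over a rectangle is an iterated integral of D in
    one order; in the other order it says that B is a primitive of D in y. *)
Lemma dX_mixed (A B C D : R -> R -> R) : dX 0 1 A B ->
  dX 0 1 (fun y x => A x y) (fun y x => C x y) -> dX 0 1 C D ->
  dX 0 1 (fun y x => B x y) (fun y x => D x y).
Proof.
move=> AB AC CD; have [cA cB _] := AB; have [_ cC _] := AC; have [cC' cD _] := CD.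
apply: dX_closure; [exact: (cont2_swap cB)|exact: (cont2_swap cD)|] => y x /andP[y0 y1] x01.
pose c := y / 2; have c0 : 0 < c by rewrite /c; lra.
have cy : c < y by rewrite /c; lra.
have E t : 0 < t < 1 -> c <= t -> B x t - B x c - I1 c t (D x) = 0.
  case/andP => t0 t1 ct.
  pose f (z : R) := B z t - B z c - I1 c t (D z).
  have cf : continuous f.
    apply: cont1D; last by apply: cont1N; exact: cont_I1.
    by apply: cont1D; [exact: (@cont2_s2 _ _ t cB)|apply: cont1N; exact: (@cont2_s2 _ _ c cB)].
  apply: (@I1_eq0_cont f 0 1 cf _ x x01) => z /andP[z0 z1].
  have cI : continuous (fun z : R => I1 c t (D z)) by exact: cont_I1.
  have cBt : continuous (B ^~ t) by exact: (@cont2_s2 _ _ t cB).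
  have cBc : continuous (B ^~ c) by exact: (@cont2_s2 _ _ c cB).
  have cAz : continuous (C z) by exact: (@cont2_s1 _ _ z cC').
  have cA0 : continuous (C 0) by exact: (@cont2_s1 _ _ 0 cC').
  have h1 : I1 0 z (fun x => I1 c t (D x)) = I1 c t (fun y => I1 0 z (D ^~ y)) by exact: (I2_swap 0 z c t cD).
  have h2 : I1 c t (fun y => I1 0 z (D ^~ y)) = I1 c t (fun y => C z y - C 0 y).
    apply: eq_I1 => s /andP[cs st]; apply: (I1_dX (c := 0) (d := 1)) => //; [exact: ltW|exact: ltW|].
    by rewrite (le_trans (ltW c0) cs) (le_trans st (ltW t1)).
  have z01 : 0 <= z <= 1 by rewrite !ltW.
  have h3 : I1 c t (C z) = A z t - A z c by exact: (I1_dX (ltW c0) ct (ltW t1) z01 AC).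
  have h4 : I1 c t (C 0) = A 0 t - A 0 c.
    by apply: (I1_dX (ltW c0) ct (ltW t1) _ AC); rewrite lexx ler01.
  have h5 : I1 0 z (B ^~ t) = A z t - A 0 t.
    by apply: (I1_dX _ (ltW z0) (ltW z1) _ AB) => //; rewrite !ltW.
  have h6 : I1 0 z (B ^~ c) = A z c - A 0 c.
    by apply: (I1_dX _ (ltW z0) (ltW z1) _ AB) => //; rewrite (ltW c0) (le_trans ct (ltW t1)).
  rewrite /f I1B//; last by apply: cont1D => //; exact: cont1N.
  by rewrite I1B// h1 h2 I1B// h3 h4 h5 h6; ring.
have D1 : is_derive y 1 (fun t => I1 c t (D x)) (D x y).
  exact: (I1_derive (@cont2_s1 _ _ x cD) cy).
have D2 := is_deriveD (is_derive_cst (B x c) y 1) D1.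
rewrite add0r in D2; apply: (is_derive_near _ D2).
near=> t; have := E t.
have ct : c <= t by apply: ltW; near: t; exact: lt_nbhsr.
have t1 : t < 1 by near: t; exact: lt_nbhsl.
rewrite t1 (lt_le_trans c0 ct) => /(_ isT ct) e.
change (B x c + I1 c t (D x) = B x t); move: e; lra.
Unshelve. all: by end_near. Qed.

End Extension.

Section Chains.
Context {R : realType}.
Implicit Types (F g : R * R -> R) (G : R -> R -> R) (x y t : R) (n m i j : nat).

Definition mix F i j : R -> R -> R := bar (pd i j F).

Lemma Cm_iter_dy m F j : (j <= m)%N -> Cm m F -> Cm (m - j) (iter j dy F).
Proof.
move=> jm CF; elim: j jm => [|j IH] jm; first by rewrite subn0.
by have := IH (ltnW jm); rewrite -(subnSK jm) /= => -[_ []].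
Qed.

Lemma Cm_iter_dx m F i : (i <= m)%N -> Cm m F -> Cm (m - i) (iter i dx F).
Proof.
move=> im CF; elim: i im => [|i IH] im; first by rewrite subn0.
by have := IH (ltnW im); rewrite -(subnSK im) /= => -[_ []].
Qed.

Lemma Cm_pd m F i j : (i + j <= m)%N -> Cm m F -> Cm (m - (i + j)) (pd i j F).
Proof.
move=> ijm CF; rewrite addnC subnDA; apply: Cm_iter_dx; first by rewrite leq_subRL ?(leq_trans (leq_addl i j))// addnC.
by apply: Cm_iter_dy => //; exact: leq_trans (leq_addl i j) ijm.
Qed.

Lemma Cm_continuous m F : Cm m F -> {in Omega, continuous F}.
Proof. by case: m => [|m] []. Qed.

Lemma mix_Omega n F i j z : Cm n F -> (i + j <= n)%N -> Omega z -> pd i j F z = mix F i j z.1 z.2.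
Proof.
by move=> CF ij zO; apply: bar_Omega => //; apply: Cm_continuous (Cm_pd ij CF).
Qed.

Lemma near01 x : 0 < x < 1 -> \forall t \near x, 0 < t < 1.
Proof.
move=> /andP[x0 x1]; near=> t; apply/andP; split; near: t; [exact: lt_nbhsr|exact: lt_nbhsl].
Unshelve. all: by end_near. Qed.

(** The derivatives in x of pd i j are given; those in y are given for i = 0
    only and follow for larger i from the symmetry of mixed derivatives. *)
Lemma smooth_mix n F : Cmbar n F -> smooth2 n (mix F).
Proof.
move=> [_ CF cvF].
have cm i j : (i + j <= n)%N -> cont2 (mix F i j).
  by move=> ij; apply: cont_bar => z zO; exact: cvF.
have DX i j : (i + j < n)%N -> dX 0 1 (mix F i j) (mix F i.+1 j).
  move=> ij; apply: dX_closure; [exact: cm (ltnW ij)|exact: cm|] => x y hx hy.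
  have := Cm_pd (ltnW ij) CF; rewrite -(subnSK ij) => -[_ [D1 _ _ _]].
  have xyO : Omega (x, y) by exact/OmegaP.
  rewrite -(@mix_Omega n F i.+1 j (x, y) CF ij xyO).
  have := derivableP (D1 (x, y) xyO); rewrite -derive1E; apply: is_derive_near.
  have := near01 hx; apply: filterS => t ht.
  by rewrite (mix_Omega CF (ltnW ij))//; exact/OmegaP.
have DY0 j : (j < n)%N -> dX 0 1 (fun y x => mix F 0 j x y) (fun y x => mix F 0 j.+1 x y).
  move=> ij; apply: dX_closure; [exact: (cont2_swap (@cm 0%N j (ltnW ij)))|exact: (cont2_swap (@cm 0%N j.+1 ij))|] => y x hy hx.
  have := @Cm_pd n F 0 j (ltnW ij) CF; rewrite -(subnSK ij) => -[_ [_ D2 _ _]].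
  have xyO : Omega (x, y) by exact/OmegaP.
  rewrite -(@mix_Omega n F 0 j.+1 (x, y) CF ij xyO).
  have := derivableP (D2 (x, y) xyO); rewrite -derive1E; apply: is_derive_near.
  have := near01 hy; apply: filterS => t ht.
  by rewrite (@mix_Omega n F 0 j (x, t) CF (ltnW ij))//; exact/OmegaP.
split=> [//|i j ij]; split; first exact: DX.
elim: i j ij => [|i IH] j ij; first exact: DY0.
apply: (@dX_mixed R (mix F i j) (mix F i.+1 j) (mix F i j.+1) (mix F i.+1 j.+1)).
- by apply: DX; exact: ltnW.
- by apply: IH; exact: ltnW.
- by apply: DX; rewrite addnS.
Qed.

Lemma dx_eq g (G G' : R -> R -> R) : (forall z, Omega z -> g z = G z.1 z.2) -> dX 0 1 G G' ->
  forall z, Omega z -> dx g z = G' z.1 z.2.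
Proof.
move=> gG [_ _ D] [x y] xyO; have /OmegaP[/= hx /andP[y0 y1]] := xyO.
have D1 : is_derive x 1 (fun t => g (t, y)) (G' x y).
  have := D x y hx; rewrite !ltW// => /(_ isT); apply: is_derive_near.
  have := near01 hx; apply: filterS => t ht.
  by rewrite gG//; apply/OmegaP; rewrite y0.
by rewrite /dx derive1E; exact: derive_val.
Qed.

Lemma dy_eq g (G G' : R -> R -> R) : (forall z, Omega z -> g z = G z.1 z.2) ->
  dX 0 1 (fun y x => G x y) (fun y x => G' x y) ->
  forall z, Omega z -> dy g z = G' z.1 z.2.
Proof.
move=> gG [_ _ D] [x y] xyO; have /OmegaP[/= /andP[x0 x1] hy] := xyO.
have D1 : is_derive y 1 (fun t => g (x, t)) (G' x y).
  have := D y x hy; rewrite !ltW// => /(_ isT); apply: is_derive_near.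
  have := near01 hy; apply: filterS => t ht.
  by rewrite gG//; apply/OmegaP; rewrite x0.
by rewrite /dy derive1E; exact: derive_val.
Qed.

Lemma mix_closed n F z : Cmbar n F -> Omegabar z -> F z = mix F 0 0 z.1 z.2.
Proof. by move=> [cF _ _] zO; exact: bar_closed. Qed.

End Chains.

(** * Traces and forms of broken polynomials *)

Section Elements.
Context {R : realType} (k N : nat) (X : nat -> R).
Implicit Types (u v g : R * R -> R) (F G : R -> R -> R) (i j : nat).

(** The parts of the forms in y are those in x for the functions with
    exchanged variables. *)
Definition sw v : R * R -> R := fun z => v (z.2, z.1).

Definition on_elt v F i j : Prop :=
  forall x y, X i < x < X i.+1 -> X j < y < X j.+1 -> v (x, y) = F x y.

Lemma on_elt_sw v F i j : on_elt v F i j -> on_elt (sw v) (fun y x => F x y) j i.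
Proof. by move=> h x y hx hy; rewrite /sw /= h. Qed.

Lemma trxm_elt v F i j y : cont2 F -> X i < X i.+1 -> on_elt v F i j ->
  X j < y < X j.+1 -> trxm X v i.+1 y = F (X i.+1) y.
Proof.
move=> cF iX vF hy; apply/cvg_lim => //.
have : F x y @[x --> (X i.+1)^'-] --> F (X i.+1) y.
  by apply: cvg_at_left_filter; exact: (@cont2_s2 _ _ y cF).
apply: cvg_trans; apply: near_eq_cvg; near=> x; rewrite vF//.
by apply/andP; split; near: x; [exact: nbhs_left_gt|exact: nbhs_left_lt].
Unshelve. all: by end_near. Qed.

Lemma trxp_elt v F i j y : cont2 F -> X i < X i.+1 -> on_elt v F i j ->
  X j < y < X j.+1 -> trxp X v i y = F (X i) y.
Proof.
move=> cF iX vF hy; apply/cvg_lim => //.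
have : F x y @[x --> (X i)^'+] --> F (X i) y.
  by apply: cvg_at_right_filter; exact: (@cont2_s2 _ _ y cF).
apply: cvg_trans; apply: near_eq_cvg; near=> x; rewrite vF//.
by apply/andP; split; near: x; [exact: nbhs_right_gt|exact: nbhs_right_lt].
Unshelve. all: by end_near. Qed.

Lemma corner_elt v F i j : cont2 F -> X i < X i.+1 -> X j < X j.+1 -> on_elt v F i j ->
  corner X v i.+1 j.+1 = F (X i.+1) (X j.+1).
Proof.
move=> cF iX jX vF.
have PF : ProperFilter (within (Elt X i.+1 j.+1) (nbhs (X i.+1, X j.+1))).
  apply: within_nbhs_proper => U [[V W] /= [/nbhs_ballP[d d0 dV] /nbhs_ballP[e e0 eW]] VWU].
  have ex a b (r : R) : a < b -> 0 < r -> exists2 s, a < s < b & `|b - s| < r.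
    move=> ab r0; pose t := Num.min r (b - a).
    have t0 : 0 < t by rewrite lt_min r0 subr_gt0.
    have t1 : t <= b - a by rewrite ge_min lexx orbT.
    have t2 : t <= r by rewrite ge_min lexx.
    exists (b - t / 2); first by apply/andP; split; lra.
    by rewrite opprB addrC subrK gtr0_norm; lra.
  have [s hs ds] := ex _ _ d iX d0; have [r hr er] := ex _ _ e jX e0.
  exists (s, r); split; first by rewrite /Elt /Ival /= !in_itv /=.
  by apply: VWU; split; [apply: dV|apply: eW].
apply/cvg_lim => //.
have : (fun w : R * R => F w.1 w.2) @ within (Elt X i.+1 j.+1) (nbhs (X i.+1, X j.+1)) --> F (X i.+1) (X j.+1).
  by apply: cvg_trans (cF (X i.+1, X j.+1)); apply: cvg_app; exact: cvg_within.
apply: cvg_trans; apply: near_eq_cvg; near=> w.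
have [] : Elt X i.+1 j.+1 w by near: w; exact: withinT.
rewrite /Ival /= !in_itv /= => hx hy; rewrite -(vF _ _ hx hy); by case: (w).
Unshelve. all: by end_near. Qed.

Lemma dx_elt v (C : 'M[R]_k.+1) i j : on_elt v (ev C) i j -> on_elt (dx v) (evx C) i j.
Proof.
move=> vC x y /andP[x0 x1] hy.
have D : is_derive x 1 (fun t => v (t, y)) (evx C x y).
  have := is_derive_ev C x y; apply: is_derive_near; near=> t; rewrite vC//.
  by apply/andP; split; near: t; [exact: lt_nbhsr|exact: lt_nbhsl].
by rewrite /dx derive1E; exact: derive_val.
Unshelve. all: by end_near. Qed.

Lemma ip2_elt u v F i j : cont2 F -> on_elt (u \* v) F i j ->
  ip2 (Elt X i.+1 j.+1) u v = I2 (X i) (X i.+1) (X j) (X j.+1) F.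
Proof.
move=> cF uvF.
by have [h _] := @leb2_rectI2 R (X i) (X i.+1) (X j) (X j.+1) (u \* v) F cF uvF.
Qed.

Lemma ip1_itv (f g H : R -> R) j : continuous H ->
  (forall y, X j < y < X j.+1 -> f y * g y = H y) -> ip1 (Ival X j.+1) f g = I1 (X j) (X j.+1) H.
Proof. by move=> cH fgH; exact: I1_oo_eq. Qed.

Lemma ipN_S2 u v (F : nat -> nat -> R -> R -> R) :
  (forall i j, cont2 (F i j)) -> (forall i j, (i < N)%N -> (j < N)%N -> on_elt (u \* v) (F i j) i j) ->
  ipN N X u v = S2 N X F.
Proof.
move=> cF uvF; rewrite /ipN big_add1 big_mkord /S2 [RHS]exchange_big; apply: eq_bigr => i _.
by rewrite big_add1 big_mkord; apply: eq_bigr => j _; rewrite (@ip2_elt _ _ (F i j))//; exact: uvF.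
Qed.

End Elements.

Lemma alg_neg_sum (R : realType) (p q r l : R) : - (p + (q - r - l)) = - (p + q - r) + l.
Proof. ring. Qed.

Section Forms.
Context {R : realType} (k N : nat) (X : nat -> R).
Hypothesis N0 : (0 < N)%N.
Hypothesis X0 : X 0 = 0.
Hypothesis XN : X N = 1.
Hypothesis Xinc : forall i, (i < N)%N -> X i < X i.+1.
Implicit Types (u v U s P : R * R -> R) (A : R -> R -> R).

(** C i j is the coefficient matrix of v on the element (i, j), 1 <= i, j <=
    N. *)
Definition broken v (C : nat -> nat -> 'M[R]_k.+1) : Prop :=
  forall i j, (i < N)%N -> (j < N)%N -> on_elt X v (ev (C i.+1 j.+1)) i j.

Definition tr (C : nat -> nat -> 'M[R]_k.+1) i j := (C j i)^T.

Lemma broken_sw v C : broken v C -> broken (sw v) (tr C).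
Proof.
by move=> vC i j iN jN x y hx hy; rewrite /sw /tr /= ev_tr (vC j i).
Qed.

Lemma trxm_broken v C i j y : broken v C -> (i < N)%N -> (j < N)%N -> X j < y < X j.+1 ->
  trxm X v i.+1 y = ev (C i.+1 j.+1) (X i.+1) y.
Proof.
move=> vC iN jN hy; apply: (trxm_elt _ (Xinc iN) (vC i j iN jN) hy); exact: cont_ev.
Qed.

Lemma trxp_broken v C i j y : broken v C -> (i < N)%N -> (j < N)%N -> X j < y < X j.+1 ->
  trxp X v i y = ev (C i.+1 j.+1) (X i) y.
Proof.
move=> vC iN jN hy; apply: (trxp_elt _ (Xinc iN) (vC i j iN jN) hy); exact: cont_ev.
Qed.

Lemma jumpx_jmp v C i j y : broken v C -> (i <= N)%N -> (j < N)%N -> X j < y < X j.+1 ->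
  jumpx N X v i y = jmp N X (col C j) i y.
Proof.
move=> vC iN jN hy; rewrite /jumpx /jmp /col.
case: i iN => [|i] iN.
  by rewrite eqxx eq_sym (gtn_eqF N0) subr0 (trxp_broken vC _ jN hy).
rewrite /=; case: eqP => [E|/eqP NE].
  by rewrite (trxm_broken vC iN jN hy) sub0r.
by rewrite (trxp_broken vC _ jN hy) ?(trxm_broken vC iN jN hy)// ltn_neqAle NE.
Qed.

Lemma cont_jmp (C : nat -> 'M[R]_k.+1) i : continuous (jmp N X C i).
Proof.
have c1 : continuous (fun y => if i == N then 0 else ev (C i.+1) (X i) y).
  by case: (i == N); ct.
have c2 : continuous (fun y => if i == 0%N then 0 else ev (C i) (X i) y).
  by case: (i == 0%N); ct.
by rewrite /jmp; ct.
Qed.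

Lemma I1_jmp (C : nat -> 'M[R]_k.+1) i c d (W : R -> R) : continuous W ->
  I1 c d (fun y => W y * jmp N X C i y) =
  (if i == N then 0 else I1 c d (fun y => W y * ev (C i.+1) (X i) y)) -
  (if i == 0%N then 0 else I1 c d (fun y => W y * ev (C i) (X i) y)).
Proof.
move=> cW; rewrite /jmp; case: (i == N); case: (i == 0%N).
- by rewrite (@eq_I1 _ _ _ _ (fun=> 0)) ?I1_0 ?subrr// => y _; rewrite mulr0.
- rewrite sub0r -mulN1r -I1Z; last by ct.
  by apply: eq_I1 => y _; rewrite sub0r mulrN mulN1r.
- by rewrite subr0; apply: eq_I1 => y _; rewrite subr0.
- by rewrite -I1B; [apply: eq_I1 => y _; rewrite mulrBr|ct|ct].
Qed.

Lemma sum_from1 (f : nat -> R) : \sum_(1 <= i < N) f i = \sum_(i < N) (if (i : nat) == 0%N then 0 else f i).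
Proof.
case: N N0 => // n _; rewrite big_add1 /= big_mkord [RHS]big_ord_recl /= add0r.
by [].
Qed.

(** The parts in x of the forms; those in y are obtained through sw. *)
Definition T2x U s : R := ipN N X U (dx s)
  + \sum_(1 <= j < N.+1) \sum_(1 <= i < N) ip1 (Ival X j) (trxm X U i) (jumpx N X s i).

Definition T3x P v : R := ipN N X P (dx v)
  + \sum_(1 <= j < N.+1)
      (\sum_(0 <= i < N) ip1 (Ival X j) (trxp X P i) (jumpx N X v i)
       - ip1 (Ival X j) (trxm X P N) (trxm X v N)).

Definition T4x (a : R * R -> R) lam U v : R := - ipN N X (a \* U) (dx v)
  - \sum_(1 <= j < N.+1)
      (\sum_(1 <= i < N.+1)
         ip1 (Ival X j) (fun y => a (X i, y) * trxm X U i y) (jumpx N X v i)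
       - ip1 (Ival X j) (fun y => lam * trxm X U N y) (trxm X v N)).

Lemma ipN_dx U s CU Cs : broken U CU -> broken s Cs ->
  ipN N X U (dx s) = S2 N X (fun i j x y => ev (CU i.+1 j.+1) x y * evx (Cs i.+1 j.+1) x y).
Proof.
move=> hU hs; apply: ipN_S2 => [i j|i j iN jN x y hx hy]; first by ct.
by rewrite /= (hU i j)// (dx_elt (hs i j iN jN)).
Qed.

Lemma T2x_B2 U s CU Cs : broken U CU -> broken s Cs -> T2x U s = B2 N X CU Cs.
Proof.
move=> hU hs; rewrite /T2x (ipN_dx hU hs) big_add1 big_mkord /S2 -big_split /B2.
apply: eq_bigr => -[j jN] _ /=; rewrite /b2 sum_from1.
pose Af i := I1 (X j) (X j.+1) (fun y => ev (CU i j.+1) (X i) y * ev (Cs i.+1 j.+1) (X i) y).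
pose Bf i := I1 (X j) (X j.+1) (fun y => ev (CU i j.+1) (X i) y * ev (Cs i j.+1) (X i) y).
have E : \sum_(i < N) (if (i : nat) == 0%N then 0 else ip1 (Ival X j.+1) (trxm X U i) (jumpx N X s i))
  = \sum_(i < N) (if (i : nat) == 0%N then 0 else Af i) - \sum_(i < N) (if (i.+1)%N == N then 0 else Bf i.+1).
  rewrite tele_shift0// -sumrB; apply: eq_bigr => -[[|i] iN] _ /=; first by rewrite subrr.
  rewrite (@ip1_itv _ _ _ _ (fun y => ev (CU i.+1 j.+1) (X i.+1) y * jmp N X (col Cs j) i.+1 y)); last 2 first.
  - by have cj := @cont_jmp (col Cs j) i.+1; ct.
  - by move=> y hy; rewrite (trxm_broken hU (ltnW iN) jN hy) (jumpx_jmp hs (ltnW iN) jN hy).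
  by rewrite I1_jmp ?(ltn_eqF iN)//; ct.
rewrite E -sumrB -big_split; apply: eq_bigr => i _ /=; rewrite -addrA; by [].
Qed.

Lemma T3x_B3 P v CP Cv : broken P CP -> broken v Cv -> T3x P v = B3 N X CP Cv.
Proof.
move=> hP hv; rewrite /T3x (ipN_dx hP hv) big_add1 big_mkord /S2 -big_split /B3.
apply: eq_bigr => -[j jN] _ /=; rewrite /b3 big_mkord.
pose Af i := I1 (X j) (X j.+1) (fun y => ev (CP i.+1 j.+1) (X i) y * ev (Cv i.+1 j.+1) (X i) y).
pose Bf i := I1 (X j) (X j.+1) (fun y => ev (CP (if i == N then N else i.+1) j.+1) (X i) y * ev (Cv i j.+1) (X i) y).
have E1 : ip1 (Ival X j.+1) (trxm X P N) (trxm X v N) = Bf N.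
  have [n nE] : exists n, N = n.+1 by exists N.-1; rewrite prednK.
  rewrite /Bf eqxx; apply: ip1_itv; first by ct.
  move=> y hy; have nN : (n < N)%N by rewrite nE.
  by rewrite nE (trxm_broken hP nN jN hy) (trxm_broken hv nN jN hy).
have E : \sum_(i < N) ip1 (Ival X j.+1) (trxp X P i) (jumpx N X v i)
  = \sum_(i < N) Af i - \sum_(i < N) (if (i : nat) == 0%N then 0 else Bf i).
  rewrite -sumrB; apply: eq_bigr => -[i iN] _ /=.
  rewrite (@ip1_itv _ _ _ _ (fun y => ev (CP i.+1 j.+1) (X i) y * jmp N X (col Cv j) i y)); last 2 first.
  - by have cj := @cont_jmp (col Cv j) i; ct.
  - by move=> y hy; rewrite (trxp_broken hP iN jN hy) (jumpx_jmp hv (ltnW iN) jN hy).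
  by rewrite I1_jmp /Bf ?(ltn_eqF iN)//; ct.
have E2 := tele_shift Bf N0.
rewrite E1 E -addrA -opprD -E2 -sumrB -big_split; apply: eq_bigr => i _ /=.
by rewrite [LHS]addrA.
Qed.

Section Convection.
Variables (a : R * R -> R) (A : R -> R -> R) (lam : R).
Hypothesis cA : cont2 A.
Hypothesis aA : forall z, Omegabar z -> a z = A z.1 z.2.

Lemma Omegabar_line i j y : (i <= N)%N -> (j < N)%N -> X j < y < X j.+1 -> Omegabar (X i, y).
Proof.
move=> iN jN /andP[h1 h2]; apply/OmegabarP; rewrite /= (X_ge0 X0 Xinc)// (X_le1 XN Xinc)//; split=> //.
rewrite (le_trans (X_ge0 X0 Xinc (ltnW jN)) (ltW h1)).
by rewrite (le_trans (ltW h2))// (X_le1 XN Xinc).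
Qed.

Lemma Omega_elt i j x y : (i < N)%N -> (j < N)%N -> X i < x < X i.+1 -> X j < y < X j.+1 -> Omega (x, y).
Proof.
move=> iN jN /andP[x1 x2] /andP[y1 y2]; apply/OmegaP => /=.
rewrite (le_lt_trans (X_ge0 X0 Xinc (ltnW iN)) x1) (le_lt_trans (X_ge0 X0 Xinc (ltnW jN)) y1).
by rewrite (lt_le_trans x2 (X_le1 XN Xinc _))// (lt_le_trans y2 (X_le1 XN Xinc _)).
Qed.

Lemma T4x_B4 U v CU Cv : broken U CU -> broken v Cv -> T4x a lam U v = B4 N X A lam CU Cv.
Proof.
move=> hU hv; rewrite /T4x.
have -> : ipN N X (a \* U) (dx v) = S2 N X (fun i j x y => A x y * ev (CU i.+1 j.+1) x y * evx (Cv i.+1 j.+1) x y).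
  apply: ipN_S2 => [i j|i j iN jN x y hx hy]; first by ct.
  rewrite /= (hU i j)// (dx_elt (hv i j iN jN))// aA//.
  by apply: Omega_sub; exact: Omega_elt hx hy.
rewrite big_add1 big_mkord /S2 -opprD -big_split /B4 -sumrN.
apply: eq_bigr => -[j jN] _ /=; rewrite /b4 big_add1 big_mkord /=.
pose Af i := I1 (X j) (X j.+1) (fun y => A (X i) y * ev (CU i j.+1) (X i) y * ev (Cv i.+1 j.+1) (X i) y).
pose Bf i := I1 (X j) (X j.+1) (fun y => A (X i) y * ev (CU i j.+1) (X i) y * ev (Cv i j.+1) (X i) y).
have E1 : ip1 (Ival X j.+1) (fun y => lam * trxm X U N y) (trxm X v N) =
   I1 (X j) (X j.+1) (fun y => lam * ev (CU N j.+1) (X N) y * ev (Cv N j.+1) (X N) y).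
  have [n nE] : exists n, N = n.+1 by exists N.-1; rewrite prednK.
  apply: ip1_itv; first by ct.
  move=> y hy; have nN : (n < N)%N by rewrite nE.
  by rewrite nE (trxm_broken hU nN jN hy) (trxm_broken hv nN jN hy).
have E : \sum_(i < N) ip1 (Ival X j.+1) (fun y => a (X i.+1, y) * trxm X U i.+1 y) (jumpx N X v i.+1)
  = \sum_(i < N) (if (i.+1)%N == N then 0 else Af i.+1) - \sum_(i < N) Bf i.+1.
  rewrite -sumrB; apply: eq_bigr => -[i iN] _ /=.
  rewrite (@ip1_itv _ _ _ _ (fun y => A (X i.+1) y * ev (CU i.+1 j.+1) (X i.+1) y * jmp N X (col Cv j) i.+1 y)); last 2 first.
  - by have cj := @cont_jmp (col Cv j) i.+1; ct.
  - by move=> y hy; rewrite (trxm_broken hU iN jN hy) (jumpx_jmp hv iN jN hy) aA//; exact: Omegabar_line hy.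
  by rewrite (@I1_jmp _ _ _ _ (fun y => A (X i.+1) y * ev (CU i.+1 j.+1) (X i.+1) y))//; ct.
rewrite E1 E tele_shift0// [in RHS]sumrB [in RHS]big_split /=.
exact: alg_neg_sum.
Qed.

Lemma energyx v C : broken v C ->
  \sum_(1 <= j < N.+1)
        (\sum_(0 <= i < N) 2^-1 * ip1 (Ival X j) (fun y => a (X i, y)) (fun y => jumpx N X v i y ^+ 2)
         + ip1 (Ival X j) (fun y => 2^-1 * a (X N, y) + lam) (fun y => jumpx N X v N y ^+ 2))
  = \sum_(j < N) jump_energy N X (X j) (X j.+1) A lam (col C j).
Proof.
move=> hv; rewrite big_add1 big_mkord; apply: eq_bigr => -[j jN] _ /=.
rewrite /jump_energy big_mkord; congr (_ + _).
  apply: eq_bigr => -[i iN] _ /=; congr (_ * _).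
  apply: ip1_itv; first by have cj := @cont_jmp (col C j) i; ct.
  by move=> y hy; rewrite (jumpx_jmp hv (ltnW iN) jN hy) aA//; exact: Omegabar_line (ltnW iN) jN hy.
apply: ip1_itv; first by have cj := @cont_jmp (col C j) N; ct.
by move=> y hy; rewrite (jumpx_jmp hv (leqnn N) jN hy) aA//; exact: Omegabar_line (leqnn N) jN hy.
Qed.
End Convection.

End Forms.

(** * Integrals over the square *)

Section Gluing.
Context {R : realType} (N : nat) (X : nat -> R).
Hypothesis N0 : (0 < N)%N.
Hypothesis X0 : X 0 = 0.
Hypothesis XN : X N = 1.
Hypothesis Xinc : forall i, (i < N)%N -> X i < X i.+1.
Implicit Types (h : R * R -> R) (H : nat -> nat -> R -> R -> R).
Notation RR := (measurableTypeR R * measurableTypeR R)%type.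

Lemma X_mono i j : (i <= j)%N -> (j <= N)%N -> X i <= X j.
Proof.
elim: j => [|j IH] ij jN; first by move: ij; rewrite leqn0 => /eqP ->.
move: ij; rewrite leq_eqVlt => /orP[/eqP -> //|ij].
by apply: (le_trans (IH ij (ltnW jN))); exact: ltW (Xinc jN).
Qed.

Lemma interval_unique i j x : (i < N)%N -> (j < N)%N -> X i < x < X i.+1 -> X j < x < X j.+1 -> i = j.
Proof.
move=> iN jN /andP[i1 i2] /andP[j1 j2]; apply/eqP; rewrite eqn_leq; apply/andP; split.
  rewrite leqNgt; apply/negP => ji; have := X_mono ji (ltnW iN).
  by rewrite leNgt (lt_trans i1 j2).
rewrite leqNgt; apply/negP => ij; have := X_mono ij (ltnW jN).
by rewrite leNgt (lt_trans j1 i2).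
Qed.

Lemma interval_cover x : 0 < x < 1 -> (forall i, x != X i) -> exists2 i, (i < N)%N & X i < x < X i.+1.
Proof.
move=> /andP[x0 x1] xX.
have H n : (n <= N)%N -> x < X n -> exists2 i, (i < N)%N & X i < x < X i.+1.
  elim: n => [|n IH] nN xn; first by move: xn; rewrite X0 ltNge (ltW x0).
  have [h|h] := ltP x (X n); first exact: IH (ltnW nN) h.
  by exists n => //; rewrite lt_neqAle eq_sym xX h.
by apply: (H N (leqnn N)); rewrite XN.
Qed.

Lemma measurable_Elt i j : measurable (Elt X i j : set RR).
Proof. exact: mrect. Qed.

Lemma measurable_Omega : measurable (Omega : set RR).
Proof. exact: mrect. Qed.

Lemma Omega_fin : ((@leb2 R) Omega < +oo)%E.
Proof. exact: leb2_rect_fin. Qed.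

Lemma Elt_Omega i j : (i < N)%N -> (j < N)%N -> Elt X i.+1 j.+1 `<=` (Omega : set (R * R)).
Proof.
move=> iN jN [x y] [] /=; rewrite /Ival /= !in_itv /= => hx hy.
exact: (Omega_elt X0 XN Xinc iN jN hx hy).
Qed.

(** The lines through the nodes, on which a broken polynomial may take any
    values. *)
Definition grid : set RR := \bigcup_n ([set X n] `*` setT) `|` \bigcup_n (setT `*` [set X n]).

Lemma grid_negligible : (@leb2 R).-negligible grid.
Proof.
have m1 n : measurable ([set X n] : set (measurableTypeR R)) by exact: measurable_set1.
apply: negligibleU; apply: negligible_bigcup => n.
  apply/negligibleP; first exact: measurableX.
  apply: (etrans (leb2_rectE (m1 n) measurableT)).
  by rewrite (lebesgue_measure_set1 (X n)) mul0e.
apply/negligibleP; first exact: measurableX.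
apply: (etrans (leb2_rectE measurableT (m1 n))).
by rewrite (lebesgue_measure_set1 (X n)) mule0.
Qed.

Lemma grid_cover z : Omega z -> ~ grid z -> exists i j, [/\ (i < N)%N, (j < N)%N & Elt X i.+1 j.+1 z].
Proof.
case: z => x y /OmegaP[/= hx hy] ng.
have [|i iN hi] := interval_cover hx.
  by move=> i; apply/eqP => xX; apply: ng; left; exists i.
have [|j jN hj] := interval_cover hy.
  by move=> j; apply/eqP => yX; apply: ng; right; exists j.
by exists i, j; split => //; rewrite /Elt /Ival /= !in_itv.
Qed.

Definition glue H (z : R * R) : R :=
  \sum_(j < N) \sum_(i < N) ((fun z => H i j z.1 z.2) \_ (Elt X i.+1 j.+1)) z.

Lemma glue_elt H i j : (i < N)%N -> (j < N)%N -> on_elt X (glue H) (H i j) i j.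
Proof.
move=> iN jN x y hx hy; rewrite /glue.
have P (i' j' : 'I_N) : ((i' : nat) != i) || ((j' : nat) != j) ->
    ((fun z : R * R => H i' j' z.1 z.2) \_ (Elt X i'.+1 j'.+1)) (x, y) = 0.
  move=> ne; rewrite patchE; case: ifPn => //; rewrite inE => -[] /=; rewrite /Ival /= !in_itv /= => hx' hy'.
  by move: ne; rewrite (interval_unique (ltn_ord i') iN hx' hx) (interval_unique (ltn_ord j') jN hy' hy) !eqxx.
rewrite (bigD1 (Ordinal jN))//= [X in _ + X]big1 ?addr0; last first.
  move=> j' jj; apply: big1 => i' _; apply: P; apply/orP; right.
  by move: jj; rewrite -val_eqE.
rewrite (bigD1 (Ordinal iN))//= [X in _ + X]big1 ?addr0; last first.
  by move=> i' ii; apply: (P i' (Ordinal jN)); apply/orP; left; move: ii; rewrite -val_eqE.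
by rewrite patchE ifT// inE /Elt /Ival /= !in_itv.
Qed.

Section Integral.
Variable H : nat -> nat -> R -> R -> R.
Hypothesis cH : forall i j, cont2 (H i j).

Lemma measurable_glue (D : set RR) : measurable D -> measurable_fun D (glue H).
Proof.
move=> mD; apply: measurable_sum => j; apply: measurable_sum => i.
apply/measurable_restrict => //; first exact: measurable_Elt.
by apply: cont2_measurable => //; apply: measurableI => //; exact: measurable_Elt.
Qed.

(** Outside the negligible grid h agrees with a finite sum of continuous
    functions restricted to elements. *)
Lemma integral_Omega h : measurable_fun (Omega : set RR) h ->
  (forall i j, (i < N)%N -> (j < N)%N -> on_elt X h (H i j) i j) ->
  \int[leb2]_(z in Omega) h z = S2 N X H.
Proof.
move=> mh hH.
have ae : ae_eq (@leb2 R) Omega (EFin \o h) (EFin \o glue H).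
  apply: negligibleS grid_negligible => z; apply: contra_notP => ng zO /=.
  have [i [j [iN jN hz]]] := grid_cover zO ng.
  case: z zO ng hz => x y _ _ [] /=; rewrite /Ival /= !in_itv /= => hx hy.
  by rewrite (hH i j iN jN)// (glue_elt H iN jN).
rewrite /Rintegral (ae_eq_integral _ _ measurable_Omega _ _ ae); last 2 first.
- exact/measurable_realfun.measurable_EFinP.
- by apply/measurable_realfun.measurable_EFinP; apply: measurable_glue; exact: measurable_Omega.
pose G i j (z : RR) : \bar R := ((fun z : RR => (H i j z.1 z.2)%:E) \_ (Elt X i.+1 j.+1)) z.
have -> : (\int[leb2]_(z in Omega) (EFin \o glue H) z = \int[leb2]_(z in Omega) (\sum_(j < N) \sum_(i < N) G i j z))%E.
  apply: eq_integral => z _; rewrite /= /glue -sumEFin; apply: eq_bigr => j _.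
  rewrite -sumEFin; apply: eq_bigr => i _; rewrite /G !patchE.
  by case: ifP.
have iG (i j : 'I_N) : (@leb2 R).-integrable Omega (G i j).
  have mO := measurable_Omega; have mE := @measurable_Elt i.+1 j.+1.
  rewrite /G; apply/(integrable_mkcond _ mO); rewrite -patch_setI.
  have mI := measurableI _ _ mO mE; apply/(integrable_mkcond _ mI).
  have sI : Omega `&` Elt X i.+1 j.+1 `<=` Elt X i.+1 j.+1 by move=> z [].
  apply: (integrableS mE mI sI); exact: leb2_rect_int.
have iG2 (j : 'I_N) : (@leb2 R).-integrable Omega (fun z => \sum_(i < N) G i j z)%E.
  exact: (@integrable_sum _ _ _ (@leb2 R) Omega measurable_Omega 'I_N _ xpredT (fun i => G i j) (fun i _ => iG i j)).
rewrite (integral_sum measurable_Omega iG2).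
have -> : (\sum_(j < N) \int[leb2]_(z in Omega) (\sum_(i < N) G i j z) =
   \sum_(j < N) \sum_(i < N) (I2 (X i) (X i.+1) (X j) (X j.+1) (H i j))%:E)%E.
  apply: eq_bigr => j _; rewrite (integral_sum measurable_Omega (fun i : 'I_N => iG i j)).
  apply: eq_bigr => i _; rewrite /G -integral_mkcondr (setIidr (Elt_Omega (ltn_ord i) (ltn_ord j))).
  have [<- _] := @leb2_rectI2 R (X i) (X i.+1) (X j) (X j.+1) (fun z => H i j z.1 z.2) (H i j) (@cH i j) (fun x y _ _ => erefl).
  rewrite /Rintegral fineK//; apply: integrable_fin_num; [exact: mrect|exact: leb2_rect_int].
rewrite /S2 -[RHS]/(fine (\sum_(j < N) \sum_(i < N) I2 (X i) (X i.+1) (X j) (X j.+1) (H i j))%:E).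
by congr fine; rewrite -sumEFin; apply: eq_bigr => j _; rewrite sumEFin.
Qed.

Lemma glue_inL2 : inL2 Omega (glue H).
Proof.
have mg := measurable_glue measurable_Omega.
split=> //; have : (@leb2 R).-integrable (Omega : set RR) (EFin \o (fun z => glue H z ^+ 2)).
  apply: measurable_bounded_integrable; [exact: measurable_Omega|exact: Omega_fin|exact: measurable_realfun.measurable_funX|].
  have bd (i j : 'I_N) : {M : R | forall z, `|((fun z => H i j z.1 z.2) \_ (Elt X i.+1 j.+1)) z| <= M}.
    apply: cid; have [M [M0 MH]] := cont2_bounded (X i) (X i.+1) (X j) (X j.+1) (@cH i j).
    exists M => -[x y]; rewrite patchE; case: ifPn => [|_]; last by rewrite normr0.
    rewrite inE => -[] /=; rewrite /Ival /= !in_itv /= => /andP[a b] /andP[c d].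
    by apply: MH; rewrite !ltW.
  exists ((\sum_(j < N) \sum_(i < N) sval (bd i j)) ^+ 2); split; first exact: num_real.
  move=> M MM z _ /=; apply: le_trans (ltW MM).
  rewrite normrX; have h : `|glue H z| <= \sum_(j < N) \sum_(i < N) sval (bd i j).
    rewrite /glue; apply: (le_trans (ler_norm_sum _ _ _)); apply: ler_sum => j _.
    apply: (le_trans (ler_norm_sum _ _ _)); apply: ler_sum => i _.
    exact: (svalP (bd i j) z).
  by rewrite lerXn2r ?nnegrE// (le_trans _ h).
by [].
Qed.

End Integral.
End Gluing.

(** * Gauss-Radau projections as tensor products *)

Section TensorDofs.
Context {R : realType} (k : nat) (a b c d : R).
Hypothesis ab : a < b.
Hypothesis cd : c < d.
Implicit Types (F G : R -> R -> R) (K : proj_kind).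

Definition tproj K K' F x y := proj k K a b (fun s => proj k K' c d (F s) y) x.

(** The projection sees a function through its tensor-product degrees of
    freedom only. *)
Lemma eq_tproj K K' F G : cont2 F -> cont2 G ->
  (forall l m, (l < k.+1)%N -> (m < k.+1)%N ->
     dof k K a b l (fun s => dof k K' c d m (F s)) = dof k K a b l (fun s => dof k K' c d m (G s))) ->
  forall x y, tproj K K' F x y = tproj K K' G x y.
Proof.
move=> cF cG FG x y; rewrite /tproj /proj; apply: eq_bigr => l _; congr (_ * _).
rewrite dof_sum; last by move=> m; exact: cont_dof.
rewrite dof_sum; last by move=> m; exact: cont_dof.
by apply: eq_bigr => m _; rewrite FG.
Qed.

Lemma tproj_ev K K' (C : 'M[R]_k.+1) x y : tproj K K' (ev C) x y = ev C x y.
Proof.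
rewrite /tproj.
have E s : proj k K' c d (ev C s) y = ev C s y.
  have -> : ev C s = horner (polx C^T s) by apply/funext => t; rewrite -evE ev_tr.
  by rewrite proj_id// size_polx.
have -> : (fun s => proj k K' c d (ev C s) y) = horner (polx C y).
  by apply/funext => s; rewrite E evE.
by rewrite proj_id ?size_polx// -evE.
Qed.

Lemma monomial_poly e f l : exists2 p : {poly R}, (size p <= l.+1)%N & forall s, ((s - e) / (f - e)) ^+ l = p.[s].
Proof.
have [p sp pE] := scaled_poly ('X^l : {poly R}) e f.
by exists p => [|s]; [rewrite size_polyXn in sp|rewrite pE hornerXn].
Qed.

Lemma tdof_moment K K' l m : is_moment k K l -> is_moment k K' m ->
  exists (e : R) (p q : {poly R}), [/\ (size p <= l.+1)%N, (size q <= m.+1)%N &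
    forall F, cont2 F -> dof k K a b l (fun s => dof k K' c d m (F s)) = e * I2 a b c d (fun s t => F s t * (p.[s] * q.[t]))].
Proof.
move=> Kl Km; have [p sp pE] := monomial_poly a b l; have [q sq qE] := monomial_poly c d m.
exists ((b - a)^-1 * (d - c)^-1), p, q; split=> // F cF.
rewrite /dof Kl Km -mulrA; congr (_ * _).
have cI (r : R) : continuous (fun s => I1 c d (fun t => F s t * q.[t])).
  by apply: (@cont_I1 _ (fun s t => F s t * q.[t])); ct.
rewrite /I2 -I1Z; last first.
  by apply: (@cont_I1 _ (fun s t => F s t * (p.[s] * q.[t]))); ct.
apply: eq_I1 => s _; rewrite pE -mulrA; congr (_ * _).
rewrite mulrC -I1Z; last first.
  have -> : (fun t => F s t * ((t - c) / (d - c)) ^+ m) = (fun t => F s t * q.[t]).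
    by apply/funext => t; rewrite qE.
  by have h := @cont2_s1 _ _ s cF; ct.
by apply: eq_I1 => t _; rewrite qE mulrCA.
Qed.

End TensorDofs.

Section DofValues.
Context {R : realType} (k : nat).
Implicit Types (c d : R) (g : R -> R).

Lemma dof_right c d g : dof k Radau_right c d k g = g d.
Proof. by rewrite /dof /is_moment ltnn. Qed.

Lemma dof_left c d g : dof k Radau_left c d k g = g c.
Proof. by rewrite /dof /is_moment ltnn. Qed.

Lemma dof_mom K c d m g : is_moment k K m ->
  dof k K c d m g = (d - c)^-1 * I1 c d (fun y => g y * ((y - c) / (d - c)) ^+ m).
Proof. by rewrite /dof => ->. Qed.
End DofValues.

Section GaussRadau.
Context {R : realType} (k N : nat) (X : nat -> R).
Hypothesis k1 : (1 <= k)%N.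
Implicit Types (F : R -> R -> R) (v z g : R * R -> R) (C : 'M[R]_k.+1).

Lemma polyQ_tensor (p q : {poly R}) m n : (size p <= m.+1)%N -> (size q <= n.+1)%N ->
  polyQ m n (fun z : R * R => p.[z.1] * q.[z.2]).
Proof.
move=> sp sq; exists (\matrix_(r, s) (p`_r * q`_s)) => x y /=.
rewrite (horner_coef_wide _ sp) (horner_coef_wide _ sq) mulr_suml.
apply: eq_bigr => r _; rewrite mulr_sumr; apply: eq_bigr => s _.
by rewrite mxE; ring.
Qed.

Section OneElement.
Variables (i j : nat) (v z : R * R -> R) (C : 'M[R]_k.+1) (F : R -> R -> R).
Hypothesis iX : X i < X i.+1.
Hypothesis jX : X j < X j.+1.
Hypothesis cF : cont2 F.
Hypothesis vC : on_elt X v (ev C) i j.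
Hypothesis zF : on_elt X z F i j.

Lemma moments_eq m n (p q : {poly R}) : (size p <= m.+1)%N -> (size q <= n.+1)%N ->
  (forall g, polyQ m n g -> ip2 (Elt X i.+1 j.+1) v g = ip2 (Elt X i.+1 j.+1) z g) ->
  I2 (X i) (X i.+1) (X j) (X j.+1) (fun s t => ev C s t * (p.[s] * q.[t]))
  = I2 (X i) (X i.+1) (X j) (X j.+1) (fun s t => F s t * (p.[s] * q.[t])).
Proof.
move=> sp sq H; have := H _ (polyQ_tensor sp sq).
rewrite (@ip2_elt _ _ _ _ (fun s t => ev C s t * (p.[s] * q.[t]))); last 2 first.
- by ct.
- by move=> x y hx hy; rewrite /= vC.
rewrite (@ip2_elt _ _ _ _ (fun s t => F s t * (p.[s] * q.[t]))) //; first by ct.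
by move=> x y hx hy; rewrite /= zF.
Qed.

Lemma line_moments_eq (f g h r : R -> R) n l :
  continuous h -> continuous r -> (forall y, X n < y < X n.+1 -> f y = h y) ->
  (forall y, X n < y < X n.+1 -> g y = r y) -> (l < k.+1)%N -> X n < X n.+1 ->
  (forall q : {poly R}, (size q <= l.+1)%N ->
        ip1 (Ival X n.+1) f (horner q) = ip1 (Ival X n.+1) g (horner q)) ->
  (X n.+1 - X n)^-1 * I1 (X n) (X n.+1) (fun y => h y * ((y - X n) / (X n.+1 - X n)) ^+ l) =
  (X n.+1 - X n)^-1 * I1 (X n) (X n.+1) (fun y => r y * ((y - X n) / (X n.+1 - X n)) ^+ l).
Proof.
move=> ch cr fh gr lk nX H; have [q sq qE] := monomial_poly (X n) (X n.+1) l.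
have := H q sq; rewrite (@ip1_itv _ _ _ _ (fun y => h y * q.[y])); [|by ct|by move=> y hy; rewrite fh].
rewrite (@ip1_itv _ _ _ _ (fun y => r y * q.[y])); [|by ct|by move=> y hy; rewrite gr].
move=> E; congr (_ * _).
rewrite (@eq_I1 _ _ _ _ (fun y => h y * q.[y])); last by move=> y _; rewrite qE.
by rewrite E; apply: eq_I1 => y _; rewrite qE.
Qed.

(** The four groups of conditions prescribe the tensor-product degrees of
    freedom: moment or end-point value in x combined with moment or end-point
    value in y. *)
Lemma GR_minus_elt :
  (forall g, polyQ k.-1 k.-1 g -> ip2 (Elt X i.+1 j.+1) v g = ip2 (Elt X i.+1 j.+1) z g) ->
  (forall q : {poly R}, (size q <= k)%N ->
        ip1 (Ival X j.+1) (trxm X v i.+1) (horner q) = ip1 (Ival X j.+1) (trxm X z i.+1) (horner q)) ->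
  (forall q : {poly R}, (size q <= k)%N ->
        ip1 (Ival X i.+1) (trym X v j.+1) (horner q) = ip1 (Ival X i.+1) (trym X z j.+1) (horner q)) ->
  corner X v i.+1 j.+1 = corner X z i.+1 j.+1 ->
  forall x y, ev C x y = tproj k (X i) (X i.+1) (X j) (X j.+1) Radau_right Radau_right F x y.
Proof.
move=> H1 H2 H3 H4 x y.
rewrite -(tproj_ev iX jX Radau_right Radau_right C).
have ce : cont2 (ev C) by exact: cont_ev.
apply: eq_tproj => // l m; rewrite !ltnS.
rewrite leq_eqVlt => /orP[/eqP ->|lk]; rewrite leq_eqVlt => /orP[/eqP ->|mk].
- rewrite !dof_right.
  have := H4; rewrite (corner_elt ce iX jX vC) (corner_elt cF iX jX zF); exact.
- have Km : is_moment k Radau_right m by rewrite /is_moment mk.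
  rewrite !dof_right !dof_mom//.
  apply: (@line_moments_eq (trxm X v i.+1) (trxm X z i.+1) (ev C (X i.+1)) (F (X i.+1))) => //.
  + by ct.
  + by ct.
  + by move=> t ht; rewrite (trxm_elt ce iX vC ht).
  + by move=> t ht; rewrite (trxm_elt cF iX zF ht).
  + exact: ltnW.
  + by move=> q sq; apply: H2; exact: leq_trans sq mk.
- have Kl : is_moment k Radau_right l by rewrite /is_moment lk.
  under [in LHS]eq_fun do rewrite dof_right; under [in RHS]eq_fun do rewrite dof_right.
  rewrite !dof_mom//.
  have ce' : cont2 (fun t s => ev C s t) by exact: cont2_swap ce.
  have cF' : cont2 (fun t s => F s t) by exact: cont2_swap cF.
  apply: (@line_moments_eq (trym X v j.+1) (trym X z j.+1) (ev C ^~ (X j.+1)) (F ^~ (X j.+1))) => //.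
  + by ct.
  + by ct.
  + by move=> t ht; exact: (trxm_elt ce' jX (on_elt_sw vC) ht).
  + by move=> t ht; exact: (trxm_elt cF' jX (on_elt_sw zF) ht).
  + exact: ltnW.
  + by move=> q sq; apply: H3; exact: leq_trans sq lk.
- have Kl : is_moment k Radau_right l by rewrite /is_moment lk.
  have Km : is_moment k Radau_right m by rewrite /is_moment mk.
  have [e [p [q [sp sq E]]]] := @tdof_moment R k (X i) (X i.+1) (X j) (X j.+1) _ _ l m Kl Km.
  rewrite (E _ ce) (E _ cF); congr (_ * _); apply: moments_eq H1; rewrite prednK//.
    exact: leq_trans sp lk.
  exact: leq_trans sq mk.
Qed.

(** In y all k + 1 moments are prescribed, both inside the element and on its
    left side, so the factor in y is the L2 projection. *)
Lemma GR_xplus_elt :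
  (forall g, polyQ k.-1 k g -> ip2 (Elt X i.+1 j.+1) v g = ip2 (Elt X i.+1 j.+1) z g) ->
  (forall q : {poly R}, (size q <= k.+1)%N ->
     ip1 (Ival X j.+1) (trxp X v i) (horner q) = ip1 (Ival X j.+1) (trxp X z i) (horner q)) ->
  forall x y, ev C x y = tproj k (X i) (X i.+1) (X j) (X j.+1) Radau_left Orthogonal F x y.
Proof.
move=> H1 H2 x y.
rewrite -(tproj_ev iX jX Radau_left Orthogonal C).
have ce : cont2 (ev C) by exact: cont_ev.
apply: eq_tproj => // l m; rewrite ltnS.
have Km : is_moment k Orthogonal m by rewrite /is_moment orbT.
rewrite leq_eqVlt => /orP[/eqP ->|lk] mk.
  rewrite !dof_left !dof_mom//.
  apply: (@line_moments_eq (trxp X v i) (trxp X z i) (ev C (X i)) (F (X i))) => //.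
  - by ct.
  - by ct.
  - by move=> t ht; rewrite (trxp_elt ce iX vC ht).
  - by move=> t ht; rewrite (trxp_elt cF iX zF ht).
  - by move=> q sq; apply: H2; exact: leq_trans sq mk.
have Kl : is_moment k Radau_left l by rewrite /is_moment lk.
have [e [p [q [sp sq E]]]] := @tdof_moment R k (X i) (X i.+1) (X j) (X j.+1) _ _ l m Kl Km.
rewrite (E _ ce) (E _ cF); congr (_ * _); apply: moments_eq H1; last exact: leq_trans sq mk.
rewrite prednK//; exact: leq_trans sp lk.
Qed.

End OneElement.

Lemma polyQ_sw g m n : polyQ m n g -> polyQ n m (sw g).
Proof.
move=> [c gc]; exists c^T => x y; rewrite /sw /= gc exchange_big.
by apply: eq_bigr => s _; apply: eq_bigr => r _; rewrite mxE mulrAC.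
Qed.

Lemma polyQ_cont g m n : polyQ m n g -> cont2 (fun x y => g (x, y)).
Proof.
move=> [c gc]; have -> : (fun x y => g (x, y)) = (fun x y => \sum_(r < m.+1) \sum_(s < n.+1) c r s * x ^+ r * y ^+ s).
  by apply/funext => x; apply/funext => y; rewrite gc.
apply: cont2_sum => r; apply: cont2_sum => s.
have h n' : continuous (fun x : R => x ^+ n') by apply: cont1X; exact: cont1_id.
by ct.
Qed.

Lemma ip2_sw i j v g F m n : cont2 F -> on_elt X v F i j -> polyQ m n g ->
  ip2 (Elt X j.+1 i.+1) (sw v) (sw g) = ip2 (Elt X i.+1 j.+1) v g.
Proof.
move=> cF vF gQ; have cg := polyQ_cont gQ.
rewrite (@ip2_elt _ _ _ _ (fun y x => F x y * g (x, y))); last 2 first.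
- by apply: (@cont2_swap _ (fun x y => F x y * g (x, y))); ct.
- by move=> y x hy hx; rewrite /sw /= vF.
rewrite (@ip2_elt _ _ _ _ (fun x y => F x y * g (x, y))); last 2 first.
- by ct.
- by move=> x y hx hy; rewrite /= vF.
by rewrite [RHS]I2_swap//; ct.
Qed.

Lemma GR_yplus_elt i j v z C F : X i < X i.+1 -> X j < X j.+1 -> cont2 F ->
  on_elt X v (ev C) i j -> on_elt X z F i j ->
  (forall g, polyQ k k.-1 g -> ip2 (Elt X i.+1 j.+1) v g = ip2 (Elt X i.+1 j.+1) z g) ->
  (forall q : {poly R}, (size q <= k.+1)%N ->
     ip1 (Ival X i.+1) (tryp X v j) (horner q) = ip1 (Ival X i.+1) (tryp X z j) (horner q)) ->
  forall x y, ev C^T y x = tproj k (X j) (X j.+1) (X i) (X i.+1) Radau_left Orthogonal (fun t s => F s t) y x.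
Proof.
move=> iX jX cF vC zF H1 H2 x y.
have vC' : on_elt X (sw v) (ev C^T) j i.
  by move=> t s ht hs; rewrite ev_tr /sw /= vC.
apply: (GR_xplus_elt jX iX (cont2_swap cF) vC' (on_elt_sw zF)) => [g gQ|q sq]; last exact: H2.
have gQ' := polyQ_sw gQ; have gE : g = sw (sw g) by apply/funext => -[].
rewrite gE (@ip2_sw i j v _ (ev C) k k.-1)//; last by exact: cont_ev.
rewrite (@ip2_sw i j z _ F k k.-1)//; exact: H1.
Qed.

End GaussRadau.

(** * The bilinear form on families of coefficients *)

Section Linearity.
Context {R : realType} (k N : nat) (X : nat -> R) (c d : R).
Implicit Types (U V P Q s v : nat -> 'M[R]_k.+1) (C D E : 'M[R]_k.+1) (W G : R -> R -> R) (w g : R -> R).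

Lemma I2_evB a b C D G : cont2 G ->
  I2 a b c d (fun x y => ev (C - D) x y * G x y) =
  I2 a b c d (fun x y => ev C x y * G x y) - I2 a b c d (fun x y => ev D x y * G x y).
Proof.
by move=> cG; rewrite -I2B; [apply: eq_I2 => x y _ _; rewrite evB mulrBl|ct|ct].
Qed.

Lemma I1_evB x C D g : continuous g ->
  I1 c d (fun y => ev (C - D) x y * g y) =
  I1 c d (fun y => ev C x y * g y) - I1 c d (fun y => ev D x y * g y).
Proof.
by move=> cg; rewrite -I1B; [apply: eq_I1 => y _; rewrite evB mulrBl|ct|ct].
Qed.

Lemma I2_wevB a b W C D G : cont2 W -> cont2 G ->
  I2 a b c d (fun x y => W x y * ev (C - D) x y * G x y) =
  I2 a b c d (fun x y => W x y * ev C x y * G x y) - I2 a b c d (fun x y => W x y * ev D x y * G x y).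
Proof.
by move=> cW cG; rewrite -I2B; [apply: eq_I2 => x y _ _; rewrite evB mulrBr mulrBl|ct|ct].
Qed.

Lemma I1_wevB x w C D g : continuous w -> continuous g ->
  I1 c d (fun y => w y * ev (C - D) x y * g y) =
  I1 c d (fun y => w y * ev C x y * g y) - I1 c d (fun y => w y * ev D x y * g y).
Proof.
by move=> cw cg; rewrite -I1B; [apply: eq_I1 => y _; rewrite evB mulrBr mulrBl|ct|ct].
Qed.

Lemma alg3B (a a' b b' e e' : R) : a - a' + (b - b') - (e - e') = (a + b - e) - (a' + b' - e').
Proof. ring. Qed.

Lemma ifB (t : bool) (a b : R) : (if t then 0 else a - b) = (if t then 0 else a) - (if t then 0 else b).
Proof. by case: t; rewrite ?subrr. Qed.

Lemma b2B U V s : b2 N X c d (fun i => U i - V i) s = b2 N X c d U s - b2 N X c d V s.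
Proof.
rewrite /b2 -sumrB; apply: eq_bigr => i _.
rewrite I2_evB; last by ct.
rewrite I1_evB; last by ct.
rewrite I1_evB; last by ct.
by rewrite !ifB alg3B.
Qed.

Lemma b3B P Q v : b3 N X c d (fun i => P i - Q i) v = b3 N X c d P v - b3 N X c d Q v.
Proof.
rewrite /b3 -sumrB; apply: eq_bigr => i _.
rewrite I2_evB; last by ct.
rewrite I1_evB; last by ct.
rewrite I1_evB; last by ct.
by rewrite alg3B.
Qed.

Lemma b4B a lam U V v : cont2 a ->
  b4 N X c d a lam (fun i => U i - V i) v = b4 N X c d a lam U v - b4 N X c d a lam V v.
Proof.
move=> ca; rewrite /b4 I1_wevB; [|ct|ct].
have E (p q r s t : R) : t = p - q -> - t + (r - s) = - p + r - (- q + s) by move=> ->; ring.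
apply: E; rewrite -sumrB; apply: eq_bigr => i _.
rewrite I2_wevB; [|ct|ct].
rewrite I1_wevB; [|ct|ct].
rewrite I1_wevB; [|ct|ct].
by rewrite !ifB alg3B.
Qed.

Lemma I2_mul0 a b (F : R -> R -> R) (G : R -> R -> R) : (forall x y, G x y = 0) -> I2 a b c d (fun x y => F x y * G x y) = 0.
Proof. by move=> G0; rewrite -[RHS](I2_0 a b c d); apply: eq_I2 => x y _ _; rewrite G0 mulr0. Qed.

Lemma I1_mul0 (f g : R -> R) : (forall y, g y = 0) -> I1 c d (fun y => f y * g y) = 0.
Proof. by move=> g0; rewrite -[RHS](I1_0 c d); apply: eq_I1 => y _; rewrite g0 mulr0. Qed.

Lemma if00 (t : bool) : (if t then 0 else 0) = 0 :> R. Proof. by case: t. Qed.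

Lemma b2_0r U : b2 N X c d U (fun=> 0) = 0.
Proof.
rewrite /b2 big1// => i _; rewrite I2_mul0; last by move=> *; rewrite evx0.
by rewrite !I1_mul0 ?if00 ?addr0 ?subrr// => y; rewrite ev0.
Qed.

Lemma b3_0r P : b3 N X c d P (fun=> 0) = 0.
Proof.
rewrite /b3 big1// => i _; rewrite I2_mul0; last by move=> *; rewrite evx0.
by rewrite !I1_mul0 ?addr0 ?subrr// => y; rewrite ev0.
Qed.

Lemma b4_0r a lam U : b4 N X c d a lam U (fun=> 0) = 0.
Proof.
rewrite /b4 big1 ?oppr0 ?add0r; first by rewrite I1_mul0// => y; rewrite ev0.
move=> i _; rewrite I2_mul0; last by move=> *; rewrite evx0.
by rewrite !I1_mul0 ?if00 ?addr0 ?subrr ?addr0// => y; rewrite ev0.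
Qed.
End Linearity.

Section MatrixForm.
Context {R : realType} (k N : nat) (X : nat -> R) (eps : R).
Notation fam := (nat -> nat -> 'M[R]_k.+1).
Implicit Types (U V P Q s v r : fam).
Notation S2 := (S2 N X).

Definition fsub U V : fam := fun i j => U i j - V i j.
Definition fzero : fam := fun _ _ => 0.

Lemma B2B U V s : B2 N X (fsub U V) s = B2 N X U s - B2 N X V s.
Proof. by rewrite /B2 -sumrB; apply: eq_bigr => j _; rewrite -b2B. Qed.
Lemma B3B U V s : B3 N X (fsub U V) s = B3 N X U s - B3 N X V s.
Proof. by rewrite /B3 -sumrB; apply: eq_bigr => j _; rewrite -b3B. Qed.
Lemma B4B a lam U V s : cont2 a -> B4 N X a lam (fsub U V) s = B4 N X a lam U s - B4 N X a lam V s.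
Proof. by move=> ca; rewrite /B4 -sumrB; apply: eq_bigr => j _; rewrite -b4B. Qed.
Lemma B2_0r U : B2 N X U fzero = 0.
Proof. by rewrite /B2 big1// => j _; exact: b2_0r. Qed.
Lemma B3_0r U : B3 N X U fzero = 0.
Proof. by rewrite /B3 big1// => j _; exact: b3_0r. Qed.
Lemma B4_0r a lam U : B4 N X a lam U fzero = 0.
Proof. by rewrite /B4 big1// => j _; exact: b4_0r. Qed.

Lemma tr_sub U V : tr (fsub U V) = fsub (tr U) (tr V).
Proof.
by apply/funext => i; apply/funext => j; rewrite /tr /fsub; apply/matrixP => a b; rewrite !mxE.
Qed.
Lemma tr_zero : tr fzero = fzero.
Proof. by apply/funext => i; apply/funext => j; rewrite /tr /fzero trmx0. Qed.

Lemma S2_evB U V (G : nat -> nat -> R -> R -> R) : (forall i j, cont2 (G i j)) ->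
  S2 (fun i j x y => ev (fsub U V i.+1 j.+1) x y * G i j x y) =
  S2 (fun i j x y => ev (U i.+1 j.+1) x y * G i j x y) - S2 (fun i j x y => ev (V i.+1 j.+1) x y * G i j x y).
Proof.
move=> cG; rewrite -S2B; [|by move=> i j; ct|by move=> i j; ct].
by apply: eq_S2 => i j x y _ _ _; rewrite /fsub evB mulrBl.
Qed.

Lemma S2_0r (F : nat -> nat -> R -> R -> R) : S2 (fun i j x y => F i j x y * ev (fzero i.+1 j.+1) x y) = 0.
Proof.
rewrite /S2 big1// => j _; rewrite big1// => i _.
by apply: I2_mul0 => x y; rewrite /fzero ev0.
Qed.

Variables (a1 a1x a2 a2y b : R -> R -> R) (lam1 lam2 : R).

(** The bilinear form in terms of coefficients. The functions a2 and a2y have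
    y as first argument, the terms in y being terms in x for the transposed
    families. *)
Definition Bm U P Q v s r : R :=
  eps^-1 * (S2 (fun i j x y => ev (P i.+1 j.+1) x y * ev (s i.+1 j.+1) x y)
            + S2 (fun i j x y => ev (Q i.+1 j.+1) x y * ev (r i.+1 j.+1) x y))
  + S2 (fun i j x y => ev (U i.+1 j.+1) x y * ((b x y - (a1x x y + a2y y x)) * ev (v i.+1 j.+1) x y))
  + (B2 N X U s + B2 N X (tr U) (tr r))
  + (B3 N X P v + B3 N X (tr Q) (tr v))
  + (B4 N X a1 lam1 U v + B4 N X a2 lam2 (tr U) (tr v)).

Hypothesis N0 : (0 < N)%N.
Hypothesis X0 : X 0 = 0.
Hypothesis XN : X N = 1.
Hypothesis Xinc : forall i, (i < N)%N -> X i < X i.+1.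
Hypothesis Ha1 : dX 0 1 a1 a1x.
Hypothesis Ha2 : dX 0 1 a2 a2y.
Hypothesis cb : cont2 b.

Let ca1 : cont2 a1. Proof. by case: Ha1. Qed.
Let ca2 : cont2 a2. Proof. by case: Ha2. Qed.
Let ca1x : cont2 a1x. Proof. by case: Ha1. Qed.
Let ca2y : cont2 a2y. Proof. by case: Ha2. Qed.

Lemma alg_BmB (e p p' q q' u u' x x' y y' z z' w w' m m' n n' : R) :
  e * (p - p' + (q - q')) + (u - u') + (x - x' + (y - y')) + (z - z' + (w - w')) + (m - m' + (n - n'))
  = (e * (p + q) + u + (x + y) + (z + w) + (m + n)) - (e * (p' + q') + u' + (x' + y') + (z' + w') + (m' + n')).
Proof. ring. Qed.

Lemma BmB U P Q U' P' Q' v s r :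
  Bm (fsub U U') (fsub P P') (fsub Q Q') v s r = Bm U P Q v s r - Bm U' P' Q' v s r.
Proof.
have ca2y' : cont2 (fun x y => a2y y x) by exact: (cont2_swap ca2y).
rewrite /Bm !tr_sub !B2B !B3B !B4B// !S2_evB; [|by move=> i j; ct..].
exact: alg_BmB.
Qed.

Definition jump_total v : R :=
  \sum_(j < N) jump_energy N X (X j) (X j.+1) a1 lam1 (col v j)
  + \sum_(j < N) jump_energy N X (X j) (X j.+1) a2 lam2 (col (tr v) j).

Lemma B4_energy a ax lam v : dX 0 1 a ax ->
  B4 N X a lam v v = \sum_(j < N) jump_energy N X (X j) (X j.+1) a lam (col v j)
    + 2^-1 * S2 (fun i j x y => ax x y * ev (v i.+1 j.+1) x y ^+ 2).
Proof.
move=> H; rewrite /B4 /S2 mulr_sumr -big_split; apply: eq_bigr => j _ /=.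
apply: b4_energy => //.
by apply: dX_sub H; [exact: (X_ge0 X0 Xinc (ltnW (ltn_ord j)))|exact: (X_le1 XN Xinc (ltn_ord j))].
Qed.

Lemma B2_B3_dual U s : B2 N X U s = - B3 N X s U.
Proof. by rewrite /B2 /B3 -sumrN; apply: eq_bigr => j _; exact: b2_b3_dual. Qed.

Lemma alg_energy (p u x y j1 j2 m n w : R) : w = u + 2^-1 * m + 2^-1 * n ->
  p + u + (- x + - y) + (x + y) + (j1 + 2^-1 * m + (j2 + 2^-1 * n)) = p + w + (j1 + j2).
Proof. by move=> ->; ring. Qed.

(** B2 and B3 cancel by duality and B4 supplies the jumps together with half
    of the divergence of the convection. *)
Lemma Bm_energy U P Q :
  Bm U P Q U P Q = eps^-1 * (S2 (fun i j x y => ev (P i.+1 j.+1) x y ^+ 2) + S2 (fun i j x y => ev (Q i.+1 j.+1) x y ^+ 2))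
  + S2 (fun i j x y => (b x y - 2^-1 * (a1x x y + a2y y x)) * ev (U i.+1 j.+1) x y ^+ 2) + jump_total U.
Proof.
have ca2y' : cont2 (fun x y => a2y y x) by exact: (cont2_swap ca2y).
rewrite /Bm !B2_B3_dual (B4_energy _ _ Ha1) (B4_energy _ _ Ha2).
apply: alg_energy.
have -> : S2 (fun i j x y => a2y x y * ev (tr U i.+1 j.+1) x y ^+ 2) = S2 (fun i j x y => a2y y x * ev (U i.+1 j.+1) x y ^+ 2).
  rewrite -S2_swap; last by move=> i j; ct.
  by apply: eq_S2 => i j x y _ _ _; rewrite /tr ev_tr.
rewrite -S2Z; last by move=> i j; ct.
rewrite -S2Z; last by move=> i j; ct.
rewrite -S2D; [|by move=> i j; ct|by move=> i j; ct].
rewrite -S2D; [|by move=> i j; ct|by move=> i j; ct].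
apply: eq_S2 => i j x y _ _ _; set u := ev _ _ _; set p := a1x x y; set q := a2y y x.
by field.
Qed.
End MatrixForm.

(** * Functions represented by families of coefficients *)

Section Representation.
Context {R : realType} (k N : nat) (X : nat -> R) (eps : R).
Notation RR := (measurableTypeR R * measurableTypeR R)%type.
Notation fam := (nat -> nat -> 'M[R]_k.+1).
Hypothesis N0 : (0 < N)%N.
Hypothesis X0 : X 0 = 0.
Hypothesis XN : X N = 1.
Hypothesis Xinc : forall i, (i < N)%N -> X i < X i.+1.
Implicit Types (u v f g : R * R -> R) (C D : fam) (F G : R -> R -> R).

(** Measurability is kept because the values of v on the grid are not
    determined by C. *)
Definition rep v C : Prop := measurable_fun (Omega : set RR) v /\ broken N X v C.

Lemma VN_rep v : VN k N X v -> exists C, rep v C.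
Proof.
move=> [[mv _] H].
have ex i j : exists c : 'M[R]_k.+1, (i < N)%N -> (j < N)%N -> on_elt X v (ev c) i j.
  have [iN|iN] := boolP (i < N)%N; last by exists 0.
  have [jN|jN] := boolP (j < N)%N; last by exists 0.
  have [g [c gc] vg] := H i.+1 j.+1 iN jN; exists c => _ _ x y hx hy.
  by rewrite vg ?gc// /Elt /Ival /= !in_itv.
exists (fun i j => projT1 (cid (ex i.-1 j.-1))); split=> // i j iN jN /=.
by case: (cid _) => c; exact.
Qed.

Definition glueM C : R * R -> R := glue N X (fun i j => ev (C i.+1 j.+1)).

Lemma rep_glue C : rep (glueM C) C.
Proof.
split; last by move=> i j iN jN; exact: glue_elt.
by apply: measurable_glue; [move=> i j; ct|exact: measurable_Omega].
Qed.

Lemma VN_glue C : VN k N X (glueM C).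
Proof.
split; first by apply: glue_inL2 => i j; ct.
move=> [|i] [|j] // iN jN.
exists (fun z => ev (C i.+1 j.+1) z.1 z.2); first by exists (C i.+1 j.+1).
move=> [x y] [] /=; rewrite /Ival /= !in_itv /= => hx hy.
by have [_ h] := rep_glue C; exact: h.
Qed.

Lemma rep_sub u v C D : rep u C -> rep v D -> rep (u \- v) (fsub C D).
Proof.
move=> [mu bu] [mv bv]; split; first exact: measurable_realfun.measurable_funB.
by move=> i j iN jN x y hx hy; rewrite /= (bu i j)// (bv i j)// /fsub evB.
Qed.

Lemma measurable_eqG f G : cont2 G -> (forall z, Omega z -> f z = G z.1 z.2) ->
  measurable_fun (Omega : set RR) f.
Proof.
move=> cG fG; have := cont2_measurable measurable_Omega cG.
apply: eq_measurable_fun => z; rewrite inE => zO; by rewrite fG.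
Qed.

Lemma ip2_Omega f g (H : nat -> nat -> R -> R -> R) :
  measurable_fun (Omega : set RR) f -> measurable_fun (Omega : set RR) g ->
  (forall i j, cont2 (H i j)) ->
  (forall i j, (i < N)%N -> (j < N)%N -> on_elt X (f \* g) (H i j) i j) ->
  ip2 Omega f g = S2 N X H.
Proof.
move=> mf mg cH fgH; apply: (integral_Omega X0 XN Xinc) => //.
exact: measurable_realfun.measurable_funM.
Qed.

Lemma normL2_sq f (H : nat -> nat -> R -> R -> R) :
  measurable_fun (Omega : set RR) f -> (forall i j, cont2 (H i j)) ->
  (forall i j, (i < N)%N -> (j < N)%N -> on_elt X f (H i j) i j) ->
  normL2 f ^+ 2 = S2 N X (fun i j x y => H i j x y ^+ 2).
Proof.
move=> mf cH fH; have E : ip2 Omega f f = S2 N X (fun i j x y => H i j x y ^+ 2).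
  apply: ip2_Omega => // i j; first by ct.
  by move=> iN jN x y hx hy; rewrite /= (fH i j).
by rewrite /normL2 sqr_sqrtr E// S2_ge0// => *; exact: sqr_ge0.
Qed.

Lemma ip2_ev u v C D : rep u C -> rep v D ->
  ip2 Omega u v = S2 N X (fun i j x y => ev (C i.+1 j.+1) x y * ev (D i.+1 j.+1) x y).
Proof.
move=> [mu bu] [mv bv]; apply: ip2_Omega => // i j; first by ct.
by move=> iN jN x y hx hy; rewrite /= (bu i j)// (bv i j).
Qed.

Lemma ipN_sw u v (F : nat -> nat -> R -> R -> R) : (forall i j, cont2 (F i j)) ->
  (forall i j, (i < N)%N -> (j < N)%N -> on_elt X (u \* v) (F i j) i j) ->
  ipN N X (sw u) (sw v) = ipN N X u v.
Proof.
move=> cF uvF; rewrite (ipN_S2 cF uvF) -(S2_swap _ _ cF).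
apply: ipN_S2 => [i j|i j iN jN x y hx hy]; first exact: (cont2_swap (@cF j i)).
by have := uvF j i jN iN y x hy hx.
Qed.

Lemma sw_dy v : sw (dy v) = dx (sw v).
Proof. by apply/funext => -[]. Qed.

Lemma dy_elt v C i j : broken N X v C -> (i < N)%N -> (j < N)%N ->
  on_elt X (dy v) (fun x y => evx (tr C j.+1 i.+1) y x) i j.
Proof.
move=> vC iN jN x y hx hy.
exact: (dx_elt (broken_sw vC jN iN) hy hx).
Qed.

Section Coefficients.
Variables (a1 a2 b : R * R -> R) (A1 A1x A2 A2y Bb : R -> R -> R) (lam1 lam2 : R).
Hypothesis HA1 : dX 0 1 A1 A1x.
Hypothesis HA2 : dX 0 1 A2 A2y.
Hypothesis cB : cont2 Bb.
Hypothesis a1E : forall z, Omegabar z -> a1 z = A1 z.1 z.2.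
Hypothesis a2E : forall z, Omegabar z -> a2 z = A2 z.2 z.1.
Hypothesis bE : forall z, Omegabar z -> b z = Bb z.1 z.2.
Hypothesis divE : forall z, Omega z -> diva a1 a2 z = A1x z.1 z.2 + A2y z.2 z.1.

Let cA1 : cont2 A1. Proof. by case: HA1. Qed.
Let cA2 : cont2 A2. Proof. by case: HA2. Qed.
Let cA1x : cont2 A1x. Proof. by case: HA1. Qed.
Let cA2y : cont2 A2y. Proof. by case: HA2. Qed.
Let cA2y' : cont2 (fun x y => A2y y x). Proof. exact: (cont2_swap cA2y). Qed.

Let a2E' z : Omegabar z -> sw a2 z = A2 z.1 z.2.
Proof. by move=> /OmegabarP[h1 h2]; rewrite /sw a2E//; apply/OmegabarP. Qed.

Section Form.
Variables (W z : triple R) (CU CP CQ Cv Cs Cr : fam).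
Hypothesis rU : rep (tu W) CU.
Hypothesis rP : rep (tp W) CP.
Hypothesis rQ : rep (tq W) CQ.
Hypothesis rv : rep (tu z) Cv.
Hypothesis rs : rep (tp z) Cs.
Hypothesis rr : rep (tq z) Cr.

Let inO i j x y : (i < N)%N -> (j < N)%N -> X i < x < X i.+1 -> X j < y < X j.+1 -> Omega (x, y).
Proof. exact: (Omega_elt X0 XN Xinc). Qed.

Lemma ldgT1E : ldgT1 eps a1 a2 b W z =
  eps^-1 * (S2 N X (fun i j x y => ev (CP i.+1 j.+1) x y * ev (Cs i.+1 j.+1) x y)
            + S2 N X (fun i j x y => ev (CQ i.+1 j.+1) x y * ev (Cr i.+1 j.+1) x y))
  + S2 N X (fun i j x y => ev (CU i.+1 j.+1) x y * ((Bb x y - (A1x x y + A2y y x)) * ev (Cv i.+1 j.+1) x y)).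
Proof.
rewrite /ldgT1 (ip2_ev rP rs) (ip2_ev rQ rr); congr (_ + _).
have [mU bU] := rU; have [mv bv] := rv.
have cBd : cont2 (fun x y => Bb x y - (A1x x y + A2y y x)) by ct.
apply: ip2_Omega => //.
- apply: measurable_realfun.measurable_funM => //.
  by apply: (measurable_eqG cBd) => p pO; rewrite /= bE ?divE//; exact: Omega_sub.
- by move=> i j; ct.
- move=> i j iN jN x y hx hy; have O := inO iN jN hx hy.
  rewrite /= (bU i j)// (bv i j)//.
  rewrite bE ?divE//=; last exact: Omega_sub.
  ring.
Qed.

Lemma ldgT2E : ldgT2 N X W z = B2 N X CU Cs + B2 N X (tr CU) (tr Cr).
Proof.
case: W z rU rs rr => [U P Q] [v s r] /= [_ bU] [_ bs] [_ br].
rewrite -(T2x_B2 N0 Xinc bU bs) -(T2x_B2 N0 Xinc (broken_sw bU) (broken_sw br)).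
rewrite /T2x -sw_dy (@ipN_sw U (dy r) (fun i j x y => ev (CU i.+1 j.+1) x y * evx (tr Cr j.+1 i.+1) y x)).
- by rewrite -!addrA.
- by move=> i j; ct.
- by move=> i j iN jN x y hx hy; rewrite /= (bU i j)// (dy_elt br iN jN).
Qed.

Lemma ldgT3E : ldgT3 N X W z = B3 N X CP Cv + B3 N X (tr CQ) (tr Cv).
Proof.
case: W z rP rQ rv => [U P Q] [v s r] /= [_ bP] [_ bQ] [_ bv].
rewrite -(T3x_B3 N0 Xinc bP bv) -(T3x_B3 N0 Xinc (broken_sw bQ) (broken_sw bv)).
rewrite /T3x -sw_dy (@ipN_sw Q (dy v) (fun i j x y => ev (CQ i.+1 j.+1) x y * evx (tr Cv j.+1 i.+1) y x)).
- by rewrite -!addrA.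
- by move=> i j; ct.
- by move=> i j iN jN x y hx hy; rewrite /= (bQ i j)// (dy_elt bv iN jN).
Qed.

Lemma ldgT4E : ldgT4 N X a1 a2 lam1 lam2 W z = B4 N X A1 lam1 CU Cv + B4 N X A2 lam2 (tr CU) (tr Cv).
Proof.
case: W z rU rv => [U P Q] [v s r] /= [_ bU] [_ bv].
rewrite -(T4x_B4 N0 X0 XN Xinc lam1 cA1 a1E bU bv).
rewrite -(T4x_B4 N0 X0 XN Xinc lam2 cA2 a2E' (broken_sw bU) (broken_sw bv)).
rewrite /T4x -sw_dy -[sw a2 \* sw U]/(sw (a2 \* U)).
rewrite (@ipN_sw (a2 \* U) (dy v) (fun i j x y => A2 y x * ev (CU i.+1 j.+1) x y * evx (tr Cv j.+1 i.+1) y x)).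
- by rewrite -!addrA.
- by have h := cont2_swap cA2; move=> i j; ct.
- move=> i j iN jN x y hx hy; rewrite /= (bU i j)// (dy_elt bv iN jN)// a2E//.
  by apply: Omega_sub; exact: inO hx hy.
Qed.

Lemma B_Bm : B N X eps a1 a2 b lam1 lam2 W z =
  Bm N X eps A1 A1x A2 A2y Bb lam1 lam2 CU CP CQ Cv Cs Cr.
Proof. by rewrite /B ldgT1E ldgT2E ldgT3E ldgT4E. Qed.

End Form.

Hypothesis eps0 : 0 < eps.
Notation dens := (fun x y => Bb x y - 2^-1 * (A1x x y + A2y y x)).
Hypothesis dens0 : forall x y, 0 <= x <= 1 -> 0 <= y <= 1 -> 0 <= dens x y.

Let cdens : cont2 dens. Proof. by ct. Qed.

(** The square root in the definition of the norm is harmless since its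
    argument is nonnegative. *)
Lemma norm2_sq V (Fu Fp Fq : nat -> nat -> R -> R -> R) :
  measurable_fun (Omega : set RR) (tu V) -> measurable_fun (Omega : set RR) (tp V) ->
  measurable_fun (Omega : set RR) (tq V) ->
  (forall i j, cont2 (Fu i j)) -> (forall i j, cont2 (Fp i j)) -> (forall i j, cont2 (Fq i j)) ->
  (forall i j, (i < N)%N -> (j < N)%N -> on_elt X (tu V) (Fu i j) i j) ->
  (forall i j, (i < N)%N -> (j < N)%N -> on_elt X (tp V) (Fp i j) i j) ->
  (forall i j, (i < N)%N -> (j < N)%N -> on_elt X (tq V) (Fq i j) i j) ->
  norm2 eps a1 a2 b V ^+ 2 =
   eps^-1 * (S2 N X (fun i j x y => Fp i j x y ^+ 2) + S2 N X (fun i j x y => Fq i j x y ^+ 2))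
   + S2 N X (fun i j x y => dens x y * Fu i j x y ^+ 2).
Proof.
move=> mu mp mq cu cp cq eu ep eq.
have csq : cont2 (fun x y => Num.sqrt (dens x y)).
  move=> z; apply: (@continuous_comp _ _ _ (fun z : R * R => dens z.1 z.2) Num.sqrt z); first exact: cdens.
  exact: sqrt_continuous.
have e1 := normL2_sq mp cp ep; have e2 := normL2_sq mq cq eq.
have e3 : normL2 (fun p => Num.sqrt (b p - 2^-1 * diva a1 a2 p) * tu V p) ^+ 2 =
    S2 N X (fun i j x y => dens x y * Fu i j x y ^+ 2).
  rewrite (@normL2_sq _ (fun i j x y => Num.sqrt (dens x y) * Fu i j x y)).
  - apply: eq_S2 => i j x y iN jN [hx hy]; rewrite exprMn sqr_sqrtr//.
    by apply: dens0; [exact: (Xin X0 XN Xinc iN hx)|exact: (Xin X0 XN Xinc jN hy)].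
  - apply: measurable_realfun.measurable_funM => //.
    apply: (measurable_eqG csq) => p pO; rewrite bE ?divE//; exact: Omega_sub.
  - by move=> i j; ct.
  move=> i j iN jN x y hx hy; have O := Omega_elt X0 XN Xinc iN jN hx hy.
  by rewrite (eu i j iN jN)// bE ?divE//; exact: Omega_sub.
rewrite /norm2 e1 e2 e3 sqr_sqrtr ?mulrDr//.
rewrite !addr_ge0 ?mulr_ge0 ?invr_ge0 ?(ltW eps0)// S2_ge0// => i j x y iN jN [hx hy]; try exact: sqr_ge0.
apply: mulr_ge0 (sqr_ge0 _).
by apply: dens0; [exact: (Xin X0 XN Xinc iN hx)|exact: (Xin X0 XN Xinc jN hy)].
Qed.

Lemma normE_Bm V (CU CP CQ : fam) : rep (tu V) CU -> rep (tp V) CP -> rep (tq V) CQ ->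
  normE N X eps a1 a2 b lam1 lam2 V =
  Num.sqrt (Bm N X eps A1 A1x A2 A2y Bb lam1 lam2 CU CP CQ CU CP CQ).
Proof.
move=> [mU bU] [mP bP] [mQ bQ]; rewrite /normE; congr Num.sqrt.
rewrite (Bm_energy eps _ _ N0 X0 XN Xinc HA1 HA2 cB).
rewrite (@norm2_sq V (fun i j => ev (CU i.+1 j.+1)) (fun i j => ev (CP i.+1 j.+1)) (fun i j => ev (CQ i.+1 j.+1)))//.
- rewrite -addrA; congr (_ + _); rewrite /jump_total; congr (_ + _).
    exact: (energyx N0 X0 XN Xinc lam1 cA1 a1E bU).
  exact: (energyx N0 X0 XN Xinc lam2 cA2 a2E' (broken_sw bU)).
- by move=> i j; ct.
- by move=> i j; ct.
- by move=> i j; ct.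
Qed.

End Coefficients.
End Representation.

(** * Arithmetic of the final estimate and test functions in one component *)

Section FinalAlgebra.
Context {R : realType}.

Lemma alg_split (e p q t b2 b2' b3 b3' b4 b4' m1 m2 g1 g2 F Z : R) :
  m1 + m2 + g1 + g2 + t = F + Z ->
  e * (p + q) + t + (b2 + b2') + (b3 + b3') + (b4 + b4') - F =
  (e * p + b2 + b3 + b4 - m1 - g1) + (e * q + b2' + b3' + b4' - m2 - g2) + Z.
Proof.
move=> h; have -> : Z = m1 + m2 + g1 + g2 + t - F by rewrite h; ring.
ring. Qed.

(** The terms with t add up to at most 7 t (p + q + u + d1 + d2), and with t =
    c / 18 this is less than half of E. *)
Lemma alg_absorb (E p q u d1 d2 x y z t c D kx kz : R) :
  0 < c -> t = c / 18%:R -> 0 <= p -> 0 <= q -> 0 <= u -> 0 <= d1 -> 0 <= d2 ->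
  c * (p + q + u + d1 + d2) <= E -> E = x + y + z ->
  `|x| <= 3%:R * t * (p + u + d1) + kx * D -> `|y| <= 3%:R * t * (q + u + d2) + kx * D ->
  `|z| <= t * u + kz * D -> E <= 2%:R * (2%:R * kx + kz) * D.
Proof.
move=> c0 tE p0 q0 u0 h1 h2 hc EE hx hy hz.
have hx' : x <= 3%:R * t * (p + u + d1) + kx * D by rewrite (le_trans (ler_norm _))//.
have hy' : y <= 3%:R * t * (q + u + d2) + kx * D by rewrite (le_trans (ler_norm _))//.
have hz' : z <= t * u + kz * D by rewrite (le_trans (ler_norm _))//.
have t0 : 0 <= t by rewrite tE; lra.
have cE : c = 18%:R * t by rewrite tE; field.
have tp := mulr_ge0 t0 p0; have tq := mulr_ge0 t0 q0; have tu := mulr_ge0 t0 u0.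
have t1 := mulr_ge0 t0 h1; have t2 := mulr_ge0 t0 h2.
have hc' : 18%:R * (t * p + t * q + t * u + t * d1 + t * d2) <= E.
  by apply: le_trans hc; rewrite cE le_eqVlt; apply/orP; left; apply/eqP; ring.
have e1 : 3%:R * t * (p + u + d1) = 3%:R * (t * p) + 3%:R * (t * u) + 3%:R * (t * d1) by ring.
have e2 : 3%:R * t * (q + u + d2) = 3%:R * (t * q) + 3%:R * (t * u) + 3%:R * (t * d2) by ring.
have e3 : 2%:R * (2%:R * kx + kz) * D = 4%:R * (kx * D) + 2%:R * (kz * D) by ring.
rewrite e1 in hx'; rewrite e2 in hy'; rewrite e3.
move: (t * p) (t * q) (t * u) (t * d1) (t * d2) (kx * D) (kz * D) tp tq tu t1 t2 hc' hx' hy' hz' EE.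
by move=> a1 a2 a3 a4 a5 a6 a7; lra.
Qed.

Lemma alg_testx (e p b B2' B3' : R) : B2' = 0 -> B3' = 0 ->
  e * (p + 0) + 0 + (b + B2') + (0 + B3') + (0 + 0) = e * p + b.
Proof. by move=> -> ->; rewrite !addr0. Qed.

Lemma sqr_split (f w p o r : R) : `|f - p| <= o -> p - w = r -> (f - w) ^+ 2 <= 2%:R * o ^+ 2 + 2%:R * r ^+ 2.
Proof.
move=> h <-; have h2 : (f - p) ^+ 2 <= o ^+ 2.
  by rewrite -[leLHS]real_normK ?num_real// lerXn2r ?nnegrE// (le_trans _ h).
have := sqr_ge0 ((f - p) - (p - w)).
have -> : (f - w) ^+ 2 = 2%:R * (f - p) ^+ 2 + 2%:R * (p - w) ^+ 2 - ((f - p) - (p - w)) ^+ 2 by ring.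
move: (_ ^+ 2) ((p - w) ^+ 2) h2 => z z2; lra.
Qed.
End FinalAlgebra.

Section Tests.
Context {R : realType} (k N : nat) (X : nat -> R) (eps : R).
Notation fam := (nat -> nat -> 'M[R]_k.+1).
Variables (a1 a1x a2 a2y b : R -> R -> R) (lam1 lam2 : R).
Hypothesis ca1x : cont2 a1x.
Hypothesis ca2y : cont2 a2y.
Hypothesis cb : cont2 b.

Lemma trK (C : fam) : tr (tr C) = C.
Proof. by apply/funext => i; apply/funext => j; rewrite /tr trmxK. Qed.

Lemma S2_tr (C D : fam) : S2 N X (fun i j x y => ev (tr C i.+1 j.+1) x y * ev (tr D i.+1 j.+1) x y) =
  S2 N X (fun i j x y => ev (C i.+1 j.+1) x y * ev (D i.+1 j.+1) x y).
Proof.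
rewrite -[RHS]S2_swap; last by move=> i j; ct.
by apply: eq_S2 => i j x y _ _ _; rewrite /tr !ev_tr.
Qed.

Let S2z (U : fam) : S2 N X (fun i j x y => ev (U i.+1 j.+1) x y * ((b x y - (a1x x y + a2y y x)) * ev (fzero k i.+1 j.+1) x y)) = 0.
Proof.
by rewrite /S2 big1// => j _; rewrite big1// => i _; apply: I2_mul0 => x y; rewrite ev0 mulr0.
Qed.

Lemma Bm_testx (U P Q Z : fam) : Bm N X eps a1 a1x a2 a2y b lam1 lam2 U P Q (fzero k) Z (fzero k) =
  eps^-1 * S2 N X (fun i j x y => ev (P i.+1 j.+1) x y * ev (Z i.+1 j.+1) x y) + B2 N X U Z.
Proof.
rewrite /Bm !tr_zero S2z !B2_0r !B3_0r !B4_0r S2_0r.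
exact: alg_testx.
Qed.

Lemma Bm_testy (U P Q Z : fam) : Bm N X eps a1 a1x a2 a2y b lam1 lam2 U P Q (fzero k) (fzero k) (tr Z) =
  eps^-1 * S2 N X (fun i j x y => ev (tr Q i.+1 j.+1) x y * ev (Z i.+1 j.+1) x y) + B2 N X (tr U) Z.
Proof.
rewrite /Bm !tr_zero S2z !B2_0r !B3_0r !B4_0r S2_0r trK -[in LHS](S2_tr Q) trK.
by rewrite !addr0 !add0r.
Qed.
End Tests.

(** * The error estimate for families of coefficients *)

Lemma alg_sq (R : realType) (p q r s : R) : p * (q * r) ^+ 2 * s ^+ 2 = p * (q * (r * s)) ^+ 2.
Proof. ring. Qed.

Lemma S2_sqr_ge0 (R : realType) N (X : nat -> R) (G : nat -> nat -> R -> R -> R) :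
  0 <= S2 N X (fun i j x y => G i j x y ^+ 2).
Proof. by apply: S2_ge0 => *; exact: sqr_ge0. Qed.

Lemma scaled_S2_sqr_ge0 (R : realType) N (X : nat -> R) (e : R) (G : nat -> nat -> R -> R -> R) : 0 < e ->
  0 <= e^-1 * S2 N X (fun i j x y => G i j x y ^+ 2).
Proof. by move=> e0; apply: mulr_ge0 (S2_sqr_ge0 _ _ _); rewrite invr_ge0 ltW. Qed.

Lemma S1_sqr_ge0 (R : realType) N (X : nat -> R) (g : nat -> R -> R) :
  0 <= S1 N X (fun j y => g j y ^+ 2).
Proof. by apply: S1_ge0 => *; exact: sqr_ge0. Qed.

Lemma alg_lower (R : realType) (c e be h p q u d1 d2 U J1 J2 : R) :
  0 <= e * p -> 0 <= e * q -> 0 <= u -> 0 <= d1 -> 0 <= d2 -> c <= 1 -> c <= be -> c <= h ->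
  be * u <= U -> h * d1 <= J1 -> h * d2 <= J2 ->
  c * (e * p + e * q + u + d1 + d2) <= e * (p + q) + U + (J1 + J2).
Proof.
move=> p0 q0 u0 d10 d20 c1 cb ch hU h1 h2.
have e1 : c * (e * p) <= e * p by exact: ler_piMl.
have e2 : c * (e * q) <= e * q by exact: ler_piMl.
have e3 := le_trans (ler_wpM2r u0 cb) hU.
have e4 := le_trans (ler_wpM2r d10 ch) h1.
have e5 := le_trans (ler_wpM2r d20 ch) h2.
rewrite !mulrDr; lra.
Qed.

Lemma alg_total (R : realType) (ei p q u P Q w D2 e cE j U : R) : 0 <= j ->
  ei * p <= 2%:R * D2 * w + 2%:R * (ei * P) -> ei * q <= 2%:R * D2 * w + 2%:R * (ei * Q) ->
  u <= U * D2 + 2%:R * e -> ei * (P + Q) + e + j <= cE * D2 ->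
  ei * (p + q) + u <= (2%:R * cE + 4%:R * w + U) * D2.
Proof.
move=> j0 hp hq hu hE; rewrite mulrDr in hE; rewrite mulrDr 2!mulrDl.
have e1 : 2%:R * D2 * w = 2%:R * (w * D2) by ring.
rewrite e1 in hp hq; rewrite -!mulrA.
move: (ei * p) (ei * q) (ei * P) (ei * Q) (w * D2) (cE * D2) (U * D2) hp hq hu hE => *; lra.
Qed.

Lemma alg_dens (R : realType) (A b p q : R) : `|b| <= A -> `|p| <= A -> `|q| <= A -> b - 2^-1 * (p + q) <= 2%:R * A.
Proof. by rewrite !ler_norml => /andP[_ p1] /andP[p2 _] /andP[p3 _]; lra. Qed.

Lemma alg_weighted (R : realType) (A g c D s r : R) : 0 <= g -> g <= 2%:R * A -> s <= 2%:R * (c * D) ^+ 2 + 2%:R * r ^+ 2 ->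
  g * s <= 4%:R * A * c ^+ 2 * D ^+ 2 + 2%:R * (g * r ^+ 2).
Proof.
move=> g0 gA sr; apply: (le_trans (ler_wpM2l g0 sr)).
have h := ler_wpM2r (mulr_ge0 (ler0n R 2) (sqr_ge0 (c * D))) gA.
have -> : 4%:R * A * c ^+ 2 * D ^+ 2 = 2%:R * A * (2%:R * (c * D) ^+ 2) by ring.
have -> : g * (2%:R * (c * D) ^+ 2 + 2%:R * r ^+ 2) = g * (2%:R * (c * D) ^+ 2) + 2%:R * (g * r ^+ 2) by ring.
by rewrite lerD2r.
Qed.

Lemma alg_flux (R : realType) (e O w T D2 Sx : R) : 0 <= e -> 0 <= D2 -> e * O <= w ->
  T <= 2%:R * D2 * O + 2%:R * Sx -> e * T <= 2%:R * D2 * w + 2%:R * (e * Sx).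
Proof.
move=> e0 D0 hO hT; apply: (le_trans (ler_wpM2l e0 hT)).
have -> : e * (2%:R * D2 * O + 2%:R * Sx) = 2%:R * D2 * (e * O) + 2%:R * (e * Sx) by ring.
by rewrite lerD2r ler_wpM2l// mulr_ge0.
Qed.

Definition swap_fam {R : realType} (F : nat -> nat -> R -> R -> R) i j (x y : R) : R := F j i y x.

Lemma smooth2_swap (R : realType) n (F : nat -> nat -> R -> R -> R) : smooth2 n F -> smooth2 n (swap_fam F).
Proof.
move=> [c d]; split=> i j ij; rewrite addnC in ij; first exact: (cont2_swap (@c _ _ ij)).
by have [d1 d2] := d j i ij; split.
Qed.

Section JumpLower.
Context {R : realType} (k N : nat) (X : nat -> R).
Hypothesis N0 : (0 < N)%N.
Hypothesis X0 : X 0 = 0.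
Hypothesis XN : X N = 1.
Hypothesis Xinc : forall i, (i < N)%N -> X i < X i.+1.

(** The jump at x = 1 is minus the trace from inside. *)
Lemma jump_lower (a : R -> R -> R) lam alpha (v : nat -> nat -> 'M[R]_k.+1) : cont2 a -> 0 <= alpha ->
  (forall x y, 0 <= x <= 1 -> 0 <= y <= 1 -> alpha <= a x y) -> 0 <= lam ->
  2^-1 * alpha * S1 N X (fun j y => ev (v N j.+1) (X N) y ^+ 2) <=
  \sum_(j < N) jump_energy N X (X j) (X j.+1) a lam (col v j).
Proof.
move=> ca al0 ha lam0; rewrite -S1Z; last by move=> j; ct.
apply: ler_sum => j _; rewrite /jump_energy.
have hy y : X j <= y <= X j.+1 -> 0 <= y <= 1 by exact: (Xin X0 XN Xinc (ltn_ord j)).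
have hX i : (i <= N)%N -> 0 <= X i <= 1 by move=> iN; rewrite (X_ge0 X0 Xinc iN) (X_le1 XN Xinc iN).
rewrite -[leLHS]add0r; apply: lerD.
  apply: sumr_ge0 => i _; apply: mulr_ge0; first by rewrite invr_ge0.
  apply: I1_ge0 => y /hy y01; apply: mulr_ge0 (sqr_ge0 _).
  exact: le_trans al0 (ha _ _ (hX _ (ltnW (ltn_ord i))) y01).
have cj := @cont_jmp R k N X (col v j) N.
apply: le_I1; [by ct|by ct|] => y /hy y01.
rewrite /jmp eqxx (gtn_eqF N0) sub0r sqrrN /col; apply: ler_wpM2r; first exact: sqr_ge0.
have := ha _ _ (hX N (leqnn N)) y01; lra.
Qed.
End JumpLower.

Section Estimate.
Context {R : realType} (k N : nat) (X : nat -> R) (eps alpha sigma m C0 Cp : R).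
Notation fam := (nat -> nat -> 'M[R]_k.+1).
Hypothesis N0 : (0 < N)%N.
Hypothesis eps0 : 0 < eps.
Hypothesis eps1 : eps <= 1.
Hypothesis alpha0 : 0 < alpha.
Hypothesis sigmak : k.+2%:R <= sigma.
Hypothesis m1 : 1 <= m.
Hypothesis C00 : 0 <= C0.
Hypothesis Hmesh : layer_mesh eps alpha sigma m N X C0.
Hypothesis Cp1 : 1 <= Cp.
Hypothesis HCp : forall K (c d : R) (g : R -> R) (M y : R), c < d -> continuous g -> c <= y <= d ->
    (forall t, c <= t <= d -> `|g t| <= M) -> `|proj k K c d g y| <= Cp * M.
Hypothesis HCa : forall K c d (g W : R -> R) y, K <> Radau_right -> c < d -> continuous g -> continuous W -> c <= y <= d ->
    (forall t, c <= t <= d -> `|g t| <= W t) -> (forall t, c <= t <= d -> W c <= W t) ->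
    `|proj k K c d g y| <= Cp * ((d - c)^-1 * I1 c d W).
Variables (S E1 E2 E3 : nat -> nat -> R -> R -> R) (K0 : R).
Hypothesis K00 : 0 <= K0.
Hypothesis sS : smooth2 k.+2 S.
Hypothesis s1 : smooth2 k.+2 E1.
Hypothesis s2 : smooth2 k.+2 E2.
Hypothesis s3 : smooth2 k.+2 E3.
Hypothesis bS : forall i j x y, (i + j <= k.+2)%N -> 0 <= x <= 1 -> 0 <= y <= 1 -> `|S i j x y| <= K0.
Hypothesis b1 : forall i j x y, (i + j <= k.+2)%N -> 0 <= x <= 1 -> 0 <= y <= 1 ->
  `|E1 i j x y| <= K0 * eps ^- i * lay eps alpha x.
Hypothesis b2 : forall i j x y, (i + j <= k.+2)%N -> 0 <= x <= 1 -> 0 <= y <= 1 ->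
  `|E2 i j x y| <= K0 * eps ^- j * lay eps alpha y.
Hypothesis b3 : forall i j x y, (i + j <= k.+2)%N -> 0 <= x <= 1 -> 0 <= y <= 1 ->
  `|E3 i j x y| <= K0 * eps ^- (i + j) * (lay eps alpha x * lay eps alpha y).

Let X0 : X 0 = 0. Proof. by case: Hmesh. Qed.
Let XN : X N = 1. Proof. by case: Hmesh. Qed.
Let Xinc i : (i < N)%N -> X i < X i.+1. Proof. by case: Hmesh => _ _ h _ _; apply: h. Qed.

Notation us := (usum S E1 E2 E3).
Notation ut := (usum (swap_fam S) (swap_fam E2) (swap_fam E1) (swap_fam E3)).

Lemma utE i j x y : ut i j x y = us j i y x.
Proof. by rewrite /usum /swap_fam; ring. Qed.

Let sS' := smooth2_swap sS.
Let s1' := smooth2_swap s1.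
Let s2' := smooth2_swap s2.
Let s3' := smooth2_swap s3.
Let bS' i j x y : (i + j <= k.+2)%N -> 0 <= x <= 1 -> 0 <= y <= 1 -> `|swap_fam S i j x y| <= K0.
Proof. by rewrite addnC => ij hx hy; exact: bS ij hy hx. Qed.
Let b1' i j x y : (i + j <= k.+2)%N -> 0 <= x <= 1 -> 0 <= y <= 1 ->
  `|swap_fam E2 i j x y| <= K0 * eps ^- i * lay eps alpha x.
Proof. by rewrite addnC => ij hx hy; exact: b2 ij hy hx. Qed.
Let b2' i j x y : (i + j <= k.+2)%N -> 0 <= x <= 1 -> 0 <= y <= 1 ->
  `|swap_fam E1 i j x y| <= K0 * eps ^- j * lay eps alpha y.
Proof. by rewrite addnC => ij hx hy; exact: b1 ij hy hx. Qed.
Let b3' i j x y : (i + j <= k.+2)%N -> 0 <= x <= 1 -> 0 <= y <= 1 ->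
  `|swap_fam E3 i j x y| <= K0 * eps ^- (i + j) * (lay eps alpha x * lay eps alpha y).
Proof. by rewrite addnC [lay _ _ x * _]mulrC => ij hx hy; exact: b3 ij hy hx. Qed.

Variables (a1 a1x a2 a2y b f : R -> R -> R) (lam1 lam2 A beta : R) (Cinv : R).
Hypothesis Ha1 : dX 0 1 a1 a1x.
Hypothesis Ha2 : dX 0 1 a2 a2y.
Hypothesis cb : cont2 b.
Hypothesis cf : cont2 f.
Hypothesis A0 : 0 <= A.
Hypothesis A1 : forall x y, 0 <= x <= 1 -> 0 <= y <= 1 -> `|a1 x y| <= A /\ `|a1x x y| <= A.
Hypothesis A2 : forall x y, 0 <= x <= 1 -> 0 <= y <= 1 -> `|a2 x y| <= A /\ `|a2y x y| <= A.
Hypothesis Ab : forall x y, 0 <= x <= 1 -> 0 <= y <= 1 -> `|b x y| <= A.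
Hypothesis a1al : forall x y, 0 <= x <= 1 -> 0 <= y <= 1 -> alpha <= a1 x y.
Hypothesis a2al : forall x y, 0 <= x <= 1 -> 0 <= y <= 1 -> alpha <= a2 x y.
Hypothesis beta0 : 0 < beta.
Hypothesis Hbeta : forall x y, 0 <= x <= 1 -> 0 <= y <= 1 -> beta <= b x y - 2^-1 * (a1x x y + a2y y x).
Hypothesis lam10 : 0 <= lam1.
Hypothesis lam20 : 0 <= lam2.
Hypothesis Cinv0 : 0 < Cinv.
Hypothesis HCinv : forall b c (q : {poly R}), b < c -> (size q <= k.+1)%N ->
  (c - b) ^+ 2 * I1 b c (fun x => (q^`()).[x] ^+ 2) <= Cinv * I1 b c (fun x => q.[x] ^+ 2).
Hypothesis u_x0 : forall y, 0 <= y <= 1 -> us 0 0 0 y = 0.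
Hypothesis u_x1 : forall y, 0 <= y <= 1 -> us 0 0 1 y = 0.
Hypothesis u_y0 : forall x, 0 <= x <= 1 -> us 0 0 x 0 = 0.
Hypothesis u_y1 : forall x, 0 <= x <= 1 -> us 0 0 x 1 = 0.
Hypothesis pdeE : forall x y, 0 <= x <= 1 -> 0 <= y <= 1 ->
  f x y = (a1 x y * us 1 0 x y - eps * us 2 0 x y) + (a2 y x * us 0 1 x y - eps * us 0 2 x y) + b x y * us 0 0 x y.

Variables (V P Q WU WP WQ : fam).
Hypothesis HV : forall i j, (i < N)%N -> (j < N)%N -> forall x y,
  ev (V i.+1 j.+1) x y = proj k Radau_right (X i) (X i.+1) ((pyj k X (us 0 0) j) ^~ y) x.
Hypothesis HP : is_flux_proj N X eps S E1 E2 E3 P.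
Hypothesis HQ : is_flux_proj N X eps (swap_fam S) (swap_fam E2) (swap_fam E1) (swap_fam E3) (tr Q).
Notation BB := (Bm N X eps a1 a1x a2 a2y b lam1 lam2).
Hypothesis HW : forall v s r : fam, BB WU WP WQ v s r = S2 N X (fun i j x y => f x y * ev (v i.+1 j.+1) x y).

Notation xu := (fsub V WU).
Notation xp := (fsub P WP).
Notation xq := (fsub Q WQ).
Notation D := (del k N alpha sigma m C0 Cp K0).
Let D0 : 0 <= D. Proof. exact: (del_ge0 k alpha sigma N0 m1 C00 Cp1 K00). Qed.

Let ca1 : cont2 a1. Proof. by case: Ha1. Qed.
Let ca2 : cont2 a2. Proof. by case: Ha2. Qed.
Let ca1x : cont2 a1x. Proof. by case: Ha1. Qed.
Let ca2y : cont2 a2y. Proof. by case: Ha2. Qed.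
Let ca2' : cont2 (fun x y => a2 y x). Proof. exact: (cont2_swap ca2). Qed.
Let ca2y' : cont2 (fun x y => a2y y x). Proof. exact: (cont2_swap ca2y). Qed.
Let cus i j : (i + j <= k.+2)%N -> cont2 (us i j). Proof. exact: (cont_usum sS s1 s2 s3). Qed.
Let cut i j : (i + j <= k.+2)%N -> cont2 (ut i j). Proof. exact: (cont_usum sS' s2' s1' s3'). Qed.

Let S2z (H : R -> R -> R) : S2 N X (fun i j x y => H x y * ev (fzero k i.+1 j.+1) x y) = 0.
Proof. exact: (@S2_0r R k N X (fun _ _ => H)). Qed.

(** The load does not act on the second component of the test function. *)
Lemma galerkin_x (Z : fam) :
  eps^-1 * S2 N X (fun i j x y => ev (xp i.+1 j.+1) x y * ev (Z i.+1 j.+1) x y) + B2 N X xu Z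
   = eps^-1 * S2 N X (fun i j x y => ev (P i.+1 j.+1) x y * ev (Z i.+1 j.+1) x y) + B2 N X V Z.
Proof.
have h := BmB N X eps lam1 lam2 Ha1 Ha2 cb V P Q WU WP WQ (fzero k) Z (fzero k).
by rewrite HW S2z subr0 !Bm_testx in h.
Qed.

Lemma galerkin_y (Z : fam) :
  eps^-1 * S2 N X (fun i j x y => ev (tr xq i.+1 j.+1) x y * ev (Z i.+1 j.+1) x y) + B2 N X (tr xu) Z
   = eps^-1 * S2 N X (fun i j x y => ev (tr Q i.+1 j.+1) x y * ev (Z i.+1 j.+1) x y) + B2 N X (tr V) Z.
Proof.
have h := BmB N X eps lam1 lam2 Ha1 Ha2 cb V P Q WU WP WQ (fzero k) (fzero k) (tr Z).
by rewrite HW S2z subr0 !Bm_testy in h.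
Qed.

Definition Xterm := eps^-1 * S2 N X (fun i j x y => ev (P i.+1 j.+1) x y * ev (xp i.+1 j.+1) x y)
   + B2 N X V xp + B3 N X P xu + B4 N X a1 lam1 V xu
   - S2 N X (fun i j x y => a1x x y * ev (V i.+1 j.+1) x y * ev (xu i.+1 j.+1) x y)
   - S2 N X (fun i j x y => (a1 x y * us 1 0 x y - eps * us 2 0 x y) * ev (xu i.+1 j.+1) x y).

Definition Yterm := eps^-1 * S2 N X (fun i j x y => ev (tr Q i.+1 j.+1) x y * ev (tr xq i.+1 j.+1) x y)
   + B2 N X (tr V) (tr xq) + B3 N X (tr Q) (tr xu) + B4 N X a2 lam2 (tr V) (tr xu)
   - S2 N X (fun i j x y => a2y x y * ev (tr V i.+1 j.+1) x y * ev (tr xu i.+1 j.+1) x y)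
   - S2 N X (fun i j x y => (a2 x y * ut 1 0 x y - eps * ut 2 0 x y) * ev (tr xu i.+1 j.+1) x y).

Definition Zterm := S2 N X (fun i j x y => b x y * (ev (V i.+1 j.+1) x y - us 0 0 x y) * ev (xu i.+1 j.+1) x y).

Let cxu i j : cont2 (ev (xu i.+1 j.+1)). Proof. by ct. Qed.

(** By the differential equation the load cancels the operator in both
    directions, up to the reaction term with u - V. *)
Lemma error_split : BB xu xp xq xu xp xq = Xterm + Yterm + Zterm.
Proof.
rewrite (BmB N X eps lam1 lam2 Ha1 Ha2 cb) HW /Xterm /Yterm /Zterm /Bm S2_tr.
apply: alg_split.
have k00 : (0 + 0 <= k.+2)%N by []. have k10 : (1 + 0 <= k.+2)%N by [].
have k20 : (2 + 0 <= k.+2)%N by []. have k01 : (0 + 1 <= k.+2)%N by [].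
have k02 : (0 + 2 <= k.+2)%N by [].
have c00 := @cus _ _ k00; have c10 := @cus _ _ k10; have c20 := @cus _ _ k20.
have c01 := @cus _ _ k01; have c02 := @cus _ _ k02.
have t10 := @cut _ _ k10; have t20 := @cut _ _ k20.
have -> : S2 N X (fun i j x y => a2y x y * ev (tr V i.+1 j.+1) x y * ev (tr xu i.+1 j.+1) x y) =
   S2 N X (fun i j x y => a2y y x * ev (V i.+1 j.+1) x y * ev (xu i.+1 j.+1) x y).
  rewrite -[RHS]S2_swap; last by move=> i j; ct.
  by apply: eq_S2 => i j x y _ _ _; rewrite /tr !ev_tr.
have -> : S2 N X (fun i j x y => (a2 x y * ut 1 0 x y - eps * ut 2 0 x y) * ev (tr xu i.+1 j.+1) x y) =
   S2 N X (fun i j x y => (a2 y x * us 0 1 x y - eps * us 0 2 x y) * ev (xu i.+1 j.+1) x y).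
  rewrite -[RHS]S2_swap; last by move=> i j; ct.
  by apply: eq_S2 => i j x y _ _ _; rewrite /tr !ev_tr !utE.
do 4 (rewrite -S2D; [|by move=> i j; ct|by move=> i j; ct]).
rewrite -S2D; [|by move=> i j; ct|by move=> i j; ct].
apply: eq_S2 => i j x y iN jN [hx hy].
rewrite pdeE ?(Xin X0 XN Xinc iN hx) ?(Xin X0 XN Xinc jN hy)//.
move: (ev _ _ _) (ev _ _ _) (us _ _ _ _) (us _ _ _ _) (us _ _ _ _) (us _ _ _ _) (us _ _ _ _) (a1 _ _) (a2 _ _) (a1x _ _) (a2y _ _) (b _ _) => z1 z2 z3 z4 z5 z6 z7 z8 z9 w1 w2 w3.
ring.
Qed.

Definition cdir t := xdir_total_const k alpha sigma Cp A Cinv t.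

Lemma Xterm_bound t : 0 < t -> `|Xterm| <=
  3%:R * t * (eps^-1 * S2 N X (fun i j x y => ev (xp i.+1 j.+1) x y ^+ 2)
      + S2 N X (fun i j x y => ev (xu i.+1 j.+1) x y ^+ 2)
      + S1 N X (fun j y => ev (xu N j.+1) (X N) y ^+ 2)) + cdir t * D ^+ 2.
Proof.
move=> t0; exact: (xdir_total N0 eps0 eps1 alpha0 sigmak m1 C00 Hmesh Cp1 HCp HCa K00 sS s1 s2 s3 bS b1 b2 b3
  Ha1 A0 A1 Cinv0 HCinv u_x0 u_x1 HV HP lam1 t0 galerkin_x).
Qed.

Let HVt i j : (i < N)%N -> (j < N)%N -> forall x y,
  ev (tr V i.+1 j.+1) x y = proj k Radau_right (X i) (X i.+1) ((pyj k X (ut 0 0) j) ^~ y) x.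
Proof.
move=> iN jN x y; rewrite /tr ev_tr HV// /pyj.
have c00 : cont2 (us 0 0) by exact: cus.
rewrite -(proj_comm k Radau_right Radau_right (X j) (X j.+1) (X i) (X i.+1) y x c00).
congr proj; apply/funext => t; congr proj; apply/funext => s; by rewrite utE.
Qed.

Lemma Yterm_bound t : 0 < t -> `|Yterm| <=
  3%:R * t * (eps^-1 * S2 N X (fun i j x y => ev (tr xq i.+1 j.+1) x y ^+ 2)
      + S2 N X (fun i j x y => ev (tr xu i.+1 j.+1) x y ^+ 2)
      + S1 N X (fun j y => ev (tr xu N j.+1) (X N) y ^+ 2)) + cdir t * D ^+ 2.
Proof.
have u0 y : 0 <= y <= 1 -> ut 0 0 0 y = 0 by move=> hy; rewrite utE u_y0.
have u1 y : 0 <= y <= 1 -> ut 0 0 1 y = 0 by move=> hy; rewrite utE u_y1.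
move=> t0; exact: (xdir_total N0 eps0 eps1 alpha0 sigmak m1 C00 Hmesh Cp1 HCp HCa K00 sS' s2' s1' s3' bS' b1' b2' b3'
  Ha2 A0 A2 Cinv0 HCinv u0 u1 HVt HQ lam2 t0 galerkin_y).
Qed.

Let uerr i j x y : (i < N)%N -> (j < N)%N -> inK X i j x y ->
  `|us 0 0 x y - ev (V i.+1 j.+1) x y| <= (1 + Cp) * D.
Proof.
exact: (u_error N0 eps0 alpha0 sigmak m1 C00 Hmesh Cp1 HCp K00 sS s1 s2 s3 bS b1 b2 b3 HV).
Qed.

Let c00 : cont2 (us 0 0). Proof. exact: cus. Qed.

Lemma Zterm_bound t : 0 < t -> `|Zterm| <=
  t * S2 N X (fun i j x y => ev (xu i.+1 j.+1) x y ^+ 2) + (4%:R * t)^-1 * (A * (1 + Cp)) ^+ 2 * D ^+ 2.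
Proof.
move=> t0; have -> : (4%:R * t)^-1 * (A * (1 + Cp)) ^+ 2 * D ^+ 2 = (4%:R * t)^-1 * (A * ((1 + Cp) * D)) ^+ 2.
  exact: alg_sq.
apply: (young_const X0 XN Xinc t0 (H := fun i j x y => b x y * (ev (V i.+1 j.+1) x y - us 0 0 x y)) (F := fun i j => ev (xu i.+1 j.+1))).
- by move=> i j; ct.
- exact: cxu.
move=> i j x y iN jN hK; have [hx hy] := hK; rewrite normrM distrC; apply: ler_pM => //; last exact: uerr.
by apply: Ab; [exact: (Xin X0 XN Xinc iN hx)|exact: (Xin X0 XN Xinc jN hy)].
Qed.

Definition cmin := Num.min 1 (Num.min beta (2^-1 * alpha)).
Lemma cmin_gt0 : 0 < cmin.
Proof. by rewrite /cmin !lt_min ltr01 beta0 mulr_gt0. Qed.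

Lemma energy_lower :
  cmin * (eps^-1 * S2 N X (fun i j x y => ev (xp i.+1 j.+1) x y ^+ 2)
    + eps^-1 * S2 N X (fun i j x y => ev (xq i.+1 j.+1) x y ^+ 2)
    + S2 N X (fun i j x y => ev (xu i.+1 j.+1) x y ^+ 2)
    + S1 N X (fun j y => ev (xu N j.+1) (X N) y ^+ 2)
    + S1 N X (fun j y => ev (tr xu N j.+1) (X N) y ^+ 2)) <= BB xu xp xq xu xp xq.
Proof.
rewrite (Bm_energy eps lam1 lam2 N0 X0 XN Xinc Ha1 Ha2 cb) /jump_total.
have al0 := ltW alpha0.
have j1 := jump_lower N0 X0 XN Xinc xu ca1 al0 a1al lam10.
have j2 := jump_lower N0 X0 XN Xinc (tr xu) ca2 al0 a2al lam20.
have hu : beta * S2 N X (fun i j x y => ev (xu i.+1 j.+1) x y ^+ 2) <=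
    S2 N X (fun i j x y => (b x y - 2^-1 * (a1x x y + a2y y x)) * ev (xu i.+1 j.+1) x y ^+ 2).
  rewrite -S2Z; last by move=> i j; ct.
  apply: le_S2; [by move=> i j; ct|by move=> i j; ct|] => i j x y iN jN [hx hy].
  apply: ler_wpM2r; first exact: sqr_ge0.
  by apply: Hbeta; [exact: (Xin X0 XN Xinc iN hx)|exact: (Xin X0 XN Xinc jN hy)].
have p0 : 0 <= eps^-1 * S2 N X (fun i j x y => ev (xp i.+1 j.+1) x y ^+ 2).
  exact: scaled_S2_sqr_ge0.
have q0 : 0 <= eps^-1 * S2 N X (fun i j x y => ev (xq i.+1 j.+1) x y ^+ 2).
  exact: scaled_S2_sqr_ge0.
have u0 : 0 <= S2 N X (fun i j x y => ev (xu i.+1 j.+1) x y ^+ 2).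
  exact: S2_sqr_ge0.
have d10 : 0 <= S1 N X (fun j y => ev (xu N j.+1) (X N) y ^+ 2).
  exact: S1_sqr_ge0.
have d20 : 0 <= S1 N X (fun j y => ev (tr xu N j.+1) (X N) y ^+ 2).
  exact: S1_sqr_ge0.
have l1 : cmin <= 1 by rewrite /cmin ge_min lexx.
have l2 : cmin <= beta by rewrite /cmin !ge_min lexx orbT.
have l3 : cmin <= 2^-1 * alpha by rewrite /cmin !ge_min lexx !orbT.
exact: (alg_lower p0 q0 u0 d10 d20 l1 l2 l3 hu j1 j2).
Qed.

Lemma S2_sqr_tr (C : fam) : S2 N X (fun i j x y => ev (tr C i.+1 j.+1) x y ^+ 2) =
  S2 N X (fun i j x y => ev (C i.+1 j.+1) x y ^+ 2).
Proof.
rewrite -[RHS]S2_swap; last by move=> i j; ct.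
by apply: eq_S2 => i j x y _ _ _; rewrite /tr !ev_tr.
Qed.

Definition cenergy := 2%:R * (2%:R * cdir (cmin / 18%:R) + (4%:R * (cmin / 18%:R))^-1 * (A * (1 + Cp)) ^+ 2).

Lemma energy_bound : BB xu xp xq xu xp xq <= cenergy * D ^+ 2.
Proof.
have t0 : 0 < cmin / 18%:R by rewrite divr_gt0// cmin_gt0.
have hX := Xterm_bound t0; have hY := Yterm_bound t0; have hZ := Zterm_bound t0.
rewrite !S2_sqr_tr in hY.
apply: (alg_absorb cmin_gt0 erefl _ _ _ _ _ energy_lower error_split hX hY hZ).
- exact: scaled_S2_sqr_ge0.
- exact: scaled_S2_sqr_ge0.
- exact: S2_sqr_ge0.
- exact: S1_sqr_ge0.
- exact: S1_sqr_ge0.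
Qed.

Definition ctotal := 2%:R * cenergy + 4%:R * (3%:R * (1 + 2%:R / (gam k sigma * alpha))) + 4%:R * A * (1 + Cp) ^+ 2.

Let Om := S2 N X (fun i j x y => om k X eps alpha sigma i x ^+ 2).
Let OmE : eps^-1 * Om <= 3%:R * (1 + 2%:R / (gam k sigma * alpha)).
Proof.
rewrite /Om (S2_fst X0 XN Xinc (f := fun i x => om k X eps alpha sigma i x ^+ 2)); last first.
  by move=> i; apply: cont1X; exact: cont_om.
exact: (om_sq_sum eps0 eps1 alpha0 sigmak Hmesh).
Qed.

Let flux_total (F : R -> R -> R) (C E : fam) : cont2 F ->
  (forall i j x y, (i < N)%N -> (j < N)%N -> inK X i j x y -> `|F x y - ev (C i.+1 j.+1) x y| <= D * om k X eps alpha sigma i x) ->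
  eps^-1 * S2 N X (fun i j x y => (F x y - ev (E i.+1 j.+1) x y) ^+ 2) <=
   2%:R * D ^+ 2 * (3%:R * (1 + 2%:R / (gam k sigma * alpha)))
   + 2%:R * (eps^-1 * S2 N X (fun i j x y => ev (fsub C E i.+1 j.+1) x y ^+ 2)).
Proof.
move=> cF FC; have co i : continuous (om k X eps alpha sigma i) by exact: cont_om.
have h : S2 N X (fun i j x y => (F x y - ev (E i.+1 j.+1) x y) ^+ 2) <=
   2%:R * D ^+ 2 * Om + 2%:R * S2 N X (fun i j x y => ev (fsub C E i.+1 j.+1) x y ^+ 2).
  rewrite -S2Z; last by move=> i j; ct.
  rewrite -S2Z; last by move=> i j; ct.
  rewrite -S2D; [|by move=> i j; ct|by move=> i j; ct].
  apply: le_S2; [by move=> i j; ct|by move=> i j; ct|] => i j x y iN jN hK.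
  rewrite -mulrA -exprMn; apply: sqr_split (FC i j x y iN jN hK) _.
  by rewrite /fsub evB.
have ei : 0 <= eps^-1 by rewrite invr_ge0 ltW.
exact: (alg_flux ei (sqr_ge0 D) OmE h).
Qed.

(** The projection error plus the difference of the projection and the
    discrete solution, the latter being controlled by energy_bound. *)
Lemma total_bound :
  eps^-1 * (S2 N X (fun i j x y => (eps * us 1 0 x y - ev (WP i.+1 j.+1) x y) ^+ 2)
    + S2 N X (fun i j x y => (eps * us 0 1 x y - ev (WQ i.+1 j.+1) x y) ^+ 2))
   + S2 N X (fun i j x y => (b x y - 2^-1 * (a1x x y + a2y y x)) * (us 0 0 x y - ev (WU i.+1 j.+1) x y) ^+ 2)
  <= ctotal * D ^+ 2.
Proof.
have c10 : cont2 (us 1 0) by exact: cus.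
have c01 : cont2 (us 0 1) by exact: cus.
have t10 : cont2 (ut 1 0) by exact: cut.
have cf1 : cont2 (flux eps (us 1 0)) by rewrite /flux; ct.
have cf2 : cont2 (flux eps (ut 1 0)) by rewrite /flux; ct.
have hp := @flux_total (flux eps (us 1 0)) P WP cf1 (fun i j x y iN jN hK =>
  flux_error N0 eps0 alpha0 sigmak m1 C00 Hmesh Cp1 HCp HCa K00 sS s1 s2 s3 bS b1 b2 b3 HP iN jN hK).
have hq := @flux_total (flux eps (ut 1 0)) (tr Q) (tr WQ) cf2 (fun i j x y iN jN hK =>
  flux_error N0 eps0 alpha0 sigmak m1 C00 Hmesh Cp1 HCp HCa K00 sS' s2' s1' s3' bS' b1' b2' b3' HQ iN jN hK).
have e1 : S2 N X (fun i j x y => (flux eps (ut 1 0) x y - ev (tr WQ i.+1 j.+1) x y) ^+ 2) =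
  S2 N X (fun i j x y => (eps * us 0 1 x y - ev (WQ i.+1 j.+1) x y) ^+ 2).
  rewrite -[RHS]S2_swap; last by move=> i j; ct.
  by apply: eq_S2 => i j x y _ _ _; rewrite /flux utE /tr ev_tr.
rewrite e1 -tr_sub S2_sqr_tr in hq.
have hu : S2 N X (fun i j x y => (b x y - 2^-1 * (a1x x y + a2y y x)) * (us 0 0 x y - ev (WU i.+1 j.+1) x y) ^+ 2)
  <= 4%:R * A * (1 + Cp) ^+ 2 * D ^+ 2 + 2%:R * S2 N X (fun i j x y => (b x y - 2^-1 * (a1x x y + a2y y x)) * ev (xu i.+1 j.+1) x y ^+ 2).
  have cd : cont2 (fun x y => b x y - 2^-1 * (a1x x y + a2y y x)) by ct.
  rewrite -[X in _ <= X + _](S2_cst X0 XN Xinc) -S2Z; last by move=> i j; ct.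
  rewrite -S2D; [|by move=> i j; ct|by move=> i j; ct].
  apply: le_S2; [by move=> i j; ct|by move=> i j; ct|] => i j x y iN jN hK.
  have [hx hy] := hK; have x01 := Xin X0 XN Xinc iN hx; have y01 := Xin X0 XN Xinc jN hy.
  have h := @sqr_split R (us 0 0 x y) (ev (WU i.+1 j.+1) x y) (ev (V i.+1 j.+1) x y) ((1 + Cp) * D) (ev (xu i.+1 j.+1) x y) (uerr iN jN hK).
  have {}h := h (esym (evB _ _ _ _)).
  have g0 : 0 <= b x y - 2^-1 * (a1x x y + a2y y x) by apply: le_trans (Hbeta x01 y01); exact: ltW.
  have gA : b x y - 2^-1 * (a1x x y + a2y y x) <= 2%:R * A.
    have [_ p1] := A1 x01 y01; have [_ p2] := A2 y01 x01.
    exact: (alg_dens (Ab x01 y01) p1 p2).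
  exact: (alg_weighted g0 gA h).
have hE := energy_bound.
rewrite (Bm_energy eps lam1 lam2 N0 X0 XN Xinc Ha1 Ha2 cb) in hE.
have j0 : 0 <= jump_total N X a1 a2 lam1 lam2 xu.
  have al0 := ltW alpha0.
  have half0 : 0 <= 2^-1 :> R by rewrite invr_ge0.
  have j1 := jump_lower N0 X0 XN Xinc xu ca1 al0 a1al lam10.
  have j2 := jump_lower N0 X0 XN Xinc (tr xu) ca2 al0 a2al lam20.
  apply: addr_ge0; [apply: le_trans j1|apply: le_trans j2];
    by apply: mulr_ge0; [exact: mulr_ge0 half0 al0|exact: S1_sqr_ge0].
exact: (alg_total j0 hp hq hu hE).
Qed.

End Estimate.

(** * The data of the problem *)

Lemma cont2_closure (R : realType) (F G : R -> R -> R) : cont2 F -> cont2 G ->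
  (forall z : R * R, Omega z -> F z.1 z.2 = G z.1 z.2) ->
  forall x y, 0 <= x <= 1 -> 0 <= y <= 1 -> F x y = G x y.
Proof.
move=> cF cG FG x y hx hy; have zO : Omegabar (x, y) by exact/OmegabarP.
have h1 := @ext_eq R (fun z => F z.1 z.2) F (x, y) cF (fun _ _ => erefl) zO.
have h2 := @ext_eq R (fun z => F z.1 z.2) G (x, y) cG FG zO.
by rewrite h1 in h2.
Qed.

Lemma le_sqrt_mul (R : realType) (E c D : R) : 0 <= D -> E <= c * D ^+ 2 -> Num.sqrt E <= Num.sqrt c * D.
Proof.
move=> D0 h; apply: (le_trans (ler_wsqrtr h)).
by rewrite mulrC sqrtrM ?sqr_ge0// sqrtr_sqr ger0_norm// mulrC.
Qed.

Lemma bounded01 (R : realType) (F : R -> R -> R) : cont2 F ->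
  exists2 A, 0 <= A & forall x y, 0 <= x <= 1 -> 0 <= y <= 1 -> `|F x y| <= A.
Proof. by move=> /(cont2_bounded 0 1 0 1)[A [A0 h]]; exists A. Qed.

Lemma cont2_operator (R : realType) (e : R) (a a' b u1 u2 u3 u4 u0 : R -> R -> R) :
  cont2 a -> cont2 a' -> cont2 b -> cont2 u1 -> cont2 u2 -> cont2 u3 -> cont2 u4 -> cont2 u0 ->
  cont2 (fun x y => (a x y * u1 x y - e * u2 x y) + (a' x y * u3 x y - e * u4 x y) + b x y * u0 x y).
Proof. by move=> *; ct. Qed.

Lemma alg_pde (R : realType) (e xx yy a x a' y b u : R) :
  - e * (xx + yy) + (a * x + a' * y) + b * u = a * x - e * xx + (a' * y - e * yy) + b * u.
Proof. ring. Qed.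

Lemma cont2_scale (R : realType) (e : R) (F : R -> R -> R) : cont2 F -> cont2 (fun x y => e * F x y).
Proof. by move=> cF; ct. Qed.

Lemma cont2_mul_ev (R : realType) k (F : R -> R -> R) (C : 'M[R]_k.+1) : cont2 F -> cont2 (fun x y => F x y * ev C x y).
Proof. by move=> cF; ct. Qed.

Lemma cont2_sub_ev (R : realType) k (F : R -> R -> R) (C : 'M[R]_k.+1) : cont2 F -> cont2 (fun x y => F x y - ev C x y).
Proof. by move=> cF; ct. Qed.

Section Instance.
Context {R : realType} (k : nat).
Notation fam := (nat -> nat -> 'M[R]_k.+1).
Hypothesis k1 : (1 <= k)%N.
Variables (alpha beta sigma K : R) (a1 a2 b f : R * R -> R).
Hypothesis alpha0 : 0 < alpha.
Hypothesis beta0 : 0 < beta.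
Hypothesis sigmak : k.+2%:R <= sigma.
Hypothesis Ca1 : Cmbar 1 a1.
Hypothesis Ca2 : Cmbar 1 a2.
Hypothesis Cb : Cmbar 0 b.
Hypothesis Cf : Cmbar 0 f.
Hypothesis Ha1 : forall z, Omegabar z -> alpha <= a1 z.
Hypothesis Ha2 : forall z, Omegabar z -> alpha <= a2 z.
Hypothesis Hb : forall z, Omegabar z -> beta <= b z - 2^-1 * ext (diva a1 a2) z.

Notation A1 := (mix a1 0 0).
Notation A1x := (mix a1 1 0).
Notation A2 := (fun y x => mix a2 0 0 x y).
Notation A2y := (fun y x => mix a2 0 1 x y).
Notation Bb := (mix b 0 0).
Notation Ff := (mix f 0 0).

Let HA1 : dX 0 1 A1 A1x.
Proof. by have [_ /(_ 0%N 0%N isT) []] := smooth_mix Ca1. Qed.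
Let HA2 : dX 0 1 A2 A2y.
Proof. by have [_ /(_ 0%N 0%N isT) []] := smooth_mix Ca2. Qed.
Let cB : cont2 Bb. Proof. by have [c _] := smooth_mix Cb; exact: c. Qed.
Let cF : cont2 Ff. Proof. by have [c _] := smooth_mix Cf; exact: c. Qed.
Let cA1 : cont2 A1. Proof. by case: HA1. Qed.
Let cA2 : cont2 A2. Proof. by case: HA2. Qed.
Let cA1x : cont2 A1x. Proof. by case: HA1. Qed.
Let cA2y : cont2 A2y. Proof. by case: HA2. Qed.
Let a1E z : Omegabar z -> a1 z = A1 z.1 z.2. Proof. exact: mix_closed Ca1. Qed.
Let a2E z : Omegabar z -> a2 z = A2 z.2 z.1. Proof. exact: mix_closed Ca2. Qed.
Let bE z : Omegabar z -> b z = Bb z.1 z.2. Proof. exact: mix_closed Cb. Qed.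
Let fE z : Omegabar z -> f z = Ff z.1 z.2. Proof. exact: mix_closed Cf. Qed.
Let divE z : Omega z -> diva a1 a2 z = A1x z.1 z.2 + A2y z.2 z.1.
Proof.
have [_ c1 _] := Ca1; have [_ c2 _] := Ca2.
by move=> zO; rewrite -(@mix_Omega _ 1 a1 1 0 z c1)// -(@mix_Omega _ 1 a2 0 1 z c2).
Qed.
Let a1al x y : 0 <= x <= 1 -> 0 <= y <= 1 -> alpha <= A1 x y.
Proof.
move=> hx hy; have zO : Omegabar (x, y) by exact/OmegabarP.
by have := Ha1 zO; rewrite a1E.
Qed.
Let a2al y x : 0 <= y <= 1 -> 0 <= x <= 1 -> alpha <= A2 y x.
Proof.
move=> hy hx; have zO : Omegabar (x, y) by exact/OmegabarP.
by have := Ha2 zO; rewrite a2E.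
Qed.
Let Hbeta x y : 0 <= x <= 1 -> 0 <= y <= 1 -> beta <= Bb x y - 2^-1 * (A1x x y + A2y y x).
Proof.
move=> hx hy; have zO : Omegabar (x, y) by exact/OmegabarP.
have cd : cont2 (fun x y => A1x x y + A2y y x).
  exact: (@cont2D _ A1x (fun x y => A2y y x) cA1x (cont2_swap cA2y)).
by have := Hb zO; rewrite bE// (ext_eq cd divE zO).
Qed.

Lemma coefficients_bounded : exists2 A, 0 <= A &
  [/\ forall x y, 0 <= x <= 1 -> 0 <= y <= 1 -> `|A1 x y| <= A /\ `|A1x x y| <= A,
      forall x y, 0 <= x <= 1 -> 0 <= y <= 1 -> `|A2 x y| <= A /\ `|A2y x y| <= A &
      forall x y, 0 <= x <= 1 -> 0 <= y <= 1 -> `|Bb x y| <= A].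
Proof.
have [c1 p1 h1] := bounded01 cA1; have [c2 p2 h2] := bounded01 cA1x.
have [c3 p3 h3] := bounded01 cA2; have [c4 p4 h4] := bounded01 cA2y.
have [c5 p5 h5] := bounded01 cB.
exists (c1 + c2 + c3 + c4 + c5); first by rewrite !addr_ge0.
split=> [x y hx hy|x y hx hy|x y hx hy].
- by split; [apply: (le_trans (h1 x y hx hy)); lra|apply: (le_trans (h2 x y hx hy)); lra].
- by split; [apply: (le_trans (h3 x y hx hy)); lra|apply: (le_trans (h4 x y hx hy)); lra].
- by apply: (le_trans (h5 x y hx hy)); lra.
Qed.

Variables (A Cp Cinv : R).
Hypothesis A0 : 0 <= A.
Hypothesis AA1 : forall x y, 0 <= x <= 1 -> 0 <= y <= 1 -> `|A1 x y| <= A /\ `|A1x x y| <= A.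
Hypothesis AA2 : forall x y, 0 <= x <= 1 -> 0 <= y <= 1 -> `|A2 x y| <= A /\ `|A2y x y| <= A.
Hypothesis Ab : forall x y, 0 <= x <= 1 -> 0 <= y <= 1 -> `|Bb x y| <= A.
Hypothesis Cp1 : 1 <= Cp.
Hypothesis HCp : forall K (c d : R) (g : R -> R) (M y : R), c < d -> continuous g -> c <= y <= d ->
    (forall t, c <= t <= d -> `|g t| <= M) -> `|proj k K c d g y| <= Cp * M.
Hypothesis HCa : forall K c d (g W : R -> R) y, K <> Radau_right -> c < d -> continuous g -> continuous W -> c <= y <= d ->
    (forall t, c <= t <= d -> `|g t| <= W t) -> (forall t, c <= t <= d -> W c <= W t) ->
    `|proj k K c d g y| <= Cp * ((d - c)^-1 * I1 c d W).
Hypothesis Cinv0 : 0 < Cinv.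
Hypothesis HCinv : forall b c (q : {poly R}), b < c -> (size q <= k.+1)%N ->
  (c - b) ^+ 2 * I1 b c (fun x => (q^`()).[x] ^+ 2) <= Cinv * I1 b c (fun x => q.[x] ^+ 2).

Variables (N : nat) (eps m C0 : R) (X : nat -> R).
Hypothesis N0 : (0 < N)%N.
Hypothesis eps0 : 0 < eps.
Hypothesis eps1 : eps <= 1.
Hypothesis m1 : 1 <= m.
Hypothesis C00 : 0 <= C0.
Hypothesis Hmesh : layer_mesh eps alpha sigma m N X C0.
Variables (u S E21 E12 E22 : R * R -> R).
Hypothesis Hpde : pde eps a1 a2 b f u.
Hypothesis Hdec : decomposition k alpha K eps u S E21 E12 E22.
Variables lam1 lam2 : R.
Hypothesis lam10 : 0 <= lam1.
Hypothesis lam20 : 0 <= lam2.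
Notation p := (fun z => eps * dx u z).
Notation q := (fun z => eps * dy u z).
Variables W Piw : triple R.
Hypothesis HW : LDG_solution k N X eps a1 a2 b lam1 lam2 f W.
Hypothesis Hu : GR_minus k N X u (tu Piw).
Hypothesis Hp : GR_xplus k N X p (tp Piw).
Hypothesis Hq : GR_yplus k N X q (tq Piw).

Let X0 : X 0 = 0. Proof. by case: Hmesh. Qed.
Let XN : X N = 1. Proof. by case: Hmesh. Qed.
Let Xinc i : (i < N)%N -> X i < X i.+1. Proof. by case: Hmesh => _ _ h _ _; apply: h. Qed.

Notation us := (usum (mix S) (mix E21) (mix E12) (mix E22)).
Notation ut := (usum (swap_fam (mix S)) (swap_fam (mix E12)) (swap_fam (mix E21)) (swap_fam (mix E22))).

Let CS : [/\ Cmbar k.+2 S, Cmbar k.+2 E21, Cmbar k.+2 E12 & Cmbar k.+2 E22]. Proof. by case: Hdec. Qed.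
Let sS : smooth2 k.+2 (mix S). Proof. by case: CS => c _ _ _; exact: smooth_mix. Qed.
Let s1 : smooth2 k.+2 (mix E21). Proof. by case: CS => _ c _ _; exact: smooth_mix. Qed.
Let s2 : smooth2 k.+2 (mix E12). Proof. by case: CS => _ _ c _; exact: smooth_mix. Qed.
Let s3 : smooth2 k.+2 (mix E22). Proof. by case: CS => _ _ _ c; exact: smooth_mix. Qed.

Let bounds i j x y : (i + j <= k.+2)%N -> 0 <= x <= 1 -> 0 <= y <= 1 ->
  [/\ `|mix S i j x y| <= `|K|, `|mix E21 i j x y| <= `|K| * eps ^- i * lay eps alpha x,
      `|mix E12 i j x y| <= `|K| * eps ^- j * lay eps alpha y &
      `|mix E22 i j x y| <= `|K| * eps ^- (i + j) * (lay eps alpha x * lay eps alpha y)].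
Proof.
move=> ij hx hy; have [_ _ /(_ x y)] := Hdec.
have zO : Omegabar (x, y) by exact/OmegabarP.
move=> /(_ zO i j ij); rewrite -!bar_ext// -!/(mix _ _ _ _ _) => -[h1 h2 h3 h4].
have KK := ler_norm K; have e n : 0 <= eps ^- n by rewrite invr_ge0 exprn_ge0// ltW.
have l t : 0 <= lay eps alpha t by exact: expR_ge0.
split; [exact: le_trans h1 KK|apply: (le_trans h2)|apply: (le_trans h3)|apply: (le_trans h4)].
- by apply: ler_wpM2r => //; exact: ler_wpM2r.
- by apply: ler_wpM2r => //; exact: ler_wpM2r.
have -> : - ((alpha * (1 - x) + alpha * (1 - y)) / eps) = - (alpha * (1 - x) / eps) + - (alpha * (1 - y) / eps).
  by rewrite mulrDl opprD.
rewrite expRD; apply: ler_wpM2r; first exact: mulr_ge0.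
exact: ler_wpM2r.
Qed.

Let bS i j x y : (i + j <= k.+2)%N -> 0 <= x <= 1 -> 0 <= y <= 1 -> `|mix S i j x y| <= `|K|.
Proof. by move=> h hx hy; have [] := bounds h hx hy. Qed.
Let b1 i j x y : (i + j <= k.+2)%N -> 0 <= x <= 1 -> 0 <= y <= 1 -> `|mix E21 i j x y| <= `|K| * eps ^- i * lay eps alpha x.
Proof. by move=> h hx hy; have [] := bounds h hx hy. Qed.
Let b2 i j x y : (i + j <= k.+2)%N -> 0 <= x <= 1 -> 0 <= y <= 1 -> `|mix E12 i j x y| <= `|K| * eps ^- j * lay eps alpha y.
Proof. by move=> h hx hy; have [] := bounds h hx hy. Qed.
Let b3 i j x y : (i + j <= k.+2)%N -> 0 <= x <= 1 -> 0 <= y <= 1 -> `|mix E22 i j x y| <= `|K| * eps ^- (i + j) * (lay eps alpha x * lay eps alpha y).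
Proof. by move=> h hx hy; have [] := bounds h hx hy. Qed.

Let cus i j : (i + j <= k.+2)%N -> cont2 (us i j). Proof. exact: (cont_usum sS s1 s2 s3). Qed.
Let c00 : cont2 (us 0 0). Proof. exact: cus. Qed.
Let c10 : cont2 (us 1 0). Proof. exact: cus. Qed.
Let c01 : cont2 (us 0 1). Proof. exact: cus. Qed.
Let c20 : cont2 (us 2 0). Proof. exact: cus. Qed.
Let c02 : cont2 (us 0 2). Proof. exact: cus. Qed.

Let uE z : Omegabar z -> u z = us 0 0 z.1 z.2.
Proof.
move=> zO; have [_ h _] := Hdec; have [d1 d2 d3 d4] := CS.
rewrite h// (mix_closed d1 zO) (mix_closed d2 zO) (mix_closed d3 zO) (mix_closed d4 zO) /usum; ring.
Qed.
Let uEO z : Omega z -> u z = us 0 0 z.1 z.2. Proof. by move=> /Omega_sub; exact: uE. Qed.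

Let dyus j : (j < k.+2)%N -> dX 0 1 (fun y x => us 0 j x y) (fun y x => us 0 j.+1 x y).
Proof.
move=> jk; have := dX_usum (smooth2_swap sS) (smooth2_swap s2) (smooth2_swap s1) (smooth2_swap s3) jk.
have e i : usum (swap_fam (mix S)) (swap_fam (mix E12)) (swap_fam (mix E21)) (swap_fam (mix E22)) i 0%N = (fun y x => us 0 i x y).
  by apply/funext => y; apply/funext => x; exact: utE.
by rewrite !e.
Qed.

Let dxu z : Omega z -> dx u z = us 1 0 z.1 z.2.
Proof. by apply: (dx_eq uEO); exact: (dX_usum sS s1 s2 s3). Qed.
Let dyu z : Omega z -> dy u z = us 0 1 z.1 z.2.
Proof. by apply: (dy_eq uEO); exact: dyus. Qed.
Let dxxu z : Omega z -> pd 2 0 u z = us 2 0 z.1 z.2.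
Proof. by apply: (dx_eq dxu); exact: (dX_usum sS s1 s2 s3). Qed.
Let dyyu z : Omega z -> pd 0 2 u z = us 0 2 z.1 z.2.
Proof. by apply: (dy_eq dyu); exact: dyus. Qed.

Let pdeE x y : 0 <= x <= 1 -> 0 <= y <= 1 ->
  Ff x y = (A1 x y * us 1 0 x y - eps * us 2 0 x y) + (A2 y x * us 0 1 x y - eps * us 0 2 x y) + Bb x y * us 0 0 x y.
Proof.
have cA2' : cont2 (fun x y => A2 y x) by exact: (cont2_swap cA2).
have cR := @cont2_operator R eps _ _ _ _ _ _ _ _ cA1 cA2' cB c10 c20 c01 c02 c00.
move=> hx hy; apply: (cont2_closure cF cR _ hx hy).
move=> z zO; have zOb := Omega_sub zO; have [h _] := Hpde.
rewrite -(fE zOb) -(h z zO) (dxxu zO) (dyyu zO) (dxu zO) (dyu zO) (uEO zO) (a1E zOb) (a2E zOb) (bE zOb).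
exact: alg_pde.
Qed.

Let boundary x y : Omegabar (x, y) -> ~ Omega (x, y) -> us 0 0 x y = 0.
Proof. by move=> h1 h2; rewrite -(uE h1); have [_ h] := Hpde; exact: h. Qed.

Let u_x0 y : 0 <= y <= 1 -> us 0 0 0 y = 0.
Proof.
by move=> hy; apply: boundary => [|/OmegaP[/=]]; [apply/OmegabarP; rewrite /= lexx ler01|rewrite ltxx].
Qed.
Let u_x1 y : 0 <= y <= 1 -> us 0 0 1 y = 0.
Proof.
by move=> hy; apply: boundary => [|/OmegaP[/=]]; [apply/OmegabarP; rewrite /= lexx ler01|rewrite ltxx andbF].
Qed.
Let u_y0 x : 0 <= x <= 1 -> us 0 0 x 0 = 0.
Proof.
by move=> hx; apply: boundary => [|/OmegaP[/= _]]; [apply/OmegabarP; rewrite /= lexx ler01|rewrite ltxx].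
Qed.
Let u_y1 x : 0 <= x <= 1 -> us 0 0 x 1 = 0.
Proof.
by move=> hx; apply: boundary => [|/OmegaP[/= _]]; [apply/OmegabarP; rewrite /= lexx ler01|rewrite ltxx andbF].
Qed.

Let u_elt i j : (i < N)%N -> (j < N)%N -> on_elt X u (us 0 0) i j.
Proof. by move=> iN jN x y hx hy; rewrite uEO//; exact: (Omega_elt X0 XN Xinc iN jN hx hy). Qed.
Let p_elt i j : (i < N)%N -> (j < N)%N -> on_elt X p (flux eps (us 1 0)) i j.
Proof. by move=> iN jN x y hx hy; rewrite /= dxu//; exact: (Omega_elt X0 XN Xinc iN jN hx hy). Qed.
Let q_elt i j : (i < N)%N -> (j < N)%N -> on_elt X q (fun x y => eps * us 0 1 x y) i j.
Proof. by move=> iN jN x y hx hy; rewrite /= dyu//; exact: (Omega_elt X0 XN Xinc iN jN hx hy). Qed.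

Let cp : cont2 (flux eps (us 1 0)). Proof. exact: (@cont2_scale R eps _ c10). Qed.
Let cq : cont2 (fun x y => eps * us 0 1 x y). Proof. exact: (@cont2_scale R eps _ c01). Qed.

Lemma projection_families : exists V P Q : fam,
  [/\ [/\ rep N X (tu Piw) V, rep N X (tp Piw) P & rep N X (tq Piw) Q],
    forall i j, (i < N)%N -> (j < N)%N -> forall x y,
      ev (V i.+1 j.+1) x y = proj k Radau_right (X i) (X i.+1) ((pyj k X (us 0 0) j) ^~ y) x,
    is_flux_proj N X eps (mix S) (mix E21) (mix E12) (mix E22) P &
    is_flux_proj N X eps (swap_fam (mix S)) (swap_fam (mix E12)) (swap_fam (mix E21)) (swap_fam (mix E22)) (tr Q)].
Proof.
have [vV HV] := Hu; have [vP HP] := Hp; have [vQ HQ] := Hq.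
have [V rV] := VN_rep vV; have [P rP] := VN_rep vP; have [Q rQ] := VN_rep vQ.
exists V, P, Q; split=> // [i j iN jN x y|i j iN jN x y|i j iN jN x y].
- have [h1 h2 h3 h4] := HV i.+1 j.+1 iN jN.
  exact: (GR_minus_elt k1 (Xinc iN) (Xinc jN) c00 (rV.2 i j iN jN) (u_elt iN jN) h1 h2 h3 h4).
- have [h1 h2] := HP i.+1 j.+1 iN jN.
  exact: (GR_xplus_elt k1 (Xinc iN) (Xinc jN) cp (rP.2 i j iN jN) (p_elt iN jN) h1 h2).
have [h1 h2] := HQ j.+1 i.+1 jN iN.
have E : (fun t s => eps * us 0 1 s t) = flux eps (ut 1 0).
  by apply/funext => t; apply/funext => s; rewrite /flux utE.
rewrite -E; exact: (GR_yplus_elt k1 (Xinc jN) (Xinc iN) cq (rQ.2 j i jN iN) (q_elt jN iN) h1 h2 y x).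
Qed.

Notation D := (del k N alpha sigma m C0 Cp `|K|).

(** The constants depend on the mesh through del only. *)
Lemma error_estimates :
  normE N X eps a1 a2 b lam1 lam2 (tsub Piw W) <= Num.sqrt (cenergy k alpha sigma Cp A beta Cinv) * D /\
  norm2 eps a1 a2 b (tsub (Triple u p q) W) <= Num.sqrt (ctotal k alpha sigma Cp A beta Cinv) * D.
Proof.
have [V [P [Q [[rV rP rQ] HV HP HQ]]]] := projection_families.
have [[vU vP vQ] Wf] := HW.
have [WU rWU] := VN_rep vU; have [WP rWP] := VN_rep vP; have [WQ rWQ] := VN_rep vQ.
have HW' (v s r : fam) : Bm N X eps A1 A1x A2 A2y Bb lam1 lam2 WU WP WQ v s r =
    S2 N X (fun i j x y => Ff x y * ev (v i.+1 j.+1) x y).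
  have rg (C : fam) : rep N X (glueM N X C) C by exact: rep_glue.
  have vz : VN3 k N X (Triple (glueM N X v) (glueM N X s) (glueM N X r)).
    by split; exact: VN_glue.
  rewrite -(B_Bm eps N0 X0 XN Xinc lam1 lam2 HA1 HA2 cB a1E a2E bE divE (z := Triple (glueM N X v) (glueM N X s) (glueM N X r)) rWU rWP rWQ (rg v) (rg s) (rg r)).
  rewrite Wf// /=; have [mv bv] := rg v.
  apply: (ip2_Omega X0 XN Xinc) => //.
  - by apply: (measurable_eqG cF) => z zO; rewrite fE//; exact: Omega_sub.
  - by move=> i j; exact: (@cont2_mul_ev R k _ _ cF).
  - move=> i j iN jN x y hx hy; rewrite /= (bv i j)// fE//.
    by apply: Omega_sub; exact: (Omega_elt X0 XN Xinc iN jN hx hy).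
have D0 : 0 <= D := del_ge0 k alpha sigma N0 m1 C00 Cp1 (normr_ge0 K).
have dens0 x y : 0 <= x <= 1 -> 0 <= y <= 1 -> 0 <= Bb x y - 2^-1 * (A1x x y + A2y y x).
  by move=> hx hy; apply: le_trans (Hbeta hx hy); exact: ltW.
split.
  rewrite (normE_Bm N0 X0 XN Xinc lam1 lam2 HA1 HA2 cB a1E a2E bE divE eps0 dens0
    (V := tsub Piw W) (rep_sub rV rWU) (rep_sub rP rWP) (rep_sub rQ rWQ)).
  apply: le_sqrt_mul => //.
  exact: (energy_bound N0 eps0 eps1 alpha0 sigmak m1 C00 Hmesh Cp1 HCp HCa (normr_ge0 K) sS s1 s2 s3 bS b1 b2 b3
    HA1 HA2 cB cF A0 AA1 AA2 Ab a1al a2al beta0 Hbeta lam10 lam20 Cinv0 HCinv u_x0 u_x1 u_y0 u_y1 pdeE HV HP HQ HW').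
have n0 : 0 <= norm2 eps a1 a2 b (tsub (Triple u p q) W) by exact: sqrtr_ge0.
rewrite -[leLHS]ger0_norm// -sqrtr_sqr; apply: le_sqrt_mul => //.
have mu : measurable_fun (Omega : set (measurableTypeR R * measurableTypeR R)%type) u.
  exact: (measurable_eqG c00 uEO).
have mp : measurable_fun (Omega : set (measurableTypeR R * measurableTypeR R)%type) p.
  by apply: (measurable_eqG cp) => z zO; rewrite dxu.
have mq : measurable_fun (Omega : set (measurableTypeR R * measurableTypeR R)%type) q.
  by apply: (measurable_eqG cq) => z zO; rewrite dyu.
rewrite (norm2_sq X0 XN Xinc HA1 HA2 cB bE divE eps0 dens0 (V := tsub (Triple u p q) W)
  (Fu := fun i j x y => us 0 0 x y - ev (WU i.+1 j.+1) x y)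
  (Fp := fun i j x y => eps * us 1 0 x y - ev (WP i.+1 j.+1) x y)
  (Fq := fun i j x y => eps * us 0 1 x y - ev (WQ i.+1 j.+1) x y)).
- exact: (total_bound N0 eps0 eps1 alpha0 sigmak m1 C00 Hmesh Cp1 HCp HCa (normr_ge0 K) sS s1 s2 s3 bS b1 b2 b3
    HA1 HA2 cB cF A0 AA1 AA2 Ab a1al a2al beta0 Hbeta lam10 lam20 Cinv0 HCinv u_x0 u_x1 u_y0 u_y1 pdeE HV HP HQ HW').
- by apply: measurable_realfun.measurable_funB; [exact: mu|case: rWU].
- by apply: measurable_realfun.measurable_funB; [exact: mp|case: rWP].
- by apply: measurable_realfun.measurable_funB; [exact: mq|case: rWQ].
- by move=> i j; exact: (@cont2_sub_ev R k _ _ c00).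
- by move=> i j; exact: (@cont2_sub_ev R k _ _ cp).
- by move=> i j; exact: (@cont2_sub_ev R k _ _ cq).
- by move=> i j iN jN x y hx hy; rewrite /= (u_elt iN jN hx hy) (rWU.2 i j iN jN x y hx hy).
- by move=> i j iN jN x y hx hy; rewrite /= (rWP.2 i j iN jN x y hx hy); congr (_ - _); exact: p_elt iN jN x y hx hy.
- by move=> i j iN jN x y hx hy; rewrite /= (rWQ.2 i j iN jN x y hx hy); congr (_ - _); exact: q_elt iN jN x y hx hy.
Qed.

End Instance.

(** * The theorem *)

Theorem theorem4p1 (R : realType) (k : nat) (hk : (1 <= k)%N) :
  (exists c1 c2 : R, [/\ 0 < c1, 0 < c2 &
    forall (M : mesh_type) (N : nat) (eps : R),
      (4 <= N)%N -> ~~ odd N -> 0 < eps -> eps <= N%:R^-1 ->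
      c1 * Mstar_rate M N eps k <= Mstar M N eps k <= c2 * Mstar_rate M N eps k])
  /\
  forall (alpha beta sigma K Lam : R) (a1 a2 b f : R * R -> R),
    0 < alpha -> 0 < beta -> k.+2%:R <= sigma ->
    Cmbar 1 a1 -> Cmbar 1 a2 -> Cmbar 0 b -> Cmbar 0 f ->
    (forall z, Omegabar z -> alpha <= a1 z) ->
    (forall z, Omegabar z -> alpha <= a2 z) ->
    (forall z, Omegabar z -> beta <= b z - 2^-1 * ext (diva a1 a2) z) ->
  exists2 C : R, 0 < C &
  forall (M : mesh_type) (N : nat) (eps : R),
    (4 <= N)%N -> ~~ odd N -> 0 < eps -> eps <= N%:R^-1 ->
    tau M N eps sigma alpha = sigma * eps / alpha * phi M N eps 2^-1 ->
  forall u S E21 E12 E22 : R * R -> R,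
    pde eps a1 a2 b f u ->
    (exists kappa : R, 0 < kappa < 1 /\ Cholder k.+2 kappa u) ->
    decomposition k alpha K eps u S E21 E12 E22 ->
  forall lam1 lam2 : R, 0 <= lam1 <= Lam -> 0 <= lam2 <= Lam ->
  let X := node M N eps sigma alpha in
  let p := fun z => eps * dx u z in
  let q := fun z => eps * dy u z in
  let w := Triple u p q in
  forall W Piw : triple R,
    LDG_solution k N X eps a1 a2 b lam1 lam2 f W ->
    GR_minus k N X u (tu Piw) ->
    GR_xplus k N X p (tp Piw) ->
    GR_yplus k N X q (tq Piw) ->
    normE N X eps a1 a2 b lam1 lam2 (tsub Piw W)
      <= C * Mstar M N eps k * N%:R ^- k.+1 /\
    norm2 eps a1 a2 b (tsub w W) <= C * Mstar M N eps k * N%:R ^- k.+1.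
Proof.
split.
  exists 1, (2%:R ^+ k.+1); split=> [//||M N eps N4 _ eps0 epsN].
    by rewrite exprn_gt0.
  by rewrite mul1r; exact: Mstar_rate_equiv.
move=> alpha beta sigma K Lam a1 a2 b f alpha0 beta0 sigmak Ca1 Ca2 Cb Cf Ha1 Ha2 Hb.
have [A A0 [AA1 AA2 Ab]] := coefficients_bounded Ca1 Ca2 Cb.
have [Cp Cp1 [HCp HCa]] := @projection_constant R k.
have [Cinv Cinv0 HCinv] := @inverse_inequality R k.
have sigma0 : 0 < sigma by apply: lt_le_trans sigmak; rewrite ltr0n.
(* The constant of node_layer_mesh, the same for the three meshes. *)
pose C0 := 10 + expR 2 + 2 * sigma / alpha + 2 * (sigma / alpha).
have sa0 : 0 <= sigma / alpha by rewrite divr_ge0// ltW.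
have C00 : 0 <= C0.
  by rewrite /C0 -mulrA; have := expR_ge0 (2 : R); move: sa0; lra.
pose c := 4%:R * CL k alpha sigma C0 Cp * `|K| * (1 + Cp).
have c0 : 0 <= c.
  apply: mulr_ge0; last by rewrite addr_ge0// (le_trans ler01).
  apply: mulr_ge0 (normr_ge0 K); apply: mulr_ge0 (ler0n _ _) _.
  exact: (CL_ge0 k alpha sigma C00 Cp1).
pose c1 := Num.sqrt (cenergy k alpha sigma Cp A beta Cinv).
pose c2 := Num.sqrt (ctotal k alpha sigma Cp A beta Cinv).
have c1_ge0 : 0 <= c1 := sqrtr_ge0 _.
have c2_ge0 : 0 <= c2 := sqrtr_ge0 _.
exists ((c1 + c2) * c + 1).
  by apply: ltr_wpDl => //; apply: mulr_ge0 c0; exact: addr_ge0.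
move=> M N eps N4 oddN eps0 epsN Htau u S E21 E12 E22 Hpde _ Hdec lam1 lam2 /andP[lam10 _] /andP[lam20 _].
move=> X p q w W Piw HW Hu Hp Hq.
have N0 : (0 < N)%N by exact: leq_trans N4.
have eps1 : eps <= 1.
  by apply: (le_trans epsN); rewrite invf_le1 ?ltr0n// ler1n.
have m1 : 1 <= slope M N eps := slope_ge1 N4 epsN M.
have Hmesh : layer_mesh eps alpha sigma (slope M N eps) N X C0.
  have [n NE] : exists n, N = (2 * n)%N by exists N./2; rewrite mul2n -[LHS]odd_double_half (negPf oddN).
  rewrite /X NE in N4 epsN Htau *; apply: node_layer_mesh => //.
  by move: N4; rewrite -[4%N]/(2 * 2)%N leq_pmul2l.
have [h1 h2] := error_estimates hk alpha0 beta0 sigmak Ca1 Ca2 Cb Cf Ha1 Ha2 Hb A0 AA1 AA2 Ab Cp1 HCp HCa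
  Cinv0 HCinv N0 eps0 eps1 m1 C00 Hmesh Hpde Hdec lam10 lam20 HW Hu Hp Hq.
pose rate := Mstar M N eps k * N%:R ^- k.+1.
have dr : delta k N (slope M N eps) <= rate.
  rewrite /delta exprMn exprVn; apply: ler_wpM2r; first by rewrite invr_ge0 exprn_ge0.
  exact: slope_pow_le_Mstar.
have rate0 : 0 <= rate by apply: le_trans dr; exact: delta_ge0.
have cd : del k N alpha sigma (slope M N eps) C0 Cp `|K| <= c * rate by exact: ler_wpM2l.
have final s : 0 <= s -> s <= c1 + c2 ->
    s * del k N alpha sigma (slope M N eps) C0 Cp `|K| <= ((c1 + c2) * c + 1) * Mstar M N eps k * N%:R ^- k.+1.
  move=> s0 sc; rewrite -mulrA -/rate mulrDl mul1r -mulrA.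
  apply: (le_trans (ler_wpM2l s0 cd)); apply: (@le_trans _ _ ((c1 + c2) * (c * rate))).
    by apply: ler_wpM2r sc; exact: mulr_ge0.
  by rewrite lerDl.
split; [apply: (le_trans h1)|apply: (le_trans h2)]; apply: final => //.
  by rewrite lerDl.
by rewrite lerDr.
Qed.
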